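(* There exists a finite set $\mathcal{R}$ of at most $10^6$ rectangular tiles such that the following decision problem is $\mathsf{NP}$-complete: given as input a simply connected region $\Gamma$, decide whether $\Gamma$ admits a tiling by translated copies of tiles from $\mathcal{R}$.
   Context: Consider $\mathbb{Z}^2$ as a union of closed unit squares with pairwise disjoint interiors. A region is a finite union of such unit squares whose interior is connected; it is simply connected if it is simply connected as a subset of the plane. A tile is a finite simply connected region; a rectangular tile is an $a\times b$ rectangle of unit squares. Given a set $\mathcal{T}$ of tiles, a $\mathcal{T}$-tiling of a region $\Gamma$ is a collection of translated copies of tiles from $\mathcal{T}$ (rotations not allowed) with pairwise disjoint interiors whose union is $\Gamma$. The input region is given as the finite list of unit squares it contains; the tile set $\mathcal{R}$ is fixed and not part of the input. *)

(* Defs.v *)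
From HB Require Import structures.
From mathcomp Require Import all_boot all_order all_algebra.
From mathcomp Require Import finmap.
From mathcomp Require Import all_classical all_reals topology normedtype.
Set Implicit Arguments.
Unset Strict Implicit.
Unset Printing Implicit Defensive.
Import Order.TTheory GRing.Theory Num.Theory.
Import numFieldNormedType.Exports.

(** * Turing machines *)

Inductive move := MoveL | MoveR | Stay.

Definition move_code (m : move) : 'I_3 :=
  match m with
  | MoveL => inord 0
  | MoveR => inord 1
  | Stay => inord 2
  end.

Definition move_decode (i : 'I_3) : move :=
  match val i with
  | 0 => MoveL
  | 1 => MoveR
  | _ => Stay
  end.

Lemma move_codeK : cancel move_code move_decode.
Proof. by case; rewrite /move_decode /= inordK. Qed.

HB.instance Definition _ := Finite.copy move (can_type move_codeK).

(* A nondeterministic machine with [ntapes.+1] two-way infinite tapes; it halts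
   when no transition applies. *)
Record tm := TM {
  ntapes : nat;
  state : finType;
  symb : finType;
  blank : symb;
  start : state;
  accept : {set state};
  delta : state -> {ffun 'I_ntapes.+1 -> symb} ->
          {set state * {ffun 'I_ntapes.+1 -> symb * move}}
}.

Definition deterministic (M : tm) : Prop :=
  forall (q : state M) r, #|delta q r| <= 1.

Section Semantics.
Variable M : tm.

(* [(l, r)] is the tape whose cells left of the head are [l], nearest first,
   and whose cells from the head rightwards are [r]; all the others are blank *)
Definition tape : Type := (seq (symb M) * seq (symb M))%type.

Definition scan (t : tape) : symb M := head (blank M) t.2.

Definition update (t : tape) (a : symb M * move) : tape :=
  let: (l, r) := t in
  let r' := a.1 :: behead r in
  match a.2 with
  | MoveL => (behead l, head (blank M) l :: r')
  | MoveR => (a.1 :: l, behead r)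
  | Stay => (l, r')
  end.

Definition config : Type := (state M * ('I_(ntapes M).+1 -> tape))%type.

Definition reads (c : config) : {ffun 'I_(ntapes M).+1 -> symb M} :=
  [ffun i => scan (c.2 i)].

Definition step (c c' : config) : Prop :=
  exists2 a, (c'.1, a) \in delta c.1 (reads c) &
    forall i, c'.2 i = update (c.2 i) (a i).

Fixpoint steps (n : nat) (c c' : config) : Prop :=
  if n is m.+1 then exists2 d, step c d & steps m d c' else c = c'.

Definition halted (c : config) : Prop := delta c.1 (reads c) = finset.set0.

Definition init (w : seq (symb M)) : config :=
  (start M, fun i => if i == ord0 then ([::], w) else ([::], [::])).

(* the word that starts under the head of tape 0 and ends before the first
   blank *)
Definition output (c : config) : seq (symb M) :=
  let r := (c.2 ord0).2 in take (index (blank M) r) r.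

End Semantics.

Definition embedding (M : tm) (A : finType) (e : A -> symb M) : Prop :=
  injective e /\ forall a, e a <> blank M.

(** * NP-completeness *)

Definition language (A : finType) : Type := seq A -> Prop.

Definition NP (A : finType) (L : language A) : Prop :=
  exists (M : tm) (e : A -> symb M) (p : {poly nat}),
    embedding e /\
    forall w : seq A,
      (forall n c, steps n (init (map e w)) c -> n <= p.[size w]%R) /\
      (L w <-> exists n c, [/\ steps n (init (map e w)) c, halted c
                             & c.1 \in accept M]).

Definition polytime (A B : finType) (f : seq A -> seq B) : Prop :=
  exists (M : tm) (e : A -> symb M) (d : B -> symb M) (p : {poly nat}),
    [/\ deterministic M, embedding e, embedding d
      & forall w : seq A, exists n c,
          [/\ n <= p.[size w]%R, steps n (init (map e w)) c, halted c
            & output c = map d (f w)]].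

Definition reduces (A B : finType) (L : language A) (L' : language B) : Prop :=
  exists2 f : seq A -> seq B, polytime f & forall w, L w <-> L' (f w).

Definition NP_hard (B : finType) (L : language B) : Prop :=
  forall (A : finType) (L' : language A), NP L' -> reduces L' L.

Definition NP_complete (B : finType) (L : language B) : Prop :=
  NP L /\ NP_hard L.

(** * Regions and tilings *)

Local Open Scope classical_set_scope.
Local Open Scope ring_scope.

(* the unit square [x, x + 1] * [y, y + 1] is represented by (x, y) *)
Definition square : Type := (int * int)%type.
Definition cells : Type := {fset int * int}.

Section Plane.
Variable R : realType.

Definition unit_square (c : square) : set (R * R) :=
  `[c.1%:~R, c.1%:~R + 1] `*` `[c.2%:~R, c.2%:~R + 1].

Definition realize (S : cells) : set (R * R) :=
  \bigcup_(c in [set` S]) unit_square c.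

Definition region (S : cells) : Prop := connected (realize S)°.

Definition unit_itv : set R := `[0, 1].

Definition is_path (A : set (R * R)) (g : R -> R * R) : Prop :=
  {within unit_itv, continuous g} /\ g @` unit_itv `<=` A.

Definition path_connected (A : set (R * R)) : Prop :=
  forall x y, A x -> A y -> exists g, [/\ is_path A g, g 0 = x & g 1 = y].

(* homotopy inside A, relative to the base point g 0 = g 1 *)
Definition null_homotopic (A : set (R * R)) (g : R -> R * R) : Prop :=
  exists H : R * R -> R * R,
    [/\ {within unit_itv `*` unit_itv, continuous H},
        H @` (unit_itv `*` unit_itv) `<=` A,
        forall t, unit_itv t -> H (0, t) = g t /\ H (1, t) = g 0
      & forall s, unit_itv s -> H (s, 0) = g 0 /\ H (s, 1) = g 0].

Definition simply_connected (A : set (R * R)) : Prop :=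
  [/\ A !=set0, path_connected A
    & forall g, is_path A g -> g 0 = g 1 -> null_homotopic A g].

Definition translate (v : int * int) (S : cells) : cells :=
  [fset (((c.1 + v.1)%R, (c.2 + v.2)%R) : int * int) | c in S]%fset.

(* a placement is a pair (tile, translation vector) *)
Definition placed (p : cells * (int * int)) : set (R * R) :=
  realize (translate p.2 p.1).

Definition is_tiling (T : {fset cells}) (G : cells)
    (P : {fset cells * (int * int)}) : Prop :=
  [/\ forall p, p \in P -> p.1 \in T,
      forall p q, p \in P -> q \in P -> p != q ->
        (placed p)° `&` (placed q)° = set0
    & \bigcup_(p in [set` P]) placed p = realize G].

Definition tileable (T : {fset cells}) (G : cells) : Prop :=
  exists P, is_tiling T G P.

End Plane.

Definition rectangle (a b : nat) : cells :=
  [fset ((i%:Z, j%:Z) : int * int) | i in iota 0 a, j in iota 0 b]%fset.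

Definition rectangular (t : cells) : Prop :=
  exists a b : nat, [/\ (0 < a)%N, (0 < b)%N & t = rectangle a b].

(** * The decision problem *)

Inductive letter := Bit of bool | Minus | Comma | Semicolon.

Definition letter_code (l : letter) : bool + 'I_3 :=
  match l with
  | Bit b => inl b
  | Minus => inr (inord 0)
  | Comma => inr (inord 1)
  | Semicolon => inr (inord 2)
  end.

Definition letter_decode (x : bool + 'I_3) : letter :=
  match x with
  | inl b => Bit b
  | inr i => match val i with
             | 0%N => Minus
             | 1%N => Comma
             | _ => Semicolon
             end
  end.

Lemma letter_codeK : cancel letter_code letter_decode.
Proof. by case=> //=; rewrite inordK. Qed.

HB.instance Definition _ := Finite.copy letter (can_type letter_codeK).

(* binary expansion, most significant bit first; 0 is written as one bit *)
Definition encode_nat (n : nat) : seq letter :=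
  rev [seq Bit (odd (n %/ 2 ^ i)%N) | i <- iota 0 (trunc_log 2 n).+1].

Definition encode_int (z : int) : seq letter :=
  match z with
  | Posz n => encode_nat n
  | Negz n => Minus :: encode_nat n.+1
  end.

Definition encode (s : seq square) : seq letter :=
  flatten [seq encode_int c.1 ++ Comma :: encode_int c.2 ++ [:: Semicolon]
          | c <- s].

Definition tiling_problem (R : realType) (T : {fset cells}) : language letter :=
  fun w => exists s : seq square,
    let G : cells := [fset c in s]%fset in
    [/\ uniq s /\ w = encode s, region R G, simply_connected (@realize R G)
      & tileable R T G].

(* Main.v *)
From HB Require Import structures.
From mathcomp Require Import all_boot all_order all_algebra.
From mathcomp Require Import finmap.
From mathcomp Require Import all_classical all_reals topology normedtype.
From mathcomp Require Import zify ring lra.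
Require Import Defs.
Set Implicit Arguments.
Unset Strict Implicit.
Unset Printing Implicit Defensive.
Import Order.TTheory GRing.Theory Num.Theory.
Import numFieldNormedType.Exports.

(** Membership in NP. A finite set of cells is simply connected (with connected
    interior) exactly when its cells can be added one after the other so that
    each new cell meets the union of the previous ones in an arc of its
    boundary. Such a shelling contracts the region; conversely, a cell that
    meets a connected rest in several pieces yields a loop crossing a line
    inside the cell once, and counting crossings modulo 2 along a homotopy
    shows that it is not contractible. A certificate lists the cells in shelling
    order, each with the rectangle covering it and its position there, and is
    checked locally.

    Hardness. The computation of a nondeterministic machine is written as a CNF
    formula (Cook-Levin), and the formula as a coloring problem on a grid with
    prescribed boundary colors: each row carries the value of one variable, each
    literal owns a column, and a trigger travelling diagonally meets that column
    in the row of its variable, so that a fixed set of colors suffices; a last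
    row checks the clauses. The grid becomes a staircase-shaped region tiled by
    small rectangles of width 4 and big ones of widths 5 and 7. The widths force
    the combinatorial structure of a tiling, and the colors are read off as
    digits of the levels of the corners, one digit for each class of grid
    points modulo 2. Polynomial-time functions are generated on binary trees by
    composition and bounded iteration, and compiled to multi-tape machines. *)

(** * Stack programs *)

(** A tile sees neither its place nor the absolute level at which it lies, only its own height,
    which is the difference of the levels of two neighbouring grid points. These points lie in
    different parity classes, so their colors occupy different digits of the height and both can be
    read from it; the column parity of a big tile is given by its width. The widths 4, 5, 7 are
    chosen because neither 5 nor 7 is a sum of several of them, while 9 and 11 are sums only as 4 +
    5 and 4 + 7. Every row is shifted by 4 against the row below, so a plateau of width 5 or 7,
    together with the four columns before it, is a floor of width 9 or 11, and this forces one big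
    and one small tile. With 175 colors and 8 parity patterns there are at most 245000 tiles. For
    membership, simple connectedness speaks about all loops in the plane, and a shelling replaces it
    by local conditions. The shelling order differs from the order of the input list, but both
    orders spell words of the same length, so the certificate can be guessed as a second track on
    the input word. *)

Inductive reg := Inp | Main | Xr | Yr | Cr.

Definition rid (r : reg) : 'I_5 :=
  match r with
  | Inp => inord 0 | Main => inord 1 | Xr => inord 2 | Yr => inord 3
  | Cr => inord 4
  end.

Definition rof (i : 'I_5) : reg :=
  match val i with
  | 0 => Inp | 1 => Main | 2 => Xr | 3 => Yr | _ => Cr
  end.

Lemma ridK : cancel rid rof.
Proof. by case; rewrite /rof /= inordK. Qed.

Lemma rid0 : rid Inp = ord0.
Proof. by apply/val_inj; rewrite /= inordK. Qed.

Record store (S : Type) := Mem { m0 : seq S; m1 : seq S; m2 : seq S; m3 : seq S;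
  m4 : seq S }.

Definition rget (S : Type) (r : reg) (m : store S) : seq S :=
  match r with
  | Inp => m0 m | Main => m1 m | Xr => m2 m | Yr => m3 m | Cr => m4 m
  end.

Definition rput (S : Type) (r : reg) (s : seq S) (m : store S) : store S :=
  let: Mem a b c d e := m in
  match r with
  | Inp => Mem s b c d e | Main => Mem a s c d e | Xr => Mem a b s d e
  | Yr => Mem a b c s e | Cr => Mem a b c d s
  end.

Lemma rget_put (S : Type) r (s : seq S) m r' :
  rget r' (rput r s m) = if rid r' == rid r then s else rget r' m.
Proof.
case: eqP => [/(can_inj ridK) ->|h]; first by case: m; case: r.
by case: m => a b c d e; case: r r' h => [] [].
Qed.

Section Programs.
Variable S : finType.

Inductive prog :=
  | Push of reg & S
  | Pop of reg
  | Seq of prog & prog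
  | If of reg & pred (option S) & prog & prog
  | While of reg & pred (option S) & prog.

(** The number counts the steps of the compiled machine exactly. A push costs two, since the head
    first moves left and then overwrites the cell found there; a pop or a test costs one. *)
Inductive exec : prog -> store S -> nat -> store S -> Prop :=
  | ExecPush r a m : exec (Push r a) m 2 (rput r (a :: rget r m) m)
  | ExecPop r m : exec (Pop r) m 1 (rput r (behead (rget r m)) m)
  | ExecSeq p q m t m' t' m'' : exec p m t m' -> exec q m' t' m'' ->
      exec (Seq p q) m (t + t') m''
  | ExecIf r (P : pred (option S)) p q m t m' :
      exec (if P (ohead (rget r m)) then p else q) m t m' ->
      exec (If r P p q) m t.+1 m'
  | ExecWhileF r (P : pred (option S)) p m : ~~ P (ohead (rget r m)) -> exec (While r P p) m 1 m
  | ExecWhileT r (P : pred (option S)) p m t m' t' m'' : P (ohead (rget r m)) ->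
      exec p m t m' -> exec (While r P p) m' t' m'' ->
      exec (While r P p) m (t + t').+1 m''.

(** Control points of the compiled program. Its exit is not one of them: it is the [None] of
    [option (pstate p)], which [goto] redirects to the continuation in the enclosing program. *)
Fixpoint pstate (p : prog) : finType :=
  match p with
  | Push _ _ => bool
  | Pop _ => unit
  | Seq p q => (pstate p + pstate q)%type
  | If _ _ p q => option (pstate p + pstate q)
  | While _ _ p => option (pstate p)
  end.

Fixpoint entry (p : prog) : pstate p :=
  match p with
  | Push _ _ => true
  | Pop _ => tt
  | Seq p q => inl (entry p)
  | If _ _ p q => None
  | While _ _ p => None
  end.

Definition act := option (reg * (option S * move)).

Definition goto (A B : Type) (f : A -> B) (k : option B) (x : option A * act) :
    option B * act :=
  (if x.1 is Some a then Some (f a) else k, x.2).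

Fixpoint next (p : prog) : pstate p -> (reg -> option S) ->
    option (pstate p) * act :=
  match p return pstate p -> (reg -> option S) -> option (pstate p) * act with
  | Push r a => fun s rd =>
      if s then (Some false, Some (r, (rd r, MoveL)))
      else (None, Some (r, (Some a, Stay)))
  | Pop r => fun _ _ => (None, Some (r, (None, MoveR)))
  | Seq p q => fun s rd =>
      match s with
      | inl s => goto inl (Some (inr (entry q))) (next s rd)
      | inr s => goto inr None (next s rd)
      end
  | If r P p q => fun s rd =>
      match s with
      | None => (Some (Some (if P (rd r) then inl (entry p)
                             else inr (entry q))), None)
      | Some (inl s) => goto (Some \o inl) None (next s rd)
      | Some (inr s) => goto (Some \o inr) None (next s rd)
      end
  | While r P p => fun s rd =>
      match s with
      | None => (if P (rd r) then Some (Some (entry p)) else None, None)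
      | Some s => goto Some (Some None) (next s rd)
      end
  end.

Definition stape := (seq (option S) * seq (option S))%type.

Definition top (t : stape) : option S := head None t.2.

Definition retape (t : stape) (a : option S * move) : stape :=
  let: (l, r) := t in
  let r' := a.1 :: behead r in
  match a.2 with
  | MoveL => (behead l, head None l :: r')
  | MoveR => (a.1 :: l, behead r)
  | Stay => (l, r')
  end.

Definition acts (a : act) (rd : 'I_5 -> option S) :
    {ffun 'I_5 -> option S * move} :=
  [ffun j => if a is Some (r, x) then if j == rid r then x else (rd j, Stay)
             else (rd j, Stay)].

Definition move_tapes (a : act) (T : 'I_5 -> stape) : 'I_5 -> stape :=
  fun j => retape (T j) (acts a (fun i => top (T i)) j).

Fixpoint frun (p : prog) n (s : option (pstate p)) (T : 'I_5 -> stape)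
    (s' : option (pstate p)) (T' : 'I_5 -> stape) : Prop :=
  if n is n'.+1 then
    if s is Some s0 then
      let x := next s0 (fun r => top (T (rid r))) in
      frun n' x.1 (move_tapes x.2 T) s' T'
    else False
  else s = s' /\ T = T'.

Lemma frun_cat p n1 n2 (s1 s2 s3 : option (pstate p)) T1 T2 T3 :
  frun n1 s1 T1 s2 T2 -> frun n2 s2 T2 s3 T3 -> frun (n1 + n2) s1 T1 s3 T3.
Proof. by elim: n1 s1 T1 => [|n IH] [s|] T1 //= => [[-> ->]|[-> ->]|/IH]. Qed.

Lemma frun_lift p q (f : pstate p -> pstate q) (k : option (pstate q)) :
  (forall s rd, next (f s) rd = goto f k (next s rd)) ->
  forall n s T T', frun n (Some s) T None T' -> frun n (Some (f s)) T k T'.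
Proof.
move=> hf; elim=> [|n IH] s T T' /=; first by case.
rewrite hf /goto /=; case E: (next _ _) => [[s'|] a] /=; first exact: IH.
by case: n {IH} => [|n] //= [_ ->].
Qed.

(** The top of the stack is under the head and the stack extends to the right. Nothing is required
    of the cells on the left, which a push overwrites; the number of trailing blanks is free because
    touching an empty stack may create some. *)
Definition rep (s : seq S) (t : stape) :=
  exists k, t.2 = map Some s ++ nseq k None.

Lemma rep_top s t : rep s t -> top t = ohead s.
Proof. by case=> k; rewrite /top => ->; case: s => //; case: k. Qed.

Lemma rep_stay s t : rep s t -> rep s (retape t (top t, Stay)).
Proof.
case: t => l r [k /= ->]; rewrite /rep /top /=.
by case: s => [|a s]; [case: k => [|k]; [exists 1|exists k.+1] | exists k].
Qed.

Lemma rep_pop s t x : rep s t -> rep (behead s) (retape t (x, MoveR)).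
Proof.
case: t => l r [k /= ->]; rewrite /rep /=.
by case: s => [|a s]; [exists k.-1; case: k | exists k].
Qed.

Lemma rep_push s t a :
  rep s t -> rep (a :: s) (retape (retape t (top t, MoveL)) (Some a, Stay)).
Proof.
case: t => l r [k /= ->]; rewrite /rep /top /=.
by case: s => [|b s]; [case: k => [|k]; [exists 1|exists k.+1] | exists k].
Qed.

Definition reps (m : store S) (T : 'I_5 -> stape) :=
  forall r, rep (rget r m) (T (rid r)).

Lemma reps_none m T : reps m T -> reps m (move_tapes None T).
Proof. by move=> h r; rewrite /move_tapes /acts ffunE; apply: rep_stay. Qed.

Lemma reps_pop m T r x : reps m T ->
  reps (rput r (behead (rget r m)) m) (move_tapes (Some (r, (x, MoveR))) T).
Proof.
move=> h r'; rewrite rget_put /move_tapes /acts ffunE.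
by case: eqP => [->|_]; [apply: rep_pop; apply: h | apply: rep_stay; apply: h].
Qed.

Lemma reps_push m T r a : reps m T ->
  reps (rput r (a :: rget r m) m) (move_tapes (Some (r, (Some a, Stay)))
    (move_tapes (Some (r, (top (T (rid r)), MoveL))) T)).
Proof.
move=> h r'; rewrite rget_put /move_tapes /acts !ffunE.
case: eqP => [->|_]; first by apply: rep_push; apply: h.
by apply: rep_stay; apply: rep_stay; apply: h.
Qed.

Lemma exec_frun p m n m' : exec p m n m' -> forall T, reps m T ->
  exists2 T', reps m' T' & frun n (Some (entry p)) T None T'.
Proof.
elim=> {p m n m'}.
- by move=> r a m T h; eexists; first exact: (reps_push r a h).
- by move=> r m T h; eexists; first exact: (reps_pop r None h).
- move=> p q m t m' t' m'' _ IH1 _ IH2 T h.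
  have [T1 /IH2[T2 h2 r2] r1] := IH1 _ h; exists T2 => //.
  apply: (@frun_cat (Seq p q) _ _ _ (Some (inr (entry q))) _ _ T1).
    exact: (@frun_lift p (Seq p q) inl).
  exact: (@frun_lift q (Seq p q) inr).
- move=> r P p q m t m' _ IH T h.
  have [T' h' r'] := IH _ (reps_none h); exists T' => //=.
  rewrite (rep_top (h r)); move: r'; case: ifP => _.
    exact: (@frun_lift p (If r P p q) (Some \o inl)).
  exact: (@frun_lift q (If r P p q) (Some \o inr)).
- move=> r P p m hP T h; exists (move_tapes None T); first exact: reps_none.
  by rewrite /= (rep_top (h r)) (negbTE hP).
- move=> r P p m t m' t' m'' hP _ IH1 _ IH2 T h.
  have [T1 /IH2[T2 h2 r2] r1] := IH1 _ (reps_none h); exists T2 => //=.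
  rewrite (rep_top (h r)) hP.
  apply: (@frun_cat (While r P p) _ _ _ (Some None) _ _ T1) => //.
  exact: (@frun_lift p (While r P p) Some).
Qed.

Definition det_machine (p : prog) : tm :=
  @TM 4 (option (pstate p)) (option S) None (Some (entry p)) finset.set0
    (fun s r => if s is Some s0 then
       let x := next s0 (fun i => r (rid i)) in
       [set (x.1, acts x.2 r)]%SET else finset.set0).

Lemma det_machine_deterministic p : deterministic (det_machine p).
Proof. by move=> [s|] r /=; rewrite ?cards1 ?cards0. Qed.

Lemma frun_steps p n (s s' : option (pstate p)) T T' : frun n s T s' T' ->
  @steps (det_machine p) n (s, T) (s', T').
Proof.
elim: n s T => [|n IH] [s|] T //=; try by case=> -> ->.
move/IH; set x := next _ _ => h.
exists (x.1, move_tapes x.2 T) => //.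
have rdE : (fun i => @reads (det_machine p) (Some s, T) (rid i))
    = (fun r => top (T (rid r))) by apply/funext => r; rewrite ffunE.
exists (acts x.2 (@reads (det_machine p) (Some s, T))) => /=.
  by rewrite rdE -/x finset.set11.
move=> i; rewrite /move_tapes; congr (retape _ (_ i)).
by congr (acts _ _); apply/funext => j; rewrite ffunE.
Qed.

End Programs.

(** * Polynomial-time functions on binary trees *)

Inductive tree := Leaf | Node of tree & tree.

(** Preorder code. It is prefix-free, so several trees can lie on one stack one above the other
    without separators. *)
Fixpoint ser (d : tree) : seq bool :=
  if d is Node a b then true :: ser a ++ ser b else [:: false].

Definition tsize (d : tree) : nat := size (ser d).

Definition tfst (d : tree) := if d is Node a _ then a else Leaf.
Definition tsnd (d : tree) := if d is Node _ b then b else Leaf.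
Definition tbool (b : bool) : tree := if b then Node Leaf Leaf else Leaf.

Lemma tsizeN a b : tsize (Node a b) = (tsize a + tsize b).+1.
Proof. by rewrite /tsize /= size_cat. Qed.

Lemma ser_cat_inj a b r r' : ser a ++ r = ser b ++ r' -> a = b /\ r = r'.
Proof.
elim: a b r r' => [|a1 IH1 a2 IH2] [|b1 b2] r r' //=; first by case.
by rewrite -!catA; case=> /IH1[-> /IH2[-> ->]].
Qed.

Lemma ser_inj : injective ser.
Proof. by move=> a b h; case: (@ser_cat_inj a b [::] [::]); rewrite ?h. Qed.

(** The shift by 2 makes these bounds absorb constants, sums and products even at [n = 0] and
    [n = 1]. *)
Definition pbound (t : nat -> nat) := exists k, forall n, t n <= (n + 2) ^ k.

Lemma pbound_le s t : (forall n, s n <= t n) -> pbound t -> pbound s.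
Proof. by move=> h [k hk]; exists k => n; apply: leq_trans (h n) (hk n). Qed.

Lemma pbound_cst c : pbound (fun _ => c).
Proof.
exists c => n; apply: leq_trans (ltnW (ltn_expl c (ltnSn 1))) _.
by case: c => // c; rewrite leq_exp2r // addn2.
Qed.

Lemma pbound_id : pbound id.
Proof. by exists 1 => n; rewrite expn1 leq_addr. Qed.

Lemma exp2_le n k l : k <= l -> (n + 2) ^ k <= (n + 2) ^ l.
Proof. by move=> h; rewrite leq_exp2l // addn2. Qed.

Lemma pboundM s t : pbound s -> pbound t -> pbound (fun n => s n * t n).
Proof.
by move=> [k hk] [l hl]; exists (k + l) => n; rewrite expnD leq_mul.
Qed.

Lemma pboundD s t : pbound s -> pbound t -> pbound (fun n => s n + t n).
Proof.
move=> [k hk] [l hl]; exists (maxn k l).+1 => n.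
have a := leq_trans (hk n) (exp2_le n (leq_maxl k l)).
have b := leq_trans (hl n) (exp2_le n (leq_maxr k l)).
rewrite expnS; apply: leq_trans (leq_add a b) _.
by rewrite addnn -mul2n leq_mul2r leq_addl orbT.
Qed.

Lemma pbound_exp s k : pbound s -> pbound (fun n => s n ^ k).
Proof.
move=> hs; elim: k => [|k IH]; first exact: pbound_cst.
by apply: pbound_le (pboundM hs IH) => n; rewrite expnS.
Qed.

(** * Executions with an upper bound on the time *)

Section Runs.
Variable S : finType.

Definition runs (p : prog S) m t m' := exists2 n, n <= t & exec p m n m'.

Lemma runs_exec p m t m' : exec p m t m' -> runs p m t m'.
Proof. by move=> h; exists t. Qed.

Lemma runs_le p m t t' m' : t <= t' -> runs p m t m' -> runs p m t' m'.
Proof. by move=> h [n hn e]; exists n => //; apply: leq_trans h. Qed.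

Lemma runs_seq p q m t m' t' m'' : runs p m t m' -> runs q m' t' m'' ->
  runs (Seq p q) m (t + t') m''.
Proof.
move=> [n hn e] [n' hn' e']; exists (n + n'); first exact: leq_add.
exact: ExecSeq e e'.
Qed.

Lemma runs_if r (P : pred (option S)) p q m t m' :
  runs (if P (ohead (rget r m)) then p else q) m t m' ->
  runs (If r P p q) m t.+1 m'.
Proof. by move=> [n hn e]; exists n.+1 => //; apply: ExecIf. Qed.

Lemma runs_whileF r (P : pred (option S)) p m :
  ~~ P (ohead (rget r m)) -> runs (While r P p) m 1 m.
Proof. by move=> h; apply/runs_exec/ExecWhileF. Qed.

Lemma runs_whileT r (P : pred (option S)) p m t m' t' m'' :
  P (ohead (rget r m)) -> runs p m t m' -> runs (While r P p) m' t' m'' ->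
  runs (While r P p) m (t + t').+1 m''.
Proof.
move=> h [n hn e] [n' hn' e']; exists (n + n').+1.
  by rewrite ltnS leq_add.
exact: ExecWhileT h e e'.
Qed.

End Runs.

(** * Moving, copying and comparing trees on stacks *)

Section TreePrograms.
Variable X : finType.
Local Notation S := (bool + X)%type.
Local Notation prog := (prog S).

Definition bit_stack (s : seq bool) : seq S := map inl s.

Definition isbit (b : bool) : pred (option S) := fun o => o == Some (inl b).
Definition nonempty : pred (option S) := isSome.

Definition Skip : prog := While Main pred0 (Pop _ Main).

Lemma runs_skip m : runs Skip m 1 m.
Proof. exact: runs_whileF. Qed.

Definition bit_move (i j : reg) : prog :=
  If i (isbit true) (Seq (Pop _ i) (Push j (inl true)))
                    (Seq (Pop _ i) (Push j (inl false))).

Lemma runs_bit_move i j m b s : rget i m = inl b :: s ->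
  runs (bit_move i j) m 4 (rput j (inl b :: rget j (rput i s m)) (rput i s m)).
Proof.
move=> h; apply: runs_if; rewrite h /isbit /=.
have -> : rput i s m = rput i (behead (rget i m)) m by rewrite h.
by case: b {h} => /=; apply: (@runs_seq _ _ _ _ 1 _ 2);
  apply: runs_exec; constructor.
Qed.

Definition dump (i j : reg) : prog := While i nonempty (bit_move i j).

Lemma runs_dump i j s m : rid i != rid j -> rget i m = bit_stack s ->
  runs (dump i j) m (5 * size s + 1)
    (rput i [::] (rput j (rev (bit_stack s) ++ rget j m) m)).
Proof.
move=> hij; elim: s m => [|b s IH] m h.
  have -> : rput i [::] (rput j (rev (bit_stack [::]) ++ rget j m) m) = m.
    by move: h hij; case: m => ? ? ? ? ?; case: i; case: j => //= ->.
  by apply: runs_whileF; rewrite h.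
have {}IH := IH (rput j (inl b :: rget j (rput i (bit_stack s) m)) (rput i (bit_stack s) m)).
have /IH{}IH : rget i (rput j (inl b :: rget j (rput i (bit_stack s) m))
    (rput i (bit_stack s) m)) = bit_stack s.
  by rewrite rget_put (negbTE hij) rget_put eqxx.
apply: (@runs_le _ _ _ (4 + (5 * size s + 1)).+1); first by rewrite /=; lia.
apply: runs_whileT (runs_bit_move j h) _; first by rewrite h.
congr (runs _ _ _ _): IH; rewrite /= rev_cons cat_rcons.
by move: hij; case: m h => ? ? ? ? ?; case: i; case: j; rewrite ?eqxx.
Qed.

Definition sel (b : bool) : reg := if b then Xr else Yr.
(** The flag chooses which of [Xr] and [Yr] is written, so that one statement covers both versions
    of [pull]. *)
Definition mk (b : bool) (inp main u v c : seq S) : store S :=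
  if b then Mem inp main u v c else Mem inp main v u c.

(** [Cr] holds in unary the number of trees still to be read: a node bit replaces one pending tree
    by two, a leaf bit finishes one. The loop therefore stops exactly at the end of the first
    code. *)
Definition pull_loop b : prog :=
  While Cr nonempty
    (If Main (isbit true)
       (Seq (Pop _ Main) (Seq (Push (sel b) (inl true)) (Push Cr (inl true))))
       (Seq (Pop _ Main) (Seq (Push (sel b) (inl false)) (Pop _ Cr)))).

Definition sers (ds : seq tree) : seq bool := flatten (map ser ds).

(** Stated for a list of pending trees, since reading a node turns its two subtrees into pending
    trees; the induction is on the number of bits left. *)
Lemma runs_pull_loop b ds r inp u v :
  runs (pull_loop b)
    (mk b inp (bit_stack (sers ds) ++ r) u v (nseq (size ds) (inl true)))
    (7 * size (sers ds) + 1)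
    (mk b inp r (rev (bit_stack (sers ds)) ++ u) v [::]).
Proof.
have [n] := ubnP (size (sers ds)).
elim: n ds u => // n IH [|d ds] u; first by move=> _; case: b {IH}; apply: runs_whileF.
rewrite /sers /= size_cat => hn.
case: d hn => [|d1 d2] /= hn.
- have {}IH := IH ds (inl false :: u) (ltac:(rewrite /sers; lia)).
  apply: (@runs_le _ _ _ (5 + (7 * size (sers ds) + 1)).+1).
    by rewrite /sers; lia.
  apply: (runs_whileT (m' := mk b inp (bit_stack (sers ds) ++ r) (inl false :: u) v
     (nseq (size ds) (inl true)))); first by case: b {IH}.
    case: b {IH}; apply: runs_if; rewrite /isbit /=;
      apply: (@runs_seq _ _ _ _ 1 _ 3); try (by apply/runs_exec/ExecPop);
      apply: (@runs_seq _ _ _ _ 2 _ 1); try (by apply/runs_exec/ExecPush);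
      by apply/runs_exec/ExecPop.
  by rewrite rev_cons cat_rcons.
- have {}IH := IH (d1 :: d2 :: ds) (inl true :: u)
    (ltac:(rewrite /sers /= !size_cat; move: hn; rewrite size_cat; lia)).
  apply: (@runs_le _ _ _ (6 + (7 * size (sers (d1 :: d2 :: ds)) + 1)).+1).
    by rewrite /sers /= !size_cat; lia.
  apply: (runs_whileT (m' := mk b inp (bit_stack (sers (d1 :: d2 :: ds)) ++ r)
     (inl true :: u) v (nseq (size ds).+2 (inl true)))); first by case: b {IH}.
    rewrite /sers /= !catA.
    case: b {IH}; apply: runs_if; rewrite /isbit /=;
      apply: (@runs_seq _ _ _ _ 1 _ 4); try (by apply/runs_exec/ExecPop);
      apply: (@runs_seq _ _ _ _ 2 _ 2); by apply/runs_exec/ExecPush.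
  by congr (runs _ _ _ _): IH; rewrite /sers /= rev_cons cat_rcons !catA.
Qed.

Definition pull b : prog := Seq (Push Cr (inl true)) (pull_loop b).

Lemma runs_pull b d r inp u v :
  runs (pull b) (mk b inp (bit_stack (ser d) ++ r) u v [::]) (7 * tsize d + 3)
    (mk b inp r (rev (bit_stack (ser d)) ++ u) v [::]).
Proof.
apply: (@runs_le _ _ _ (2 + (7 * tsize d + 1))); first by lia.
apply: (runs_seq (m' := mk b inp (bit_stack (ser d) ++ r) u v [:: inl true])).
  by case: b; apply/runs_exec/ExecPush.
by have := runs_pull_loop b [:: d] r inp u v; rewrite /sers /= cats0.
Qed.

Definition clean (main : seq S) inp : store S := Mem inp main [::] [::] [::].

Lemma runs_undump i s m : rid i != rid Main -> rget i m = rev (bit_stack s) ->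
  runs (dump i Main) m (5 * size s + 1)
    (rput i [::] (rput Main (bit_stack s ++ rget Main m) m)).
Proof.
move=> hi h; have hs : rget i m = bit_stack (rev s) by rewrite h /bit_stack map_rev.
by have := runs_dump hi hs; rewrite size_rev /bit_stack map_rev revK.
Qed.

Lemma ridXM : rid Xr != rid Main. Proof. by rewrite -val_eqE /= !inordK. Qed.
Lemma ridYM : rid Yr != rid Main. Proof. by rewrite -val_eqE /= !inordK. Qed.
Lemma ridYX : rid Yr != rid Xr. Proof. by rewrite -val_eqE /= !inordK. Qed.

Definition Swap : prog :=
  Seq (pull true) (Seq (pull false) (Seq (dump Xr Main) (dump Yr Main))).

Lemma runs_swap d1 d2 r inp :
  runs Swap (clean (bit_stack (ser d1) ++ bit_stack (ser d2) ++ r) inp)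
    (12 * tsize d1 + 12 * tsize d2 + 8)
    (clean (bit_stack (ser d2) ++ bit_stack (ser d1) ++ r) inp).
Proof.
apply: (@runs_le _ _ _ ((7 * tsize d1 + 3) + ((7 * tsize d2 + 3) +
  ((5 * tsize d1 + 1) + (5 * tsize d2 + 1))))); first by lia.
apply: runs_seq; first exact: (runs_pull true d1).
rewrite cats0; apply: runs_seq; first exact: (runs_pull false d2).
rewrite cats0; apply: runs_seq; first exact: (@runs_undump Xr (ser d1) _ ridXM).
exact: (@runs_undump Yr (ser d2) _ ridYM).
Qed.

Definition Drop : prog := Seq (pull true) (While Xr nonempty (Pop _ Xr)).

Lemma runs_clear_X inp main s y c :
  runs (While Xr nonempty (Pop _ Xr)) (Mem inp main s y c) (2 * size s + 1)
    (Mem inp main [::] y c).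
Proof.
elim: s => [|a s IH]; first exact: runs_whileF.
apply: (@runs_le _ _ _ (1 + (2 * size s + 1)).+1); first by rewrite /=; lia.
by apply: runs_whileT IH => //; apply/runs_exec/ExecPop.
Qed.

Lemma runs_drop d r inp :
  runs Drop (clean (bit_stack (ser d) ++ r) inp) (9 * tsize d + 4) (clean r inp).
Proof.
apply: (@runs_le _ _ _ ((7 * tsize d + 3) + (2 * tsize d + 1))); first by lia.
apply: runs_seq; first exact: (runs_pull true d).
by rewrite cats0; have := runs_clear_X inp r (rev (bit_stack (ser d))) [::] [::];
  rewrite size_rev size_map.
Qed.

Definition restore_copy : prog :=
  While Xr nonempty
    (If Xr (isbit true)
      (Seq (Pop _ Xr) (Seq (Push Main (inl true)) (Push Yr (inl true))))
      (Seq (Pop _ Xr) (Seq (Push Main (inl false)) (Push Yr (inl false))))).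

Lemma runs_restore_copy inp main s y c :
  runs restore_copy (Mem inp main (bit_stack s) y c) (7 * size s + 1)
    (Mem inp (rev (bit_stack s) ++ main) [::] (rev (bit_stack s) ++ y) c).
Proof.
elim: s main y => [|b s IH] main y; first exact: runs_whileF.
apply: (@runs_le _ _ _ (6 + (7 * size s + 1)).+1); first by rewrite /=; lia.
rewrite /= rev_cons !cat_rcons; apply: runs_whileT (IH _ _) => //.
by case: b; apply: runs_if; rewrite /isbit /=;
  (apply: (@runs_seq _ _ _ _ 1 _ 4); first exact/runs_exec/ExecPop);
  apply: (@runs_seq _ _ _ _ 2 _ 2); apply/runs_exec/ExecPush.
Qed.

Definition Dup : prog :=
  Seq (pull true) (Seq restore_copy (Seq (dump Yr Xr) (dump Xr Main))).

Lemma runs_dup d r inp :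
  runs Dup (clean (bit_stack (ser d) ++ r) inp) (24 * tsize d + 6)
    (clean (bit_stack (ser d) ++ bit_stack (ser d) ++ r) inp).
Proof.
apply: (@runs_le _ _ _ ((7 * tsize d + 3) + ((7 * tsize d + 1) +
  ((5 * tsize d + 1) + (5 * tsize d + 1))))); first by lia.
apply: runs_seq; first exact: (runs_pull true d).
rewrite cats0; apply: runs_seq.
  have := runs_restore_copy inp r (rev (ser d)) [::] [::].
  by rewrite size_rev /bit_stack map_rev revK; apply.
rewrite cats0; apply: runs_seq; first exact: (@runs_dump Yr Xr (ser d) _ ridYX).
rewrite /= cats0; exact: (@runs_undump Xr (ser d) _ ridXM).
Qed.

Definition compare_loop : prog :=
  While Xr nonempty
    (If Xr (isbit true)
      (Seq (Pop _ Xr) (If Yr (isbit true) (Pop _ Yr)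
                         (Seq (Pop _ Yr) (Push Cr (inl true)))))
      (Seq (Pop _ Xr) (If Yr (isbit false) (Pop _ Yr)
                         (Seq (Pop _ Yr) (Push Cr (inl true)))))).

(** [k] counts the disagreements. A second stack that is too short disagrees from its end on; one
    that is too long leaves a remainder, which [Compare] adds to the count. *)
Lemma runs_compare_loop inp main u v c : exists k,
  runs compare_loop (Mem inp main (bit_stack u) (bit_stack v) (nseq c (inl true)))
    (7 * size u + 1)
    (Mem inp main [::] (bit_stack (drop (size u) v)) (nseq (k + c) (inl true)))
  /\ (k == 0) = (take (size u) v == u) /\ k <= size u.
Proof.
elim: u v c => [|b u IH] v c.
  by exists 0; split; [rewrite drop0; apply: runs_whileF | rewrite take0 eqxx].
have body k v' : (k = (v' != Some b)) -> v' = ohead v ->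
   runs (If Xr (isbit true)
      (Seq (Pop _ Xr) (If Yr (isbit true) (Pop _ Yr)
                         (Seq (Pop _ Yr) (Push Cr (inl true)))))
      (Seq (Pop _ Xr) (If Yr (isbit false) (Pop _ Yr)
                         (Seq (Pop _ Yr) (Push Cr (inl true))))))
    (Mem inp main (bit_stack (b :: u)) (bit_stack v) (nseq c (inl true))) 6
    (Mem inp main (bit_stack u) (bit_stack (behead v)) (nseq (k + c) (inl true))).
  move=> -> ->; apply: runs_if.
  have skipv : exec (Pop _ Yr) (Mem inp main (bit_stack u) (bit_stack v)
     (nseq c (inl true))) 1 (Mem inp main (bit_stack u) (bit_stack (behead v))
     (nseq c (inl true))).
    by case: v => [|x v]; [exact: ExecPop | exact: ExecPop].
  case: b; rewrite /isbit /=.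
  - apply: (@runs_seq _ _ _ _ 1 _ 4); first exact/runs_exec/ExecPop.
    apply: runs_if; rewrite /=; case: v skipv => [|[] v] /= skipv.
    + apply: (@runs_seq _ _ _ _ 1 _ 2 _ (runs_exec skipv)).
      exact/runs_exec/ExecPush.
    + by apply: runs_le (runs_exec skipv).
    + apply: (@runs_seq _ _ _ _ 1 _ 2 _ (runs_exec skipv)).
      exact/runs_exec/ExecPush.
  - apply: (@runs_seq _ _ _ _ 1 _ 4); first exact/runs_exec/ExecPop.
    apply: runs_if; rewrite /=; case: v skipv => [|[] v] /= skipv.
    + apply: (@runs_seq _ _ _ _ 1 _ 2 _ (runs_exec skipv)).
      exact/runs_exec/ExecPush.
    + apply: (@runs_seq _ _ _ _ 1 _ 2 _ (runs_exec skipv)).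
      exact/runs_exec/ExecPush.
    + by apply: runs_le (runs_exec skipv).
have [k [r [hk kl]]] := IH (behead v) ((ohead v != Some b) + c).
exists (k + (ohead v != Some b)); split; last split.
- apply: (@runs_le _ _ _ (6 + (7 * size u + 1)).+1); first by rewrite /=; lia.
  have -> : drop (size (b :: u)) v = drop (size u) (behead v) by case: v {r hk body}.
  rewrite -addnA; apply: runs_whileT r => //; exact: (body _ (ohead v)).
- rewrite addn_eq0 hk; case: v {r hk body} => [|x v] /=; first by case: u {IH kl}.
  by rewrite eqseq_cons eqb0 negbK (inj_eq Some_inj) andbC.
- by rewrite /= -addn1 leq_add // leq_b1.
Qed.

Definition Compare : prog :=
  Seq (Pop _ Main) (Seq (pull true) (Seq (pull false)
  (Seq compare_loop (Seq (While Yr nonempty (Seq (Pop _ Yr) (Push Cr (inl true))))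
  (If Cr nonempty (Seq (While Cr nonempty (Pop _ Cr)) (Push Main (inl false)))
     (Seq (Push Main (inl false)) (Seq (Push Main (inl false))
        (Push Main (inl true))))))))).

Lemma runs_compare a b r inp :
  runs Compare (clean (bit_stack (ser (Node a b)) ++ r) inp) (30 * (tsize (Node a b)) + 30)
    (clean (bit_stack (ser (tbool (ser a == ser b))) ++ r) inp).
Proof.
have [k [hr [hk kl]]] := runs_compare_loop inp r (rev (ser a)) (rev (ser b)) 0.
rewrite size_rev in hr hk kl.
set l := drop (size (ser a)) (rev (ser b)) in hr.
have r2 c m : runs (While Yr nonempty (Seq (Pop _ Yr) (Push Cr (inl true))))
   (Mem inp r [::] (bit_stack m) (nseq c (inl true))) (4 * size m + 1)
   (Mem inp r [::] [::] (nseq (size m + c) (inl true))).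
  elim: m c => [|x m IH] c; first exact: runs_whileF.
  apply: (@runs_le _ _ _ (3 + (4 * size m + 1)).+1); first by rewrite /=; lia.
  rewrite [size (x :: m)]/= [(size m).+1 + c]addSnnS; apply: runs_whileT (IH _) => //.
  by apply: (@runs_seq _ _ _ _ 1 _ 2); apply: runs_exec;
    [exact: ExecPop | exact: ExecPush].
have r3 c : runs (While Cr nonempty (Pop _ Cr))
   (Mem inp r [::] [::] (nseq c (inl true))) (2 * c + 1) (clean r inp).
  elim: c => [|c IH]; first exact: runs_whileF.
  apply: (@runs_le _ _ _ (1 + (2 * c + 1)).+1); first by lia.
  by apply: runs_whileT IH => //; apply/runs_exec/ExecPop.
have e : (size l + (k + 0) == 0) = (ser a == ser b).
  rewrite addn0 addn_eq0 hk size_eq0 /l.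
  have -> : (ser a == ser b) = (rev (ser b) == rev (ser a)).
    by rewrite (inj_eq (can_inj revK)) eq_sym.
  apply/andP/eqP => [[/eqP h0 /eqP h1]|->].
    by rewrite -[rev (ser b)](cat_take_drop (size (ser a))) h1 h0 cats0.
  by rewrite -(size_rev (ser a)) drop_size take_size.
have ll : size l <= tsize b by rewrite /l size_drop size_rev leq_subr.
apply: (@runs_le _ _ _ (1 + ((7 * tsize a + 3) + ((7 * tsize b + 3) +
  ((7 * tsize a + 1) + ((4 * size l + 1) + (2 * (size l + k) + 10))))))).
  by rewrite tsizeN; move: ll kl; rewrite /tsize; lia.
apply: (runs_seq (m' := clean (bit_stack (ser a) ++ bit_stack (ser b) ++ r) inp)).
  by rewrite /= /bit_stack map_cat -catA; apply/runs_exec/ExecPop.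
apply: runs_seq; first exact: (runs_pull true a).
rewrite cats0; apply: runs_seq; first exact: (runs_pull false b).
rewrite cats0; apply: runs_seq.
  by move: hr; rewrite /bit_stack !map_rev; apply.
apply: runs_seq; first exact: r2.
apply: (@runs_le _ _ _ (2 * (size l + k) + 9).+1); first by lia.
apply: runs_if => /=; case: (ser a == ser b) e => e.
  rewrite (eqP e) /=.
  apply: (@runs_le _ _ _ (2 + (2 + 2))); first by lia.
  by do 2?(apply: runs_seq; first exact/runs_exec/ExecPush);
    exact/runs_exec/ExecPush.
case E: (size l + (k + 0)) e => [|c] // _ /=.
apply: (@runs_le _ _ _ ((2 * c.+1 + 1) + 2)); first by lia.
by apply: runs_seq; [exact: (r3 c.+1) | exact/runs_exec/ExecPush].
Qed.

End TreePrograms.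

Arguments bit_stack {X} s.
Arguments Swap {X}.
Arguments Drop {X}.
Arguments Dup {X}.
Arguments Compare {X}.
Arguments Skip {X}.
Arguments isbit {X} b.
Arguments Pop {S} r.

(** * Encodings of data types as trees *)

Class Enc (T : Type) := enc : T -> tree.

#[export] Instance enc_unit : Enc unit := fun _ => Leaf.
#[export] Instance enc_bool : Enc bool := tbool.
#[export] Instance enc_pair (A B : Type) `{Enc A} `{Enc B} : Enc (A * B) :=
  fun x => Node (enc x.1) (enc x.2).
#[export] Instance enc_seq (A : Type) `{Enc A} : Enc (seq A) :=
  fix f s := if s is x :: s' then Node (enc x) (f s') else Leaf.
#[export] Instance enc_nat : Enc nat :=
  fix f n := if n is m.+1 then Node Leaf (f m) else Leaf.
(** Kept out of the global instances: a product of finite types is encoded sometimes by components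
    and sometimes as one finite type. *)
Definition enc_fin (F : finType) : Enc F := fun x => enc (index x (enum F)).
Arguments enc_fin : clear implicits.

Class EncInj (T : Type) {eT : Enc T} := enc_inj : injective (enc (T := T)).
Arguments EncInj T {eT}.

#[export] Instance enc_bool_inj : EncInj bool.
Proof. by case; case. Qed.

#[export] Instance enc_pair_inj (A B : Type) `{EncInj A} `{EncInj B} :
  EncInj (A * B).
Proof.
move=> [a b] [c d] h; congr pair; apply: enc_inj.
  exact: (congr1 tfst h).
exact: (congr1 tsnd h).
Qed.

#[export] Instance enc_seq_inj (A : Type) `{EncInj A} : EncInj (seq A).
Proof.
elim=> [|x s IH] [|y t] //= h; congr cons; last exact: IH (congr1 tsnd h).
by apply: enc_inj; exact: (congr1 tfst h).
Qed.

#[export] Instance enc_nat_inj : EncInj nat.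
Proof. by elim=> [|m IH] [|n] //= [/IH ->]. Qed.

Lemma enc_fin_inj (F : finType) : @EncInj F (enc_fin F).
Proof.
move=> x y /(@enc_nat_inj (index x (enum F)) (index y (enum F))) h.
rewrite -(nth_index x (mem_enum F x)) h.
by rewrite nth_index // mem_enum.
Qed.

Definition esize (A : Type) `{Enc A} (x : A) : nat := tsize (enc x).

Lemma esize_gt0 (A : Type) `{Enc A} (x : A) : 0 < esize x.
Proof. by rewrite /esize /tsize; case: (enc x). Qed.

Lemma esize_pair (A B : Type) `{Enc A} `{Enc B} (x : A) (y : B) :
  esize (x, y) = (esize x + esize y).+1.
Proof. exact: tsizeN. Qed.

Lemma esize_cons (A : Type) `{Enc A} (x : A) (s : seq A) :
  esize (x :: s) = (esize x + esize s).+1.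
Proof. exact: tsizeN. Qed.

Lemma esize_nat (n : nat) : esize n = (2 * n).+1.
Proof.
elim: n => // n IH; have -> : esize n.+1 = (1 + esize n).+1 by exact: tsizeN.
by rewrite IH; lia.
Qed.

Lemma esize_nil (A : Type) `{Enc A} : esize (Nil A) = 1.
Proof. by []. Qed.

Lemma size_le_esize (A : Type) `{Enc A} (s : seq A) : size s < esize s.
Proof.
elim: s => // x s IH; rewrite esize_cons /= !ltnS.
by apply: leq_trans IH _; apply: leq_addl.
Qed.

Lemma esize_cat (A : Type) `{Enc A} (s t : seq A) :
  (esize (s ++ t)).+1 = esize s + esize t.
Proof. by elim: s => [|x s IH] //=; rewrite !esize_cons; lia. Qed.

Lemma esize_rev (A : Type) `{Enc A} (s : seq A) : esize (rev s) = esize s.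
Proof.
elim: s => // x s IH; rewrite rev_cons -cats1.
have : (esize (rev s ++ [:: x])).+1 = esize (rev s) + esize [:: x].
  exact: esize_cat.
by rewrite IH !esize_cons esize_nil; lia.
Qed.

(** * The class PTF *)

(** The program works above an arbitrary rest [r] of the main stack and leaves it alone, which is
    what makes composition and pairing possible. It must exist for every extra alphabet [X], because
    the letters of input and output are fixed only at the end. The bound on the size of the value is
    needed to compose the time bounds. *)
Definition PTF (A B : Type) `{Enc A} `{Enc B} (f : A -> B) : Prop :=
  exists k, (forall x, esize (f x) <= (esize x + 2) ^ k) /\
  forall X : finType, exists p : prog (bool + X)%type, forall x r inp,
    runs p (clean (bit_stack (ser (enc x)) ++ r) inp) ((esize x + 2) ^ k)
           (clean (bit_stack (ser (enc (f x))) ++ r) inp).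

Lemma PTF_intro (A B : Type) `{Enc A} `{Enc B} (f : A -> B) t t' :
  pbound t -> pbound t' -> (forall x, esize (f x) <= t (esize x)) ->
  (forall X : finType, exists p : prog (bool + X)%type, forall x r inp,
    runs p (clean (bit_stack (ser (enc x)) ++ r) inp) (t' (esize x))
           (clean (bit_stack (ser (enc (f x))) ++ r) inp)) ->
  PTF f.
Proof.
move=> [k hk] [l hl] hs hp; exists (maxn k l); split=> [x|X].
  exact: leq_trans (hs x) (leq_trans (hk _) (exp2_le _ (leq_maxl _ _))).
have [p h] := hp X; exists p => x r inp; apply: runs_le (h _ _ _).
exact: leq_trans (hl _) (exp2_le _ (leq_maxr _ _)).
Qed.

Ltac pb := repeat first
  [ exact: pbound_cst | exact: pbound_id | apply: pboundD | apply: pboundM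
  | apply: pbound_exp ].

Lemma PTF_id (A : Type) `{Enc A} : PTF (fun x : A => x).
Proof.
apply: (@PTF_intro _ _ _ _ _ id (fun _ => 1)); try by pb.
by move=> X; exists Skip => x r inp; apply: runs_skip.
Qed.

Arguments PTF_id {A H}.

Lemma PTF_comp (A B C : Type) `{Enc A} `{Enc B} `{Enc C} (g : B -> C)
  (f : A -> B) : PTF g -> PTF f -> PTF (fun x => g (f x)).
Proof.
move=> [l [hg pg]] [k [hf pf]].
have h n x : ((esize (f x) + 2) ^ n <= ((esize x + 2) ^ k + 2) ^ n).
  by case: n => // n; rewrite leq_exp2r // leq_add2r.
apply: (@PTF_intro _ _ _ _ _ (fun n => ((n + 2) ^ k + 2) ^ l)
   (fun n => (n + 2) ^ k + ((n + 2) ^ k + 2) ^ l)); try by pb.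
  by move=> x; apply: leq_trans (hg _) (h _ _).
move=> X; have [p hp] := pf X; have [q hq] := pg X; exists (Seq p q) => x r inp.
apply: runs_seq (hp _ _ _) _; exact: runs_le (h _ _) (hq _ _ _).
Qed.

Lemma PTF_pair (A B C : Type) `{Enc A} `{Enc B} `{Enc C} (f : A -> B)
  (g : A -> C) : PTF f -> PTF g -> PTF (fun x => (f x, g x)).
Proof.
move=> [k [hf pf]] [l [hg pg]].
apply: (@PTF_intro _ _ _ _ _ (fun n => (n + 2) ^ k + (n + 2) ^ l + 1)
  (fun n => (24 * n + 6) + ((n + 2) ^ l + ((12 * (n + 2) ^ l + 12 * n + 8) +
     ((n + 2) ^ k + 2))))); try by pb.
  by move=> x; rewrite esize_pair addn1 ltnS leq_add.
move=> X; have [p hp] := pf X; have [q hq] := pg X.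
exists (Seq Dup (Seq q (Seq Swap (Seq p (Push Main (inl true)))))) => x r inp.
apply: runs_seq (runs_dup _ _ _) _; apply: runs_seq (hq _ _ _) _.
apply: (runs_seq (m' := clean (bit_stack (ser (enc x)) ++
   bit_stack (ser (enc (g x))) ++ r) inp)).
  apply: runs_le (runs_swap _ _ _ _); rewrite -!/(esize _) leq_add2r leq_add2r.
  by rewrite leq_mul2l hg orbT.
apply: runs_seq (hp _ _ _) _; rewrite /= /bit_stack map_cat -catA.
exact/runs_exec/ExecPush.
Qed.

Lemma PTF_fst (A B C : Type) `{Enc A} `{Enc B} `{Enc C} (f : A -> B * C) :
  PTF f -> PTF (fun x => (f x).1).
Proof.
apply: (PTF_comp (g := fst)).
apply: (@PTF_intro _ _ _ _ _ id (fun n => 1 + ((12 * n + 8) + (9 * n + 4))));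
  try by pb.
  by case=> x y; rewrite esize_pair -addnS leq_addr.
move=> X; exists (Seq (Pop Main) (Seq Swap Drop)) => -[x y] r inp.
apply: (runs_seq (m' := clean (bit_stack (ser (enc x)) ++ bit_stack (ser (enc y)) ++ r)
  inp)).
  by rewrite /= /bit_stack map_cat -catA; apply/runs_exec/ExecPop.
apply: runs_seq; first by
  apply: runs_le (runs_swap _ _ _ _); rewrite esize_pair -!/(esize _); lia.
by apply: runs_le (runs_drop _ _ _); rewrite esize_pair -!/(esize _); lia.
Qed.

Lemma PTF_snd (A B C : Type) `{Enc A} `{Enc B} `{Enc C} (f : A -> B * C) :
  PTF f -> PTF (fun x => (f x).2).
Proof.
apply: (PTF_comp (g := snd)).
apply: (@PTF_intro _ _ _ _ _ id (fun n => 1 + (9 * n + 4))); try by pb.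
  by case=> x y; rewrite esize_pair -addSn leq_addl.
move=> X; exists (Seq (Pop Main) Drop) => -[x y] r inp.
apply: (runs_seq (m' := clean (bit_stack (ser (enc x)) ++ bit_stack (ser (enc y)) ++ r)
  inp)).
  by rewrite /= /bit_stack map_cat -catA; apply/runs_exec/ExecPop.
by apply: runs_le (runs_drop _ _ _); rewrite esize_pair -!/(esize _); lia.
Qed.

Fixpoint push_bits (X : finType) (s : seq bool) : prog (bool + X)%type :=
  if s is b :: s' then Seq (push_bits X s') (Push Main (inl b)) else Skip.

Lemma runs_push_bits (X : finType) s r inp :
  runs (push_bits X s) (clean r inp) (2 * size s + 1)
    (clean (bit_stack s ++ r) inp).
Proof.
elim: s => [|b s IH] /=; first exact: runs_skip.
apply: (@runs_le _ _ _ ((2 * size s + 1) + 2)); first by lia.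
by apply: runs_seq IH _; apply/runs_exec/ExecPush.
Qed.

Lemma PTF_const (A B : Type) `{Enc A} `{Enc B} (b : B) :
  PTF (fun _ : A => b).
Proof.
apply: (@PTF_intro _ _ _ _ _ (fun _ => esize b)
  (fun n => (9 * n + 4) + (2 * esize b + 1))); try by pb.
move=> X; exists (Seq Drop (push_bits X (ser (enc b)))) => x r inp.
by apply: runs_seq; [exact: runs_drop | exact: runs_push_bits].
Qed.

Lemma PTF_ifhead (A B C : Type) `{Enc A} `{Enc B} `{Enc C} (c : A -> B)
  (f g : A -> C) : PTF c -> PTF f -> PTF g ->
  PTF (fun x => if enc (c x) is Node _ _ then f x else g x).
Proof.
move=> [m [hc pc]] [k [hf pf]] [l [hg pg]].
apply: (@PTF_intro _ _ _ _ _ (fun n => (n + 2) ^ k + (n + 2) ^ l)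
  (fun n => (24 * n + 6) + ((n + 2) ^ m + ((9 * (n + 2) ^ m + 4) +
    ((n + 2) ^ k + (n + 2) ^ l) + 1)))); try by pb.
  move=> x; case: (enc (c x)) => [|? ?].
    exact: leq_trans (hg x) (leq_addl _ _).
  exact: leq_trans (hf x) (leq_addr _ _).
move=> X; have [p hp] := pf X; have [q hq] := pg X; have [u hu] := pc X.
exists (Seq Dup (Seq u (If Main (isbit true) (Seq Drop p) (Seq Drop q)))).
move=> x r inp; apply: runs_seq (runs_dup _ _ _) _.
apply: runs_seq (hu _ _ _) _; rewrite addn1; apply: runs_if.
have hd : runs Drop (clean (bit_stack (ser (enc (c x))) ++ bit_stack (ser (enc x)) ++ r)
   inp) (9 * (esize x + 2) ^ m + 4) (@clean X (bit_stack (ser (enc x)) ++ r) inp).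
  by apply: runs_le (runs_drop _ _ _); rewrite leq_add2r leq_mul2l hc orbT.
rewrite /isbit /=; case: (enc (c x)) hd => [|a b] hd /=; apply: runs_seq hd _.
  by apply: runs_le (hq _ _ _); apply: leq_addl.
by apply: runs_le (hp _ _ _); apply: leq_addr.
Qed.

(** Only the trees matter: functions into different types with equal encodings have the same
    programs. *)
Lemma PTF_cast (A B C : Type) `{Enc A} `{Enc B} `{Enc C} (f : A -> B)
  (g : A -> C) : (forall x, enc (f x) = enc (g x)) -> PTF f -> PTF g.
Proof.
move=> e [k [hf pf]]; exists k; split=> [x|X]; first by rewrite /esize -e; apply: hf.
by have [p hp] := pf X; exists p => x r inp; rewrite -e.
Qed.

Lemma PTF_ext (A B : Type) `{Enc A} `{Enc B} (f g : A -> B) :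
  f =1 g -> PTF f -> PTF g.
Proof. by move=> e; apply: PTF_cast => x; rewrite e. Qed.

Lemma PTF_if (A C : Type) `{Enc A} `{Enc C} (c : A -> bool) (f g : A -> C) :
  PTF c -> PTF f -> PTF g -> PTF (fun x => if c x then f x else g x).
Proof.
move=> hc hf hg; apply: PTF_ext (PTF_ifhead hc hf hg) => x.
by case: (c x).
Qed.

Lemma PTF_eq (A : Type) (B : eqType) `{Enc A} `{EncInj B} (f g : A -> B) :
  PTF f -> PTF g -> PTF (fun x => f x == g x).
Proof.
move=> hf hg.
apply: (PTF_comp (g := fun p : B * B => p.1 == p.2) (f := fun x => (f x, g x)));
  last exact: PTF_pair.
apply: (@PTF_intro _ _ _ _ _ (fun n => 3) (fun n => 30 * n + 30)); try by pb.
  by move=> [a b]; rewrite /esize /= /enc /enc_bool; case: (a == b).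
move=> X; exists Compare => -[a b] r inp.
have -> : enc ((a, b).1 == (a, b).2) = tbool (ser (enc a) == ser (enc b)).
  congr tbool; apply/eqP/eqP => [/= -> //|/ser_inj h]; exact: enc_inj.
exact: runs_compare.
Qed.

Lemma PTF_cons (A B : Type) `{Enc A} `{Enc B} (f : A -> B) (g : A -> seq B) :
  PTF f -> PTF g -> PTF (fun x => f x :: g x).
Proof. by move=> hf hg; apply: PTF_cast (PTF_pair hf hg). Qed.

Lemma PTF_S (A : Type) `{Enc A} (f : A -> nat) :
  PTF f -> PTF (fun x => (f x).+1).
Proof. by move=> hf; apply: PTF_cast (PTF_pair (PTF_const tt) hf). Qed.

Lemma PTF_seqcase (A B C : Type) `{Enc A} `{Enc B} `{Enc C} (l : A -> seq B)
  (n : A -> C) (c : A * (B * seq B) -> C) : PTF l -> PTF n -> PTF c ->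
  PTF (fun x => if l x is y :: s then c (x, (y, s)) else n x).
Proof.
move=> [m [hl pl]] [k [hn pn]] [j [hc pc]].
pose N n := n + (n + 2) ^ m + 1.
have hN i x y s : l x = y :: s ->
    (esize (x, (y, s)) + 2) ^ i <= (N (esize x) + 2) ^ i.
  move=> e; case: i => // i; rewrite leq_exp2r // leq_add2r /N esize_pair addn1 ltnS.
  by rewrite leq_add2l; have := hl x; rewrite e.
apply: (@PTF_intro _ _ _ _ _ (fun n => (n + 2) ^ k + (N n + 2) ^ j)
  (fun n => (24 * n + 6) + ((n + 2) ^ m + ((12 * (n + 2) ^ m + 12 * n + 8) +
    ((n + 2) ^ k + (2 + (N n + 2) ^ j)) + 1)))); rewrite /N; try by pb.
  move=> x; case E: (l x) => [|y s].
    exact: leq_trans (hn x) (leq_addr _ _).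
  exact: leq_trans (hc _) (leq_trans (hN _ _ _ _ E) (leq_addl _ _)).
move=> X; have [p hp] := pl X; have [q hq] := pn X; have [u hu] := pc X.
(* A nonempty list and the pair of its head and tail have the same tree, so a swap and one more node
   bit already build the argument of [c]. *)
exists (Seq Dup (Seq p (If Main (isbit true)
  (Seq Swap (Seq (Push Main (inl true)) u)) (Seq Drop q)))).
move=> x r inp; apply: runs_seq (runs_dup _ _ _) _.
apply: runs_seq (hp _ _ _) _; rewrite addn1; apply: runs_if.
rewrite /isbit; case E: (l x) => [|y s].
  rewrite /=; apply: runs_seq; last first.
    by apply: runs_le (hq _ _ _); apply: leq_addr.
  apply: runs_le (runs_drop Leaf _ _); rewrite /tsize /=.
  by have := expn_gt0 (esize x + 2) m; rewrite {1}addn2; lia.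
apply: (runs_seq (m' := clean (bit_stack (ser (enc x)) ++
   bit_stack (ser (enc (y, s))) ++ r) inp)).
  apply: runs_le (runs_swap (enc (y, s)) _ _ _); rewrite leq_add2r leq_add2r.
  by rewrite leq_mul2l; have := hl x; rewrite E => ->.
apply: (@runs_le _ _ _ (2 + (esize (x, (y, s)) + 2) ^ j)).
  by apply: leq_trans (leq_addl _ _); rewrite leq_add2l; apply: hN.
apply: runs_seq; first exact/runs_exec/ExecPush.
by have := hu (x, (y, s)) r inp; rewrite /= /bit_stack map_cat -catA.
Qed.

Lemma PTF_natcase (A C : Type) `{Enc A} `{Enc C} (f : A -> nat)
  (n : A -> C) (c : A * nat -> C) : PTF f -> PTF n -> PTF c ->
  PTF (fun x => if f x is m.+1 then c (x, m) else n x).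
Proof.
move=> hf hn hc.
have e k : enc (nseq k tt) = enc k.
  by elim: k => // k IH; rewrite -[RHS]/(Node Leaf (enc k)) -IH.
apply: PTF_ext (PTF_seqcase (l := fun x => nseq (f x) tt)
  (c := fun p => c (p.1, size p.2.2)) _ hn _) => [x||].
- by case: (f x) => //= k; rewrite size_nseq.
- by apply: PTF_cast hf => x; rewrite e.
- apply: (PTF_comp (g := c)) => //; apply: PTF_pair; first exact: PTF_fst PTF_id.
  have hs : PTF (fun s : seq unit => size s).
    apply: PTF_cast (PTF_id (A := seq unit)) => s.
    by rewrite -e; congr enc; elim: s => // [[] s /= {1}->].
  exact: PTF_comp hs (PTF_snd (PTF_snd PTF_id)).
Qed.

Section Foldl.
Variables (E A X : Type).
Context `{Enc E} `{Enc A} `{Enc X}.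
Variable step : E -> A -> X -> A.

(** One step may enlarge the accumulator only by an amount that depends on the environment and the
    current element. Such additive growth keeps the whole iteration polynomial, whereas a constant
    factor per step could make it exponential. *)
Definition grows := exists2 q, pbound q &
  forall e a x, esize (step e a x) <= esize a + q (esize e + esize x).

Lemma PTF_foldl_base : PTF (fun p : E * (A * X) => step p.1 p.2.1 p.2.2) ->
  grows ->
  PTF (fun p : seq X * (E * A) => foldl (step p.2.1) p.2.2 p.1).
Proof.
move=> hs [q [k hq] hg].
pose F (p : (X * seq X) * (E * A)) := (p.1.2, (p.2.1, step p.2.1 p.2.2 p.1.1)).
have [kF [_ pF]] : PTF F.
  have h1 : PTF (fun p : (X * seq X) * (E * A) => p.1) by exact: PTF_fst PTF_id.
  have h2 : PTF (fun p : (X * seq X) * (E * A) => p.2) by exact: PTF_snd PTF_id.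
  have h3 : PTF (fun p : (X * seq X) * (E * A) => step p.2.1 p.2.2 p.1.1).
    exact: PTF_comp hs (PTF_pair (PTF_fst h2) (PTF_pair (PTF_snd h2) (PTF_fst h1))).
  exact: PTF_pair (PTF_snd h1) (PTF_pair (PTF_fst h2) h3).
pose G n := (n + 2) ^ k.
pose B n := n + n * G n.
have hG e a x N : esize e + esize x <= N ->
    esize (step e a x) <= esize a + G N.
  move=> h; apply: leq_trans (hg _ _ _) _; rewrite leq_add2l.
  by apply: leq_trans (hq _) _; rewrite /G; case: (k) => // k'; rewrite leq_exp2r // leq_add2r.
have size_fold N e s a : esize e + esize s <= N ->
    esize (foldl (step e) a s) <= esize a + size s * G N.
  elim: s a => [|x s IH] a /=; first by rewrite mul0n addn0.
  rewrite esize_cons => h; apply: leq_trans (IH _ _) _; first by lia.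
  have := hG e a x N; rewrite mulSn; lia.
pose C n := 2 + ((n + B n + 4) ^ kF + 1) + 1.
apply: (@PTF_intro _ _ _ _ _ (fun n => n + n * G n)
  (fun n => 1 + ((n * C n + 1) + (1 + (1 + (9 * n + 4))))));
  rewrite /C /B /G; try by pb.
  move=> [s [e a]] /=; apply: leq_trans (size_fold (esize (s, (e, a))) _ _ _ _) _.
    by rewrite !esize_pair; lia.
  rewrite leq_add //; first by rewrite !esize_pair; lia.
  have hs' : size s < esize s by exact: size_le_esize.
  by rewrite leq_mul2r !esize_pair; lia.
move=> Y; have [p hp] := pF Y.
(* Between two rounds the main stack holds the remaining list and the pair of environment and
   accumulator, without a common root. Pushing a node bit joins them into the argument of [F], and
   popping the root of the result separates them again. *)
pose loop := While Main (isbit true) (Seq (Push Main (inl true)) (Seq p (Pop Main))).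
exists (Seq (Pop Main) (Seq loop (Seq (Pop Main) (Seq (Pop Main) Drop)))).
move=> [s [e a]] r inp; set N := esize (s, (e, a)); rewrite -/(G _) -/(B _) -/(C _).
have run_loop t b : esize e + esize t <= N -> esize b + esize e + size t * G N <= B N ->
    runs loop (clean (bit_stack (ser (enc t)) ++ bit_stack (ser (enc (e, b))) ++ r) inp)
      (size t * C N + 1)
      (clean (bit_stack (ser (enc (Nil X))) ++
        bit_stack (ser (enc (e, foldl (step e) b t))) ++ r) inp).
  elim: t b => [|x t IH] b; first by move=> _ _; apply: runs_whileF.
  rewrite esize_cons /= => h1 h2.
  have hb := hG e b x N (ltac:(lia)).
  apply: (@runs_le _ _ _ ((2 + ((N + B N + 4) ^ kF + 1)) + (size t * C N + 1)).+1).
    by rewrite mulSn /C; lia.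
  apply: runs_whileT (IH (step e b x) _ _) => //; try lia.
    apply: runs_seq; first exact/runs_exec/ExecPush.
    apply: (runs_seq (m' := clean (inl true :: bit_stack (ser (enc t)) ++
      bit_stack (ser (enc (e, step e b x))) ++ r) inp)); last exact/runs_exec/ExecPop.
    have := hp ((x, t), (e, b)) r inp; rewrite /F /= /bit_stack !map_cat /= !map_cat -!catA.
    rewrite /= -!catA; apply: runs_le; case: (kF) => // kk; rewrite leq_exp2r //.
    by rewrite !esize_pair; lia.
apply: (runs_seq (m' := clean (bit_stack (ser (enc s)) ++ bit_stack (ser (enc (e, a))) ++ r)
  inp)).
  by rewrite /= /bit_stack map_cat -catA; apply/runs_exec/ExecPop.
have hN : N = (esize s + (esize e + esize a).+1).+1 by rewrite /N !esize_pair.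
have hs' : size s < esize s by exact: size_le_esize.
apply: runs_seq.
  apply: runs_le (run_loop s a _ _); [|lia|]; first by rewrite leq_add2r leq_mul2r; lia.
  by rewrite /B leq_add ?leq_mul2r; lia.
apply: runs_seq; first exact/runs_exec/ExecPop.
apply: runs_seq; first exact/runs_exec/ExecPop.
rewrite /= /bit_stack map_cat -catA.
by apply: runs_le (runs_drop (enc e) _ _); rewrite -/(esize _); lia.
Qed.

Lemma PTF_foldl (l : E -> seq X) (a : E -> A) :
  PTF (fun p : E * (A * X) => step p.1 p.2.1 p.2.2) -> grows ->
  PTF l -> PTF a -> PTF (fun e => foldl (step e) (a e) (l e)).
Proof.
move=> hs hg hl ha.
exact: PTF_comp (PTF_foldl_base hs hg) (PTF_pair hl (PTF_pair PTF_id ha)).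
Qed.

End Foldl.

Lemma PTF_list (E C : Type) `{Enc E} `{Enc C} (g0 : E -> C) (gs : seq (E -> C)) :
  PTF g0 -> (forall i, PTF (nth g0 gs i)) ->
  PTF (fun p : E * nat => nth g0 gs p.2 p.1).
Proof.
move=> h0; elim: gs => [|g gs IH] hgs.
  apply: PTF_ext (PTF_comp h0 (PTF_fst PTF_id)) => -[e n].
  by rewrite nth_nil.
apply: PTF_ext (PTF_natcase (PTF_snd PTF_id) (PTF_comp (hgs 0) (PTF_fst PTF_id))
  (PTF_comp (IH (fun i => hgs i.+1)) (PTF_pair (PTF_fst (PTF_fst PTF_id))
    (PTF_snd PTF_id)))).
by case=> e [|n].
Qed.

(** A case distinction over a finite type, by its unary index; the branches may be computed by
    unrelated programs. *)
Lemma PTF_fin (E C : Type) (F : finType) `{Enc E} `{Enc C} (f : E -> F)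
  (g : F -> E -> C) :
  @PTF E F _ (enc_fin F) f -> (forall y, PTF (g y)) -> PTF (fun e => g (f e) e).
Proof.
move=> hf hg.
have [y0 _|no] := pickP (@predT F); last first.
  have e0 (e : E) : False by have := no (f e).
  exists 0; split=> [x|X]; first by case: (e0 x).
  by exists Skip => x; case: (e0 x).
have hi : PTF (fun e => index (f e) (enum F)) by apply: PTF_cast hf.
have hl : PTF (fun p : E * nat => nth (g y0) [seq g y | y <- enum F] p.2 p.1).
  apply: PTF_list (hg y0) _ => i.
  have [hi'|hi'] := ltnP i (size (enum F)); first by rewrite (nth_map y0).
  by rewrite nth_default // size_map.
have h : PTF (fun e => nth (g y0) [seq g y | y <- enum F] (index (f e) (enum F)) e).
  exact: PTF_comp hl (PTF_pair PTF_id hi).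
apply: PTF_ext h => e /=.
by rewrite (nth_map y0) ?index_mem ?mem_enum // nth_index ?mem_enum.
Qed.

(** * From PTF to Turing machines *)

Lemma pbound_poly t : pbound t ->
  exists p : {poly nat}, forall n, t n <= p.[n]%R.
Proof.
move=> [k hk]; exists (('X + 2%:P) ^+ k)%R => n; apply: leq_trans (hk n) _.
have -> : (('X + 2%:P) ^+ k : {poly nat})%R.[n]%R = (n + 2) ^ k; last by [].
elim: k {hk} => [|k IH]; first by rewrite expr0 hornerC.
by rewrite exprS hornerM IH hornerD hornerX hornerC expnS.
Qed.

Section ReadInput.
Variables (A X : finType) (e : A -> X).
Local Notation S := (bool + X)%type.
Local Existing Instance enc_fin.

(** A node bit followed by the code of the letter: put before the code of a list, it yields the code
    of the list with this letter in front. *)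
Definition read_letter (a : A) : seq bool := true :: ser (enc a).

Definition read_body : prog S :=
  foldr (fun a p => If Inp (fun o => o == Some (inr (e a)))
           (Seq (Pop Inp) (push_bits X (read_letter a))) p) Skip (enum A).

Definition read_input : prog S :=
  Seq (push_bits X [:: false]) (While Inp isSome read_body).

Lemma runs_read_body c a w main : injective e ->
  (forall a, 2 * size (read_letter a) + 2 <= c) ->
  runs read_body (clean main [seq inr (e a) | a <- a :: w]) (c + #|A|)
    (clean (bit_stack (read_letter a) ++ main) [seq inr (e a) | a <- w]).
Proof.
move=> he hc; rewrite /read_body cardE.
have : a \in enum A by rewrite mem_enum.
elim: (enum A) => // b s IH; rewrite inE /= => ha.
rewrite addnS; apply: runs_if => /=.
case: eqP => [[/he <-]|hab].
  apply: (@runs_le _ _ _ (1 + (2 * size (read_letter a) + 1))).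
    by have := hc a; lia.
  apply: runs_seq; [exact/runs_exec/ExecPop | exact: runs_push_bits].
apply: IH; case/orP: ha => // /eqP ab.
by case: hab; rewrite ab.
Qed.

Lemma runs_read_input : injective e -> exists2 t, pbound t &
  forall w, runs read_input (clean [::] [seq inr (e a) | a <- w]) (t (size w))
    (clean (bit_stack (ser (enc (rev w)))) [::]).
Proof.
move=> he; pose c := \max_(a : A) (2 * size (read_letter a) + 2).
have hc a : 2 * size (read_letter a) + 2 <= c by apply: leq_bigmax.
exists (fun n => 3 + (n * (c + #|A|).+1 + 1)); first by pb.
move=> w; apply: runs_seq; first exact: runs_push_bits.
have -> : bit_stack [:: false] ++ [::] = bit_stack (ser (enc (Nil A))) :> seq S by [].
rewrite -[rev w]cats0; elim: w (Nil A) => [|a w IH] u; first exact: runs_whileF.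
rewrite rev_cons cat_rcons.
apply: (@runs_le _ _ _ ((c + #|A|) + (size w * (c + #|A|).+1 + 1)).+1).
  by rewrite /= mulSn; lia.
apply: runs_whileT (IH (a :: u)) => //.
have := runs_read_body a w (bit_stack (ser (enc u))) he hc.
by rewrite /read_letter /= /bit_stack map_cat.
Qed.

End ReadInput.

Section WriteOutput.
Variables (B X : finType) (e : B -> X).
Local Notation S := (bool + X)%type.
Local Existing Instance enc_fin.

(** A letter is stored as its index in unary, each unit being the two bits [true] and [false]. One
    unit is removed for each letter of the enumeration that is passed over. *)
Definition write_body (s : seq B) : prog S :=
  foldr (fun b p => If Main (isbit false) (Seq (Pop Main) (Push Inp (inr (e b))))
           (Seq (Pop Main) (Seq (Pop Main) p))) Skip s.

Definition write_output : prog S :=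
  While Main (isbit true) (Seq (Pop Main) (write_body (enum B))).

Lemma runs_write_body s b0 i main out : i < size s ->
  runs (write_body s) (clean (bit_stack (ser (enc i)) ++ main) out) (4 * (i + 1))
    (clean main (inr (e (nth b0 s i)) :: out)).
Proof.
elim: s i => // b s IH [|i] hi.
  apply: runs_if => /=; apply: (@runs_seq _ _ _ _ 1 _ 2).
    exact/runs_exec/ExecPop.
  exact/runs_exec/ExecPush.
apply: (@runs_le _ _ _ (1 + (1 + (4 * (i + 1)))).+1); first by lia.
apply: runs_if => /=; apply: runs_seq; first exact/runs_exec/ExecPop.
apply: runs_seq; first exact/runs_exec/ExecPop.
exact: IH.
Qed.

Lemma runs_write_output (s : seq B) out :
  runs write_output (clean (bit_stack (ser (enc s))) out)
    (size s * (4 * #|B| + 2) + 1) (clean [:: inl false] (rev [seq inr (e b) | b <- s] ++ out)).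
Proof.
elim: s out => [|b s IH] out; first exact: runs_whileF.
apply: (@runs_le _ _ _ ((1 + 4 * #|B|) + (size s * (4 * #|B| + 2) + 1)).+1).
  by rewrite /= mulSn; lia.
rewrite [map _ _]/= rev_cons cat_rcons; apply: runs_whileT (IH _) => //.
apply: runs_seq; first exact/runs_exec/ExecPop.
have hb : index b (enum B) < size (enum B) by rewrite index_mem mem_enum.
have := runs_write_body b (bit_stack (ser (enc s))) out hb.
rewrite nth_index ?mem_enum // => h; rewrite /= /bit_stack map_cat.
by apply: runs_le (h _); rewrite leq_mul2l /= addn1 cardE.
Qed.

End WriteOutput.

Lemma reps_init (S : finType) (w : seq S) :
  reps (Mem w [::] [::] [::] [::])
    (fun i => if i == ord0 then ([::], map Some w) else ([::], [::])).
Proof.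
move=> r; exists 0; rewrite cats0 -rid0.
case: eqP => [/(can_inj ridK) -> //|]; by case: r.
Qed.

Lemma PTF_rev (A : Type) `{Enc A} : PTF (fun s : seq A => rev s).
Proof.
have h : PTF (fun s : seq A => foldl (fun a x => x :: a) [::] s).
  apply: (PTF_foldl (step := fun _ a x => x :: a)) => //.
  - exact: PTF_cons (PTF_snd (PTF_snd PTF_id)) (PTF_fst (PTF_snd PTF_id)).
  - by exists (fun n => n + 1); [pb | move=> e a x; rewrite esize_cons; lia].
  - exact: PTF_id.
  - exact: PTF_const.
apply: PTF_ext h => s; rewrite -[rev s]cats0.
elim: s (Nil A) => // x s IH u /=; rewrite IH rev_cons cat_rcons.
by [].
Qed.

Lemma steps_output (S : finType) (p : prog S) m n m' : exec p m n m' ->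
  forall T, reps m T -> exists2 T', reps m' T' &
  @steps (det_machine p) n (Some (entry p), T) (None, T').
Proof.
move=> h T /(exec_frun h)[T' hT' r]; exists T' => //; exact: frun_steps.
Qed.

Lemma take_index_blank (S : eqType) (s : seq S) j :
  let r := map Some s ++ nseq j None in take (index None r) r = map Some s.
Proof.
rewrite /= index_cat; have /negbTE -> : None \notin map Some s.
  by apply/mapP => -[].
have -> : index None (nseq j (@None S)) = 0 by case: j.
by rewrite addn0 take_size_cat.
Qed.

Section Polytime.
Variables A B : finType.
Local Existing Instance enc_fin.

Lemma enc_size_word (w : seq A) : esize w <= size w * (2 * #|A| + 2) + 1.
Proof.
elim: w => // a w IH; rewrite esize_cons [size _]/= mulSn.
have -> : esize a = esize (index a (enum A)) by [].
rewrite esize_nat; have : index a (enum A) < #|A|.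
  by rewrite cardE index_mem mem_enum.
by lia.
Qed.

Lemma PTF_polytime (f : seq A -> seq B) : PTF f -> polytime f.
Proof.
move=> hf; pose X := (A + B)%type : finType.
(* Reading the input pushes its letters and so reverses the word; writing the output reverses it
   once more. Both are compensated here. *)
have {}hf : PTF (fun w : seq A => rev (f (rev w))).
  exact: PTF_comp (@PTF_rev B _) (PTF_comp hf (@PTF_rev A _)).
have [k [hs hp]] := hf; have [p hpp] := hp X.
have [t [kt ht] hr] := @runs_read_input A X inl (fun x y => fun '(erefl) => erefl).
pose P := Seq (@read_input A X inl) (Seq p (@write_output B X inr)).
pose N n := n * (2 * #|A| + 2) + 1.
have [q hq] : exists q : {poly nat}, forall n,
    (n + 2) ^ kt + ((N n + 2) ^ k + ((N n + 2) ^ k * (4 * #|B| + 2) + 1)) <= q.[n]%R.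
  by apply: pbound_poly; rewrite /N; pb.
exists (det_machine P), (fun a => Some (inr (inl a))), (fun b => Some (inr (inr b))), q.
split; first exact: det_machine_deterministic.
- by split=> [x y [->]|].
- by split=> [x y [->]|].
move=> w; set v := rev (f (rev (rev w))).
have hN : (esize (rev w) + 2) ^ k <= (N (size w) + 2) ^ k.
  by case: (k) => // k'; rewrite leq_exp2r // leq_add2r esize_rev enc_size_word.
have [n hn ex] : runs P (clean [::] [seq inr (inl a) | a <- w]) q.[size w]%R
    (clean [:: inl false] [seq inr (inr b) | b <- f w]).
  apply: runs_le (hq _) _; apply: runs_seq; first exact: runs_le (ht _) (hr w).
  apply: (runs_seq (m' := clean (bit_stack (ser (enc v))) [::])).
    apply: runs_le hN _; have := hpp (rev w) [::] [::]; rewrite !cats0; exact.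
  have := @runs_write_output B X inr v [::].
  rewrite cats0 -map_rev [rev v]revK revK; apply: runs_le; rewrite leq_add2r leq_mul2r.
  apply/orP; right; apply: leq_trans hN; apply: leq_trans (hs _).
  exact: ltnW (size_le_esize _).
have [T' hT st] := steps_output ex (reps_init _).
exists n, (None, T'); split=> //.
  move: st; rewrite /init -!map_comp; congr (steps _ _ _).
by have [j hj] := hT Inp; rewrite /output -rid0 hj /= take_index_blank -map_comp.
Qed.

End Polytime.

(** * Acceptance and running time of all computations from a configuration *)

Section Outcome.
Variable M : tm.

(** Bounding all computations and characterizing acceptance together lets both properties of a
    nondeterministic machine be proved in one backward induction over its phases. *)
Definition outcome (c : config M) (t : nat) (b : Prop) :=
  (forall n c', steps n c c' -> n <= t) /\
  ((exists n c', [/\ steps n c c', halted c' & c'.1 \in accept M]) <-> b).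

Implicit Types (c d : config M) (s : state M).

Definition tuned c s (a : {ffun 'I_(ntapes M).+1 -> symb M * move}) : config M :=
  (s, fun i => update (c.2 i) (a i)).

Lemma step_set1 c s' a : delta c.1 (reads c) = [set (s', a)]%SET ->
  forall d, step c d <-> d = tuned c s' a.
Proof.
move=> hd [s T]; split=> [[a']|[-> ->]].
  rewrite hd /= => /finset.set1P[-> ->] h; congr pair; exact/funext.
by exists a; rewrite // hd finset.set11.
Qed.

Lemma outcome_set1 c s' a t b : delta c.1 (reads c) = [set (s', a)]%SET ->
  outcome (tuned c s' a) t b -> outcome c t.+1 b.
Proof.
move=> hd [ht hb]; split.
  by move=> [|n] c' //= [d /(step_set1 hd) ->]; apply: ht.
rewrite -hb; split=> -[n [c' [h1 h2 h3]]].
  case: n h1 => [|n] /= h1.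
    by move: h2; rewrite -h1 /halted hd => h;
      have := finset.set11 (s', a); rewrite h finset.inE.
  by case: h1 => d /(step_set1 hd) -> ?; exists n, c'.
exists n.+1, c'; split=> //; exists (tuned c s' a) => //.
exact/(step_set1 hd).
Qed.

Lemma outcome_halt c b : halted c -> (c.1 \in accept M <-> b) -> outcome c 0 b.
Proof.
move=> hc hb; have hs n c' : steps n c c' -> n = 0 /\ c = c'.
  case: n => [|n] //= [d [a]]; rewrite hc finset.inE //.
split=> [n c' /hs[-> //]|]; rewrite -hb; split=> [[n [c' [/hs[_ <-] _]]]//|h].
by exists 0, c.
Qed.

Lemma outcome_branch (I : Type) c (d : I -> config M) t (b : I -> Prop) :
  (forall c', step c c' <-> exists i, c' = d i) -> (~ halted c \/ c.1 \notin accept M) ->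
  (forall i, outcome (d i) t (b i)) ->
  outcome c t.+1 (exists i, b i).
Proof.
move=> hd hh ho; split.
  by move=> [|n] c' //= [e /hd[i ->]]; apply: (proj1 (ho i)).
split=> [[n [c' [h1 h2 h3]]]|[i /(proj2 (ho i))[n [c' [h1 h2 h3]]]]].
  case: n h1 => [|n] /= h1; first by case: hh; rewrite h1 => // /negP.
  case: h1 => e /hd[i ->] h; exists i; apply/(proj2 (ho i)).
  by exists n, c'.
by exists n.+1, c'; split=> //; exists (d i) => //; apply/hd; exists i.
Qed.

End Outcome.

Section Guess.
Variables A C : finType.
Local Notation X := (A + A * C)%type.
Local Notation S := (bool + X)%type.
Variable p : prog S.

Local Notation st := (pstate p + (bool + option bool))%type.
Local Notation stG := (inr (inl true) : st).
Local Notation stB := (inr (inl false) : st).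
Local Notation stE := (inr (inr None) : st).

(** Four phases: replace each input letter [a] by a guessed pair [(a, c)] while moving right; return
    to the left end; run the deterministic program [p]; accept if the top bit of [Main] is [true].
    Only the first phase is nondeterministic. *)
Definition guess_delta (s : st) (r : {ffun 'I_5 -> option S}) :
    {set st * {ffun 'I_5 -> option S * move}} :=
  match s with
  | inl s0 => let x := next s0 (fun i => r (rid i)) in
      [set (if x.1 is Some s' then inl s' else stE, acts x.2 r)]%SET
  | inr (inl true) =>
      match r (rid Inp) with
      | None => [set (stB, acts (Some (Inp, (None, MoveL))) r)]%SET
      | Some (inr (inl a)) =>
          [set (stG, acts (Some (Inp, (Some (inr (inr (a, c))), MoveR))) r)
             | c : C]%SET
      | _ => finset.set0
      end
  | inr (inl false) =>
      if r (rid Inp) is Some x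
      then [set (stB, acts (Some (Inp, (Some x, MoveL))) r)]%SET
      else [set (inl (entry p), acts (Some (Inp, (None, MoveR))) r)]%SET
  | inr (inr None) =>
      [set (inr (inr (Some (r (rid Main) == Some (inl true)))), acts None r)]%SET
  | _ => finset.set0
  end.

Definition guess_machine : tm :=
  @TM 4 st (option S) None stG [set inr (inr (Some true))]%SET guess_delta.

Local Notation M := guess_machine.

Lemma guess_reads (s : st) T i : @reads M (s, T) i = top (T i).
Proof. by rewrite ffunE. Qed.

Lemma guess_move (s s' : st) T a :
  @tuned M (s, T) s' (acts a (@reads M (s, T))) = (s', move_tapes a T).
Proof.
congr pair; apply/funext => i; rewrite /move_tapes; congr (retape _ (acts _ _ _)).
by apply/funext => j; rewrite ffunE.
Qed.

Lemma outcome_exit T : @outcome M (stE, T) 1 (top (T (rid Main)) == Some (inl true)).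
Proof.
apply: outcome_set1; first by [].
by apply: outcome_halt; rewrite //= finset.inE guess_reads; case: (top _ == _).
Qed.

Lemma outcome_frun n s T T' : frun n (Some s) T None T' ->
  @outcome M (inl s, T) n.+1 (top (T' (rid Main)) == Some (inl true)).
Proof.
elim: n s T => [|n IH] s T /=; first by case.
set x := next _ _ => h; apply: outcome_set1; first by [].
have <- : x = next s (fun i => @reads M (inl s, T) (rid i)).
  by congr next; apply/funext => i; rewrite guess_reads.
rewrite guess_move; case: x.1 h => [s'|] h; first exact: IH.
by case: n h {IH} => //= [[_ <-]]; apply: outcome_exit.
Qed.

Definition other_blank (T : 'I_5 -> stape S) :=
  forall r, rid r != rid Inp -> rep [::] (T (rid r)).

Lemma other_blank_move T x : other_blank T -> other_blank (move_tapes (Some (Inp, x)) T).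
Proof.
move=> h r hr; rewrite /move_tapes /acts ffunE (negbTE hr).
by apply: rep_stay; apply: h.
Qed.

Lemma move_Inp (T : 'I_5 -> stape S) x :
  move_tapes (Some (Inp, x)) T (rid Inp) = retape (T (rid Inp)) x.
Proof. by rewrite /move_tapes /acts ffunE eqxx. Qed.

Lemma outcome_back (b : seq S -> Prop) t l r T : other_blank T ->
  T (rid Inp) = (behead (map Some l), head None (map Some l) :: map Some r ++ [:: None]) ->
  (forall T, other_blank T -> rep (rev l ++ r) (T (rid Inp)) ->
     @outcome M (inl (entry p), T) t (b (rev l ++ r))) ->
  @outcome M (stB, T) (size l + t).+1 (b (rev l ++ r)).
Proof.
elim: l r T => [|y l IH] r T hT hI ho.
  apply: (@outcome_set1 M (stB, T) (inl (entry p))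
    (acts (Some (Inp, (None, MoveR))) (@reads M (stB, T)))).
    by rewrite /= guess_reads hI.
  rewrite guess_move; apply: ho; first exact: other_blank_move.
  by rewrite move_Inp hI /=; exists 1.
apply: (@outcome_set1 M (stB, T) stB
  (acts (Some (Inp, (Some y, MoveL))) (@reads M (stB, T)))).
  by rewrite /= guess_reads hI.
rewrite guess_move rev_cons cat_rcons.
apply: IH; first exact: other_blank_move.
  by rewrite move_Inp hI.
by move=> T' h1 h2; rewrite -cat_rcons -rev_cons; apply: ho => //;
  rewrite rev_cons cat_rcons.
Qed.

(** [z] is the part of the word that already carries guessed letters and lies left of the head, [w]
    the part still to come. *)
Lemma outcome_guess (V : seq (A * C) -> Prop) t z w T : other_blank T ->
  T (rid Inp) = (map Some (rev [seq inr (inr x) | x <- z]),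
                 [seq Some (inr (inl a)) | a <- w]) ->
  (forall v T, size v = size z + size w -> other_blank T ->
    rep [seq inr (inr x) | x <- v] (T (rid Inp)) ->
     @outcome M (inl (entry p), T) t (V v)) ->
  @outcome M (stG, T) (2 * size w + size z + t + 2)
    (exists2 c, size c = size w & V (z ++ zip w c)).
Proof.
elim: w z T => [|a w IH] z T hT hI ho.
  have -> : (exists2 c : seq C, size c = size (Nil A) & V (z ++ zip [::] c)) = V z.
    apply/propext; split=> [[[|//] _]|hv]; first by rewrite cats0.
    by exists [::]; rewrite ?cats0.
  rewrite muln0 add0n addn2.
  apply: (@outcome_set1 M (stG, T) stB
    (acts (Some (Inp, (None, MoveL))) (@reads M (stG, T)))).
    by rewrite /= guess_reads hI.
  rewrite guess_move.
  pose bb (s : seq S) := forall v, s = [seq inr (inr x) | x <- v] -> V v.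
  set l := rev [seq (inr (inr x) : S) | x <- z].
  have hl : rev l ++ [::] = [seq inr (inr x) | x <- z] by rewrite cats0 revK.
  have hv : bb (rev l ++ [::]) = V z.
    apply/propext; split=> [|h v]; first exact.
    by rewrite hl => /inj_map <- // x y [].
  have -> : size z = size l by rewrite size_rev size_map.
  rewrite -hv; apply: (@outcome_back bb t l [::]); first exact: other_blank_move.
    by rewrite move_Inp hI.
  by move=> T' h1; rewrite hv hl => h2; apply: ho; rewrite //= addn0.
have hst c' : @step M (stG, T) c' <-> exists c : C, c' = (stG, move_tapes
   (Some (Inp, (Some (inr (inr (a, c))), MoveR))) T).
  rewrite /step /= guess_reads hI /=; case: c' => s' T'; split.
    case=> a' /finset.imsetP[c _ [-> ->]] h; exists c.
    rewrite -(guess_move stG); congr pair; exact/funext.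
  case=> c; rewrite -(guess_move stG) => -[-> ->].
  by eexists; first by apply/finset.imsetP; exists c.
have -> : (exists2 c, size c = size (a :: w) & V (z ++ zip (a :: w) c)) =
    (exists c0 : C, exists2 c, size c = size w & V (rcons z (a, c0) ++ zip w c)).
  apply/propext; split=> [[[//|c0 c] [hs] hv]|[c0 [c hs hv]]].
    by exists c0, c => //; rewrite cat_rcons.
  by exists (c0 :: c); rewrite /= ?hs // -cat_rcons.
rewrite (_ : 2 * _ + _ + _ + 2 = (2 * size w + (size z).+1 + t + 2).+1); last by rewrite /=; lia.
apply: (outcome_branch hst); first by right; rewrite finset.inE.
move=> c; rewrite -(size_rcons z (a, c)); apply: IH; first exact: other_blank_move.
  by rewrite move_Inp hI /= map_rcons rev_rcons.
by move=> v T' hv h1 h2; apply: ho => //; rewrite hv size_rcons /= addnS.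
Qed.

End Guess.

Section NPGuess.
Variables A C : finType.

(** The certificate is written on the word letter by letter, so it has the same length and any
    larger information per position is put into the finite type [C]. *)
Lemma NP_guess (L : language A) (V : seq (A * C) -> bool) :
  @PTF _ _ (@enc_seq _ (enc_fin (A * C)%type)) enc_bool V ->
  (forall w, L w <-> exists2 c, size c = size w & V (zip w c)) -> NP L.
Proof.
set AC := (A * C)%type : finType; move=> hV hL.
have [k [hs hp]] := PTF_comp hV (@PTF_rev AC (enc_fin AC)).
have [p hpp] := hp (A + A * C)%type.
have [t [kt ht] hr] := @runs_read_input AC (A + A * C)%type inr (fun x y => fun '(erefl) => erefl).
pose P := Seq (@read_input AC (A + A * C)%type inr) p.
pose N n := n * (2 * #|AC| + 2) + 1.
have [q hq] : exists q : {poly nat}, forall n,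
    2 * n + 0 + ((n + 2) ^ kt + (N n + 2) ^ k).+1 + 2 <= q.[n]%R.
  apply: pbound_poly; apply: (@pbound_le _ (fun n => 2 * n + 0 + ((n + 2) ^ kt + (N n + 2) ^ k + 1) + 2)).
    by move=> n; rewrite addn1.
  by rewrite /N; pb.
exists (guess_machine P), (fun a => Some (inr (inl a))), q.
split; first by split=> [x y [->]|].
move=> w.
set T0 := (@init (guess_machine P) [seq Some (inr (inl a)) | a <- w]).2.
have hb : other_blank T0.
  by move=> r hr'; exists 0; rewrite /T0 /init /= -rid0 (negbTE hr').
have hI : T0 (rid Inp) = ([::], [seq Some (inr (inl a)) | a <- w]).
  by rewrite rid0.
set t1 := ((size w + 2) ^ kt + (N (size w) + 2) ^ k).+1.
have ho v T : size v = 0 + size w -> other_blank T ->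
    rep [seq inr (inr x) | x <- v] (T (rid Inp)) ->
    @outcome (guess_machine P) (inl (entry P), T) t1 (V v).
  rewrite add0n => hv hT hI'.
  have hm : reps (Mem [seq inr (inr x) | x <- v] [::] [::] [::] [::]) T.
    case=> //; by apply: hT; rewrite -val_eqE /= !inordK.
  have [n hn ex] : runs P (clean [::] [seq inr (inr x) | x <- v])
     ((size w + 2) ^ kt + (N (size w) + 2) ^ k) (clean (bit_stack (ser (enc (V v)))) [::]).
    rewrite -hv; apply: runs_seq; first exact: runs_le (ht _) (hr v).
    have := hpp (rev v) [::] [::]; rewrite !cats0 revK; apply: runs_le.
    case: (k) => // k'; rewrite leq_exp2r // leq_add2r esize_rev.
    exact: enc_size_word.
  have [T' hT' fr] := exec_frun ex hm.
  have [h1 h2] := outcome_frun fr; split=> [m c /h1 h|].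
    by apply: leq_trans h _; rewrite ltnS.
  rewrite h2 (rep_top (hT' Main)).
  have -> : ohead (rget Main (@clean (A + A * C)%type (bit_stack (ser (enc (V v)))) [::]))
      =
      Some (inl (V v)) by case: (V v).
  by split=> [/eqP[->]|->].
have [h1 h2] := @outcome_guess A C P (fun v => V v) t1 [::] w T0 hb hI ho.
split=> [n c|]; last by rewrite hL -h2.
by move/h1 => h; apply: leq_trans h (hq _).
Qed.

End NPGuess.

(** * The staircase region *)

Definition Wd (k : nat) : nat := if odd k then 7 else 5.
(** Left end of column [k], that is the sum of the widths before it: two consecutive widths add up
    to 12. [kidx] is the inverse, the column that contains a given abscissa. *)
Definition Ws (k : nat) : nat := 12 * (k %/ 2) + 5 * (k %% 2).
Definition kidx (u : nat) : nat := 2 * (u %/ 12) + (5 <= u %% 12).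

Lemma WsS k : Ws k.+1 = Ws k + Wd k.
Proof. rewrite /Ws /Wd; case E: (odd k); move: E; rewrite -(odd_mod k (erefl : odd 2 = false)); lia. Qed.

Lemma Ws0 : Ws 0 = 0. Proof. by []. Qed.

Lemma Wd57 k : Wd k = 5 \/ Wd k = 7.
Proof. by rewrite /Wd; case: odd; [right | left]. Qed.

Lemma Ws_le k l : k <= l -> Ws k <= Ws l.
Proof. by rewrite /Ws; lia. Qed.

Lemma kidxP u : Ws (kidx u) <= u < Ws (kidx u).+1.
Proof.
rewrite WsS /Wd /Ws /kidx; case: (leqP 5 (u %% 12)) => h /=.
  have -> : odd (2 * (u %/ 12) + 1) by rewrite oddD oddM.
  by lia.
have -> : odd (2 * (u %/ 12) + 0) = false by rewrite oddD oddM.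
by lia.
Qed.

Lemma kidx_eq u k : Ws k <= u < Ws k.+1 -> kidx u = k.
Proof.
move=> h; have := kidxP u; case: (ltngtP (kidx u) k) => // hk.
  by have := Ws_le hk; lia.
by have := Ws_le hk; lia.
Qed.

Lemma kidx_lt u n : (kidx u < n) = (u < Ws n).
Proof.
have := kidxP u; case: (ltnP (kidx u) n) => hk.
  by have := Ws_le hk; lia.
by have := Ws_le hk; lia.
Qed.

Section Staircase.
Variables (m n : nat) (Y : nat -> nat -> nat).

(** Each row is moved to the left by 4, the width of a small tile, against the row below it. *)
Definition Xi (i k : nat) : nat := Ws k + 4 * (m.-1 - i).
Definition Xt : nat := Ws n + 4 * m.

(** The lower profile of row [i], equivalently the upper profile of the rows below it: on the left
    the steps of the left border of the rows from [i] on, in the middle the plateaus at the levels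
    of row [i], on the right the steps of the right border of the rows below [i]. The region lies
    between the profiles 0 and [m]. *)
Definition env (i x : nat) : nat :=
  if x < 4 * (m - i) then Y (m.-1 - x %/ 4) 0
  else if x - 4 * (m - i) < Ws n then Y i (kidx (x - 4 * (m - i)))
  else Y (m.-1 - (x - Ws n) %/ 4) n.

Lemma env_left i j x : i <= j < m -> Xi j 0 <= x < Xi j 0 + 4 -> env i x = Y j 0.
Proof.
rewrite /Xi /env Ws0 => hij hx; have -> : x < 4 * (m - i) by lia.
by congr (Y _ 0); lia.
Qed.

Lemma env_mid i k x : i <= m -> k < n -> Ws k + 4 * (m - i) <= x < Ws k.+1 + 4 * (m - i) ->
  env i x = Y i k.
Proof.
rewrite /env => hi hk hx; have := Ws_le hk => hl.
have -> : x < 4 * (m - i) = false by lia.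
have -> : x - 4 * (m - i) < Ws n by lia.
by congr (Y i _); apply: kidx_eq; lia.
Qed.

Lemma env_right i j x : j < i <= m -> Xi j n <= x < Xi j n + 4 -> env i x = Y j n.
Proof.
rewrite /Xi /env => hij hx.
have -> : x < 4 * (m - i) = false by lia.
have -> : x - 4 * (m - i) < Ws n = false by lia.
by congr (Y _ n); lia.
Qed.

Definition inG (x y : nat) : bool := (x < Xt) && (env 0 x <= y < env m x).

End Staircase.

Section Tiled.
Variable G : nat -> nat -> bool.
Variables tx ty tw th : nat -> nat -> nat.

(** A tiling given by functions of a cell: corner, width and height of the tile covering it,
    constant on each tile. *)
Definition tiled := forall x y, G x y ->
  [/\ tx x y <= x < tx x y + tw x y, ty x y <= y < ty x y + th x y
    & forall x' y', tx x y <= x' < tx x y + tw x y ->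
        ty x y <= y' < ty x y + th x y ->
        [/\ G x' y', tx x' y' = tx x y, ty x' y' = ty x y,
            tw x' y' = tw x y & th x' y' = th x y]].

Hypothesis tl : tiled.

Lemma next_start x1 y1 x2 y : G x1 y1 -> ty x1 y1 <= y < ty x1 y1 + th x1 y1 ->
  x2 = tx x1 y1 + tw x1 y1 -> G x2 y -> tx x2 y = x2.
Proof.
move=> g1 hy e g2; have [a1 a2 a3] := tl g1; have [b1 b2 b3] := tl g2.
have [//|lt] : tx x2 y = x2 \/ tx x2 y < x2 by lia.
have [_ c1 _ c3 _] := a3 x2.-1 y (ltac:(lia)) hy.
have [_ d1 _ d3 _] := b3 x2.-1 y (ltac:(lia)) (ltac:(lia)).
lia.
Qed.

Lemma next_floor x1 y1 x y2 : G x1 y1 -> tx x1 y1 <= x < tx x1 y1 + tw x1 y1 ->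
  y2 = ty x1 y1 + th x1 y1 -> G x y2 -> ty x y2 = y2.
Proof.
move=> g1 hx e g2; have [a1 a2 a3] := tl g1; have [b1 b2 b3] := tl g2.
have [//|lt] : ty x y2 = y2 \/ ty x y2 < y2 by lia.
have [_ _ c1 _ c3] := a3 x y2.-1 hx (ltac:(lia)).
have [_ _ d1 _ d3] := b3 x y2.-1 (ltac:(lia)) (ltac:(lia)).
lia.
Qed.

(** A tile reaching across [x2] would contain the cell at [x2], whose tile is known to begin
    there. *)
Lemma wall_stops x1 x2 y : G x1 y -> (G x2 y -> tx x2 y = x2) -> x1 < x2 ->
  tx x1 y + tw x1 y <= x2.
Proof.
move=> g1 w lt; have [a1 a2 a3] := tl g1; rewrite leqNgt; apply/negP => h.
have [g2 c _ _ _] := a3 x2 y (ltac:(lia)) a2.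
by have := w g2; lia.
Qed.

End Tiled.

(** * Rigidity of the tilings of the staircase region *)

Section Rigidity.
Variables (m n : nat) (Yb : nat -> nat -> nat) (bs : nat -> nat -> nat).
Variables (dl hs H : nat).
Hypotheses (m_gt0 : 0 < m) (n_gt0 : 0 < n).
Hypotheses (dl_gt0 : 0 < dl) (hs_gt : 20 * dl < hs) (H_gt : hs + 20 * dl < H).
Hypotheses (bsSl : forall i k, bs i.+1 k = bs i k + H)
           (bsSr : forall i k, bs i k.+1 = bs i k + hs).
Hypothesis Yb_near : forall i k, (i == 0) || (i == m) || (k == 0) || (k == n) ->
  bs i k <= Yb i k <= bs i k + dl.

Variables (sm : nat -> Prop) (bg : bool -> nat -> Prop).
Hypothesis sm_near : forall h, sm h -> hs <= h + dl /\ h <= hs + dl.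
Hypothesis bg_near : forall b h, bg b h -> H <= h + dl /\ h <= H + dl.
(** The levels that code something at a grid point. Heights are known only up to [dl], so these
    errors would add up from row to row; [ok_step] brings a level that is reached both from below
    and from the left back to within [dl] of its base value. *)
Variable ok : nat -> nat -> nat -> Prop.
Hypothesis ok_near : forall i k y, ok i k y -> bs i k <= y <= bs i k + dl.
Hypothesis ok_bottom : forall k, ok 0 k (Yb 0 k).
Hypothesis ok_left : forall i, ok i 0 (Yb i 0).
Hypothesis ok_step : forall i k a b y, ok i k.+1 a -> ok i.+1 k b ->
  bg (odd k.+1) (y - a) -> sm (y - b) -> a <= y -> b <= y -> ok i.+1 k.+1 y.

Local Notation G := (inG m n Yb).
Local Notation X := (Xi m).
Local Notation lo := (env m n Yb 0).
Local Notation hi := (env m n Yb m).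

Variables tx ty tw th : nat -> nat -> nat.
Hypothesis tl : tiled G tx ty tw th.
Hypothesis dims : forall x y, G x y ->
  tw x y = 4 /\ sm (th x y) \/ exists b : bool, tw x y = (if b then 7 else 5) /\ bg b (th x y).

Lemma dims_w x y : G x y -> [\/ tw x y = 4, tw x y = 5 | tw x y = 7].
Proof.
by move=> /dims[[-> _]|[[] [-> _]]]; [constructor 1|constructor 3|constructor 2].
Qed.

Lemma dims_h x y : G x y -> hs <= th x y + dl.
Proof. by move=> /dims[[_ /sm_near]|[b [_ /bg_near]]]; lia. Qed.

Lemma dims_sm x y : G x y -> tw x y = 4 -> sm (th x y).
Proof. by move=> /dims[[_ //]|[[] [-> _]]]. Qed.

Lemma dims_bg x y k : G x y -> tw x y = Wd k -> bg (odd k) (th x y).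
Proof.
move=> /dims[[e _]|[b [e h]]]; rewrite /Wd e; first by case: (odd k).
by move: h; case: b {e}; case: (odd k).
Qed.

Lemma bs_le i j k l : i <= j -> k <= l -> bs i k <= bs j l.
Proof.
move=> hij hkl; apply: (@leq_trans (bs j k)).
  by rewrite -(subnKC hij); elim: (j - i) => [|d IH]; rewrite ?addn0 // addnS bsSl; lia.
by rewrite -(subnKC hkl); elim: (l - k) => [|d IH]; rewrite ?addn0 // addnS bsSr; lia.
Qed.

Lemma mid_range i k x : i < m -> k < n -> X i k <= x < X i k.+1 ->
  [/\ x < Xt m n, lo x <= bs i k + dl & bs i.+1 k <= hi x].
Proof.
rewrite /Xi => hi_ hk hx; have hkn := Ws_le hk.
have hX : x < Xt m n by rewrite /Xt; lia.
split=> //.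
  have [h4|h4] := ltnP x (4 * m).
    have := @env_left m n Yb 0 (m.-1 - x %/ 4) x (ltac:(lia)).
    rewrite /Xi Ws0 => -> //; last by lia.
    have := @Yb_near (m.-1 - x %/ 4) 0 (ltac:(by rewrite eqxx !orbT)).
    by have := @bs_le (m.-1 - x %/ 4) i 0 k (ltac:(lia)) (ltac:(lia)); lia.
  set u := x - 4 * m; have ku := kidxP u.
  have lk : kidx u < n by rewrite kidx_lt /u; move: hX; rewrite /Xt; lia.
  have lk' : kidx u <= k by rewrite -ltnS kidx_lt /u; lia.
  rewrite (@env_mid m n Yb 0 (kidx u)) //; last by rewrite /u in ku *; lia.
  have := @Yb_near 0 (kidx u) (ltac:(by rewrite eqxx)).
  by have := @bs_le 0 i (kidx u) k (ltac:(lia)) lk'; lia.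
have [h4|h4] := ltnP x (Ws n).
  have ku := kidxP x.
  have lk : kidx x < n by rewrite kidx_lt.
  have lk' : k <= kidx x by rewrite leqNgt kidx_lt; lia.
  rewrite (@env_mid m n Yb m (kidx x)) //; last by rewrite subnn; lia.
  have := @Yb_near m (kidx x) (ltac:(by rewrite eqxx orbT)).
  by have := @bs_le i.+1 m k (kidx x) hi_ lk'; lia.
rewrite (@env_right m n Yb m (m.-1 - (x - Ws n) %/ 4)); last 2 first.
- by lia.
- by rewrite /Xi; lia.
have := @Yb_near (m.-1 - (x - Ws n) %/ 4) n (ltac:(by rewrite eqxx !orbT)).
by have := @bs_le i.+1 (m.-1 - (x - Ws n) %/ 4) k n (ltac:(lia)) (ltac:(lia)); lia.
Qed.

Section Row.
(** [t k] is the level of the plateau on which row [i] is to be built above column [k]. By [t_floor]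
    the plateau is flat, and by [t_wall] its left side is a vertical wall reaching down past the
    previous plateau. *)
Variables (i : nat) (t : nat -> nat).
Hypothesis i_lt : i < m.
Let R := Yb i n.
Let R_near : bs i n <= R <= bs i n + dl.
Proof. by apply: Yb_near; rewrite eqxx !orbT. Qed.

Hypothesis t_near : forall k, k < n -> bs i k <= t k + dl /\ t k <= bs i k + 2 * dl.
Hypothesis t_floor : forall k x, k < n -> X i k + 4 <= x < X i k.+1 + 4 ->
  lo x <= t k /\ (G x (t k) -> ty x (t k) = t k).
Hypothesis t_wall : forall k y, k < n -> bs i k <= y + hs + 5 * dl -> y < t k ->
  G (X i k + 4) y -> tx (X i k + 4) y = X i k + 4.

Lemma XS k : X i k.+1 = X i k + Wd k.
Proof. by rewrite /Xi WsS; lia. Qed.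

Lemma hi_last x : X i n <= x < X i n + 4 -> hi x = R.
Proof. by move=> h; apply: env_right h; rewrite i_lt leqnn. Qed.

Lemma last_wall y : bs i n <= y + hs + 5 * dl -> ~~ G (X i n + 4) y.
Proof.
move=> hy; apply/negP; rewrite /inG /Xt => /andP[hx /andP[_ h]].
case: i i_lt h hx hy => [|j] hj h hx hy; first by move: hx; rewrite /Xi; lia.
rewrite (@env_right m n Yb m j) in h; [|lia|by rewrite /Xi; lia].
have := @Yb_near j n (ltac:(by rewrite eqxx !orbT)).
by rewrite bsSl in hy; lia.
Qed.

Lemma in_plateau k x y : k < n -> X i k + 4 <= x < X i k.+1 + 4 ->
  t k <= y -> y < bs i k + hs -> G x y.
Proof.
move=> hk hx h1 h2; have [hl _] := t_floor hk hx.
have [hx2|hx2] := ltnP x (X i k.+1).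
  have [a _ c] := @mid_range i k x i_lt hk (ltac:(lia)).
  by rewrite /inG a; rewrite bsSl in c; lia.
have [e|lt] : k.+1 = n \/ k.+1 < n by lia.
  rewrite /inG; rewrite e in hx hx2; rewrite hi_last; last by lia.
  have -> : x < Xt m n by move: hx; rewrite /Xi /Xt; lia.
  have rb : bs i n = bs i k + hs by rewrite -e bsSr.
  by have := R_near; lia.
have := XS k.+1; have := Wd57 k.+1 => w e.
have [a _ c] := @mid_range i k.+1 x i_lt lt (ltac:(lia)).
by rewrite /inG a; rewrite bsSl bsSr in c; lia.
Qed.

Lemma right_wall k y : k < n -> t k <= y -> (k.+1 < n -> y < t k.+1) ->
  G (X i k.+1 + 4) y -> tx (X i k.+1 + 4) y = X i k.+1 + 4.
Proof.
move=> hk h1 h2; have := t_near hk => tn; have := bsSr i k => e.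
have [e2|lt] : k.+1 = n \/ k.+1 < n by lia.
  by rewrite e2 => g; case/negP: (@last_wall y (ltac:(rewrite -e2; lia))).
by apply: t_wall => //; [lia | apply: h2].
Qed.

(** A tile starting at the left end of a plateau leaves a floor of width 5 or 7, which only a single
    big tile can cover. It rises above the next plateau, on which again a tile must start at the
    left end. At the last plateau it would rise above the level [R] bounding the region there. *)
Lemma bad_plateau k : k < n -> tx (X i k + 4) (t k) = X i k + 4 -> False.
Proof.
have [d] := ubnP (n - k); elim: d k => // d IH k hd hk e.
have := t_near hk => tn; have := XS k => xs; have := bsSr i k => bk.
have g : G (X i k + 4) (t k) by apply: (in_plateau hk); case: (Wd57 k); lia.
have tn' : k.+1 < n -> t k < t k.+1 by move=> h; have := t_near h; lia.
have [_ f] := t_floor hk (ltac:(case: (Wd57 k); lia) : X i k + 4 <= X i k + 4 < X i k.+1 + 4).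
have {}f := f g.
have [a1 a2 a3] := tl g.
have wl : tx (X i k + 4) (t k) + tw (X i k + 4) (t k) <= X i k.+1 + 4.
  apply: (wall_stops tl g); last by case: (Wd57 k); lia.
  by apply: right_wall.
have ew : tw (X i k + 4) (t k) = Wd k.
  have [//|lt] : tw (X i k + 4) (t k) = Wd k \/ tw (X i k + 4) (t k) < Wd k by lia.
  have [x2 ex2] : {x2 | x2 = X i k + 4 + tw (X i k + 4) (t k)} by eexists.
  have g2 : G x2 (t k) by apply: (in_plateau hk); lia.
  have s2 : tx x2 (t k) = x2 by apply: (next_start tl g); rewrite ?e ?f //; lia.
  have w2 : tx x2 (t k) + tw x2 (t k) <= X i k.+1 + 4.
    apply: (wall_stops tl g2); last by lia.
    by apply: right_wall.
  have := dims_w g2; have := dims_w g; case: (Wd57 k) => w [] u [] v; lia.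
have := dims_bg g ew => /bg_near hb.
have [e2|lt] : k.+1 = n \/ k.+1 < n by lia.
  have [] := a3 (X i n + 3) R.
  - by rewrite -e2; lia.
  - by move: R_near; rewrite -e2; lia.
  by rewrite /inG hi_last; lia.
have tn2 := t_near lt.
apply: (IH k.+1) => //; first by lia.
apply: (next_start tl g); rewrite ?e ?f; [lia | lia |].
by apply: (in_plateau lt); case: (Wd57 k.+1); rewrite ?XS ?bsSr; lia.
Qed.

(** The situation in front of plateau [k] once the row is filled up to there: the four columns
    before it have a flat floor at level [z]. If [z] exceeds [t k], the tile below that floor is a
    wall for the plateau. *)
Definition pre (k z : nat) :=
  [/\ forall x, X i k <= x < X i k + 4 -> lo x <= z /\ (G x z -> ty x z = z),
      G (X i k) z -> tx (X i k) z = X i k,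
      t k < z -> G (X i k + 4) (t k) -> tx (X i k + 4) (t k) = X i k + 4
    & bs i k <= z + 3 * dl /\ z <= bs i k + 3 * dl].

Lemma in_corner k x z : k < n -> pre k z -> X i k <= x < X i k + 4 -> G x z.
Proof.
move=> hk [p1 _ _ p4] hx; have [l _] := p1 x hx.
have := XS k; have := Wd57 k => w xs.
have [a _ c] := @mid_range i k x i_lt hk (ltac:(lia)).
by rewrite /inG a; rewrite bsSl in c; lia.
Qed.

(** A floor above the plateau makes the plateau bad directly. A floor below it is a pocket of width
    4 closed by a wall; the tile filling it has width 4 and is high enough to rise above the
    plateau, which is again bad. *)
Lemma flush k z : k < n -> pre k z -> z = t k.
Proof.
move=> hk hp; have [p1 p2 p3 [p4 p5]] := hp; have tn := t_near hk.
have xs := XS k; have w57 := Wd57 k.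
have gp : G (X i k + 4) (t k) by apply: (in_plateau hk); lia.
case: (ltngtP z (t k)) => // h; last by case: (bad_plateau hk (p3 h gp)).
have g : G (X i k) z by apply: (in_corner hk hp); lia.
have [_ /(_ g) f] := p1 (X i k) (ltac:(lia)); have s := p2 g.
have w : tx (X i k) z + tw (X i k) z <= X i k + 4.
  apply: (wall_stops tl g); last by lia.
  by apply: t_wall => //; lia.
have w4 : tw (X i k) z = 4 by have := dims_w g; case=> ?; lia.
have hh := dims_h g.
case: (bad_plateau hk); apply: (next_start tl g) => //; rewrite ?s ?f; lia.
Qed.

Definition placed_row k :=
  [/\ G (X i k) (t k), tx (X i k) (t k) = X i k, ty (X i k) (t k) = t k
    & tw (X i k) (t k) = Wd k].

(** The joint floor has width 9 or 11 and so carries exactly one big and one small tile; the small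
    one cannot come first, since the plateau would then be bad. The small tile provides the floor
    before the next plateau. After the last one it must end exactly at [R], the space left being too
    low for another tile. *)
Lemma fill_floor k : k < n -> pre k (t k) ->
  placed_row k /\
  exists h, [/\ sm h, k.+1 < n -> pre k.+1 (t k + h) & k.+1 = n -> R = t k + h].
Proof.
move=> hk hp; have [p1 p2 _ _] := hp; have tn := t_near hk.
have xs := XS k; have w57 := Wd57 k; have bk := bsSr i k.
have tn' : k.+1 < n -> t k < t k.+1 by move=> h; have := t_near h; lia.
have inF x : X i k <= x < X i k.+1 + 4 -> G x (t k) /\ ty x (t k) = t k.
  move=> hx; have [h4|h4] := ltnP x (X i k + 4).
    have g : G x (t k) by apply: (in_corner hk hp); lia.
    by have [_ /(_ g)] := p1 x (ltac:(lia)).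
  have g : G x (t k) by apply: (in_plateau hk); lia.
  by have [_ /(_ g)] := t_floor hk (ltac:(lia) : X i k + 4 <= x < X i k.+1 + 4).
have wl x : X i k <= x < X i k.+1 + 4 -> tx x (t k) + tw x (t k) <= X i k.+1 + 4.
  move=> hx; have [g _] := inF x hx; apply: (wall_stops tl g); last by lia.
  by apply: right_wall.
have nx x : X i k <= x < X i k.+1 + 4 -> tx x (t k) = x -> x + tw x (t k) < X i k.+1 + 4 ->
    tx (x + tw x (t k)) (t k) = x + tw x (t k).
  move=> hx s lt; have [g f] := inF x hx; have [_ a2 _] := tl g.
  have hw := dims_w g.
  by apply: (next_start tl g) => //; [lia|apply: (proj1 (inF _ _)); lia].
have [g f] := inF (X i k) (ltac:(lia)); have s := p2 g.
have w1 := wl (X i k) (ltac:(lia)).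
have ew : tw (X i k) (t k) = Wd k.
  have d1 := dims_w g; have n1 := nx (X i k) (ltac:(lia)) s.
  have [e4|ne4] : tw (X i k) (t k) = 4 \/ tw (X i k) (t k) <> 4 by lia.
    by rewrite e4 in n1; case: (bad_plateau hk (n1 (ltac:(lia)))).
  have [//|ne] : tw (X i k) (t k) = Wd k \/ tw (X i k) (t k) <> Wd k by lia.
  have lt : X i k + tw (X i k) (t k) < X i k.+1 + 4 by case: d1; lia.
  have [x2 ex2] : {x2 | x2 = X i k + tw (X i k) (t k)} by eexists.
  have s2 := n1 lt; rewrite -ex2 in lt s2.
  have hx2 : X i k <= x2 < X i k.+1 + 4 by lia.
  have [g2 _] := inF x2 hx2; have d2 := dims_w g2; have w2 := wl x2 hx2.
  have [lt2|ge2] := ltnP (x2 + tw x2 (t k)) (X i k.+1 + 4); last first.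
    by case: d1; case: d2; case: w57; lia.
  have [x3 ex3] : {x3 | x3 = x2 + tw x2 (t k)} by eexists.
  have s3 := nx x2 hx2 s2 lt2; rewrite -ex3 in lt2 s3.
  have hx3 : X i k <= x3 < X i k.+1 + 4 by lia.
  have [g3 _] := inF x3 hx3; have d3 := dims_w g3; have w3 := wl x3 hx3.
  by case: d1; case: d2; case: d3; case: w57; lia.
have hb := bg_near (dims_bg g ew).
split; first by [].
have hx' : X i k <= X i k.+1 < X i k.+1 + 4 by lia.
have [g' f'] := inF _ hx'.
have s' : tx (X i k.+1) (t k) = X i k.+1.
  by have := nx (X i k) (ltac:(lia)) s; rewrite ew -xs; apply; lia.
have w' : tw (X i k.+1) (t k) = 4.
  by have := wl _ hx'; rewrite s'; have := dims_w g'; case; lia.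
have hsm := dims_sm g' w'; have sn := sm_near hsm.
have [b1 b2 b3] := tl g'.
exists (th (X i k.+1) (t k)); split=> // hk1.
  have tn1 := t_near hk1; split.
  - move=> x hx; have [gx ? ? ? ?] := b3 x (t k) (ltac:(lia)) (ltac:(lia)).
    split; first by move: gx; rewrite /inG; lia.
    by apply: (next_floor tl g'); rewrite ?s' ?w' ?f'; lia.
  - by apply: (next_start tl g); rewrite ?s ?f ?ew; lia.
  - by move=> lt; apply: (next_start tl g'); rewrite ?s' ?f' ?w'; lia.
  - by lia.
have [z ez] : {z | z = t k + th (X i k.+1) (t k)} by eexists.
rewrite -ez; have rb : bs i n = bs i k + hs by rewrite -hk1 bk.
have hl : hi (X i n) = R by apply: hi_last; lia.
have [gz _ _ _ _] := b3 (X i n) z.-1 (ltac:(rewrite -hk1; lia)) (ltac:(lia)).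
have zR : z <= R by move: gz; rewrite /inG hl; lia.
have [//|lt] : R = z \/ z < R by lia.
have gz' : G (X i n) z by move: gz; rewrite /inG hl; lia.
have fz : ty (X i n) z = z.
  have eX : X i n = X i k.+1 by rewrite hk1.
  by apply: (next_floor tl g'); rewrite ?s' ?w' ?f' // eX; lia.
have [c1 c2 c3] := tl gz'; have hz := dims_h gz'.
have [top _ _ _ _] := c3 (X i n) (z + th (X i n) z).-1 (ltac:(lia)) (ltac:(lia)).
by move: top; rewrite /inG hl; have := R_near; lia.
Qed.

Lemma row_levels : [/\ Yb i 0 = t 0, forall k, k < n -> placed_row k,
    forall k, k.+1 < n -> t k < t k.+1 /\ sm (t k.+1 - t k)
  & t n.-1 <= R /\ sm (R - t n.-1)].
Proof.
have p0 : pre 0 (Yb i 0).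
  have L_near := @Yb_near i 0 (ltac:(by rewrite eqxx !orbT)).
  have hlo x : X i 0 <= x < X i 0 + 4 -> lo x = Yb i 0.
    by move=> hx; rewrite (@env_left m n Yb 0 i) ?i_lt.
  split; last by lia.
  - move=> x hx; rewrite hlo //; split=> // g; have [a1 a2 a3] := tl g.
    have [//|lt] : ty x (Yb i 0) = Yb i 0 \/ ty x (Yb i 0) < Yb i 0 by lia.
    have [g' _ _ _ _] := a3 x (Yb i 0).-1 a1 (ltac:(lia)).
    by move: g'; rewrite /inG hlo //; lia.
  - move=> g; have [a1 a2 a3] := tl g.
    have [//|lt] : tx (X i 0) (Yb i 0) = X i 0 \/ tx (X i 0) (Yb i 0) < X i 0 by lia.
    have [g' _ _ _ _] := a3 (X i 0).-1 (Yb i 0) (ltac:(lia)) a2.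
    move: g'; rewrite /inG (@env_left m n Yb 0 i.+1); last 2 first.
    + by move: lt; rewrite /Xi Ws0; lia.
    + by move: lt; rewrite /Xi Ws0; lia.
    have := @Yb_near i.+1 0 (ltac:(by rewrite eqxx !orbT)).
    by rewrite bsSl; lia.
  - move=> lt g; have [a1 a2 a3] := tl g.
    have [//|lt'] : tx (X i 0 + 4) (t 0) = X i 0 + 4 \/ tx (X i 0 + 4) (t 0) < X i 0 + 4 by lia.
    have [g' _ _ _ _] := a3 (X i 0 + 3) (t 0) (ltac:(lia)) a2.
    by move: g'; rewrite /inG hlo; lia.
have h0 := flush n_gt0 p0.
have hpre k : k < n -> pre k (t k).
  elim: k => [_|k IH hk]; first by rewrite -h0.
  have [_ [h [_ /(_ hk) hp _]]] := fill_floor (ltnW hk) (IH (ltnW hk)).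
  by have e := flush hk hp; rewrite -e in hp *.
split=> //.
- by move=> k hk; have [] := fill_floor hk (hpre k hk).
- move=> k hk; have [_ [h [hsm /(_ hk) hp _]]] := fill_floor (ltnW hk) (hpre k (ltnW hk)).
  have e := flush hk hp; rewrite -e addKn; split=> //.
  by have := sm_near hsm; lia.
- have hk : n.-1 < n by lia.
  have [_ [h [hsm _ e]]] := fill_floor hk (hpre _ hk).
  by rewrite e ?prednK // addKn leq_addr.
Qed.

End Row.

Fixpoint level (i k : nat) : nat :=
  if i is j.+1 then level j k + th (X j k) (level j k) else Yb 0 k.

(** The hypotheses under which row [i] can be analysed. The tolerance [2 * dl] above the base value
    is one [dl] for the level below and one for the height of the tile on it. *)
Definition ready (i : nat) :=
  [/\ forall k, k < n -> bs i k <= level i k + dl /\ level i k <= bs i k + 2 * dl,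
      forall k x, k < n -> Ws k + 4 * (m - i) <= x < Ws k.+1 + 4 * (m - i) ->
        lo x <= level i k /\ (G x (level i k) -> ty x (level i k) = level i k)
    & forall k y, k < n -> bs i k <= y + hs + 5 * dl -> y < level i k ->
        G (Ws k + 4 * (m - i)) y -> tx (Ws k + 4 * (m - i)) y = Ws k + 4 * (m - i)].

Definition row_done (i : nat) :=
  [/\ Yb i 0 = level i 0, forall k, k < n -> placed_row i (level i) k,
    forall k, k.+1 < n -> level i k < level i k.+1 /\ sm (level i k.+1 - level i k)
  & level i n.-1 <= Yb i n /\ sm (Yb i n - level i n.-1)].

Lemma ready_done i : i < m -> ready i -> row_done i.
Proof.
move=> hi_ [h1 h2 h3]; have e k : Ws k + 4 * (m - i) = X i k + 4 by rewrite /Xi; lia.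
apply: row_levels => // [k x|k y]; first by rewrite -!e; apply: h2.
by rewrite -!e; apply: h3.
Qed.

Lemma ready0 : ready 0.
Proof.
have lo_mid k x : k < n -> Ws k + 4 * (m - 0) <= x < Ws k.+1 + 4 * (m - 0) -> lo x = Yb 0 k.
  by move=> hk hx; rewrite (@env_mid m n Yb 0 k).
split=> [k hk|k x hk hx|k y hk _ /= hy].
- by have := @Yb_near 0 k (ltac:(by rewrite eqxx)); rewrite /=; lia.
- rewrite (lo_mid k) //=; split=> // g; have [a1 a2 a3] := tl g.
  have [//|lt] : ty x (Yb 0 k) = Yb 0 k \/ ty x (Yb 0 k) < Yb 0 k by lia.
  have [g' _ _ _ _] := a3 x (Yb 0 k).-1 a1 (ltac:(lia)).
  by move: g'; rewrite /inG (lo_mid k) //; lia.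
- rewrite /inG (lo_mid k) //; first by lia.
  by rewrite WsS; case: (Wd57 k); lia.
Qed.

Lemma ready_ok i : i < m -> ready i -> row_done i /\
  (forall j, j < i -> row_done j) ->
  (forall k, k < n -> ok i k (level i k)) ->
  ready i.+1 /\ (forall k, k < n -> bg (odd k) (level i.+1 k - level i k)).
Proof.
move=> hi_ hr [[d1 d2 d3 d4] _] hok.
have e k : Ws k + 4 * (m - i.+1) = X i k by rewrite /Xi; lia.
have hb k : k < n -> bg (odd k) (th (X i k) (level i k)).
  by move=> hk; have [g _ _ w] := d2 k hk; apply: dims_bg.
have lS k : level i.+1 k = level i k + th (X i k) (level i k) by [].
split; last by move=> k hk; rewrite lS addKn; apply: hb.
split=> [k hk|k x hk|k y hk]; rewrite ?e lS; have nb := bg_near (hb k hk); have no := ok_near (hok k hk);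
  have [g s f w] := d2 k hk; have [a1 a2 a3] := tl g.
- by rewrite bsSl; lia.
- move=> hx; have hx' : tx (X i k) (level i k) <= x < tx (X i k) (level i k) + tw (X i k) (level i k).
    by rewrite s w; move: hx; rewrite /Xi WsS; lia.
  split; last by apply: (next_floor tl g) => //; rewrite f.
  have [g' _ _ _ _] := a3 x (level i k) hx' a2.
  by move: g'; rewrite /inG; lia.
- rewrite bsSl => h1 h2 g'.
  have [_ -> _ _ _] := a3 (X i k) y a1 (ltac:(lia)).
  by [].
Qed.

Lemma all_ready i : i <= m -> ready i /\ (forall j, j < i -> row_done j /\
  (forall k, k < n -> ok j k (level j k) /\ bg (odd k) (level j.+1 k - level j k))).
Proof.
elim: i => [_|i IH hi_]; first by split=> //; exact: ready0.
have [hr hj] := IH (ltnW hi_); have hd := ready_done hi_ hr.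
have hok k : k < n -> ok i k (level i k).
  case: i hi_ hr hj hd {IH} => [|i] hi_ hr hj hd; first by move=> _; apply: ok_bottom.
  have [d1 d2 d3 d4] := hd.
  elim: k => [_|k IHk hk]; first by rewrite -d1; apply: ok_left.
  have [lt hsm] := d3 k hk.
  have [_ /(_ k.+1 hk)[o1 o2]] := hj i (ltnSn i).
  apply: ok_step o1 (IHk (ltnW hk)) o2 hsm _ (ltnW lt); exact: leq_addr.
have [r' b'] := @ready_ok i hi_ hr (conj hd (fun j h => proj1 (hj j h))) hok.
split=> // j; rewrite ltnS leq_eqVlt => /orP[/eqP ->|/hj//].
by split=> // k hk; split; [apply: hok | apply: b'].
Qed.

Theorem rigid : exists Yf : nat -> nat -> nat,
  [/\ forall i k, i <= m -> k <= n -> (i == 0) && (k < n) || (k == 0) && (i < m) ||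
        (i == m) && (k < n) || (k == n) && (i < m) -> Yf i k = Yb i k,
      forall i k, i < m -> k < n -> ok i k (Yf i k),
      forall i k, i < m -> k < n -> Yf i k <= Yf i.+1 k /\ bg (odd k) (Yf i.+1 k - Yf i k)
    & forall i k, i < m -> k < n -> Yf i k <= Yf i k.+1 /\ sm (Yf i k.+1 - Yf i k)].
Proof.
(* No big tile stands over column [n], so the levels there are taken from the border. *)
exists (fun i k => if k < n then level i k else Yb i k).
have [[h1 h2 h3] hj] := all_ready (leqnn m).
(* The top row ends at the upper border: it cannot exceed it, and a remaining gap would be too low
   for any tile. *)
have hm k : k < n -> level m k = Yb m k.
  move=> hk; have [j em] : exists j, m = j.+1 by exists m.-1; lia.
  have jm : j < m by lia.
  have [[_ d2 _ _] o] := hj j jm; have [g s f w] := d2 k hk; have [ok1 b1] := o k hk.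
  have [a1 a2 a3] := tl g; have nb := bg_near (dims_bg g w).
  have n1 := h1 k hk; have Yn := @Yb_near m k (ltac:(by rewrite eqxx orbT)).
  have hx : hi (X j k) = Yb m k.
    by rewrite (@env_mid m n Yb m k) // /Xi em WsS; case: (Wd57 k); lia.
  have lS : level m k = level j k + th (X j k) (level j k).
    have : level j.+1 k = level j k + th (X j k) (level j k) by [].
    by rewrite -em.
  have [g' _ _ _ _] := a3 (X j k) (level m k).-1 a1 (ltac:(lia)).
  have le : level m k <= Yb m k by move: g'; rewrite /inG hx; lia.
  have [//|lt] : level m k = Yb m k \/ level m k < Yb m k by lia.
  have g2 : G (X j k) (level m k) by move: g'; rewrite /inG hx; lia.
  have f2 : ty (X j k) (level m k) = level m k by apply: (next_floor tl g) => //; rewrite f.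
  have [c1 c2 c3] := tl g2; have hz := dims_h g2.
  have [top _ _ _ _] := c3 (X j k) (level m k + th (X j k) (level m k)).-1 c1 (ltac:(lia)).
  by move: top; rewrite /inG hx; lia.
split=> [i k hi_ hk||i k hi_ hk|i k hi_ hk].
- case: ltnP => [lt|ge]; last by [].
  case/orP => [/orP[/orP[|]|]|]; first by case/andP => /eqP ->.
  + by case/andP => /eqP -> him; have [[]] := hj i him.
  + by case/andP => /eqP -> _; apply: hm.
  + by case/andP => /eqP e; rewrite e ltnn in lt.
- by move=> i k hi_ hk; rewrite hk; have [_ /(_ k hk)[]] := hj i hi_.
- by rewrite hk; split; [rewrite /= leq_addr | have [_ /(_ k hk)[]] := hj i hi_].
- rewrite hk; have [[_ _ d3 d4] _] := hj i hi_.
  have [lt|e] : k.+1 < n \/ k.+1 = n by lia.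
    by rewrite lt; have [/ltnW] := d3 k lt.
  by rewrite e ltnn; have <- : n.-1 = k by lia.
Qed.

End Rigidity.

(** * Tiling the staircase region *)

Section Build.
Variables (m n : nat) (Y : nat -> nat -> nat).
Hypothesis n_gt0 : 0 < n.
Hypothesis Yv : forall i k, i < m -> k < n -> Y i k < Y i.+1 k.
Hypothesis Yh : forall i k, i < m -> k < n -> Y i k < Y i k.+1.

Local Notation X := (Xi m).
Local Notation E := (env m n Y).

Definition row_of (x y : nat) : nat := find (fun i => y < E i.+1 x) (iota 0 m).

(** Within row [i] a cell above the plateau of its column belongs to the big tile, one below it to
    the small tile that fills the step in front of this plateau. *)
Definition built (x y : nat) : (nat * nat) * (nat * nat) :=
  let i := row_of x y in
  let k := kidx (x - 4 * (m.-1 - i)) in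
  if (k < n) && (Y i k <= y)
  then ((X i k, Y i k), (Wd k, Y i.+1 k - Y i k))
  else ((X i k, Y i k.-1), (4, Y i k - Y i k.-1)).

(** How row [i] meets a vertical line: not at all, only in a big tile, in a small tile with the big
    tile of the next column above it, or only in the last small tile. *)
Lemma env_cases i x : i < m -> x < Xt m n ->
  let u := x - 4 * (m.-1 - i) in let k := kidx u in
  (x < 4 * (m.-1 - i) \/ Ws n + 4 <= u) /\ E i x = E i.+1 x \/
  4 * (m.-1 - i) <= x /\
  [\/ [/\ k < n, E i x = Y i k & E i.+1 x = Y i.+1 k],
      [/\ 0 < k < n, u < Ws k + 4, E i x = Y i k.-1 & E i.+1 x = Y i.+1 k]
    | [/\ k = n, u < Ws n + 4, E i x = Y i n.-1 & E i.+1 x = Y i n]].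
Proof.
move=> hi hx; rewrite /env.
have [h1|h1] := ltnP x (4 * (m - i.+1)).
  have -> : x < 4 * (m - i) by lia.
  by left; split=> //; left; lia.
have e1 : 4 * (m - i.+1) = 4 * (m.-1 - i) by lia.
have e2 : 4 * (m - i) = 4 * (m.-1 - i) + 4 by lia.
rewrite e1 e2 in h1 *; have [u eu] : {u | u = x - 4 * (m.-1 - i)} by eexists.
have -> : x - (4 * (m.-1 - i) + 4) = u - 4 by lia.
have ku := kidxP u; have ku4 := kidxP (u - 4).
rewrite -eu; have [h2|h2] := ltnP u (Ws n).
  have hk : kidx u < n by rewrite kidx_lt.
  right; split=> //; have [h3|h3] := ltnP x (4 * (m.-1 - i) + 4).
    have k0 : kidx u = 0 by apply: kidx_eq; rewrite /Ws /=; lia.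
    have -> : m.-1 - x %/ 4 = i by lia.
    by constructor 1; rewrite k0.
  have -> : u - 4 < Ws n by lia.
  have lek : kidx (u - 4) < (kidx u).+1 by rewrite kidx_lt; lia.
  have w : Ws (kidx (u - 4)).+2 = Ws (kidx (u - 4)).+1 + Wd (kidx (u - 4)).+1 by rewrite WsS.
  have [ek|ne] : kidx u = kidx (u - 4) \/ kidx u <> kidx (u - 4) by lia.
    by constructor 1; rewrite -ek.
  have ek : kidx u = (kidx (u - 4)).+1.
    have l := Ws_le (ltac:(lia) : (kidx (u - 4)).+1 <= kidx u).
    by apply: kidx_eq; rewrite w; case: (Wd57 (kidx (u - 4)).+1); lia.
  have ew : Ws (kidx u) = Ws (kidx (u - 4)).+1 by rewrite ek.
  by constructor 2; split=> //; [lia | lia | rewrite ek].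
have hn5 : 5 <= Ws n := Ws_le n_gt0.
have [h3|h3] := ltnP (u - 4) (Ws n); last first.
  have -> : x < 4 * (m.-1 - i) + 4 = false by lia.
  by left; split=> //; right; lia.
have -> : x < 4 * (m.-1 - i) + 4 = false by lia.
have -> : m.-1 - (x - Ws n) %/ 4 = i by lia.
have kn : kidx u = n by apply: kidx_eq; rewrite WsS; case: (Wd57 n); lia.
have kn4 : kidx (u - 4) = n.-1.
  have := WsS n.-1; rewrite prednK // => w.
  by apply: kidx_eq; rewrite prednK //; case: (Wd57 n.-1); lia.
by right; split=> //; constructor 3; rewrite kn4 kn; split=> //; lia.
Qed.

Lemma env_le i x : i < m -> x < Xt m n -> E i x <= E i.+1 x.
Proof.
move=> hi hx; have := env_cases hi hx; rewrite /=; set k := kidx _.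
case=> [[_ -> //]|[_ [[hk -> ->]|[/andP[k0 hk] _ -> ->]|[_ _ -> ->]]]].
- exact: ltnW (Yv hi hk).
- have := Yv hi hk; have := @Yh i k.-1 hi; rewrite prednK //; lia.
- by have := @Yh i n.-1 hi; rewrite prednK //; lia.
Qed.

Lemma env_mono i j x : i <= j <= m -> x < Xt m n -> E i x <= E j x.
Proof.
move=> /andP[hij]; rewrite -(subnKC hij); elim: (j - i) => [|d IH]; rewrite ?addn0 //.
rewrite addnS => h hx; apply: leq_trans (IH (ltnW h) hx) (env_le h hx).
Qed.

Lemma row_ofE i x y : i < m -> x < Xt m n -> E i x <= y < E i.+1 x -> row_of x y = i.
Proof.
move=> hi hx /andP[h1 h2]; rewrite /row_of; set p := fun i => _.
have hp : has p (iota 0 m) by apply/hasP; exists i; rewrite ?mem_iota.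
case: (ltngtP (find p (iota 0 m)) i) => // h.
  have := nth_find 0 hp; rewrite nth_iota; last by lia.
  rewrite {1}/p add0n => h3.
  by have := @env_mono (find p (iota 0 m)).+1 i x (ltac:(lia)) hx; lia.
by have := before_find 0 h; rewrite nth_iota // /p add0n h2.
Qed.

Lemma built_in i x y : i < m -> x < Xt m n -> E i x <= y < E i.+1 x ->
  inG m n Y x y.
Proof.
move=> hi hx hy; rewrite /inG hx; have := @env_mono 0 i x (ltac:(lia)) hx.
by have := @env_mono i.+1 m x (ltac:(lia)) hx; lia.
Qed.

Lemma in_bigP i k x y : i < m -> k < n -> X i k <= x < X i k.+1 ->
  Y i k <= y < Y i.+1 k ->
  inG m n Y x y /\ built x y = ((X i k, Y i k), (Wd k, Y i.+1 k - Y i k)).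
Proof.
move=> hi hk hx hy; have hn := Ws_le hk.
have hX : x < Xt m n by move: hx; rewrite /Xi /Xt; lia.
have ek : kidx (x - 4 * (m.-1 - i)) = k.
  by apply: kidx_eq; move: hx; rewrite /Xi; lia.
have hE : E i x <= y < E i.+1 x.
  have := env_cases hi hX; rewrite /= ek.
  case=> [[h _]|[_ [[_ -> ->]//|[/andP[k0 _] _ -> ->]|[h _ _ _]]]].
  - by move: h hx; rewrite /Xi; lia.
  - by have := @Yh i k.-1 hi; rewrite prednK //; lia.
  - by lia.
have hr : row_of x y = i by apply: row_ofE.
split; last by rewrite /built hr ek hk; case: leqP => //; lia.
exact: built_in hE.
Qed.

Lemma in_smallP i k x y : i < m -> k < n -> X i k.+1 <= x < X i k.+1 + 4 ->
  Y i k <= y < Y i k.+1 ->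
  inG m n Y x y /\ built x y = ((X i k.+1, Y i k), (4, Y i k.+1 - Y i k)).
Proof.
move=> hi hk hx hy; have hn := Ws_le hk.
have hX : x < Xt m n by move: hx; rewrite /Xi /Xt; lia.
have ek : kidx (x - 4 * (m.-1 - i)) = k.+1.
  by apply: kidx_eq; move: hx; rewrite /Xi [Ws k.+2]WsS; case: (Wd57 k.+1); lia.
have hE : E i x <= y < E i.+1 x.
  have := env_cases hi hX; rewrite /= ek.
  case=> [[h _]|[_ [[hk1 h1 h2]|[hk1 _ -> ->]|[h _ -> ->]]]].
  - by move: h hx; rewrite /Xi; lia.
  - have := @env_mid m n Y i k x (ltnW hi) hk; rewrite h2 => -> //.
      by have := Yv hi hk1; lia.
    by move: hx; rewrite /Xi WsS; case: (Wd57 k); lia.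
  - by have := @Yv i k.+1 hi (ltac:(lia)); rewrite /=; lia.
  - by rewrite -h.
have hr : row_of x y = i by apply: row_ofE.
split; first exact: built_in hE.
rewrite /built hr ek /=; have -> : Y i k.+1 <= y = false by lia.
by rewrite andbF.
Qed.

Lemma inG_row x y : inG m n Y x y ->
  exists2 i, i < m & E i x <= y < E i.+1 x.
Proof.
move=> /andP[hx /andP[h1 h2]].
have : forall j, j <= m -> y < E j x -> exists2 i, i < j & E i x <= y < E i.+1 x.
  elim=> [|j IH] hj h; first by lia.
  have [le|lt] := leqP (E j x) y; first by exists j; rewrite // le.
  by have [i hi h'] := IH (ltnW hj) lt; exists i => //; apply: ltnW.
by move=> /(_ m (leqnn m) h2).
Qed.

Lemma inG_piece x y : inG m n Y x y -> exists i k, [/\ i < m, k < n &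
  (X i k <= x < X i k.+1 /\ Y i k <= y < Y i.+1 k) \/
  (X i k.+1 <= x < X i k.+1 + 4 /\ Y i k <= y < Y i k.+1)].
Proof.
move=> g; have [i hi hy] := inG_row g; have hX : x < Xt m n by case/andP: g.
have := env_cases hi hX; rewrite /=; set u := x - _; have ku := kidxP u.
case=> [[_ e]|[h4 [[hk e1 e2]|[/andP[k0 hk] hu e1 e2]|[hk hu e1 e2]]]].
- by rewrite e in hy; lia.
- exists i, (kidx u); split=> //; left; rewrite -e1 -e2; split=> //.
  by rewrite /Xi /u in ku *; lia.
- have [le|lt] := leqP (Y i (kidx u)) y.
    exists i, (kidx u); split=> //; left; split; last by lia.
    by rewrite /Xi /u in ku *; lia.
  exists i, (kidx u).-1; split=> //; first by lia.
  right; rewrite prednK //; split; last by lia.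
  by rewrite /Xi /u in ku hu *; lia.
- exists i, n.-1; split=> //; first by lia.
  right; rewrite prednK //; split; last by lia.
  by rewrite /Xi; rewrite hk /u in ku hu *; lia.
Qed.

Theorem built_tiled :
  tiled (inG m n Y) (fun x y => (built x y).1.1) (fun x y => (built x y).1.2)
    (fun x y => (built x y).2.1) (fun x y => (built x y).2.2) /\
  forall x y, inG m n Y x y -> exists i k, [/\ i < m, k < n &
    (built x y).2 = (Wd k, Y i.+1 k - Y i k) \/
    (built x y).2 = (4, Y i k.+1 - Y i k)].
Proof.
have XS i k : X i k.+1 = X i k + Wd k by rewrite /Xi WsS; lia.
split=> x y g; have [i [k [hi hk [[hx hy]|[hx hy]]]]] := inG_piece g.
- have [_ ->] := in_bigP hi hk hx hy; rewrite /= -XS; have := Yv hi hk => lt.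
  split=> //; first by lia.
  move=> x' y' hx' hy'; have [g' ->] := @in_bigP i k x' y' hi hk hx' (ltac:(lia)).
  by [].
- have [_ ->] := in_smallP hi hk hx hy; have := Yh hi hk => lt /=.
  split=> //; first by lia.
  move=> x' y' hx' hy'; have [g' ->] := @in_smallP i k x' y' hi hk hx' (ltac:(lia)).
  by [].
- by exists i, k; split=> //; left; have [_ ->] := in_bigP hi hk hx hy.
- by exists i, k; split=> //; right; have [_ ->] := in_smallP hi hk hx hy.
Qed.

End Build.

Arguments unit_square : clear implicits.
Arguments realize : clear implicits.

(** * Combinatorial description of tilings *)

Section CellTopology.
Variable R : realType.
Local Open Scope ring_scope.
Local Open Scope classical_set_scope.
Implicit Types (S A B : cells) (c d : square) (z : R * R).

Lemma unit_squareP c z : unit_square R c z <->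
  [/\ c.1%:~R <= z.1, z.1 <= c.1%:~R + 1, c.2%:~R <= z.2 & z.2 <= c.2%:~R + 1].
Proof.
rewrite /unit_square /setX /= !in_itv /=.
by split=> [[/andP[-> ->] /andP[-> ->]]//|[-> -> -> ->]].
Qed.

Definition open_cell c : set (R * R) := [set z |
  [/\ c.1%:~R < z.1, z.1 < c.1%:~R + 1, c.2%:~R < z.2 & z.2 < c.2%:~R + 1]].

Lemma open_cell_sub c : open_cell c `<=` unit_square R c.
Proof. by move=> z [/ltW ? /ltW ? /ltW ? /ltW ?]; apply/unit_squareP. Qed.

Lemma int_between (a b : int) (r : R) :
  a%:~R < r -> r < a%:~R + 1 -> b%:~R <= r -> r <= b%:~R + 1 -> a = b.
Proof.
move=> h1 h2 h3 h4.
have ab : a < b + 1 by rewrite -(ltr_int R) rmorphD; apply: lt_le_trans h1 h4.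
have ba : b < a + 1 by rewrite -(ltr_int R) rmorphD; apply: le_lt_trans h3 h2.
by lia.
Qed.

Lemma open_cell_square c d z : open_cell c z -> unit_square R d z -> c = d.
Proof.
case: c d => [a b] [a' b'] [h1 h2 h3 h4] /unit_squareP[k1 k2 k3 k4].
by congr pair; [apply: (int_between h1 h2) | apply: (int_between h3 h4)].
Qed.

Lemma open_cell_realize c S z : open_cell c z -> realize R S z <-> c \in S.
Proof.
move=> hz; split=> [[d /= hd hs]|hc]; first by rewrite (open_cell_square hz hs).
by exists c => //; apply: open_cell_sub.
Qed.

Lemma nbhs_pairP z (A : set (R * R)) : nbhs z A <->
  exists2 e : R, 0 < e & forall w, `|z.1 - w.1| < e -> `|z.2 - w.2| < e -> A w.
Proof.
split=> [/nbhs_ballP[e e0 h]|[e e0 h]].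
  by exists e => // w h1 h2; apply: h; split; rewrite /= -ball_normE.
apply/nbhs_ballP; exists e => // w [h1 h2]; apply: h.
  by move: h1; rewrite -ball_normE.
by move: h2; rewrite -ball_normE.
Qed.

Lemma open_cell_nbhs c z : open_cell c z -> nbhs z (open_cell c).
Proof.
move=> [h1 h2 h3 h4]; apply/nbhs_pairP.
pose e := Num.min (Num.min (z.1 - c.1%:~R) (c.1%:~R + 1 - z.1))
                  (Num.min (z.2 - c.2%:~R) (c.2%:~R + 1 - z.2)).
exists e; first by rewrite /e !lt_min !subr_gt0 h1 h2 h3 h4.
move=> w; rewrite /e !lt_min !ltr_norml.
by move=> /andP[/andP[/andP[? ?] /andP[? ?]] _] /andP[_ /andP[/andP[? ?] /andP[? ?]]];
  split; lra.
Qed.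

Definition center c : R * R := (c.1%:~R + 2^-1, c.2%:~R + 2^-1).

Lemma center_open c : open_cell c (center c).
Proof. by rewrite /open_cell /center /=; split; lra. Qed.

Lemma center_realize c S : realize R S (center c) <-> c \in S.
Proof. exact: open_cell_realize (center_open c). Qed.

Lemma open_cell_interior c S z : c \in S -> open_cell c z -> (realize R S)° z.
Proof.
move=> hc hz; apply: filterS (open_cell_nbhs hz) => w hw.
by apply/(open_cell_realize _ hw).
Qed.

Lemma near_open_cell z e : 0 < e -> exists c w,
  [/\ open_cell c w, `|z.1 - w.1| < e & `|z.2 - w.2| < e].
Proof.
move=> e0.
have H (r : R) : exists (a : int) (s : R), [/\ a%:~R < s, s < a%:~R + 1 & `|r - s| < e].
  pose a := Num.floor r; have /andP[h1 h2] := @real_floor_itv R r (num_real r).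
  pose t := Num.min (e / 2) ((a%:~R + 1 - r) / 2).
  have t0 : 0 < t.
    rewrite /t lt_min divr_gt0 //= divr_gt0 // subr_gt0.
    by move: h2; rewrite rmorphD.
  exists a, (r + t); split.
  - by apply: le_lt_trans h1 _; rewrite ltrDl.
  - have : t <= (a%:~R + 1 - r) / 2 by rewrite /t ge_min lexx orbT.
    by move: h2; rewrite rmorphD /= -/a; lra.
  - rewrite opprD addNKr normrN gtr0_norm //.
    by apply: (@le_lt_trans _ _ (e / 2)); [rewrite /t ge_min lexx | lra].
have [a [s [h1 h2 h3]]] := H z.1; have [b [t [k1 k2 k3]]] := H z.2.
by exists (a, b), (s, t).
Qed.

(** Every neighbourhood meets an open cell, and a point of an open cell lies in no other cell; so a
    common interior point yields a common cell. *)
Lemma realize_interior_disjoint A B :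
  (realize R A)° `&` (realize R B)° = set0 <-> [disjoint A & B]%fset.
Proof.
split=> h.
  apply/fdisjointP => c hA; apply/negP => hB.
  suff : set0 (center c) by [].
  by rewrite -h; split; apply: (open_cell_interior (c := c)) (center_open c).
apply/seteqP; split=> // z [/nbhs_pairP[e e0 hA] /nbhs_pairP[e' e0' hB]].
have e'' : 0 < Num.min e e' by rewrite lt_min e0.
have [c [w [hw]]] := near_open_cell z e''.
rewrite !lt_min => /andP[a1 a2] /andP[b1 b2].
have /(open_cell_realize _ hw) cA := hA w a1 b1.
have /(open_cell_realize _ hw) cB := hB w a2 b2.
by have /fdisjointP/(_ _ cA)/negP := h.
Qed.

(** A tiling as the map sending each cell to the placed tile covering it; disjointness becomes
    constancy of the map on each tile. *)
Definition fun_tiling (T : {fset cells}) (G : cells)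
    (f : square -> cells * (int * int)) : Prop :=
  forall c, c \in G -> [/\ (f c).1 \in T, c \in translate (f c).2 (f c).1
    & forall c', c' \in translate (f c).2 (f c).1 -> c' \in G /\ f c' = f c].

Lemma tileableP T G : tileable R T G <-> exists f, fun_tiling T G f.
Proof.
split=> [[P [hT hd hU]]|[f hf]].
  have hex c : exists p, c \in G -> p \in P /\ c \in translate p.2 p.1.
    have [hc|hc] := boolP (c \in G); last by exists (fset0, (0, 0)).
    have /center_realize : c \in G by [].
    rewrite -hU => -[p /= hp /center_realize hc']; by exists p.
  have [f hf] := choice hex; exists f => c hc; have [fP cf] := hf c hc.
  split; [exact: hT | by [] |] => c' hc'.
  have c'G : c' \in G.
    apply/center_realize; rewrite -hU; exists (f c) => //; exact/center_realize.
  split=> //; have [fP' cf'] := hf c' c'G.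
  apply/eqP; apply: contraT => ne.
  have /realize_interior_disjoint/fdisjointP/(_ c' cf') := hd _ _ fP' fP ne.
  by rewrite hc'.
exists [fset f c | c in G]%fset; split.
- by move=> p /imfsetP[c /= /hf[hT _ _] ->].
- move=> p q /imfsetP[c /= hc ->] /imfsetP[d /= hd ->] ne.
  apply/realize_interior_disjoint/fdisjointP => c' h1; apply/negP => h2.
  have [_ _ /(_ c' h1)[_ e1]] := hf c hc; have [_ _ /(_ c' h2)[_ e2]] := hf d hd.
  by move: ne; rewrite -e1 -e2 eqxx.
- apply/seteqP; split=> [z [p /= /imfsetP[c /= hc ->] [d /= hd hz]]|z [c /= hc hz]].
    by have [_ _ /(_ d hd)[hG _]] := hf c hc; exists d.
  exists (f c) => /=; first by apply/imfsetP; exists c.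
  by have [_ hc' _] := hf c hc; exists c.
Qed.

End CellTopology.

Lemma mem_rectangle a b (x y : nat) :
  ((Posz x, Posz y) \in rectangle a b) = (x < a) && (y < b).
Proof.
apply/imfset2P/andP => [[i /= hi [j /= hj [-> ->]]]|[hx hy]].
  by move: hi hj; rewrite !mem_iota.
by exists x; rewrite ?mem_iota //; exists y; rewrite ?mem_iota.
Qed.

Lemma mem_rectangleN a b c : c \in rectangle a b ->
  exists x y : nat, [/\ c = (Posz x, Posz y), x < a & y < b].
Proof.
case/imfset2P => i /= hi [j /= hj ->]; exists i, j.
by move: hi hj; rewrite !mem_iota.
Qed.

Lemma mem_translate v (S : cells) (c : square) :
  (c \in translate v S) = (((c.1 - v.1)%R, (c.2 - v.2)%R) \in S).
Proof.
apply/imfsetP/idP => [[d /= hd ->] /=|h].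
  by rewrite !addrK -surjective_pairing.
by exists ((c.1 - v.1)%R, (c.2 - v.2)%R); rewrite //= !subrK -surjective_pairing.
Qed.

(** * Grid colorings as tilings *)

Section Digits.
Variable q : nat.

Definition val4 a b c d : nat := a + q * (b + q * (c + q * d)).

Lemma val4D a b c d a' b' c' d' :
  val4 a b c d + val4 a' b' c' d' = val4 (a + a') (b + b') (c + c') (d + d').
Proof. by rewrite /val4 !mulnDr; lia. Qed.

Lemma digit_inj a b a' b' : a < q -> a' < q -> a + q * b = a' + q * b' ->
  a = a' /\ b = b'.
Proof.
move=> h h' e; have q0 : 0 < q by lia.
have ea : a = a'.
  have := congr1 (modn^~ q) e.
  by rewrite addnC mulnC modnMDl addnC [q * b']mulnC modnMDl !modn_small.
split=> //; rewrite ea in e; apply/eqP; rewrite -(eqn_pmul2l q0); apply/eqP; lia.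
Qed.

Lemma val4_inj a b c d a' b' c' d' : a < q -> b < q -> c < q -> a' < q ->
  b' < q -> c' < q -> val4 a b c d = val4 a' b' c' d' ->
  [/\ a = a', b = b', c = c' & d = d'].
Proof.
move=> ha hb hc ha' hb' hc' /(digit_inj ha ha')[-> /(digit_inj hb hb')[->]].
by move=> /(digit_inj hc hc')[-> ->].
Qed.

Lemma leq_val4 a b c d a' b' c' d' : a <= a' -> b <= b' -> c <= c' -> d <= d' ->
  val4 a b c d <= val4 a' b' c' d'.
Proof. by move=> h1 h2 h3 h4; rewrite !leq_add // leq_mul // leq_add // leq_mul // leq_add // leq_mul. Qed.

Definition dg (b : bool) (r : nat) : nat := if b then r else 0.

(** The rank written as the digit reserved for the parity class of [(i, k)], all other digits being
    zero. *)
Definition phi (i k r : nat) : nat :=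
  val4 (dg (~~ odd i && ~~ odd k) r) (dg (odd i && ~~ odd k) r)
       (dg (~~ odd i && odd k) r) (dg (odd i && odd k) r).

End Digits.

Section DigitEquations.
Variable N : nat.
Local Notation ph := (phi (4 * N + 1)).
Implicit Types (i k r s u v : nat) (j l : bool).

(** The equations below add at most three ranks in one digit, so in base [4 * N + 1] there are no
    carries. *)
Lemma digits_eq a b c d a' b' c' d' :
  val4 (4 * N + 1) a b c d = val4 (4 * N + 1) a' b' c' d' ->
  [&& a <= 3 * N, b <= 3 * N, c <= 3 * N, a' <= 3 * N, b' <= 3 * N
    & c' <= 3 * N] -> [/\ a = a', b = b', c = c' & d = d'].
Proof. by move=> e h; apply: (val4_inj _ _ _ _ _ _ e); lia. Qed.

Ltac digits := rewrite /phi /= ?oddb ?val4D => /digits_eq; rewrite /dg.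
Ltac solve_digits := rewrite /=; match goal with |- (is_true ?A -> _) -> _ =>
  let H := fresh in (have H : A by lia); move=> /(_ H); clear H;
  case=> ? ? ? ?; first [split; lia | lia | by split=> //; lia] end.

Lemma phi_rank_inj i k r s : 0 < r <= N -> 0 < s <= N -> ph i k r = ph i k s -> r = s.
Proof.
by move=> hr hs; digits; case: (odd i); case: (odd k); solve_digits.
Qed.

(** Ranks are positive, so the positions of the nonzero digits show for which parity class a height
    was made; a height of the wrong class would leave a nonzero sum on one side of some digit and
    zero on the other. *)
Lemma phi_edge_v i k j r s u v : 0 < r <= N -> 0 < s <= N -> 0 < u <= N ->
  0 < v <= N -> ph i.+1 k v + ph j (odd k) r = ph i k u + ph (~~ j) (odd k) s ->
  r = u /\ s = v.
Proof.
by move=> h1 h2 h3 h4; digits; case: j; case: (odd i); case: (odd k); solve_digits.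
Qed.

Lemma phi_edge_h i k j l r s u v : 0 < r <= N -> 0 < s <= N -> 0 < u <= N ->
  0 < v <= N -> ph i k.+1 v + ph j l r = ph i k u + ph j (~~ l) s ->
  r = u /\ s = v.
Proof.
move=> h1 h2 h3 h4; digits.
by case: j; case: l; case: (odd i); case: (odd k); solve_digits.
Qed.

Lemma phi_corner i k (j j' l : bool) r s u r1 s1 u1 : 0 < r <= N -> 0 < s <= N ->
  0 < u <= N -> 0 < r1 <= N -> 0 < s1 <= N -> 0 < u1 <= N ->
  ph i k.+1 r + ph (~~ j) (odd k.+1) s + ph j' l u1 =
  ph i.+1 k u + ph j' (~~ l) s1 + ph j (odd k.+1) r1 ->
  [/\ j' = ~~ odd i, l = odd k & u = u1].
Proof.
move=> h1 h2 h3 h4 h5 h6; digits.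
by case: j; case: j'; case: l; case: (odd i); case: (odd k); solve_digits.
Qed.

End DigitEquations.

Section Coloring.
Variables (C : finType) (Rh Rv : rel C).

Definition crank (c : C) : nat := (index c (enum C)).+1.
Local Notation N := #|C|.
Local Notation q := (4 * N + 1).
Local Notation ph := (phi q).

Lemma crank_le c : 0 < crank c <= N.
Proof. by rewrite /crank cardE /= index_mem mem_enum. Qed.

Lemma crank_inj : injective crank.
Proof.
move=> c d [] h; rewrite -(nth_index c (mem_enum C c)) h.
by rewrite nth_index // mem_enum.
Qed.

Definition dlt : nat := (val4 q N N N N).+1.
(** 21 and 42 are the smallest multiples of [dlt] satisfying the hypotheses [20 * dl < hs] and
    [hs + 20 * dl < H] of the rigidity theorem. *)
Definition hsm : nat := 21 * dlt.
Definition hbg : nat := 42 * dlt.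
Definition base (i k : nat) : nat := hbg * i + hsm * k.
Definition lev (i k : nat) (c : C) : nat := base i k + ph i k (crank c).

Lemma phi_lt i k c : ph i k (crank c) < dlt.
Proof.
have /andP[_ h] := crank_le c; rewrite ltnS.
by apply: leq_val4; rewrite /dg; case: ifP => _; lia.
Qed.

Definition small_heights : seq nat :=
  [seq hsm + ph ik.1 ik.2.+1 (crank p.2) - ph ik.1 ik.2 (crank p.1)
     | ik <- [:: (0, 0); (0, 1); (1, 0); (1, 1)],
       p <- [seq p <- enum {: C * C} | Rh p.1 p.2]].

(** The column parity [b] is recorded by the width, hence only the row parity varies. *)
Definition big_heights (b : bool) : seq nat :=
  [seq hbg + ph i.+1 b (crank p.2) - ph i b (crank p.1)
     | i <- [:: 0; 1], p <- [seq p <- enum {: C * C} | Rv p.1 p.2]].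

Definition tile_seq : seq cells :=
  [seq rectangle 4 h | h <- small_heights] ++
  [seq rectangle 5 h | h <- big_heights false] ++
  [seq rectangle 7 h | h <- big_heights true].

Definition tile_set : {fset cells} := [fset t in tile_seq]%fset.

Lemma mem_tile_set t : (t \in tile_set) = (t \in tile_seq).
Proof. by apply/imfsetP/idP => [[x /= hx ->]//|h]; exists t. Qed.

Lemma phi_odd i k r : ph i k r = ph (odd i) (odd k) r.
Proof. by rewrite /phi !oddb. Qed.

Lemma small_heightsP h : h \in small_heights <-> exists (i k : bool) c d,
  Rh c d /\ h + ph i k (crank c) = hsm + ph i (~~ k) (crank d).
Proof.
have le i k c : ph i k (crank c) <= hsm.
  by have := phi_lt i k c; rewrite /hsm; lia.
split.
  case/allpairsP => -[[i k] [c d]] /= [hik]; rewrite mem_filter /= => /andP[hR _] ->.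
  exists (odd i), (odd k), c, d; split=> //.
  rewrite -(phi_odd i k) subnK; last by apply: leq_trans (le _ _ _) (leq_addr _ _).
  by congr addn; apply: phi_odd.
case=> i [k [c [d [hR e]]]]; apply/allpairsP; exists ((i : nat, k : nat), (c, d)).
split; [by case: i {e}; case: k | by rewrite mem_filter mem_enum hR |].
have -> : ph i k.+1 (crank d) = ph i (~~ k) (crank d) by case: (i); case: (k).
by rewrite -e addnK.
Qed.

Lemma big_heightsP b h : h \in big_heights b <-> exists (i : bool) c d,
  Rv c d /\ h + ph i b (crank c) = hbg + ph (~~ i) b (crank d).
Proof.
have le i k c : ph i k (crank c) <= hbg.
  by have := phi_lt i k c; rewrite /hbg; lia.
split.
  case/allpairsP => -[i [c d]] /= [hik]; rewrite mem_filter /= => /andP[hR _] ->.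
  exists (odd i), c, d; split=> //.
  have eb j r : ph (odd j) b r = ph j b r by rewrite phi_odd [RHS]phi_odd oddb.
  rewrite eb subnK; last by apply: leq_trans (le _ _ _) (leq_addr _ _).
  by congr addn; rewrite phi_odd [RHS]phi_odd /= !oddb.
case=> i [c [d [hR e]]]; apply/allpairsP; exists (i : nat, (c, d)).
split; [by case: i {e} | by rewrite mem_filter mem_enum hR |].
have -> : ph i.+1 b (crank d) = ph (~~ i) b (crank d) by case: (i).
by rewrite -e addnK.
Qed.

Lemma small_near h : h \in small_heights -> hsm <= h + dlt /\ h <= hsm + dlt.
Proof.
move/small_heightsP => [i [k [c [d [_ e]]]]].
by have := phi_lt i k c; have := phi_lt i (~~ k) d; lia.
Qed.

Lemma big_near b h : h \in big_heights b -> hbg <= h + dlt /\ h <= hbg + dlt.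
Proof.
move/big_heightsP => [i [c [d [_ e]]]].
by have := phi_lt i b c; have := phi_lt (~~ i) b d; lia.
Qed.

Lemma dlt_gt0 : 0 < dlt. Proof. by []. Qed.

Lemma lev_le i k c : base i k <= lev i k c <= base i k + dlt.
Proof. by rewrite /lev; have := phi_lt i k c; lia. Qed.

Lemma lev_inj i k c d : lev i k c = lev i k d -> c = d.
Proof.
move=> e; have {}e : ph i k (crank c) = ph i k (crank d) by move: e; rewrite /lev; lia.
apply: crank_inj; exact: phi_rank_inj (crank_le c) (crank_le d) e.
Qed.

Lemma decode_v i k c d : lev i k c <= lev i.+1 k d ->
  lev i.+1 k d - lev i k c \in big_heights (odd k) -> Rv c d.
Proof.
move=> le /big_heightsP[j [a [b [hR e]]]].
have {}e : ph i.+1 k (crank d) + ph j (odd k) (crank a) =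
           ph i k (crank c) + ph (~~ j) (odd k) (crank b).
  by move: e le; rewrite /lev /base mulnS; lia.
suff [<- <-] : a = c /\ b = d by [].
suff [h1 h2] : crank a = crank c /\ crank b = crank d by split; apply: crank_inj.
exact: phi_edge_v (crank_le a) (crank_le b) (crank_le c) (crank_le d) e.
Qed.

Lemma decode_h i k c d : lev i k c <= lev i k.+1 d ->
  lev i k.+1 d - lev i k c \in small_heights -> Rh c d.
Proof.
move=> le /small_heightsP[j [l [a [b [hR e]]]]].
have {}e : ph i k.+1 (crank d) + ph j l (crank a) =
           ph i k (crank c) + ph j (~~ l) (crank b).
  by move: e le; rewrite /lev /base mulnS; lia.
suff [<- <-] : a = c /\ b = d by [].
suff [h1 h2] : crank a = crank c /\ crank b = crank d by split; apply: crank_inj.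
exact: phi_edge_h (crank_le a) (crank_le b) (crank_le c) (crank_le d) e.
Qed.

(* The vertex above [b] and right of [d] is reached by a big and by a small
   tile; comparing digits forces both to end in the same color. *)
Lemma decode_corner i k (b d : C) y : lev i k.+1 b <= y -> lev i.+1 k d <= y ->
  y - lev i k.+1 b \in big_heights (odd k.+1) -> y - lev i.+1 k d \in small_heights ->
  exists c, y = lev i.+1 k.+1 c.
Proof.
move=> l1 l2 /big_heightsP[j [b1 [c [_ e1]]]] /small_heightsP[j' [l [d1 [c1 [_ e2]]]]].
suff h : ph i.+1 k.+1 (crank c1) = ph j' (~~ l) (crank c1) /\
    ph i.+1 k (crank d) = ph j' l (crank d1).
  by exists c1; move: e2 l2; rewrite /lev /base !mulnS (proj1 h) (proj2 h); lia.
have e : ph i k.+1 (crank b) + ph (~~ j) (odd k.+1) (crank c) + ph j' l (crank d1) =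
    ph i.+1 k (crank d) + ph j' (~~ l) (crank c1) + ph j (odd k.+1) (crank b1).
  by move: e1 e2 l1 l2; rewrite /lev /base !mulnS; lia.
have [-> -> ->] := phi_corner (crank_le b) (crank_le c) (crank_le d) (crank_le b1)
  (crank_le c1) (crank_le d1) e.
by split; rewrite phi_odd /= [in RHS]phi_odd !oddb.
Qed.

Lemma rectangle_inj a b a' b' : 0 < a -> 0 < b -> rectangle a b = rectangle a' b' ->
  a = a' /\ b = b'.
Proof.
move=> ha hb e.
have h x y : (x < a) && (y < b) = (x < a') && (y < b') by rewrite -!mem_rectangle e.
have := h a.-1 b.-1; have := h a'.-1 b'.-1; have := h a 0; have := h 0 b.
by have := h a' 0; have := h 0 b'; lia.
Qed.

Lemma tile_setP t : t \in tile_set -> exists a b, [/\ t = rectangle a b, 0 < a, 0 < b &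
  a = 4 /\ b \in small_heights \/
  exists f : bool, a = (if f then 7 else 5) /\ b \in big_heights f].
Proof.
rewrite mem_tile_set !mem_cat => /or3P[] /mapP[h hh ->].
- exists 4, h; split=> //; last by left.
  by have := small_near hh; have := dlt_gt0; rewrite /hsm; lia.
- exists 5, h; split=> //; last by right; exists false.
  by have := big_near hh; have := dlt_gt0; rewrite /hbg; lia.
- exists 7, h; split=> //; last by right; exists true.
  by have := big_near hh; have := dlt_gt0; rewrite /hbg; lia.
Qed.

Lemma tile_set_rectangular t : t \in tile_set -> rectangular t.
Proof. by move=> /tile_setP[a [b [-> ha hb _]]]; exists a, b. Qed.

(** The factor 8 consists of four parity classes for width 4 and two for each of the widths 5 and
    7. *)
Lemma card_tile_set : #|` tile_set|%fset <= 8 * N ^ 2.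
Proof.
apply: (@leq_trans (size tile_seq)).
  apply: uniq_leq_size; first exact: fset_uniq.
  by move=> t; rewrite mem_tile_set.
have hs (r : rel C) : size [seq p <- enum {: C * C} | r p.1 p.2] <= N ^ 2.
  by rewrite size_filter; apply: leq_trans (count_size _ _) _; rewrite -cardE card_prod mulnn.
rewrite !size_cat !size_map !size_allpairs /=.
move: (hs Rh) (hs Rv); move: (size _) (size _) (N ^ 2) => a b c; lia.
Qed.

Section Instance.
Variables (R : realType) (m n : nat) (cb : nat -> nat -> C).
Hypotheses (m_gt0 : 0 < m) (n_gt0 : 0 < n).

Definition Yb (i k : nat) : nat := lev i k (cb i k).

Definition grid_cells : seq square :=
  [seq (Posz x, Posz y) | x <- iota 0 (Xt m n),
     y <- iota (env m n Yb 0 x) (env m n Yb m x - env m n Yb 0 x)].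

Lemma mem_grid_cells c : c \in grid_cells <->
  exists x y, c = (Posz x, Posz y) /\ inG m n Yb x y.
Proof.
split=> [/allpairsPdep[x [y [hx hy ->]]]|[x [y [-> /andP[hx hy]]]]].
  exists x, y; split=> //; move: hx hy; rewrite !mem_iota /inG /= => -> h; lia.
by apply/allpairsPdep; exists x, y; rewrite !mem_iota; split=> //; lia.
Qed.

Lemma uniq_grid_cells : uniq grid_cells.
Proof.
apply: allpairs_uniq_dep => [|x _|[x y] [x' y'] _ _ /= [-> ->] //]; exact: iota_uniq.
Qed.

(** The corner [(m, n)] is left out: no tile and no color constraint reaches it. *)
Definition edge_pos i k := (i == 0) && (k < n) || (k == 0) && (i < m) ||
        (i == m) && (k < n) || (k == n) && (i < m).

Definition colorable := exists col : nat -> nat -> C,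
  [/\ forall i k, i <= m -> k <= n -> edge_pos i k -> col i k = cb i k,
      forall i k, i < m -> k < n -> Rv (col i k) (col i.+1 k)
    & forall i k, i < m -> k < n -> Rh (col i k) (col i k.+1)].

Local Notation G := (inG m n Yb).

(** The rigidity theorem is applied with [ok] meaning that a level codes some color; [decode_corner]
    supplies its inductive step, and the heights of the tiles then give the constraints. *)
Lemma tileable_colorable : tileable R tile_set [fset c in grid_cells]%fset -> colorable.
Proof.
move=> /tileableP[f hf].
have inGP x y : ((Posz x, Posz y) \in [fset c in grid_cells]%fset) = G x y.
  rewrite !inE; apply/idP/idP => [/mem_grid_cells[x' [y' [[-> ->]]]]//|h].
  by apply/mem_grid_cells; exists x, y.
have hex (p : nat * nat) : exists t : (nat * nat) * (nat * nat), G p.1 p.2 ->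
   [/\ f (Posz p.1, Posz p.2) = (rectangle t.2.1 t.2.2, (Posz t.1.1, Posz t.1.2)),
     0 < t.2.1, 0 < t.2.2 & t.2.1 = 4 /\ t.2.2 \in small_heights \/
     exists b : bool, t.2.1 = (if b then 7 else 5) /\ t.2.2 \in big_heights b].
  case: p => x y /=; have [g|ng] := boolP (G x y); last by exists ((0, 0), (0, 0)).
  have := hf (Posz x, Posz y); rewrite inGP => /(_ g).
  case E: (f _) => [t [v w]] /= [/tile_setP[a [b [-> ha hb hd]]] _ h3].
  have := h3 (v, w); rewrite mem_translate /= !subrr (mem_rectangle a b 0 0) ha hb.
  case=> //; rewrite inE /= => /mem_grid_cells[v' [w' [[-> ->] _]]] _.
  by exists ((v', w'), (a, b)).
have [t ht] := choice hex.
pose tx x y := (t (x, y)).1.1; pose ty x y := (t (x, y)).1.2.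
pose tw x y := (t (x, y)).2.1; pose th x y := (t (x, y)).2.2.
have mt x y x' y' : G x y -> ((Posz x', Posz y') \in
    translate (f (Posz x, Posz y)).2 (f (Posz x, Posz y)).1) =
    (tx x y <= x' < tx x y + tw x y) && (ty x y <= y' < ty x y + th x y).
  move=> g; have [-> _ _ _] := ht (x, y) g; rewrite mem_translate /= -/(tx x y) -/(ty x y) -/(tw x y) -/(th x y).
  have [hx|hx] := leqP (tx x y) x'; last first.
    rewrite /=; apply/negbTE/negP => /mem_rectangleN[a [b [[]]]]; lia.
  have [hy|hy] := leqP (ty x y) y'; last first.
    rewrite /= andbF; apply/negbTE/negP => /mem_rectangleN[a [b [[]]]]; lia.
  rewrite !subzn // mem_rectangle; lia.
have tl : tiled G tx ty tw th.
  move=> x y g; have := hf (Posz x, Posz y); rewrite inGP => /(_ g)[_].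
  rewrite mt // => /andP[h1 h2] h3; split=> // x' y' h1' h2'.
  have [] := h3 (Posz x', Posz y'); first by rewrite mt // h1' h2'.
  rewrite inGP => g' e; have [e1 a1 b1 _] := ht (x, y) g; have [e2 a2 b2 _] := ht (x', y') g'.
  move: e; rewrite e1 e2 => -[/(rectangle_inj a2 b2)[ea eb] ec ed].
  by rewrite /tx /ty /tw /th ea eb ec ed.
have dims x y : G x y -> tw x y = 4 /\ th x y \in small_heights \/
    exists b : bool, tw x y = (if b then 7 else 5) /\ th x y \in big_heights b.
  by move=> g; have [] := ht (x, y) g.
have [|||||||||||Yf [Yf1 Yf2 Yf3 Yf4]] := @rigid m n Yb base dlt hsm hbg m_gt0 n_gt0 dlt_gt0 _ _ _ _ _
  (fun h => h \in small_heights) (fun b h => h \in big_heights b) _ _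
  (fun i k y => exists c, y = lev i k c) _ _ _ _ tx ty tw th tl dims.
- by rewrite /hsm; have := dlt_gt0; lia.
- by rewrite /hsm /hbg; have := dlt_gt0; lia.
- by move=> i k; rewrite /base mulnS; lia.
- by move=> i k; rewrite /base mulnS; lia.
- by move=> i k _; apply: lev_le.
- exact: small_near.
- exact: big_near.
- by move=> i k y [c ->]; apply: lev_le.
- by move=> k; exists (cb 0 k).
- by move=> i; exists (cb i 0).
- move=> i k a b y [c ->] [d ->] h1 h2 h3 h4; exact: decode_corner h3 h4 h1 h2.
have hcol (p : nat * nat) : exists c, p.1 <= m -> p.2 <= n -> ~~ ((p.1 == m) && (p.2 == n)) ->
    Yf p.1 p.2 = lev p.1 p.2 c.
  case: p => i k /=; have [lt|nlt] := boolP ((i < m) && (k < n)).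
    by case/andP: lt => li lk; have [c] := Yf2 i k li lk; exists c.
  by exists (cb i k) => hi hk hn; rewrite Yf1 //; move: nlt hn; lia.
have [col hc] := choice hcol; exists (fun i k => col (i, k)); split=> [i k hi hk he|i k hi hk|i k hi hk].
- apply: (@lev_inj i k); rewrite -(hc (i, k)) //=; first by rewrite Yf1.
  by move: he; rewrite /edge_pos; lia.
- have [le h] := Yf3 i k hi hk; move: le h.
  rewrite (hc (i, k)) ?(hc (i.+1, k)) /=; try lia; exact: decode_v.
- have [le h] := Yf4 i k hi hk; move: le h.
  rewrite (hc (i, k)) ?(hc (i, k.+1)) /=; try lia; exact: decode_h.
Qed.

Lemma lev_ltS i k c d : lev i k c < lev i.+1 k d.
Proof. by have := lev_le i k c; have := lev_le i.+1 k d; rewrite /base mulnS /hbg; have := dlt_gt0; lia. Qed.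

Lemma lev_ltSr i k c d : lev i k c < lev i k.+1 d.
Proof. by have := lev_le i k c; have := lev_le i k.+1 d; rewrite /base mulnS /hsm; have := dlt_gt0; lia. Qed.

Lemma env_edge (Y Y' : nat -> nat -> nat) x : x < Xt m n ->
  (forall i k, i <= m -> k <= n -> edge_pos i k -> Y i k = Y' i k) ->
  env m n Y 0 x = env m n Y' 0 x /\ env m n Y m x = env m n Y' m x.
Proof.
rewrite /Xt => hx h; rewrite /env subn0 subnn muln0 subn0 ltn0.
split.
  case: ltnP => h1; first by apply: h; rewrite /edge_pos; lia.
  have -> : x - 4 * m < Ws n by lia.
  have : kidx (x - 4 * m) < n by rewrite kidx_lt; lia.
  by move=> hk; apply: h; rewrite /edge_pos; lia.
case: ltnP => h1; last by apply: h; rewrite /edge_pos; lia.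
have : kidx x < n by rewrite kidx_lt.
by move=> hk; apply: h; rewrite /edge_pos; lia.
Qed.

Lemma colorable_tileable : colorable -> tileable R tile_set [fset c in grid_cells]%fset.
Proof.
move=> [col [hb hv hh]]; pose Y i k := lev i k (col i k).
have eG x y : G x y = inG m n Y x y.
  rewrite /inG; case hx: (x < Xt m n) => //=.
  have [|-> -> //] := @env_edge Yb Y x hx.
  by move=> i k hi hk he; rewrite /Yb /Y hb.
have [tl dims] := @built_tiled m n Y n_gt0 (fun i k _ _ => lev_ltS i k _ _)
  (fun i k _ _ => lev_ltSr i k _ _).
pose b (c : square) := built m n Y `|c.1|%N `|c.2|%N.
apply/tileableP; exists (fun c => (rectangle (b c).2.1 (b c).2.2, (Posz (b c).1.1, Posz (b c).1.2))).
move=> c; rewrite inE /= => /mem_grid_cells[x [y [-> g]]].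
have mt x' y' : ((Posz x', Posz y') \in translate (Posz (built m n Y x y).1.1, Posz (built m n Y x y).1.2)
    (rectangle (built m n Y x y).2.1 (built m n Y x y).2.2)) =
    ((built m n Y x y).1.1 <= x' < (built m n Y x y).1.1 + (built m n Y x y).2.1) &&
    ((built m n Y x y).1.2 <= y' < (built m n Y x y).1.2 + (built m n Y x y).2.2).
  rewrite mem_translate /=; move: (built m n Y x y) => [[vx vy] [w h]] /=.
  have [hx|hx] := leqP vx x'; last first.
    rewrite /=; apply/negbTE/negP => /mem_rectangleN[a1 [b1 [[]]]]; lia.
  have [hy|hy] := leqP vy y'; last first.
    rewrite /= andbF; apply/negbTE/negP => /mem_rectangleN[a1 [b1 [[]]]]; lia.
  rewrite !subzn // mem_rectangle; lia.
rewrite /b /=; rewrite eG in g; have [h1 h2 h3] := tl x y g; split.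
- have [i [k [hi hk]]] := dims x y g; rewrite mem_tile_set !mem_cat; case=> -> /=.
    have hh' : Y i.+1 k - Y i k \in big_heights (odd k).
      apply/big_heightsP; exists (odd i), (col i k), (col i.+1 k); split; first exact: hv.
      have := lev_ltS i k (col i k) (col i.+1 k); rewrite /Y /lev.
      rewrite [ph i k _]phi_odd [ph i.+1 k _]phi_odd /= [ph (~~ odd i) (odd k) _]phi_odd.
      by rewrite /base mulnS !oddb; lia.
    apply/or3P; move: hh'; rewrite /Wd; case: (odd k) => hh'.
      by constructor 3; apply: map_f.
    by constructor 2; apply: map_f.
  apply/or3P; constructor 1; apply: map_f.
  apply/small_heightsP; exists (odd i), (odd k), (col i k), (col i k.+1); split; first exact: hh.
  have := lev_ltSr i k (col i k) (col i k.+1); rewrite /Y /lev.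
  rewrite [ph i k _]phi_odd [ph i k.+1 _]phi_odd /= [ph (odd i) (~~ odd k) _]phi_odd.
  by rewrite /base mulnS !oddb; lia.
- by rewrite mt h1 h2.
- move=> [c1 c2] hc; have [x' [y' ec]] : exists x' y' : nat, (c1, c2) = (Posz x', Posz y').
    move: hc; rewrite mem_translate /= => /mem_rectangleN[a1 [b1 [[e1 e2] _ _]]].
    exists ((built m n Y x y).1.1 + a1), ((built m n Y x y).1.2 + b1).
    by congr pair; lia.
  rewrite ec mt in hc *; case/andP: hc => h1' h2'.
  have [g' e1 e2 e3 e4] := h3 x' y' h1' h2'; split.
    by rewrite inE /=; apply/mem_grid_cells; exists x', y'; rewrite eG.
  by rewrite /= e1 e2 e3 e4.
Qed.

End Instance.
End Coloring.

(** * Satisfiability as a grid coloring *)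

Definition literal : Type := (nat * bool)%type.
Definition cnf : Type := seq (seq literal).

Definition lit_true (x : nat -> bool) (l : literal) : bool := x l.1 (+) l.2.
Definition satisfies (x : nat -> bool) (F : cnf) : bool := all (has (lit_true x)) F.

(* check row?, horizontal bit, content of the column, trigger, trigger of the
   left neighbour; a column is blank ([None]), a clause end ([Some None]) or
   carries the value of a literal *)
Definition icolor : finType :=
  (bool * bool * option (option bool) * option bool * option bool)%type.
(* trigger, trigger of the left neighbour, kind of the column: blank, clause
   end ([Some false]) or literal ([Some true]) *)
Definition bcolor : finType := (option bool * option bool * option bool)%type.
Definition color : finType := (icolor + (bcolor + (bool + bool)))%type.

Definition cI (c : icolor) : color := inl c.
Definition cB (c : bcolor) : color := inr (inl c).
Definition cL (check : bool) : color := inr (inr (inl check)).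
Definition cT : color := inr (inr (inr true)).
Definition cR : color := inr (inr (inr false)).

(** The check row reads the columns from left to right and remembers whether the current clause has
    met a true literal; a clause end requires this and starts afresh. *)
Definition scan_ok (acc : bool) (v : option (option bool)) (acc' : bool) : bool :=
  match v with
  | None => acc' == acc
  | Some None => acc && ~~ acc'
  | Some (Some b) => acc' == acc || b
  end.

Definition row_ok (check : bool) (h : bool) (v : option (option bool)) (h' : bool) :=
  if check then scan_ok h v h' else h' == h.

Definition crossing_ok (c : icolor) : bool :=
  let: (check, h, v, tr, _) := c in
  match tr, v with
  | Some s, Some (Some b) => check || (h == b (+) s)
  | _, _ => true
  end.

Definition kind_ok (k : option bool) (v : option (option bool)) : bool :=
  match k, v with
  | None, None => true
  | Some false, Some None => true
  | Some true, Some (Some _) => true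
  | _, _ => false
  end.

Definition Rh (a b : color) : bool :=
  match a, b with
  | inl (ck, h, _, tr, _), inl (ck', h', v', _, tl') =>
      [&& ck == ck', tl' == tr & row_ok ck h v' h']
  | inr (inr (inl ck)), inl (ck', h', v', _, tl') =>
      [&& ck == ck', tl' == None & ck ==> scan_ok false v' h']
  | inl _, inr (inr (inr false)) => true
  | inr (inr (inl _)), inr (inl (_, tl', _)) => tl' == None
  | inr (inl (tr, _, _)), inr (inl (_, tl', _)) => tl' == tr
  | inr (inl _), inr (inr (inr false)) => true
  | inr (inr (inl _)), inr (inr (inr false)) => true
  | _, _ => false
  end.

(** The trigger of a cell is that of the left neighbour of the cell in the row before: this is the
    diagonal motion. A vertical edge can check it because each cell also stores the trigger of its
    left neighbour, which the horizontal edges verify. *)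
Definition Rv (a b : color) : bool :=
  match a, b with
  | inr (inl (_, tl, kd)), inl c => [&& crossing_ok c, c.1.2 == tl & kind_ok kd c.1.1.2]
  | inl a, inl c => [&& crossing_ok c, c.1.2 == a.2 & c.1.1.2 == a.1.1.2]
  | inl _, inr (inr (inr true)) => true
  | inr (inr (inl _)), inr (inr (inl _)) => true
  | _, _ => false
  end.

(** There are 144 inner colors, 27 bottom colors and 4 others. *)
Lemma card_color : 8 * #|color| ^ 2 <= 10 ^ 6.
Proof. by rewrite /color /icolor /bcolor !card_sum !card_prod !card_option !card_bool. Qed.

Definition wcell : Type := (option bool * option bool * bool)%type.

Section Word.
Variables (V : nat) (x : nat -> bool).

(** The trigger stands [l.1.+1] columns before the literal column, the last of the block. Moving one
    column per row it arrives there in row [l.1.+1], which carries the variable [l.1]. The full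
    length [V.+1] keeps the triggers of other blocks away. *)
Definition block (l : literal) : seq wcell :=
  [seq (if p == V - l.1.+1 then Some l.2 else None,
        if p == V then Some true else None, lit_true x l) | p <- iota 0 V.+1].

Definition piece (o : option literal) : seq wcell :=
  if o is Some l then block l else [:: (None, Some false, false)].

Definition pieces (F : cnf) : seq (option literal) :=
  flatten [seq rcons (map Some cl) None | cl <- F].

Definition word_of (ps : seq (option literal)) : seq wcell := flatten (map piece ps).

Lemma word_some l ps : word_of (Some l :: ps) = block l ++ word_of ps.
Proof. by []. Qed.

Lemma word_none ps : word_of (None :: ps) = (None, Some false, false) :: word_of ps.
Proof. by []. Qed.

Fixpoint scan_word (acc : bool) (ws : seq wcell) : bool :=
  match ws with
  | [::] => true
  | (_, None, _) :: ws' => scan_word acc ws'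
  | (_, Some false, _) :: ws' => acc && scan_word false ws'
  | (_, Some true, b) :: ws' => scan_word (acc || b) ws'
  end.

Lemma scan_block acc l ws :
  scan_word acc (block l ++ ws) = scan_word (acc || lit_true x l) ws.
Proof.
rewrite /block -[V.+1]addn1 iotaD map_cat -catA add0n.
rewrite [X in _ ++ (X ++ _)]/= eqxx /=.
have : forall p, p \in iota 0 V -> p != V by move=> p; rewrite mem_iota; lia.
elim: (iota 0 V) => //= p s IH h; rewrite (negbTE (h p (mem_head _ _))).
by apply: IH => q hq; apply: h; rewrite inE hq orbT.
Qed.

Lemma scan_clause acc cl ws :
  scan_word acc (word_of (rcons (map Some cl) None) ++ ws) =
  (acc || has (lit_true x) cl) && scan_word false ws.
Proof.
elim: cl acc => [|l cl IH] acc; first by rewrite /= orbF.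
by rewrite map_cons rcons_cons word_some -catA scan_block IH orbA.
Qed.

Lemma scan_pieces F : scan_word false (word_of (pieces F)) = satisfies x F.
Proof.
elim: F => //= cl F IH; rewrite /pieces /= /word_of map_cat flatten_cat.
by rewrite -/(word_of _) scan_clause -IH.
Qed.

Definition d0 : wcell := (None, None, false).

Lemma nth_block l p : p <= V -> nth d0 (block l) p =
  (if p == V - l.1.+1 then Some l.2 else None,
   if p == V then Some true else None, lit_true x l).
Proof. by move=> h; rewrite (nth_map 0) ?size_iota // nth_iota. Qed.

Lemma size_block l : size (block l) = V.+1.
Proof. by rewrite size_map size_iota. Qed.

Lemma no_early_literal ps j : j < V -> (nth d0 (word_of ps) j).1.2 != Some true.
Proof.
elim: ps j => [|[l|] ps IH] j hj; first by rewrite nth_nil.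
  rewrite word_some nth_cat size_block ltnS (ltnW hj) nth_block ?(ltnW hj) //=.
  by case: (eqVneq j V) => // e; move: hj; rewrite e ltnn.
by case: j hj => //= j hj; apply: IH; apply: ltnW.
Qed.

Definition vars_lt (ps : seq (option literal)) :=
  all (fun o => if o is Some l then l.1 < V else true) ps.

(* Triggers are at least [V + 1] columns away from all literal columns but
   their own. *)
Lemma trigger_literal ps a b s : vars_lt ps -> a < b <= a + V ->
  (nth d0 (word_of ps) a).1.1 = Some s -> (nth d0 (word_of ps) b).1.2 = Some true ->
  (nth d0 (word_of ps) b).2 = x (b - a).-1 (+) s.
Proof.
elim: ps a b => [|[l|] ps IH] a b; first by rewrite !nth_nil.
  rewrite word_some => /andP[hl hps] hab; rewrite !nth_cat size_block.
  have [ha|ha] := ltnP a V.+1.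
    rewrite nth_block //=; case: eqP => // ea [<-].
    have [hb|hb] := ltnP b V.+1.
      rewrite nth_block //=; case: eqP => // eb _; rewrite /lit_true.
      by congr (x _ (+) _); lia.
    move=> h; by have := @no_early_literal ps (b - V.+1) (ltac:(lia)); rewrite h.
  have -> : b < V.+1 = false by lia.
  have -> : b - a = b - V.+1 - (a - V.+1) by lia.
  by apply: IH => //; lia.
rewrite word_none; case: a b => [|a] [|b] //= hps hab.
by rewrite subSS; apply: IH => //; lia.
Qed.

Lemma own_trigger ps b : vars_lt ps -> (nth d0 (word_of ps) b).1.2 = Some true ->
  exists v s, [/\ v < V, v < b, (nth d0 (word_of ps) (b - v.+1)).1.1 = Some s
    & (nth d0 (word_of ps) b).2 = x v (+) s].
Proof.
elim: ps b => [|[l|] ps IH] b; first by rewrite nth_nil.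
  rewrite word_some => /andP[hl hps]; rewrite !nth_cat size_block.
  have [hb|hb] := ltnP b V.+1.
    rewrite nth_block //; case: (eqVneq b V) => // eb _; exists l.1, l.2.
    have hb' : b - l.1.+1 < V.+1 by lia.
    rewrite nth_cat size_block hb' nth_block //; split=> //; first by lia.
    by rewrite /= eb eqxx.
  move=> h; have [v [s [h1 h2 h3 h4]]] := IH _ hps h; exists v, s; split=> //; first by lia.
  rewrite nth_cat size_block; have -> : b - v.+1 < V.+1 = false by lia.
  by rewrite subnAC.
rewrite word_none; case: b => //= b hps h.
have [v [s [h1 h2 h3 h4]]] := IH _ hps h; exists v, s; split=> //; first by lia.
by have -> : b.+1 - v.+1 = (b - v.+1).+1 by lia.
Qed.

End Word.

Section Sat.
Variables (V : nat) (F : cnf).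
Hypothesis F_vars : all (all (fun l : literal => l.1 < V)) F.

Let ps := pieces F.
Lemma pieces_vars : vars_lt V ps.
Proof.
apply/allP => o /flattenP[s /mapP[cl hcl ->]]; rewrite mem_rcons inE.
case/orP => [/eqP -> //|/mapP[l hl ->]].
by have /allP/(_ _ hcl)/allP/(_ _ hl) := F_vars.
Qed.

Definition word : seq (option bool * option bool) := unzip1 (word_of V xpred0 ps).

Lemma word_unzip x : unzip1 (word_of V x ps) = word.
Proof.
rewrite /word; elim: ps => // -[l|] s IH; last by rewrite !word_none /= IH.
by rewrite !word_some /unzip1 !map_cat -!/(unzip1 _) IH /block /unzip1 -!map_comp.
Qed.

(** Column 0 is the left border and has no trigger; with truncated subtraction, [tr0 (k - i)] is
    then [None] for all [i >= k]. *)
Definition tr0 (k : nat) : option bool := if k is j.+1 then (nth (None, None) word j).1 else None.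
Definition kd0 (k : nat) : option bool := (nth (None, None) word k.-1).2.

(** Row 0 holds the triggers, rows 1 to [V] the variables, row [V.+1] the check, and row [V.+2] is
    the upper border. *)
Definition gm : nat := V.+2.
Definition gn : nat := (size word).+1.

Definition border (i k : nat) : color :=
  if k == 0 then cL (i == V.+1) else if k == gn then cR
  else if i == 0 then cB (tr0 k, tr0 k.-1, kd0 k) else cT.

Lemma nth_word x j : nth (None, None) word j = (nth d0 (word_of V x ps) j).1.
Proof.
have [h|h] := ltnP j (size word).
  by rewrite -(word_unzip x) (nth_map d0) //; move: h; rewrite -(word_unzip x) size_map.
by rewrite !nth_default //; move: h; rewrite -(word_unzip x) size_map.
Qed.

Lemma sat_colorable x : satisfies x F -> colorable Rh Rv gm gn border.
Proof.
move=> hsat; pose W := word_of V x ps.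
have sW : size W = size word by rewrite -(word_unzip x) size_map.
pose vv k : option (option bool) := match kd0 k with None => None
  | Some false => Some None | Some true => Some (Some (nth d0 W k.-1).2) end.
(* The bit of the check row after column [k]. *)
pose acc := fix acc k := if k is j.+1 then match vv k with None => acc j
  | Some None => false | Some (Some b) => acc j || b end else false.
have hacc k : 0 < k <= size word -> scan_ok (acc k.-1) (vv k) (acc k).
  have hs j : j <= size W -> scan_word (acc j) (drop j W).
    elim: j => [_|j IH hj]; first by rewrite drop0 /= /W /ps scan_pieces.
    have := IH (ltnW hj); rewrite (drop_nth d0 hj) /=.
    have e : kd0 j.+1 = (nth d0 W j).1.2 by rewrite /kd0 /= (nth_word x).
    rewrite /vv e /=; case: (nth d0 W j) => [[a [[]|]] b] //= /andP[].
    by [].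
  case: k => // j /andP[_ hj]; have hj' : j < size W by rewrite sW.
  have := hs j (ltnW hj'); rewrite (drop_nth d0 hj') /=.
  have e : kd0 j.+1 = (nth d0 W j).1.2 by rewrite /kd0 /= (nth_word x).
  rewrite /scan_ok /vv e /=; case: (nth d0 W j) => [[a [[]|]] b] //= /andP[-> _].
  by [].
pose hv i k := if i == V.+1 then acc k else x i.-1.
(* The trigger seen at row [i] and column [k] started in column [k - i] of row 0. *)
pose ic i k : icolor := (i == V.+1, hv i k, vv k, tr0 (k - i), tr0 (k.-1 - i)).
exists (fun i k => if (0 < i < gm) && (0 < k < gn) then cI (ic i k) else border i k).
have hcr i k : 0 < i < gm -> 0 < k < gn -> crossing_ok (ic i k).
  move=> hi hk; rewrite /crossing_ok /ic; case E: (tr0 (k - i)) => [s|] //.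
  rewrite /vv; case E2: (kd0 k) => [[]|] //; rewrite /hv.
  case: eqP => //= ne; apply/eqP.
  have lt : i < k by move: E; case: ltnP => // h; have -> : k - i = 0 by lia.
  have := @trigger_literal V x ps (k - i).-1 k.-1 s pieces_vars.
  rewrite -/W => -> //.
  - by rewrite addbK; congr x; lia.
  - by move: hi; rewrite /gm; lia.
  - by move: E; rewrite /tr0; case: (k - i) => //= j; rewrite (nth_word x).
  - by move: E2; rewrite /kd0 (nth_word x).
have hkd k : kind_ok (kd0 k) (vv k) by rewrite /vv; case: (kd0 k) => [[]|].
split.
- move=> i k hi hk; rewrite /edge_pos => he.
  have -> : (0 < i < gm) && (0 < k < gn) = false by move: he; lia.
  by [].
- move=> i k hi hk; have [k0|k0] := posnP k.
    by rewrite k0 !andbF /border /=.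
  have hk' : (0 < k < gn) by rewrite k0.
  rewrite hk /= !andbT hi andbT.
  have nk : (k == gn) = false by lia.
  have nk0 : (k == 0) = false by lia.
  have [i0|i0] := posnP i.
    rewrite i0 [1 < gm]/= /border nk nk0 eqxx.
    by apply/and3P; split; [exact: hcr | apply/eqP; congr tr0; lia | exact: hkd].
  have [lt|ge] := ltnP i.+1 gm; last by rewrite /border nk nk0.
  apply/and3P; split; [by apply: hcr; lia | apply/eqP; congr tr0; lia | exact: eqxx].
- move=> i k hi hk; have [i0|i0] := posnP i.
    rewrite i0 /= /border; have [k0|k0] := posnP k.
      rewrite k0 /=; case: (1 == gn) => //=.
    have -> : (k == gn) = false by lia.
    by rewrite /=; case: (k.+1 == gn) => //=.
  rewrite hi /=; have [lt|ge] := ltnP k.+1 gn; last first.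
    have -> : k.+1 = gn by lia.
    rewrite /border eqxx; have [k0|k0] := posnP k; first by rewrite k0.
    by rewrite leqnn.
  have [k0|k0] := posnP k.
    rewrite k0 /border /= /cI /=; rewrite eqxx /=; apply/implyP => /eqP e.
    by rewrite /hv e eqxx; apply: (hacc 1); move: lt; rewrite k0 /gn; lia.
  rewrite hk; apply/and3P; split; [by apply/eqP | by apply/eqP | rewrite /row_ok /hv].
  case: (i == V.+1); last exact: eqxx.
  by apply: (hacc k.+1); move: lt; rewrite /gn; lia.
Qed.

Lemma colorable_sat : colorable Rh Rv gm gn border -> exists x, satisfies x F.
Proof.
move=> [col [hb hv hh]].
have Bk k : 0 < k < gn -> col 0 k = cB (tr0 k, tr0 k.-1, kd0 k).
  move=> hk; rewrite hb //; [|lia|by rewrite /edge_pos; lia].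
  rewrite /border; have -> : (k == 0) = false by lia.
  by have -> : (k == gn) = false by lia.
have Lk i : i < gm -> col i 0 = cL (i == V.+1).
  move=> hi; rewrite hb //; first by lia.
  by rewrite /edge_pos hi /= orbT.
have Ik i k : 0 < i < gm -> 0 < k < gn -> exists c, col i k = cI c.
  move=> hi hk; have := hv i k (ltac:(lia)) (ltac:(lia)); have := hh i k (ltac:(lia)) (ltac:(lia)).
  have := hv i.-1 k (ltac:(lia)) (ltac:(lia)); have := hh i k.-1 (ltac:(lia)) (ltac:(lia)).
  rewrite !prednK; try lia.
  case: (col i k) => [c|[b|[l|[]]]]; first by exists c.
  + by case: (col i.-1 k) => [?|[[[? ?] ?]|[?|[]]]].
  + by case: (col i k.-1) => [[[[[? ?] ?] ?] ?]|[[[? ?] ?]|[?|[]]]].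
  + by case: (col i.+1 k) => [?|[?|[?|[]]]].
  + by case: (col i k.+1) => [[[[[? ?] ?] ?] ?]|[[[? ?] ?]|[?|[]]]].
pose ic i k : icolor := if col i k is inl c then c else (false, false, None, None, None).
have hic i k : 0 < i < gm -> 0 < k < gn -> col i k = inl (ic i k).
  by move=> hi hk; have [c e] := Ik i k hi hk; rewrite /ic e.
pose ck i k := (ic i k).1.1.1.1; pose h i k := (ic i k).1.1.1.2.
pose vv i k := (ic i k).1.1.2; pose tr i k := (ic i k).1.2; pose tl i k := (ic i k).2.
have icE i k : ic i k = (ck i k, h i k, vv i k, tr i k, tl i k).
  by rewrite /ck /h /vv /tr /tl; case: (ic i k) => [[[[? ?] ?] ?] ?].
have V1 k : 0 < k < gn -> [/\ crossing_ok (ic 1 k), tr 1 k = tr0 k.-1 & kind_ok (kd0 k) (vv 1 k)].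
  move=> hk; have := hv 0 k (ltac:(by [])) (ltac:(lia)); rewrite Bk // hic // /Rv /cB.
  by case/and3P => ? /eqP ? ?.
have VS i k : 0 < i -> i.+1 < gm -> 0 < k < gn ->
    [/\ crossing_ok (ic i.+1 k), tr i.+1 k = tl i k & vv i.+1 k = vv i k].
  move=> hi hi' hk; have := hv i k (ltac:(lia)) (ltac:(lia)); rewrite !hic //; try lia.
  by case/and3P => ? /eqP ? /eqP ?.
have H1 i : 0 < i < gm -> 1 < gn -> [/\ ck i 1 = (i == V.+1), tl i 1 = None &
     (i == V.+1) ==> scan_ok false (vv i 1) (h i 1)].
  move=> hi hg; have := hh i 0 (ltac:(lia)) (ltac:(lia)); rewrite Lk; last by lia.
  rewrite hic // icE /= => /and3P[/eqP <- /eqP -> ?].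
  by [].
have HS i k : 0 < i < gm -> 0 < k -> k.+1 < gn -> [/\ ck i k.+1 = ck i k, tl i k.+1 = tr i k &
     row_ok (ck i k) (h i k) (vv i k.+1) (h i k.+1)].
  move=> hi hk hk'; have := hh i k (ltac:(lia)) (ltac:(lia)); rewrite !hic //; try lia.
  by rewrite !icE /= => /and3P[/eqP -> /eqP -> ?].
have hck i k : 0 < i < gm -> 0 < k < gn -> ck i k = (i == V.+1).
  move=> hi; elim: k => // k IH hk; have [k0|k0] := posnP k.
    by rewrite k0; case: (H1 i hi (ltac:(lia))).
  by have [-> _ _] := HS i k hi k0 (ltac:(lia)); apply: IH; lia.
have htl i k : 0 < i < gm -> 0 < k < gn -> tl i k = if k == 1 then None else tr i k.-1.
  move=> hi hk; case: k hk => // -[|k] hk; first by case: (H1 i hi (ltac:(lia))).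
  by case: (HS i k.+1 hi (ltac:(lia)) (ltac:(lia))).
have htr i k : 0 < i < gm -> 0 < k < gn -> tr i k = tr0 (k - i).
  elim: i k => // i IH k hi hk; have [i0|i0] := posnP i.
    by rewrite i0; have [_ -> _] := V1 k hk; congr tr0; lia.
  have [_ -> _] := VS i k i0 (ltac:(lia)) hk; rewrite htl //; last by lia.
  case: eqP => k1; first by have -> : k - i.+1 = 0 by lia.
  by rewrite IH; [congr tr0; lia | lia | lia].
have hvv i k : 0 < i < gm -> 0 < k < gn -> vv i k = vv 1 k.
  elim: i => // i IH hi hk; have [->//|i0] := posnP i.
  by have [_ _ ->] := VS i k i0 (ltac:(lia)) hk; apply: IH; lia.
have hcr i k : 0 < i < gm -> 0 < k < gn -> crossing_ok (ic i k).
  case: i => // -[|i] hi hk; first by case: (V1 k hk).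
  by case: (VS i.+1 k (ltac:(lia)) (ltac:(lia)) hk).
(* The assignment is read at the first inner column; the value is constant along each variable
   row. *)
pose x v := h v.+1 1; exists x.
have hrow i k : 0 < i <= V -> 0 < k < gn -> h i k = x i.-1.
  move=> hi; elim: k => // k IH hk; have [k0|k0] := posnP k.
    by rewrite k0 /x prednK //; lia.
  have [_ _] := HS i k (ltac:(rewrite /gm; lia)) k0 (ltac:(lia)).
  rewrite hck; [|by rewrite /gm; lia|lia].
  have -> : (i == V.+1) = false by lia.
  by move=> /eqP ->; apply: IH; lia.
pose W := word_of V x ps.
have sW : size W = size word by rewrite -(word_unzip x) size_map.
(* A literal column meets its own trigger in the row of its variable, and there the crossing
   condition fixes the value it carries. *)
have hval k : 0 < k < gn -> kd0 k = Some true -> vv 1 k = Some (Some (nth d0 W k.-1).2).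
  move=> hk kd; have [_ _] := V1 k hk; rewrite kd; case E: (vv 1 k) => [[b|]|] // _.
  have kd' : (nth d0 W k.-1).1.2 = Some true by move: kd; rewrite /kd0 (nth_word x).
  have [v [s [h1 h2 h3 ->]]] := own_trigger pieces_vars kd'.
  have hi : 0 < v.+1 < gm by rewrite /gm; lia.
  have := hcr v.+1 k hi hk; rewrite icE /crossing_ok htr // hvv // E.
  have -> : tr0 (k - v.+1) = Some s.
    have -> : k - v.+1 = (k.-1 - v.+1).+1 by lia.
    by rewrite /= (nth_word x).
  rewrite hck //; have -> /= : (v.+1 == V.+1) = false by lia.
  by rewrite hrow // => /eqP ->; rewrite addbK.
have hm : 0 < V.+1 < gm by rewrite /gm; lia.
have e k : 0 < k < gn -> kd0 k = (nth d0 W k.-1).1.2 by rewrite /kd0 (nth_word x).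
pose acc k := if k == 0 then false else h V.+1 k.
have hacc k : k.+1 < gn -> scan_ok (acc k) (vv 1 k.+1) (acc k.+1).
  move=> hk; rewrite /acc /=; have [k0|k0] := posnP k.
    have [_ _] := H1 V.+1 hm (ltac:(lia)); rewrite eqxx k0 /= hvv //; lia.
  have [_ _] := HS V.+1 k hm k0 hk; rewrite hck //; last by lia.
  by rewrite eqxx /row_ok hvv //; lia.
rewrite -(scan_pieces V) -/ps -/W -[W]drop0.
have -> : false = acc 0 by [].
(* Induction on the length [d] of the suffix still to be scanned, from the end of the word
   backwards. *)
suff H d : d <= size W -> scan_word (acc (size W - d)) (drop (size W - d) W).
  by have := H _ (leqnn _); rewrite subnn.
elim: d => [|d IH] hd; first by rewrite subn0 drop_size.
set j := size W - d.+1; have hj : j < size W by rewrite /j; lia.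
have ej : size W - d = j.+1 by rewrite /j; lia.
have := IH (ltnW hd); rewrite ej (drop_nth d0 hj) /=.
have := hacc j (ltac:(rewrite /gn; lia)); have [_ _] := V1 j.+1 (ltac:(rewrite /gn; lia)).
have := hval j.+1 (ltac:(rewrite /gn; lia)); rewrite (e j.+1) /=; last by rewrite /gn; lia.
case: (nth d0 W j) => [[a [[]|]] b] /=.
- by move=> /(_ erefl) -> _ /= /eqP ->.
- by case: (vv 1 j.+1) => [[]|] // _ _ /= /andP[-> /negbTE ->].
- by case: (vv 1 j.+1) => [[]|] // _ _ /= /eqP ->.
Qed.

End Sat.

(** * The Cook-Levin formula *)

Section CookLevin.
Variables (M : tm) (w : seq (symb M)) (T : nat).
Local Notation Q := (state M).
Local Notation S := (symb M).
Local Notation K := 'I_(ntapes M).+1.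
Local Notation rd := {ffun K -> S}.
Local Notation ac := (Q * {ffun K -> S * move})%type.
(* a pair of state and scanned symbols, with the chosen transition, or [None]
   once the machine has halted in an accepting state *)
Definition choice_of : finType := (Q * rd * option ac)%type.
Local Notation U := choice_of.

Definition valid_choice (u : U) : bool :=
  if u.2 is Some y then y \in delta u.1.1 u.1.2
  else (delta u.1.1 u.1.2 == finset.set0) && (u.1.1 \in accept M).

Definition effect (u : U) : ac :=
  if u.2 is Some y then y else (u.1.1, [ffun j => (u.1.2 j, Stay)]).

(** [nC t o j s] says that at time [t] tape [j] has the symbol [s] at offset [o] from the head,
    where offset [B] is the head itself. The tape moves under a fixed head, so no variables for head
    positions are needed and all times have the same clauses. *)
Variables (nS : nat -> Q -> nat) (nU : nat -> U -> nat)
  (nC : nat -> nat -> K -> S -> nat).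

Local Notation B := T.+1.

Definition pos (v : nat) : literal := (v, false).
Definition neg (v : nat) : literal := (v, true).

Definition init_cell (j : K) (o : nat) : S :=
  if j == ord0 then if o < B then blank M else nth (blank M) w (o - B)
  else blank M.

Definition shift (mv : move) (o : nat) : nat :=
  match mv with MoveL => o.+1 | MoveR => o.-1 | Stay => o end.

Definition offsets : seq nat := iota 0 (2 * B).+1.

Lemma mem_offsets o : (o \in offsets) = (o <= 2 * B).
Proof. by rewrite mem_iota add0n ltnS. Qed.

Local Opaque offsets.

Definition F_init : cnf :=
  [:: [:: pos (nS 0 (start M))]] ++ flatten [seq [seq [:: pos (nC 0 o j (init_cell j o))] | o <- offsets]
          | j <- enum K].

Definition F_choose (t : nat) : cnf :=
  [:: [seq pos (nU t u) | u <- [seq u <- enum U | valid_choice u]]].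

(** The choice [None] makes the machine idle in an accepting halting configuration, so a shorter
    computation can be prolonged to time [T]. *)
Definition F_last : cnf :=
  [:: [seq pos (nU T u) | u <- [seq u <- enum U | valid_choice u && (u.2 == None)]]].

Definition F_read (t : nat) : cnf :=
  flatten [seq [:: neg (nU t u); pos (nS t u.1.1)] ::
     [seq [:: neg (nU t u); pos (nC t B j (u.1.2 j))] | j <- enum K] | u <- enum U].

(** Uniqueness is imposed where a transition reads: on the state and on the cells under the
    heads. *)
Definition F_unique (t : nat) : cnf :=
  [seq [:: neg (nS t p.1); neg (nS t p.2)] | p <- [seq p <- enum {: Q * Q} | p.1 != p.2]] ++
  flatten [seq [seq [:: neg (nC t B j p.1); neg (nC t B j p.2)]
          | p <- [seq p <- enum {: S * S} | p.1 != p.2]] | j <- enum K].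

(** The tautological clause stands for the offset [B], whose new content is prescribed by the
    preceding clause, and for the two ends of the window, whose content may be shifted out of it. It
    keeps the clauses one map over all offsets. *)
Definition F_move (t : nat) : cnf :=
  flatten [seq [:: neg (nU t u); pos (nS t.+1 (effect u).1)] ::
    flatten [seq [:: neg (nU t u);
        pos (nC t.+1 (shift ((effect u).2 j).2 B) j ((effect u).2 j).1)] ::
      flatten [seq [seq
           if (o == B) || (o == 0) || (o == 2 * B) then [:: neg (nU t u); pos (nU t u)]
           else [:: neg (nU t u); neg (nC t o j x);
                    pos (nC t.+1 (shift ((effect u).2 j).2 o) j x)]
         | o <- offsets] | x <- enum S] | j <- enum K] | u <- enum U].

Definition formula : cnf :=
  F_init ++ F_last ++
  flatten [seq F_choose t ++ F_read t ++ F_unique t | t <- iota 0 T.+1] ++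
  flatten [seq F_move t | t <- iota 0 T].

(** The left part of a tape is listed from the head outwards, so the offset just before [B], which
    is [T], has index 0. *)
Definition cell (tp : tape M) (o : nat) : S :=
  if o < B then nth (blank M) tp.1 (T - o) else nth (blank M) tp.2 (o - B).

Lemma cell_head tp : cell tp B = scan tp.
Proof. by rewrite /cell ltnn subnn /scan; case: tp.2. Qed.

Lemma cell_write tp a : cell (update tp a) (shift a.2 B) = a.1.
Proof.
case: tp a => l r [b []] /=; rewrite /cell.
- by rewrite ltnNge leqnSn /= subSnn.
- by rewrite ltnSn subnn.
- by rewrite ltnn subnn.
Qed.

Lemma cell_keep tp a o : o != B -> 0 < o < 2 * B ->
  cell (update tp a) (shift a.2 o) = cell tp o.
Proof.
case: tp a => l r [b mv] hB ho; rewrite /cell /update /=.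
have [lt|ge] := ltnP o B.
  case: mv => /=.
  - have [lt2|ge2] := ltnP o.+1 B.
      by rewrite nth_behead; congr nth; lia.
    have -> : o.+1 - B = 0 by lia.
    by rewrite /=; have -> : T - o = 0 by lia; case: l.
  - have -> : o.-1 < B by lia.
    by have -> : T - o.-1 = (T - o).+1 by lia.
  - by rewrite lt.
case: mv => /=.
- have -> : o.+1 < B = false by lia.
  have -> : o.+1 - B = (o - B.+1).+2 by lia.
  have -> : o - B = (o - B.+1).+1 by lia.
  by rewrite /= nth_behead.
- have -> : o.-1 < B = false by lia.
  have -> : o - B = (o.-1 - B).+1 by lia.
  by rewrite nth_behead.
- have -> : o < B = false by lia.
  have -> : o - B = (o - B.+1).+1 by lia.
  by rewrite /= nth_behead.
Qed.

Lemma cell_init j o : cell ((init w).2 j) o = init_cell j o.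
Proof.
rewrite /cell /init /init_cell /=; case: eqP => _ /=; rewrite ?nth_nil //.
by case: ltnP.
Qed.

Lemma satisfies_cat x F G : satisfies x (F ++ G) = satisfies x F && satisfies x G.
Proof. exact: all_cat. Qed.

Lemma satisfies_flatten (I : eqType) x (s : seq I) (f : I -> cnf) :
  satisfies x (flatten (map f s)) <-> {in s, forall i, satisfies x (f i)}.
Proof.
elim: s => [|i s IH] /=; first by split.
rewrite satisfies_cat; split=> [/andP[h /IH h'] k|h].
  by rewrite inE => /orP[/eqP ->|/h'].
rewrite h ?mem_head //=; apply/IH => k hk; apply: h; by rewrite inE hk orbT.
Qed.

Lemma satisfies_map (I : eqType) x (s : seq I) (f : I -> seq literal) :
  satisfies x (map f s) <-> {in s, forall i, has (lit_true x) (f i)}.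
Proof. by rewrite /satisfies all_map; split=> [/allP|h]; [|apply/allP]. Qed.

Lemma shift_back mv t o' : t.+1 < o' -> o' + t.+1 < 2 * B ->
  exists o, [/\ o' = shift mv o, t < o, o + t < 2 * B & 0 < o < 2 * B].
Proof.
move=> h1 h2; exists (match mv with MoveL => o'.-1 | MoveR => o'.+1 | Stay => o' end).
by case: mv; split=> /=; lia.
Qed.

Lemma inner_offset o : 0 < o < 2 * B ->
  [/\ (o == 0) = false, (o == 2 * B) = false & o <= 2 * B].
Proof. by move=> h; split; lia. Qed.

Lemma head_offset t : t <= T -> t < B /\ B + t < 2 * B.
Proof. by lia. Qed.

(** Following the true choice variables rebuilds a computation. It may meet an accepting halt before
    time [T], which is the first alternative of [main]. *)
Lemma formula_sound x : satisfies x formula -> exists n c,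
  [/\ steps n (init w) c, halted c & c.1 \in accept M].
Proof.
rewrite /formula 3!satisfies_cat => /and4P[]; rewrite satisfies_cat => /andP[hs0].
have {}hs0 : x (nS 0 (start M)) by move: hs0; rewrite /= /lit_true /= orbF addbF andbT.
move=> /satisfies_flatten hc0 hlast /satisfies_flatten ht /satisfies_flatten hm.
have hgen t : t <= T -> [/\ satisfies x (F_choose t), satisfies x (F_read t)
    & satisfies x (F_unique t)].
  move=> h; have := ht t; rewrite mem_iota leq0n add0n ltnS => /(_ h).
  by rewrite satisfies_cat => /andP[h1]; rewrite satisfies_cat => /andP[h2 h3].
(* Nothing is known outside the window, so the reliable part loses one offset at each end with every
   step. At time [T] it still contains the head. *)
pose good t (c : config M) := x (nS t c.1) /\
  forall j o, t < o -> o + t < 2 * B -> x (nC t o j (cell (c.2 j) o)).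
have main t : t <= T -> (exists n c, [/\ steps n (init w) c, halted c & c.1 \in accept M]) \/
    exists c, steps t (init w) c /\ good t c.
  elim: t => [_|t IH hT].
    right; exists (init w); split=> //; split=> // j o _ ho; rewrite cell_init.
    have /satisfies_map := hc0 j (mem_enum _ _).
    by move=> /(_ o); rewrite mem_offsets /lit_true /= orbF addbF; apply; rewrite addn0 in ho; exact: ltnW.
  have [?|[c [hst [g1 g2]]]] := IH (ltnW hT); first by left.
  have [h1 h2 h3] := hgen t (ltnW hT).
  have [u hv hu] : exists2 u, valid_choice u & x (nU t u).
    move: h1; rewrite /F_choose /= andbT has_map => /hasP[u].
    by rewrite mem_filter => /andP[hv _]; rewrite /= /lit_true /= addbF; exists u.
  have eu : u.1 = (c.1, reads c).
    move: h2 => /satisfies_flatten/(_ u (mem_enum _ _)) /=.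
    rewrite /lit_true /= hu !addbF /= orbF => /andP[hq /satisfies_map hr].
    move: h3; rewrite satisfies_cat => /andP[/satisfies_map uq /satisfies_flatten ur].
    have e1 : u.1.1 = c.1.
      apply/eqP; apply: contraT => ne.
      have := uq (u.1.1, c.1); rewrite mem_filter /= ne mem_enum /lit_true /= hq g1.
      by move=> /(_ isT).
    have e2 : u.1.2 = reads c.
      apply/ffunP => j; rewrite ffunE -cell_head.
      apply/eqP; apply: contraT => ne.
      have := hr j (mem_enum _ _); rewrite /= /lit_true /= hu /= orbF addbF => hr'.
      have [b1 b2] := head_offset (ltnW hT); have gB := g2 j B b1 b2.
      have /satisfies_map := ur j (mem_enum _ _).
      move=> /(_ (u.1.2 j, cell (c.2 j) B)); rewrite mem_filter /= ne mem_enum.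
      by rewrite /lit_true /= hr' gB => /(_ isT).
    by case: (u.1) e1 e2 => /= ? ? -> ->.
  case: u hv hu eu => u [y|] hv hu /= eu; last first.
    left; exists t, c; split=> //; move: hv; rewrite /valid_choice /= eu /= => /andP[/eqP h hacc] //.
  right; pose c' : config M := (y.1, fun j => update (c.2 j) (y.2 j)).
  have hstep : step c c'.
    exists y.2 => //=; move: hv; rewrite /valid_choice /= eu /=.
    by case: (y).
  exists c'; split.
    have {}hst := hst; have snoc : forall n (a b d : config M), steps n a b -> step b d -> steps n.+1 a d.
      elim=> [|n IHn] a b d /=; first by move=> -> ?; exists d.
      by move=> [e he hn] hd; exists e => //; apply: IHn hd.
    exact: snoc hst hstep.
  have := hm t; rewrite mem_iota => /(_ hT) /satisfies_flatten/(_ (u, Some y) (mem_enum _ _)) /=.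
  rewrite {1 2}/lit_true /= hu addbF orbF => /andP[hS /satisfies_flatten hC]; split=> //.
  move=> j o' h1' h2'; have := hC j (mem_enum _ _) => /= /andP[].
  rewrite /lit_true /= hu !addbF /= orbF => hw /satisfies_flatten hk.
  have [o [eo ho1 ho2 ho3]] := shift_back (y.2 j).2 h1' h2'.
  rewrite /c' /= eo; have [e|ne] := eqVneq o B; first by rewrite e cell_write.
  rewrite cell_keep //.
  have g := g2 j o ho1 ho2.
  have := hk (cell (c.2 j) o) (mem_enum _ _) => /satisfies_map/(_ o).
  rewrite mem_offsets (negbTE ne) /=.
  have [-> -> ->] := inner_offset ho3.
  by rewrite /= /lit_true /= hu g addbF orbF /=; apply.
have [//|[c [hst [g1 g2]]]] := main T (leqnn T).
have [h1 h2 h3] := hgen T (leqnn T).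
move: hlast; rewrite /F_last /= andbT has_map => /hasP[u].
rewrite mem_filter => /andP[/andP[hv /eqP hn] _]; rewrite /= /lit_true /= addbF => hu.
have eu : u.1 = (c.1, reads c).
  move: h2 => /satisfies_flatten/(_ u (mem_enum _ _)) /=.
  rewrite /lit_true /= hu !addbF /= orbF => /andP[hq /satisfies_map hr].
  move: h3; rewrite satisfies_cat => /andP[/satisfies_map uq /satisfies_flatten ur].
  have e1 : u.1.1 = c.1.
    apply/eqP; apply: contraT => ne.
    have := uq (u.1.1, c.1); rewrite mem_filter /= ne mem_enum /lit_true /= hq g1.
    by move=> /(_ isT).
  have e2 : u.1.2 = reads c.
    apply/ffunP => j; rewrite ffunE -cell_head.
    apply/eqP; apply: contraT => ne.
    have := hr j (mem_enum _ _); rewrite /= /lit_true /= hu /= orbF addbF => hr'.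
    have [b1 b2] := head_offset (leqnn T); have gB := g2 j B b1 b2.
    have /satisfies_map := ur j (mem_enum _ _).
    move=> /(_ (u.1.2 j, cell (c.2 j) B)); rewrite mem_filter /= ne mem_enum.
    by rewrite /lit_true /= hr' gB => /(_ isT).
  by case: (u.1) e1 e2 => /= ? ? -> ->.
exists T, c; split=> //; move: hv; rewrite /valid_choice hn eu /= => /andP[/eqP h hacc] //.
Qed.

Lemma steps_path n (c d : config M) : steps n c d -> exists f : nat -> config M,
  [/\ f 0 = c, f n = d & forall i, i < n -> step (f i) (f i.+1)].
Proof.
elim: n c => [|n IH] c /=; first by move=> <-; exists (fun _ => c).
case=> e hce /IH[f [f0 fn fs]]; exists (fun i => if i is j.+1 then f j else c).
by split=> // -[|i] hi; [rewrite f0 | apply: fs].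
Qed.

(** The computation is continued by repeating its last configuration up to time [T]. The numbering
    of the variables enters only through the last hypothesis, that every valuation of the three
    families is realized. *)
Lemma formula_complete n c :
  steps n (init w) c -> halted c -> c.1 \in accept M -> n <= T ->
  (forall (yS : nat -> Q -> bool) (yU : nat -> U -> bool)
    (yC : nat -> nat -> K -> S -> bool), exists x, forall t, t <= T ->
     [/\ forall q, x (nS t q) = yS t q, forall u, x (nU t u) = yU t u
       & forall o j s, o <= 2 * B -> x (nC t o j s) = yC t o j s]) ->
  exists x, satisfies x formula.
Proof.
move=> /steps_path[f [f0 fn fs]] hh ha hn hx.
have hact i : exists a, i < n -> ((f i.+1).1, a) \in delta (f i).1 (reads (f i)) /\
    forall j, (f i.+1).2 j = update ((f i).2 j) (a j).
  have [lt|ge] := ltnP i n; last by exists [ffun _ => (blank M, Stay)].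
  by have [a h1 h2] := fs i lt; exists a.
have [act hact'] := choice hact.
pose g t := f (minn t n).
pose ch t : U := ((g t).1, reads (g t), if t < n then Some ((f t.+1).1, act t) else None).
have [x hx'] := hx (fun t q => q == (g t).1) (fun t u => u == ch t)
  (fun t o j s => s == cell ((g t).2 j) o).
have gt t : t < n -> g t = f t by move=> h; rewrite /g; have -> : minn t n = t by lia.
have hvalid t : valid_choice (ch t).
  rewrite /valid_choice /ch /=; have [lt|ge] := ltnP t n.
    by rewrite gt //; have [] := hact' t lt.
  have -> : g t = c by rewrite /g -fn; congr f; lia.
  by rewrite hh eqxx ha.
have heff t : g t.+1 = ((effect (ch t)).1, fun j => update ((g t).2 j) ((effect (ch t)).2 j))
    \/ n <= t.
  rewrite /effect /ch /=; have [lt|ge] := ltnP t n; [left|by right].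
  have [h1 h2] := hact' t lt; rewrite (gt t lt).
  have -> : g t.+1 = f t.+1 by rewrite /g; congr f; lia.
  by case: (f t.+1) h2 => q tp /= h2; congr pair; apply/funext.
exists x; rewrite /formula 3!satisfies_cat; apply/and4P; split.
- have [hS hU hC] := hx' 0 (leq0n _).
  have g0 : g 0 = init w by rewrite /g min0n.
  rewrite satisfies_cat; apply/andP; split; first by rewrite /= /lit_true /= hS g0 eqxx.
  apply/satisfies_flatten => j _.
  apply/satisfies_map => o; rewrite mem_offsets => ho /=.
  by rewrite /lit_true /= hC ?g0 ?cell_init ?eqxx //; lia.
- have [hS hU hC] := hx' T (leqnn _).
  rewrite /F_last /= andbT has_map; apply/hasP; exists (ch T).
    by rewrite mem_filter hvalid mem_enum /ch /=; have -> : T < n = false by lia.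
  by rewrite /= /lit_true /= hU eqxx.
- apply/satisfies_flatten => t; rewrite mem_iota => ht.
  have [hS hU hC] := hx' t (ltac:(lia)).
  rewrite satisfies_cat; apply/andP; split; last (rewrite satisfies_cat; apply/andP; split).
  + rewrite /F_choose /= andbT has_map; apply/hasP; exists (ch t).
      by rewrite mem_filter hvalid mem_enum.
    by rewrite /= /lit_true /= hU eqxx.
  + apply/satisfies_flatten => u _ /=; rewrite /lit_true /= hU hS.
    have [->|ne] := eqVneq u (ch t); last first.
      by rewrite /=; apply/satisfies_map => j _; rewrite /= /lit_true /= hU (negbTE ne).
    rewrite /= eqxx /=; apply/satisfies_map => j _; rewrite /= /lit_true /= hC; last by lia.
    by rewrite /ch /= ffunE cell_head eqxx orbT.
  + rewrite satisfies_cat; apply/andP; split.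
      apply/satisfies_map => -[p q]; rewrite mem_filter /= => /andP[ne _].
      rewrite /lit_true /= !hS !addbT orbF -negb_and; apply/negP => /andP[/eqP e1 /eqP e2].
      by move: ne; rewrite e1 e2 eqxx.
    apply/satisfies_flatten => j _; apply/satisfies_map => -[p q]; rewrite mem_filter /= => /andP[ne _].
    rewrite /lit_true /= !hC; [|lia|lia].
    rewrite !addbT orbF -negb_and; apply/negP => /andP[/eqP e1 /eqP e2].
    by move: ne; rewrite e1 e2 eqxx.
- apply/satisfies_flatten => t; rewrite mem_iota => ht.
  have [hS hU hC] := hx' t (ltac:(lia)); have [hS' hU' hC'] := hx' t.+1 (ltac:(lia)).
  have gS : g t.+1 = ((effect (ch t)).1, (g t.+1).2).
    have [-> //|ge] := heff t; rewrite /effect /ch /=; have -> : t < n = false by lia.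
    have -> : g t.+1 = g t by rewrite /g; congr f; lia.
    by case: (g t).
  have gC j o : (o = B \/ o != B /\ 0 < o < 2 * B) -> cell ((g t.+1).2 j) (shift ((effect (ch t)).2 j).2 o) =
      if o == B then ((effect (ch t)).2 j).1 else cell ((g t).2 j) o.
    move=> ho; have [->|ge] := heff t.
      by case: ho => [->|[ne ho]] /=; [rewrite eqxx cell_write | rewrite (negbTE ne) cell_keep].
    have -> : g t.+1 = g t by rewrite /g; congr f; lia.
    rewrite /effect /ch /=; have -> /= : t < n = false by lia.
    rewrite ffunE /=; case: eqP => [->|//]; by rewrite ffunE cell_head.
  apply/satisfies_flatten => u _ /=; rewrite /lit_true /= hU hS'.
  have [->|ne] := eqVneq u (ch t); last first.
    rewrite /=; apply/satisfies_flatten => j _ /=; rewrite /lit_true /= hU (negbTE ne) /=.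
    apply/satisfies_flatten => s _; apply/satisfies_map => o _.
    by case: ifP => _; rewrite /= /lit_true /= hU (negbTE ne).
  rewrite {1}gS /= eqxx /=; apply/satisfies_flatten => j _ /=.
  have hsh o : o <= 2 * B -> 0 < o < 2 * B -> shift ((effect (ch t)).2 j).2 o <= 2 * B.
    by case: ((effect (ch t)).2 j).2 => /=; lia.
  rewrite /lit_true /= hC' ?gC ?eqxx ?orbT /=; [|by left|by apply: hsh; lia].
  apply/satisfies_flatten => s _; apply/satisfies_map => o; rewrite mem_offsets => ho.
  case: ifP => [_|/negbT ne]; rewrite /= /lit_true /= ?hU ?eqxx //.
  have hob : o != B /\ 0 < o < 2 * B by lia.
  rewrite hC; last by lia.
  rewrite hC'; last by apply: hsh; lia.
  rewrite gC; last by right.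
  by rewrite (negbTE (proj1 hob)) addbF addbT orbF; case: (s == _); rewrite ?orbT.
Qed.

End CookLevin.

(** * Arithmetic and list functions in polynomial time *)

Lemma PTF_app2 (Z E X Y : Type) (eZ : Enc Z) (eE : Enc E) (eX : Enc X) (eY : Enc Y)
    (f : E -> X -> Y) (g : Z -> E) (h : Z -> X) :
  PTF (fun p : E * X => f p.1 p.2) -> PTF g -> PTF h -> PTF (fun z => f (g z) (h z)).
Proof.
move=> hf hg hh.
exact: (PTF_comp (g := fun p : E * X => f p.1 p.2) (f := fun z => (g z, h z)) hf (PTF_pair hg hh)).
Qed.

Section Library.
Variables (E : Type) (eE : Enc E).

Lemma PTF_iter (A : Type) (eA : Enc A) (step : E -> A -> A) (n : E -> nat) (a : E -> A) q :
  PTF (fun p : E * A => step p.1 p.2) -> pbound q ->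
  (forall e x, esize (step e x) <= esize x + q (esize e)) ->
  PTF n -> PTF a -> PTF (fun e => iter (n e) (step e) (a e)).
Proof.
move=> hs hq hg hn ha.
have hn' : PTF (fun e => nseq (n e) tt).
  apply: PTF_cast hn => e; elim: (n e) => // k IH; rewrite -[LHS]/(Node Leaf (enc k)) IH //.
have hs' : PTF (fun p : E * (A * unit) => step p.1 p.2.1).
  by apply: (PTF_app2 hs); [exact: PTF_fst PTF_id | exact: PTF_fst (PTF_snd PTF_id)].
apply: PTF_ext (PTF_foldl (step := fun e a (_ : unit) => step e a) hs' _ hn' ha) => [e|].
  by elim: (n e) (a e) => //= k IH x; rewrite IH -iterSr.
case: hq => k hk; exists (fun m => (m + 2) ^ k); first by pb.
move=> e x y; apply: leq_trans (hg e x) _; rewrite leq_add2l; apply: leq_trans (hk _) _.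
by case: k {hk} => // k; rewrite leq_exp2r // leq_add2r leq_addr.
Qed.

Lemma PTF_add (f g : E -> nat) : PTF f -> PTF g -> PTF (fun e => f e + g e).
Proof.
move=> hf hg; have h : PTF (fun e => iter (f e) S (g e)).
  apply: (PTF_iter (step := fun _ => S) (q := fun=> 2)) => //.
  - by apply: PTF_S; exact: PTF_snd PTF_id.
  - by pb.
  - by move=> e x; rewrite !esize_nat; lia.
by apply: PTF_ext h => e; elim: (f e) => //= k ->.
Qed.

End Library.

Section Library2.
Variables (E : Type) (eE : Enc E).

Lemma PTF_mul (f g : E -> nat) : PTF f -> PTF g -> PTF (fun e => f e * g e).
Proof.
move=> hf hg.
have h : PTF (fun e => iter (f e) (fun a => a + g e) 0).
  have [k [hk _]] := hg.
  apply: (PTF_iter (step := fun e a => a + g e) (q := fun m => (m + 2) ^ k)) => //.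
  - apply: PTF_add; [exact: PTF_snd PTF_id | exact: PTF_comp hg (PTF_fst PTF_id)].
  - by pb.
  - move=> e x; have := hk e; rewrite !esize_nat; lia.
  - exact: PTF_const.
apply: PTF_ext h => e; elim: (f e) => //= k ->; by rewrite mulSn addnC.
Qed.

Lemma PTF_pred (f : E -> nat) : PTF f -> PTF (fun e => (f e).-1).
Proof.
move=> hf; apply: PTF_ext (PTF_natcase (c := fun p => p.2) hf (PTF_const 0) (PTF_snd PTF_id)) => e.
by case: (f e).
Qed.

Lemma PTF_sub (f g : E -> nat) : PTF f -> PTF g -> PTF (fun e => f e - g e).
Proof.
move=> hf hg.
have h : PTF (fun e => iter (g e) predn (f e)).
  apply: (PTF_iter (step := fun _ => predn) (q := fun=> 0)) => //.
  - apply: PTF_ext (PTF_natcase (f := fun p : E * nat => p.2) (c := fun p => p.2)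
      (PTF_snd PTF_id) (PTF_const 0) (PTF_snd PTF_id)) => -[e x] /=.
    by case: x.
  - by pb.
  - by move=> e x; rewrite !esize_nat; lia.
apply: PTF_ext h => e; elim: (g e) => [|k IH]; first by rewrite subn0.
by rewrite iterS IH subnS.
Qed.

Lemma PTF_leq (f g : E -> nat) : PTF f -> PTF g -> PTF (fun e => f e <= g e).
Proof. by move=> hf hg; apply: PTF_eq; [exact: PTF_sub | exact: PTF_const]. Qed.

Lemma PTF_negb (f : E -> bool) : PTF f -> PTF (fun e => ~~ f e).
Proof. by move=> hf; apply: PTF_ext (PTF_if hf (PTF_const false) (PTF_const true)) => e; case: (f e). Qed.

Lemma PTF_andb (f g : E -> bool) : PTF f -> PTF g -> PTF (fun e => f e && g e).
Proof. by move=> hf hg; exact: PTF_if hf hg (PTF_const false). Qed.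

Lemma PTF_orb (f g : E -> bool) : PTF f -> PTF g -> PTF (fun e => f e || g e).
Proof. by move=> hf hg; exact: PTF_if hf (PTF_const true) hg. Qed.

Lemma PTF_divmod (d : nat) (f : E -> nat) : PTF f -> PTF (fun e => (f e %/ d.+1, f e %% d.+1)).
Proof.
move=> hf; pose step (p : nat * nat) := if p.2 == d then (p.1.+1, 0) else (p.1, p.2.+1).
have h : PTF (fun e => iter (f e) step (0, 0)).
  apply: (PTF_iter (step := fun _ => step) (q := fun=> 2)) => //.
  - rewrite /step; apply: PTF_if.
    + by apply: PTF_eq; [exact: PTF_snd (PTF_snd PTF_id) | exact: PTF_const].
    + apply: PTF_pair; [|exact: PTF_const]; apply: PTF_S; exact: PTF_fst (PTF_snd PTF_id).
    + apply: PTF_pair; [exact: PTF_fst (PTF_snd PTF_id) |].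
      by apply: PTF_S; exact: PTF_snd (PTF_snd PTF_id).
  - by pb.
  - by move=> e [a b]; rewrite /step /=; case: eqP => _; rewrite !esize_pair !esize_nat; lia.
  - exact: PTF_const.
apply: PTF_ext h => e; elim: (f e) => [|k IH]; first by rewrite div0n mod0n.
rewrite iterS IH /step /=; have := ltn_pmod k (ltn0Sn d); have := divn_eq k d.+1.
set a := k %/ d.+1; set b := k %% d.+1 => e1 lt; case: eqP => [bd|nd].
  have -> : k.+1 = a.+1 * d.+1 + 0 by rewrite e1 bd; lia.
  by rewrite divnMDl // modnMDl div0n mod0n addn0.
have hb : b.+1 < d.+1 by lia.
have -> : k.+1 = a * d.+1 + b.+1 by rewrite {1}e1; lia.
by rewrite divnMDl // modnMDl divn_small // modn_small // addn0.
Qed.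

Lemma PTF_div (d : nat) (f : E -> nat) : PTF f -> PTF (fun e => f e %/ d.+1).
Proof. by move=> /(PTF_divmod d)/PTF_fst. Qed.

Lemma PTF_mod (d : nat) (f : E -> nat) : PTF f -> PTF (fun e => f e %% d.+1).
Proof. by move=> /(PTF_divmod d)/PTF_snd. Qed.

Lemma PTF_odd (f : E -> nat) : PTF f -> PTF (fun e => odd (f e)).
Proof.
move=> hf; apply: PTF_ext (PTF_eq (PTF_mod 1 hf) (PTF_const 1)) => e.
by rewrite modn2; case: (odd _).
Qed.

Section Lists.
Variables (X Y : Type) (eX : Enc X) (eY : Enc Y).

Lemma PTF_revl (f : E -> seq X) : PTF f -> PTF (fun e => rev (f e)).
Proof. by move=> hf; apply: (PTF_comp (g := fun s : seq X => rev s)) hf; exact: PTF_rev. Qed.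

Lemma PTF_catrev (f g : E -> seq X) : PTF f -> PTF g -> PTF (fun e => catrev (f e) (g e)).
Proof.
move=> hf hg.
apply: PTF_ext (PTF_foldl (step := fun (_ : E) (a : seq X) x => x :: a) _ _ hf hg) => [e||].
- by elim: (f e) (g e) => //= x s IH t; rewrite IH.
- by apply: PTF_cons; [exact: PTF_snd (PTF_snd PTF_id) | exact: PTF_fst (PTF_snd PTF_id)].
- by exists (fun m => m + 1); [pb | move=> e a x; rewrite esize_cons; lia].
Qed.

Lemma PTF_cat (f g : E -> seq X) : PTF f -> PTF g -> PTF (fun e => f e ++ g e).
Proof.
move=> hf hg; apply: PTF_ext (PTF_catrev (PTF_revl hf) hg) => e.
by rewrite catrevE revK.
Qed.

Lemma PTF_size (f : E -> seq X) : PTF f -> PTF (fun e => size (f e)).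
Proof.
move=> hf.
apply: PTF_ext (PTF_foldl (step := fun (_ : E) (a : nat) (_ : X) => a.+1) _ _ hf (PTF_const 0)) => [e||].
- by rewrite -[RHS]addn0; elim: (f e) 0 => //= x s IH t; rewrite IH addnS.
- by apply: PTF_S; exact: PTF_fst (PTF_snd PTF_id).
- by exists (fun=> 2); [pb | move=> e a x; rewrite !esize_nat; lia].
Qed.

Lemma PTF_flatmap (f : E -> X -> seq Y) (l : E -> seq X) :
  PTF (fun p : E * X => f p.1 p.2) -> PTF l -> PTF (fun e => flatten [seq f e x | x <- l e]).
Proof.
move=> hf hl; have [k [hk _]] := hf.
have h4 : PTF (fun p : seq Y * seq Y => catrev p.1 p.2).
  apply: PTF_ext (PTF_foldl (E := (seq Y * seq Y)%type)
    (step := fun _ (a : seq Y) y => y :: a) _ _ (PTF_fst PTF_id) (PTF_snd PTF_id)) => [[s t]||].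
  - by elim: s t => //= x s IH t; rewrite IH.
  - by apply: PTF_cons; [exact: PTF_snd (PTF_snd PTF_id) | exact: PTF_fst (PTF_snd PTF_id)].
  - by exists (fun m => m + 1); [pb | move=> e a x; rewrite esize_cons; lia].
have h : PTF (fun e => foldl (fun a x => catrev (f e x) a) [::] (l e)).
  apply: (PTF_foldl (step := fun e a x => catrev (f e x) a)) => //; last exact: PTF_const.
    have h1 : PTF (fun p : E * (seq Y * X) => f p.1 p.2.2).
      by apply: (PTF_app2 hf); [exact: PTF_fst PTF_id | exact: PTF_snd (PTF_snd PTF_id)].
    by apply: (PTF_app2 h4 h1); exact: PTF_fst (PTF_snd PTF_id).
  exists (fun m => (m + 3) ^ k); first by pb.
  move=> e a x; rewrite catrevE; have := @esize_rev Y eY (f e x); have := @esize_cat Y eY (rev (f e x)) a.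
  have := hk (e, x); rewrite esize_pair /=.
  have -> : (esize e + esize x).+1 + 2 = esize e + esize x + 3 by lia.
  by move: ((_ + 3) ^ k) => u; have := @esize_gt0 _ _ a; lia.
have h5 : PTF (fun s : seq Y => rev s) by exact: PTF_rev.
apply: PTF_ext (PTF_comp h5 h) => e.
suff H s : foldl (fun a x => catrev (f e x) a) s (l e) = rev (flatten [seq f e x | x <- l e]) ++ s.
  by rewrite H cats0 revK.
by elim: (l e) s => //= x t IH s; rewrite IH catrevE rev_cat -catA.
Qed.

Lemma PTF_map (f : E -> X -> Y) (l : E -> seq X) :
  PTF (fun p : E * X => f p.1 p.2) -> PTF l -> PTF (fun e => [seq f e x | x <- l e]).
Proof.
move=> hf hl; apply: PTF_ext (PTF_flatmap (f := fun e x => [:: f e x]) _ hl) => [e|].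
  by elim: (l e) => //= x s ->.
by apply: PTF_cons => //; exact: PTF_const.
Qed.

Lemma PTF_has (P : E -> X -> bool) (l : E -> seq X) :
  PTF (fun p : E * X => P p.1 p.2) -> PTF l -> PTF (fun e => has (P e) (l e)).
Proof.
move=> hP hl.
apply: PTF_ext (PTF_foldl (step := fun e (b : bool) x => b || P e x) _ _ hl (PTF_const false)) => [e||].
- by rewrite -[RHS]orbF orbC; elim: (l e) false => [|x s IH] b /=; rewrite ?orbF // IH orbA.
- apply: PTF_if; [exact: PTF_fst (PTF_snd PTF_id) | exact: PTF_const |].
  by apply: (PTF_app2 hP); [exact: PTF_fst PTF_id | exact: PTF_snd (PTF_snd PTF_id)].
- exists (fun=> esize true + esize false); first by pb.
  by move=> e a x; case: (_ || _); lia.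
Qed.

Lemma PTF_all (P : E -> X -> bool) (l : E -> seq X) :
  PTF (fun p : E * X => P p.1 p.2) -> PTF l -> PTF (fun e => all (P e) (l e)).
Proof.
move=> hP hl; apply: PTF_ext (PTF_negb (PTF_has (P := fun e x => ~~ P e x) _ hl)) => [e|].
  by rewrite -all_predC; apply: eq_all => x /=; rewrite negbK.
by apply: PTF_ext (PTF_if hP (PTF_const false) (PTF_const true)) => p; case: (P _ _).
Qed.

Lemma PTF_nth (d : E -> X) (l : E -> seq X) (i : E -> nat) :
  PTF d -> PTF l -> PTF i -> PTF (fun e => nth (d e) (l e) (i e)).
Proof.
move=> hd hl hi.
have h : PTF (fun e => iter (i e) behead (l e)).
  apply: (PTF_iter (step := fun _ => behead) (q := fun=> 0)) => //.
  - apply: PTF_ext (PTF_seqcase (l := fun p : E * seq X => p.2) (c := fun p => p.2.2)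
      (PTF_snd PTF_id) (PTF_const [::]) (PTF_snd (PTF_snd PTF_id))) => -[e s] /=.
    by case: s.
  - by pb.
  - by move=> e [|x s] //; rewrite [behead _]/= esize_cons; lia.
apply: PTF_ext (PTF_seqcase (c := fun p => p.2.1) h hd (PTF_fst (PTF_snd PTF_id))) => e.
have -> : iter (i e) behead (l e) = drop (i e) (l e).
  elim: (i e) (l e) => [|k IH] s; first by rewrite drop0.
  by rewrite iterSr IH; case: s => //; case: k {IH}.
by rewrite -[i e in RHS]addn0 -nth_drop; case: (drop _ _).
Qed.

End Lists.

Lemma PTF_iota (f g : E -> nat) : PTF f -> PTF g -> PTF (fun e => iota (f e) (g e)).
Proof.
move=> hf hg; have [k [hk _]] := PTF_pair hf hg.
(* The list is built from its end; its current size serves as the counter. *)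
have h : PTF (fun e => iter (g e) (fun s => (f e + (g e - (size s).+1)) :: s) [::]).
  apply: (PTF_iter (step := fun e s => (f e + (g e - (size s).+1)) :: s)
    (q := fun m => 2 * (m + 2) ^ k + 2)) => //; last exact: PTF_const.
  - have c1 : PTF (fun p : E * seq nat => f p.1) by exact: PTF_comp hf (PTF_fst PTF_id).
    have c2 : PTF (fun p : E * seq nat => g p.1) by exact: PTF_comp hg (PTF_fst PTF_id).
    have c3 : PTF (fun p : E * seq nat => (size p.2).+1).
      apply: PTF_S; apply: (PTF_comp (g := fun s : seq nat => size s)); last exact: PTF_snd PTF_id.
      apply: PTF_ext (PTF_foldl (E := seq nat) (step := fun _ (a : nat) (_ : nat) => a.+1) _ _ PTF_id (PTF_const 0)) => [s||].
      + by rewrite -[RHS]addn0; elim: s 0 => //= x s IH t; rewrite IH addnS.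
      + by apply: PTF_S; exact: PTF_fst (PTF_snd PTF_id).
      + by exists (fun=> 2); [pb | move=> e a x; rewrite !esize_nat; lia].
    apply: PTF_cons; last exact: PTF_snd PTF_id.
    apply: (PTF_add c1); apply: (PTF_comp (g := fun p : nat * nat => p.1 - p.2)) (PTF_pair c2 c3).
    have : PTF (fun p : nat * nat => iter p.2 predn p.1).
      apply: (PTF_iter (step := fun _ => predn) (q := fun=> 0)); [| |
        |exact: PTF_snd PTF_id|exact: PTF_fst PTF_id].
      + apply: PTF_ext (PTF_natcase (f := fun p : (nat * nat) * nat => p.2) (c := fun p => p.2)
          (PTF_snd PTF_id) (PTF_const 0) (PTF_snd PTF_id)) => -[e x] /=.
        by case: x.
      + by pb.
      + by move=> e x; rewrite !esize_nat; lia.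
    apply: PTF_ext => -[a b] /=; elim: b => [|b IH]; first by rewrite subn0.
    by rewrite iterS IH subnS.
  - by pb.
  - move=> e s; rewrite esize_cons; have := hk e; rewrite esize_pair !esize_nat; lia.
apply: PTF_ext h => e; move: (f e) (g e) => a b.
suff H j : j <= b -> iter j (fun s => (a + (b - (size s).+1)) :: s) [::] = iota (a + (b - j)) j.
  by rewrite H // subnn addn0.
elim: j => // j IH hj; rewrite iterS IH ?(ltnW hj) // size_iota /=.
by congr (_ :: iota _ _); lia.
Qed.

Lemma PTF_fin_const (F : finType) (Y : Type) (eY : Enc Y) (f : E -> F) (g : F -> Y) :
  @PTF E F _ (enc_fin F) f -> PTF (fun e => g (f e)).
Proof. by move=> hf; apply: (PTF_fin (g := fun y _ => g y)) => // y; exact: PTF_const. Qed.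

Lemma PTF_map_const (U Y : Type) (eY : Enc Y) (us : seq U) (g : U -> E -> Y) :
  (forall u, PTF (g u)) -> PTF (fun e => [seq g u e | u <- us]).
Proof.
move=> hg; elim: us => [|u us IH] /=; first exact: PTF_const.
exact: PTF_cons.
Qed.

Lemma PTF_flatmap_const (U Y : Type) (eY : Enc Y) (us : seq U) (g : U -> E -> seq Y) :
  (forall u, PTF (g u)) -> PTF (fun e => flatten [seq g u e | u <- us]).
Proof.
move=> hg; elim: us => [|u us IH] /=; first exact: PTF_const.
exact: PTF_cat.
Qed.

End Library2.

Ltac ptf := lazymatch goal with
  | |- PTF (fun _ => ?c) => apply: PTF_const
  | |- PTF (fun x => x) => apply: PTF_id
  | |- PTF (fun x => (_, _)) => apply: PTF_pair; ptf
  | |- PTF (fun x => fst _) => apply: PTF_fst; ptf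
  | |- PTF (fun x => snd _) => apply: PTF_snd; ptf
  | |- PTF (fun x => if _ then _ else _) => apply: PTF_if; ptf
  | |- PTF (fun x => _.+1) => apply: PTF_S; ptf
  | |- PTF (fun x => _.-1) => apply: PTF_pred; ptf
  | |- PTF (fun x => addn _ _) => apply: PTF_add; ptf
  | |- PTF (fun x => muln _ _) => apply: PTF_mul; ptf
  | |- PTF (fun x => subn _ _) => apply: PTF_sub; ptf
  | |- PTF (fun x => leq _ _) => apply: PTF_leq; ptf
  | |- PTF (fun x => divn _ ?d.+1) => apply: PTF_div; ptf
  | |- PTF (fun x => modn _ ?d.+1) => apply: PTF_mod; ptf
  | |- PTF (fun x => odd _) => apply: PTF_odd; ptf
  | |- PTF (fun x => andb _ _) => apply: PTF_andb; ptf
  | |- PTF (fun x => orb _ _) => apply: PTF_orb; ptf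
  | |- PTF (fun x => negb _) => apply: PTF_negb; ptf
  | |- PTF (fun x => eq_op _ _) => apply: PTF_eq; ptf
  | |- PTF (fun x => cons _ _) => apply: PTF_cons; ptf
  | |- PTF (fun x => cat _ _) => apply: PTF_cat; ptf
  | |- PTF (fun x => rev _) => apply: PTF_revl; ptf
  | |- PTF (fun x => size _) => apply: PTF_size; ptf
  | |- PTF (fun x => nth _ _ _) => apply: PTF_nth; ptf
  | |- PTF (fun x => iota _ _) => apply: PTF_iota; ptf
  | |- PTF (fun x => flatten (map (@?f x) (@?l x))) =>
      apply: (@PTF_flatmap _ _ _ _ _ _ f l); cbv beta; ptf
  | |- PTF (fun x => map (@?f x) (@?l x)) =>
      apply: (@PTF_map _ _ _ _ _ _ f l); cbv beta; ptf
  | |- PTF (fun x => has (@?f x) (@?l x)) => apply: (@PTF_has _ _ _ _ f l); cbv beta; ptf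
  | |- PTF (fun x => all (@?f x) (@?l x)) => apply: (@PTF_all _ _ _ _ f l); cbv beta; ptf
  | |- _ => first [ exact: (PTF_fst PTF_id) | exact: (PTF_snd PTF_id) | exact: PTF_id
      | exact: (PTF_S PTF_id) | eassumption | idtac ]
  end.

(** * Binary numbers *)

(** Binary increment, least significant bit first. *)
Fixpoint incl (s : seq bool) : seq bool :=
  if s is b :: s' then if b then false :: incl s' else true :: s' else [:: true].

(** Computed by counting up, which is polynomial because natural numbers are encoded in unary. It
    starts from a single bit so that 0 is written as in [encode_nat]. *)
Definition bits (n : nat) : seq bool := iter n incl [:: false].

Definition digits (n : nat) : seq bool :=
  [seq odd (n %/ 2 ^ i) | i <- iota 0 (trunc_log 2 n).+1].

Lemma digitsS n : 1 < n -> digits n = odd n :: digits n./2.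
Proof.
move=> n1; rewrite /digits.
have -> : trunc_log 2 n = (trunc_log 2 n./2).+1.
  by rewrite trunc_log2S.
have -> k : iota 0 k.+1 = 0 :: [seq i.+1 | i <- iota 0 k].
  by rewrite -[iota 0 _]/(0 :: iota (1 + 0) k) iotaDl.
rewrite map_cons expn0 divn1 -map_comp; congr cons; apply/eq_map => i /=.
by rewrite expnS -divn2 divnMA.
Qed.

Lemma incl_cons b s : incl (b :: s) = if b then false :: incl s else true :: s.
Proof. by []. Qed.

Lemma incl_digits n : incl (digits n) = digits n.+1.
Proof.
have [m] := ubnP n; elim: m n => // m IH [|[|n]] hn //.
rewrite digitsS // [RHS]digitsS // incl_cons.
have o3 : odd n.+3 = ~~ odd n.+2 by [].
have := odd_double_half n.+2; have := odd_double_half n.+3; rewrite o3.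
case: (boolP (odd n.+2)) => on e1 e2.
  rewrite IH; last by move: e2 hn; rewrite -muln2; lia.
  by congr (_ :: digits _); move: e1 e2; rewrite -!muln2; lia.
by congr (_ :: digits _); move: e1 e2; rewrite -!muln2; lia.
Qed.

Lemma bits_digits n : bits n = digits n.
Proof. by elim: n => // n IH; rewrite /bits iterS -/(bits n) IH incl_digits. Qed.

Lemma encode_natE n : encode_nat n = rev [seq Bit b | b <- bits n].
Proof. by rewrite bits_digits /digits -map_comp. Qed.

Lemma PTF_incl : PTF incl.
Proof.
(* The first component is the carry; the digits already treated are collected in reverse. *)
pose step (a : bool * seq bool) (b : bool) :=
  if a.1 then (b, ~~ b :: a.2) else (false, b :: a.2).
have h : PTF (fun s : seq bool => foldl step (true, [::]) s).
  apply: (PTF_foldl (E := seq bool) (step := fun _ => step)).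
  - by rewrite /step; ptf.
  - exists (fun=> 10 * (esize true + esize false) + 10); first by pb.
    move=> e [c a] b /=; rewrite /step /=.
    by case: c; case: b; rewrite /= !esize_pair !esize_cons; lia.
  - by ptf.
  - by ptf.
have h2 : PTF (fun s => let a := foldl step (true, [::]) s in
    rev (if a.1 then true :: a.2 else a.2)).
  by apply: (PTF_comp (g := fun a => rev (if a.1 then true :: a.2 else a.2)) _ h); ptf.
apply: PTF_ext h2 => s /=.
have H c t : rev (let a := foldl step (c, t) s in if a.1 then true :: a.2 else a.2) =
    rev t ++ (if c then incl s else s).
  elim: s c t => [|b s IH] c t /=; first by case: c; rewrite ?rev_cons ?cats1 ?cats0.
  by case: c => /=; rewrite IH rev_cons -cats1 -catA; case: b.
by rewrite H.
Qed.

Lemma PTF_bits : PTF bits.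
Proof.
apply: (PTF_iter (step := fun (_ : nat) => incl) (q := fun=> esize true + esize false + 1)).
- by apply: (PTF_comp PTF_incl); exact: PTF_snd PTF_id.
- by pb.
- move=> _ s; elim: s => [|[] s IH] /=; rewrite !esize_cons ?esize_nil; [lia| |lia].
  have e : esize true = 3 by []; have e' : esize false = 1 by [].
  by move: IH; rewrite e e'; lia.
- exact: PTF_id.
- exact: PTF_const.
Qed.

(** * Contractible sets *)

Section Continuity.
Variable R : realType.
Local Open Scope ring_scope.
Local Open Scope classical_set_scope.
Local Notation I := (@unit_itv R).
Implicit Types (A B Q : set (R * R)) (g h : R -> R * R).

Lemma within_comp (X Y Z : topologicalType) (B : set X) (A : set Y)
    (f : Y -> Z) (r : X -> Y) :
  {within A, continuous f} -> {within B, continuous r} -> (forall x, B x -> A (r x)) ->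
  {within B, continuous (f \o r)}.
Proof.
move=> /subspace_continuousP hf /subspace_continuousP hr hA.
apply/subspace_continuousP => x Bx.
apply: (@cvg_comp _ _ _ r f _ (within A (nbhs (r x)))); last exact: hf (hA x Bx).
move=> P hP; have h : nbhs x [set y | B y -> A (r y) -> P (r y)] := hr x Bx _ hP.
change (nbhs x [set y | B y -> P (r y)]).
by apply: filterS h => y hy By; apply: hy => //; apply: hA.
Qed.

Lemma continuous_into (X Y Z : topologicalType) (A : set Y) (f : Y -> Z) (r : X -> Y) :
  {within A, continuous f} -> continuous r -> (forall x, A (r x)) -> continuous (f \o r).
Proof.
move=> /subspace_continuousP hf hr hA x.
apply: (@cvg_comp _ _ _ r f _ (within A (nbhs (r x)))); last exact: hf (hA x).
move=> P hP; have h : nbhs x [set y | A (r y) -> P (r y)] := hr x _ hP.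
change (nbhs x [set y | P (r y)]).
by apply: filterS h => y; apply.
Qed.

Lemma continuous_pair (X Y Z : topologicalType) (f : X -> Y) (g : X -> Z) :
  continuous f -> continuous g -> continuous (fun x => (f x, g x)).
Proof. by move=> hf hg x; apply: cvg_pair; [exact: hf | exact: hg]. Qed.

Lemma continuous_fst_comp (X Y Z : topologicalType) (f : X -> Y * Z) :
  continuous f -> continuous (fun x => (f x).1).
Proof. by move=> hf x; apply: (cvg_comp _ _ (hf x)); exact: cvg_fst. Qed.

Lemma continuous_snd_comp (X Y Z : topologicalType) (f : X -> Y * Z) :
  continuous f -> continuous (fun x => (f x).2).
Proof. by move=> hf x; apply: (cvg_comp _ _ (hf x)); exact: cvg_snd. Qed.

Lemma continuous_compose (X Y Z : topologicalType) (f : X -> Y) (g : Y -> Z) :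
  continuous f -> continuous g -> continuous (fun x => g (f x)).
Proof. by move=> hf hg x; apply: (cvg_comp _ _ (hf x)); exact: hg. Qed.

Lemma continuous_const (X Y : topologicalType) (y : Y) : continuous (fun _ : X => y).
Proof. by move=> x; exact: cvg_cst. Qed.

Lemma continuous_self (X : topologicalType) : continuous (fun x : X => x).
Proof. by move=> x; exact: cvg_id. Qed.

Lemma continuous_plus (X : topologicalType) (f g : X -> R) :
  continuous f -> continuous g -> continuous (fun x => f x + g x).
Proof. by move=> hf hg x; apply: (@cvgD _ R^o); [exact: hf | exact: hg]. Qed.

Lemma continuous_opp (X : topologicalType) (f : X -> R) :
  continuous f -> continuous (fun x => - f x).
Proof. by move=> hf x; apply: (@cvgN _ R^o); exact: hf. Qed.

Lemma continuous_times (X : topologicalType) (f g : X -> R) :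
  continuous f -> continuous g -> continuous (fun x => f x * g x).
Proof. by move=> hf hg x; apply: cvgM; [exact: hf | exact: hg]. Qed.

Lemma continuous_maxr (X : topologicalType) (f g : X -> R) :
  continuous f -> continuous g -> continuous (fun x => Num.max (f x) (g x)).
Proof. by move=> hf hg x; apply: (@continuous_max R X f g x); [exact: hf | exact: hg]. Qed.

Lemma continuous_minr (X : topologicalType) (f g : X -> R) :
  continuous f -> continuous g -> continuous (fun x => Num.min (f x) (g x)).
Proof. by move=> hf hg x; apply: (@continuous_min R X f g x); [exact: hf | exact: hg]. Qed.

Definition vadd (u v : R * R) : R * R := (u.1 + v.1, u.2 + v.2).
Definition vscale (a : R) (u : R * R) : R * R := (a * u.1, a * u.2).
Definition vsub (u v : R * R) : R * R := (u.1 - v.1, u.2 - v.2).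

Lemma continuous_vadd (X : topologicalType) (f g : X -> R * R) :
  continuous f -> continuous g -> continuous (fun x => vadd (f x) (g x)).
Proof.
by move=> hf hg; apply: continuous_pair; apply: continuous_plus;
  (exact: continuous_fst_comp || exact: continuous_snd_comp).
Qed.

Lemma continuous_vsub (X : topologicalType) (f g : X -> R * R) :
  continuous f -> continuous g -> continuous (fun x => vsub (f x) (g x)).
Proof.
by move=> hf hg; apply: continuous_pair; apply: continuous_plus;
  (exact: continuous_fst_comp || exact: continuous_snd_comp ||
   (apply: continuous_opp; (exact: continuous_fst_comp || exact: continuous_snd_comp))).
Qed.

Lemma continuous_vscale (X : topologicalType) (a : X -> R) (g : X -> R * R) :
  continuous a -> continuous g -> continuous (fun x => vscale (a x) (g x)).
Proof.
by move=> hf hg; apply: continuous_pair; apply: continuous_times => //;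
  (exact: continuous_fst_comp || exact: continuous_snd_comp).
Qed.

(** The retraction of the line onto the unit interval. Composing with it turns maps defined on the
    interval into maps continuous everywhere. *)
Definition clamp (t : R) : R := Num.max 0 (Num.min 1 t).

Lemma clampP t : 0 <= clamp t <= 1.
Proof. by rewrite /clamp le_max lexx /= ge_max ler01 /= ge_min lexx. Qed.

Lemma clamp_itv t : I (clamp t).
Proof. by rewrite /unit_itv /= in_itv /= clampP. Qed.

Lemma itvP01 t : I t -> 0 <= t <= 1.
Proof. by rewrite /unit_itv /= in_itv. Qed.

Lemma clamp_id t : 0 <= t <= 1 -> clamp t = t.
Proof. by move=> /andP[h0 h1]; rewrite /clamp min_r // max_r. Qed.

Lemma clamp0 t : t <= 0 -> clamp t = 0.
Proof. by move=> h; rewrite /clamp min_r ?max_l //; lra. Qed.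

Lemma clamp1 t : 1 <= t -> clamp t = 1.
Proof. by move=> h; rewrite /clamp min_l // max_r. Qed.

Lemma continuous_clamp (X : topologicalType) (f : X -> R) :
  continuous f -> continuous (fun x => clamp (f x)).
Proof.
move=> hf; apply: continuous_maxr; first exact: continuous_const.
by apply: continuous_minr => //; exact: continuous_const.
Qed.

Lemma continuous_mull (a : R) : continuous (fun x : R => a * x).
Proof. by apply: continuous_times; [exact: continuous_const | exact: continuous_self]. Qed.

Lemma continuous_addl (a : R) : continuous (fun x : R => a + x).
Proof. by apply: continuous_plus; [exact: continuous_const | exact: continuous_self]. Qed.

Lemma continuous_clampT : continuous clamp.
Proof. by apply: continuous_clamp; exact: continuous_self. Qed.

Lemma continuous_oppT : continuous (fun x : R => - x).
Proof. by apply: continuous_opp; exact: continuous_self. Qed.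

End Continuity.

Ltac cont := lazymatch goal with
  | |- continuous (fun _ => ?c) => exact: continuous_const
  | |- continuous (fun x => x) => exact: continuous_self
  | |- continuous (fun x => clamp _) => apply: continuous_clamp; cont
  | |- continuous (fun x => vadd _ _) => apply: continuous_vadd; cont
  | |- continuous (fun x => vsub _ _) => apply: continuous_vsub; cont
  | |- continuous (fun x => vscale _ _) => apply: continuous_vscale; cont
  | |- continuous (fun x => Num.max _ _) => apply: continuous_maxr; cont
  | |- continuous (fun x => Num.min _ _) => apply: continuous_minr; cont
  | |- continuous (fun x => GRing.mul _ _) => apply: continuous_times; cont
  | |- continuous (fun x => GRing.opp _) => apply: continuous_opp; cont
  | |- continuous (fun x => GRing.add _ _) => apply: continuous_plus; cont
  | |- continuous (fun x => (_, _)) => apply: continuous_pair; cont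
  | |- continuous (fun x => (_).1) => apply: continuous_fst_comp; cont
  | |- continuous (fun x => (_).2) => apply: continuous_snd_comp; cont
  | |- continuous fst => by move=> ?; exact: cvg_fst
  | |- continuous snd => by move=> ?; exact: cvg_snd
  | |- continuous id => exact: continuous_self
  | |- continuous GRing.opp => exact: continuous_oppT
  | |- continuous clamp => exact: continuous_clampT
  | |- continuous (GRing.mul ?a) => exact: continuous_mull
  | |- continuous (GRing.add ?a) => exact: continuous_addl
  | |- _ => first [ exact: continuous_clampT | exact: continuous_mull | exact: continuous_addl
      | exact: continuous_oppT | by [] | idtac ]
  end.

Section Contractible.
Variable R : realType.
Local Open Scope ring_scope.
Local Open Scope classical_set_scope.
Local Notation I := (@unit_itv R).
Implicit Types (A B Q : set (R * R)) (g h : R -> R * R).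

Definition contractible (A : set (R * R)) : Prop := exists K (p : R * R),
  [/\ {within I `*` A, continuous K}, A p,
      forall s x, I s -> A x -> A (K (s, x)),
      forall x, A x -> K (0, x) = x & forall x, A x -> K (1, x) = p].

Lemma path_comp A g (X : topologicalType) (b : X -> R) : is_path A g ->
  continuous b -> (forall x, 0 <= b x <= 1) -> continuous (fun x => g (b x)).
Proof.
move=> [hg _] hb h; apply: (continuous_into hg hb) => x.
by rewrite /unit_itv /= in_itv /=.
Qed.

Lemma path_in A g t : is_path A g -> 0 <= t <= 1 -> A (g t).
Proof. by move=> [_ h] ht; apply: h; exists t => //; rewrite /unit_itv /= in_itv. Qed.

Lemma is_pathI A g : continuous g -> (forall t, 0 <= t <= 1 -> A (g t)) ->
  is_path A g.
Proof.
move=> hg h; split; first exact: continuous_subspaceT.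
by move=> _ [t /itvP01 ht <-]; apply: h.
Qed.

(* Two paths are concatenated by adding them and subtracting their common point. *)
Lemma path_cat A g h : is_path A g -> is_path A h -> g 1 = h 0 ->
  exists k, [/\ is_path A k, k 0 = g 0, k 1 = h 1,
    forall t, 0 <= t <= 1/2 -> k t = g (2 * t) &
    forall t, 1/2 <= t <= 1 -> k t = h (2 * t - 1)].
Proof.
move=> hg hh e.
pose k t := vsub (vadd (g (clamp (2 * t))) (h (clamp (2 * t - 1)))) (h 0).
have kl t : 0 <= t <= 1/2 -> k t = g (2 * t).
  move=> /andP[h0 h1]; rewrite /k (@clamp0 _ (2 * t - 1)); last by lra.
  rewrite clamp_id; last by lra.
  by rewrite /vsub /vadd /= !addrK; case: (g _).
have kr t : 1/2 <= t <= 1 -> k t = h (2 * t - 1).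
  move=> /andP[h0 h1]; rewrite /k (@clamp1 _ (2 * t)); last by lra.
  rewrite clamp_id; last by lra.
  by rewrite e /vsub /vadd /= [X in (X - _, _)]addrC [X in (_, X - _)]addrC !addrK; case: (h (2 * t - 1)).
exists k; split=> //.
- apply: is_pathI.
    apply: continuous_vsub; last exact: continuous_const.
    by apply: continuous_vadd; [apply: (path_comp hg) | apply: (path_comp hh)];
      (by move=> x; exact: clampP) || cont.
  move=> t /andP[t0 t1]; have [le|ge] := lerP t (1/2).
    by rewrite kl; [apply: (path_in hg); lra | lra].
  by rewrite kr; [apply: (path_in hh); lra | lra].
- by rewrite kl ?mulr0 //; lra.
- by rewrite kr; [congr h; lra | lra].
Qed.

(** The contraction [K] moves the base point along the track [K (s, g 0)], so it gives only a free
    homotopy. To keep the ends fixed, the loop is squeezed into the middle third of the time while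
    the outer thirds run out and back along the track; once the middle has shrunk to [p], the track
    is drawn back. *)
Lemma contractible_simply_connected A : contractible A -> simply_connected A.
Proof.
move=> [K [p [hK Ap KA K0 K1]]].
have KC (X : topologicalType) (a : X -> R) (f : X -> R * R) : continuous a -> continuous f ->
    (forall x, 0 <= a x <= 1) -> (forall x, A (f x)) -> continuous (fun x => K (a x, f x)).
  move=> ha hf h1 h2; apply: (continuous_into hK (continuous_pair ha hf)) => x; split=> //=.
  by rewrite /unit_itv /= in_itv /=.
have KA' s x : 0 <= s <= 1 -> A x -> A (K (s, x)).
  by move=> hs; apply: KA; rewrite /unit_itv /= in_itv /=.
split; first by exists p.
  move=> x y Ax Ay.
  have pA z : A z -> is_path A (fun t => K (clamp t, z)).
    move=> Az; apply: is_pathI; first by apply: KC => //; cont; move=> ?; exact: clampP.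
    by move=> t _; apply: KA' => //; exact: clampP.
  have pB z : A z -> is_path A (fun t => K (clamp (1 - t), z)).
    move=> Az; apply: is_pathI; first by apply: KC => //; cont; move=> ?; exact: clampP.
    by move=> t _; apply: KA' => //; exact: clampP.
  have [] := path_cat (pA x Ax) (pB y Ay).
    by rewrite subr0 !clamp1 ?K1.
  move=> k [hk k0 k1 _ _]; exists k; split=> //.
    by rewrite k0 clamp0 ?K0.
  by rewrite k1 subrr clamp0 ?K0.
move=> g hg g01.
(* A trapezoid: it rises on the first third, is 1 on the second and falls on the last. It tells how
   far the contraction may go at time [t]. *)
pose T (t : R) := Num.min (clamp (3 * t)) (clamp (3 - 3 * t)).
pose sg (s : R) := clamp (2 * s).
pose b (z : R * R) := (1 - sg z.1) * clamp z.2 + sg z.1 * clamp (3 * z.2 - 1).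
pose H (z : R * R) := vsub (vadd (K (Num.min (T z.2) (sg z.1), g (b z)))
  (K (Num.min (T z.2) (clamp (2 - 2 * z.1)), g 0))) (K (T z.2, g 0)).
have hT t : 0 <= T t <= 1.
  by rewrite /T le_min; have := clampP (3 * t); have := clampP (3 - 3 * t); rewrite ge_min; lra.
have hb z : 0 <= b z <= 1.
  rewrite /b; have := clampP z.2; have := clampP (3 * z.2 - 1); have := clampP (2 * z.1).
  rewrite -/(sg z.1); nra.
have Ag t : 0 <= t <= 1 -> A (g t) by move=> ht; exact: (path_in hg ht).
have Ag0 : A (g 0) by apply: Ag; rewrite lexx ler01.
have mn (u v : R) : 0 <= u <= 1 -> 0 <= v <= 1 -> 0 <= Num.min u v <= 1.
  by move=> /andP[? ?] /andP[? ?]; rewrite le_min ge_min; lra.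
have Hl z : 0 <= z.1 <= 1/2 -> H z = K (Num.min (T z.2) (sg z.1), g (b z)).
  move=> /andP[h0 h1]; rewrite /H (@clamp1 _ (2 - 2 * z.1)); last by lra.
  by rewrite (min_l (y := 1)) ?(andP (hT _)).2 // /vsub /vadd /= !addrK; case: (K _).
(* The two halves of the homotopy agree in the middle: on the outer thirds the loop stands at its
   base point, on the middle third [K] has reached [p]. *)
have KT t : K (T t, g (clamp (3 * t - 1))) = K (T t, g 0).
  have [le|ge] := lerP t (1/3); first by rewrite clamp0 //; lra.
  have [le2|ge2] := lerP (2/3) t.
    by rewrite clamp1 -?g01 //; lra.
  have -> : T t = 1 by rewrite /T !clamp1 ?minxx //; lra.
  by rewrite !K1 //; apply: Ag; exact: clampP.
have Hr z : 1/2 <= z.1 <= 1 -> H z = K (Num.min (T z.2) (clamp (2 - 2 * z.1)), g 0).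
  move=> /andP[h0 h1]; rewrite /H.
  have e : sg z.1 = 1 by rewrite /sg clamp1 //; lra.
  rewrite /b e subrr mul0r add0r mul1r (min_l (y := 1)) ?(andP (hT _)).2 // KT.
  by rewrite /vsub /vadd /= [X in (X - _, _)]addrC [X in (_, X - _)]addrC !addrK; case: (K _).
have HA z : 0 <= z.1 <= 1 -> A (H z).
  move=> /andP[h0 h1]; have [le|ge] := lerP z.1 (1/2).
    rewrite Hl; last by lra.
    by apply: KA'; [apply: mn => //; exact: clampP | exact: Ag].
  by rewrite Hr; [apply: KA' => //; apply: mn => //; exact: clampP | lra].
have T0 : T 0 = 0 by rewrite /T mulr0 clamp0 // min_l // (andP (clampP _)).1.
have T1 : T 1 = 0 by rewrite /T mulr1 subrr (@clamp0 _ 0) // min_r // (andP (clampP _)).1.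
have m0 (u : R) : 0 <= u <= 1 -> Num.min 0 u = 0 by move=> /andP[? ?]; rewrite min_l.
have hs s : 0 <= sg s <= 1 by exact: clampP.
exists H; split.
- apply: continuous_subspaceT; rewrite /H.
  have cT : continuous (fun z : R * R => T z.2) by rewrite /T; cont.
  have cs : continuous (fun z : R * R => sg z.1) by rewrite /sg; cont.
  apply: continuous_vsub; [apply: continuous_vadd|].
  + apply: KC; [by apply: continuous_minr| |by move=> z; apply: mn|by move=> z; apply: Ag].
    by apply: (path_comp hg) => //; rewrite /b /sg; cont.
  + by apply: KC => //; [apply: continuous_minr => //; cont | cont | move=> z; apply: mn => //; exact: clampP].
  + by apply: KC => //; cont.
- by move=> _ [z [/itvP01 h1 _] <-]; apply: HA.
- move=> t /itvP01 ht; split.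
    rewrite Hl /=; last by rewrite lexx /=; lra.
    have -> : sg 0 = 0 by rewrite /sg mulr0 clamp0.
    rewrite min_r; last by rewrite (andP (hT _)).1.
    rewrite K0; last by apply: Ag; exact: (hb (0, t)).
    rewrite /b /=.
    have -> : sg 0 = 0 by rewrite /sg mulr0 clamp0.
    by rewrite subr0 mul1r mul0r addr0 clamp_id.
  rewrite Hr /=; last by lra.
  rewrite mulr1 subrr (@clamp0 _ 0) // min_r; last by rewrite (andP (hT _)).1.
  by rewrite K0.
- move=> s /itvP01 hs'.
  have b0 : b (s, 0) = 0 by rewrite /b /= !clamp0 ?mulr0 ?addr0 //; lra.
  have b1 : b (s, 1) = 1 by rewrite /b /= !clamp1 ?mulr1 ?subrK //; lra.
  have E t : T t = 0 -> g (b (s, t)) = g 0 -> H (s, t) = g 0.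
    move=> e1 e2; rewrite /H /= e1 e2 !m0 ?K0 //; last by exact: clampP.
    by rewrite /vsub /vadd /= !addrK; case: (g 0).
  by split; apply: E => //; rewrite ?b0 ?b1.
Qed.

Definition convex2 (Q : set (R * R)) := forall x y t, Q x -> Q y -> 0 <= t <= 1 ->
  Q (vadd (vscale (1 - t) x) (vscale t y)).

Lemma contractible_convex Q p : convex2 Q -> Q p -> contractible Q.
Proof.
move=> cQ Qp; exists (fun z => vadd (vscale (1 - z.1) z.2) (vscale z.1 p)), p; split=> //.
- by apply: continuous_subspaceT; cont.
- by move=> s x /itvP01 hs Qx; apply: cQ.
- by move=> x _; rewrite /vadd /vscale /= subr0 !mul1r !mul0r !addr0; case: x.
- by move=> x _; rewrite /vadd /vscale /= subrr !mul1r !mul0r !add0r; case: p Qp.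
Qed.

Lemma within_vadd (X : topologicalType) (B : set X) (f g : X -> R * R) :
  {within B, continuous f} -> {within B, continuous g} ->
  {within B, continuous (fun x => vadd (f x) (g x))}.
Proof. exact: (@continuous_vadd _ (subspace B)). Qed.

Lemma within_vsub (X : topologicalType) (B : set X) (f g : X -> R * R) :
  {within B, continuous f} -> {within B, continuous g} ->
  {within B, continuous (fun x => vsub (f x) (g x))}.
Proof. exact: (@continuous_vsub _ (subspace B)). Qed.

Lemma within_vscale (X : topologicalType) (B : set X) (f : X -> R) (g : X -> R * R) :
  {within B, continuous f} -> {within B, continuous g} ->
  {within B, continuous (fun x => vscale (f x) (g x))}.
Proof. exact: (@continuous_vscale _ (subspace B)). Qed.

(** Points of [Q] are first moved along a straight line to their image under [rho], staying in [Q]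
    by convexity, while points of [A] rest; afterwards [K] contracts [A]. *)
Lemma contractible_retract A Q rho : contractible A -> convex2 Q ->
  {within A `|` Q, continuous rho} -> (forall x, A x -> rho x = x) ->
  (forall x, Q x -> A (rho x) /\ Q (rho x)) -> contractible (A `|` Q).
Proof.
move=> [K [p [hK Ap KA K0 K1]]] cQ hr rA rQ.
have rAQ x : (A `|` Q) x -> A (rho x) by case=> [h|/rQ[]//]; rewrite rA.
pose h (z : R * (R * R)) := vadd (vscale (1 - clamp (2 * z.1)) z.2) (vscale (clamp (2 * z.1)) (rho z.2)).
pose K' z := vsub (vadd (h z) (K (clamp (2 * z.1 - 1), rho z.2))) (rho z.2).
have h1 s x : 1/2 <= s -> h (s, x) = rho x.
  move=> hs; rewrite /h /= clamp1; last by lra.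
  by rewrite subrr /vadd /vscale /= !mul0r !mul1r !add0r; case: (rho x).
have Kl s x : s <= 1/2 -> (A `|` Q) x -> K' (s, x) = h (s, x).
  move=> hs Ax; rewrite /K' (@clamp0 _ (2 * s - 1)); last by lra.
  by rewrite /= K0; [rewrite /vsub /vadd /= !addrK | exact: rAQ].
have Kr s x : 1/2 <= s -> K' (s, x) = K (clamp (2 * s - 1), rho x).
  move=> hs; rewrite /K' h1 //=.
  by rewrite /vsub /vadd /= [X in (X - _, _)]addrC [X in (_, X - _)]addrC !addrK; case: (K _).
have cr : {within I `*` (A `|` Q), continuous (fun z : R * (R * R) => rho z.2)}.
  apply: (within_comp hr (r := snd)); last by move=> z [].
  by apply: continuous_subspaceT => z; exact: cvg_snd.
have cs (f : R -> R) : continuous f -> {within I `*` (A `|` Q), continuous (fun z : R * (R * R) => f z.1)}.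
  move=> hf; apply: continuous_subspaceT => z.
  by apply: (cvg_comp _ _ (@cvg_fst _ _ _ _ _)); exact: hf.
exists K', p; split.
- apply: within_vsub => //; apply: within_vadd.
    apply: within_vadd; apply: within_vscale => //.
    + by apply: (cs (fun s => 1 - clamp (2 * s))); cont.
    + by apply: continuous_subspaceT => z; exact: cvg_snd.
    + by apply: (cs (fun s => clamp (2 * s))); cont.
  apply: (within_comp hK (r := fun z : R * (R * R) => (clamp (2 * z.1 - 1), rho z.2))).
    apply: (@continuous_pair (subspace (I `*` (A `|` Q)))) => //.
    by apply: (cs (fun s => clamp (2 * s - 1))); cont.
  by move=> z [_ hz]; split; [exact: clamp_itv | exact: rAQ].
- by left.
- move=> s x /itvP01 hs Ax; have [le|ge] := lerP s (1/2); last first.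
    rewrite Kr; last by lra.
    by left; apply: KA; [exact: clamp_itv | exact: rAQ].
  rewrite Kl //; case: Ax => [Ax|Qx].
    left; rewrite /h /= rA // /vadd /vscale /= -!mulrDl subrK !mul1r.
    by case: x Ax.
  by right; have [_ Qr] := rQ x Qx; apply: cQ => //; exact: clampP.
- move=> x Ax; rewrite Kl //; last by lra.
  by rewrite /h /= mulr0 clamp0 // subr0 /vadd /vscale /= !mul1r !mul0r !addr0; case: x {Ax}.
- move=> x Ax; rewrite Kr; last by lra.
  by rewrite clamp1 ?K1 //; [exact: rAQ | lra].
Qed.

(** Paths and homotopies in [A] are pushed into [B] by the retraction, which fixes the given loop
    and its base point. *)
Lemma simply_connected_retract A B rho : simply_connected A -> B !=set0 -> B `<=` A ->
  {within A, continuous rho} -> (forall x, A x -> B (rho x)) ->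
  (forall x, B x -> rho x = x) -> simply_connected B.
Proof.
move=> [_ pA hA] B0 BA hr rB rid; split=> //.
  move=> x y Bx By; have [g [[hg gA] g0 g1]] := pA x y (BA _ Bx) (BA _ By).
  exists (rho \o g); split; [|by rewrite /= g0 rid|by rewrite /= g1 rid].
  split; first by apply: (within_comp hr hg) => t ht; apply: gA; exists t.
  by move=> _ [t ht <-]; apply: rB; apply: gA; exists t.
move=> g [hg gB] g01.
have [] := hA g; [by split=> // z /gB/BA|by []|].
move=> H [cH HA Hs Ht]; exists (rho \o H); split.
- by apply: (within_comp hr cH) => z hz; apply: HA; exists z.
- by move=> _ [z hz <-]; apply: rB; apply: HA; exists z.
- move=> t ht; have [e0 e1] := Hs t ht; rewrite /= e0 e1.
  have I0 : I 0 by rewrite /unit_itv /= in_itv /= lexx ler01.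
  by rewrite !rid //; apply: gB; [exists 0 | exists t].
- move=> s hs; have [e0 e1] := Ht s hs; rewrite /= e0 e1.
  have I0 : I 0 by rewrite /unit_itv /= in_itv /= lexx ler01.
  by rewrite !rid //; apply: gB; exists 0.
Qed.

End Contractible.

(** * Shellable regions *)

(** A diagonal neighbour counts only if its corner lies on none of the sides present, for otherwise
    it adds no point to the contact. Two opposite sides alone, four sides, or none give no arc. *)
Definition arc8 (e w n s ne nw se sw : bool) : bool :=
  match e, w, n, s with
  | true, false, false, false => ~~ nw && ~~ sw
  | false, true, false, false => ~~ ne && ~~ se
  | false, false, true, false => ~~ se && ~~ sw
  | false, false, false, true => ~~ ne && ~~ nw
  | true, false, true, false => ~~ sw
  | true, false, false, true => ~~ nw
  | false, true, true, false => ~~ se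
  | false, true, false, true => ~~ ne
  | true, true, true, false | true, true, false, true
  | true, false, true, true | false, true, true, true => true
  | _, _, _, _ => false
  end.

Definition shift2 (c : square) (dx dy : int) : square := ((c.1 + dx)%R, (c.2 + dy)%R).

(* the cells satisfying [P] meet the boundary of [c] in an arc made of one to
   three of its sides *)
Definition arc (P : square -> bool) (c : square) : bool :=
  let n dx dy := P (shift2 c dx dy) in
  arc8 (n 1 0)%R (n (-1) 0)%R (n 0 1)%R (n 0 (-1))%R (n 1 1)%R (n (-1) 1)%R
    (n 1 (-1))%R (n (-1) (-1))%R.

Lemma eq_arc P Q c : P =1 Q -> arc P c = arc Q c.
Proof. by move=> h; rewrite /arc !h. Qed.

(** The head of the list is the cell added last. *)
Fixpoint shelled (s : seq square) : bool :=
  if s is c :: s' then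
    (s' == [::]) || [&& c \notin s', arc (mem s') c & shelled s']
  else false.

Section Shelling.
Variable R : realType.
Local Open Scope ring_scope.
Local Open Scope classical_set_scope.
Implicit Types (S : cells) (c d : square) (u z : R * R).

Definition in_unit u : Prop := [/\ 0 <= u.1, u.1 <= 1, 0 <= u.2 & u.2 <= 1].

Definition on_sides (e w n s : bool) u : Prop :=
  [\/ e /\ u.1 = 1, w /\ u.1 = 0, n /\ u.2 = 1 | s /\ u.2 = 0].

(** The unit square retracts onto the union of the chosen sides. Reflections and the exchange of
    coordinates reduce the possible sets of sides to one, two adjacent and three. *)
Definition side_retract e w n s : Prop := exists2 r : R * R -> R * R, continuous r &
  forall u, in_unit u -> [/\ in_unit (r u), on_sides e w n s (r u)
    & on_sides e w n s u -> r u = u].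

Lemma side_retract_refl e w n s : side_retract e w n s -> side_retract w e n s.
Proof.
case=> r cr hr; pose f u : R * R := (1 - u.1, u.2).
have cf : continuous f by rewrite /f; cont.
have fI u : in_unit u -> in_unit (f u) by case=> *; split=> //=; lra.
have ff u : f (f u) = u by rewrite /f /= subKr; case: u.
have fs e' w' u : on_sides e' w' n s u -> on_sides w' e' n s (f u).
  by case=> -[h1 h2]; [constructor 2|constructor 1|constructor 3|constructor 4];
    split=> //=; lra.
exists (fun u => f (r (f u))).
  by apply: (continuous_compose (continuous_compose cf cr)); exact: cf.
move=> u hu; have [h1 h2 h3] := hr _ (fI u hu); split; [exact: fI | exact: fs |].
by move=> h; rewrite h3 ?ff //; exact: fs.
Qed.

Lemma side_retract_swap e w n s : side_retract e w n s -> side_retract n s e w.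
Proof.
case=> r cr hr; pose f u : R * R := (u.2, u.1).
have cf : continuous f by rewrite /f; cont.
have fI u : in_unit u -> in_unit (f u) by case.
have ff u : f (f u) = u by case: u.
have fs e' w' n' s' u : on_sides e' w' n' s' u -> on_sides n' s' e' w' (f u).
  by case=> h; [constructor 3|constructor 4|constructor 1|constructor 2].
exists (fun u => f (r (f u))).
  by apply: (continuous_compose (continuous_compose cf cr)); exact: cf.
move=> u hu; have [h1 h2 h3] := hr _ (fI u hu); split; [exact: fI | exact: fs |].
by move=> h; rewrite h3 ?ff //; exact: fs.
Qed.

Lemma side_retract_reflV e w n s : side_retract e w n s -> side_retract e w s n.
Proof. by move=> /side_retract_swap/side_retract_refl/side_retract_swap. Qed.

Lemma side_retract1 : side_retract false false false true.
Proof.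
exists (fun u => (u.1, 0)); first by cont.
move=> u [h1 h2 h3 h4]; split=> /=; first by split=> //=; lra.
  by constructor 4.
by case=> -[// _ e]; case: u e {h1 h2 h3 h4} => a b /= ->.
Qed.

(** Projection along the diagonal direction onto the left and bottom sides. *)
Lemma side_retract2 : side_retract false true false true.
Proof.
exists (fun u => (Num.max (u.1 - u.2) 0, Num.max (u.2 - u.1) 0)); first by cont.
move=> [x y] [/= h1 h2 h3 h4]; split=> /=.
- by split=> /=; rewrite ?le_max ?ge_max ?lexx ?orbT //; apply/andP; split; lra.
- have [le|gt] := lerP x y.
    by constructor 2; split=> //=; rewrite max_r //; lra.
  by constructor 4; split=> //=; rewrite max_r //; lra.
- case=> -[//= _ e]; rewrite e in h1 h2 h3 h4 *.
    by rewrite subr0 sub0r (max_r (x := - y)) ?(max_l (x := y)) //; lra.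
  by rewrite subr0 sub0r (max_r (x := - x)) ?(max_l (x := x)) //; lra.
Qed.

(* [sg] parametrizes the three sides by arc length measured from the middle of
   the bottom. *)
Lemma side_retract3 : side_retract true true false true.
Proof.
pose sg u : R := (2 * u.1 - 1) * (1/2 + u.2).
exists (fun u => (clamp (sg u + 1/2), Num.max 0 (Num.max (sg u - 1/2) (- sg u - 1/2)))).
  by rewrite /sg; cont.
move=> [x y] [/= h1 h2 h3 h4]; have [b1 b2] : - (3/2) <= sg (x, y) /\ sg (x, y) <= 3/2.
  by rewrite /sg /=; split; nra.
have e1 : x = 1 -> sg (x, y) = 1/2 + y by rewrite /sg /= => ->; lra.
have e0 : x = 0 -> sg (x, y) = - (1/2 + y) by rewrite /sg /= => ->; lra.
have ey : y = 0 -> sg (x, y) = x - 1/2 by rewrite /sg /= => ->; lra.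
move: (sg (x, y)) b1 b2 e1 e0 ey => a b1 b2 e1 e0 ey.
split=> /=.
- have /andP[? ?] := clampP (a + 1/2); split=> //=; first by rewrite le_max lexx.
  by rewrite !ge_max ler01 /=; apply/andP; split; lra.
- have [?|?] := lerP (a + 1/2) 0; first by constructor 2; split=> //=; exact: clamp0.
  have [?|?] := lerP 1 (a + 1/2); first by constructor 1; split=> //=; exact: clamp1.
  by constructor 4; split=> //=; apply: max_l; rewrite ge_max; apply/andP; split; lra.
- case=> -[//= _ e].
  + rewrite (e1 e) e clamp1; last by lra.
    by congr pair; rewrite (max_l (y := - _ - _)) ?(max_r (x := 0)); lra.
  + rewrite (e0 e) e clamp0; last by lra.
    by congr pair; rewrite (max_r (x := _ - 1/2)) ?(max_r (x := 0)); lra.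
  + rewrite (ey e) e clamp_id; last by apply/andP; split; lra.
    by congr pair; [lra | apply: max_l; rewrite ge_max; apply/andP; split; lra].
Qed.

Lemma arc_side_retract e w n s ne nw se sw : arc8 e w n s ne nw se sw ->
  side_retract e w n s.
Proof.
have r1 := side_retract1; have r2 := side_retract2; have r3 := side_retract3.
have X := side_retract_refl; have Y := side_retract_reflV; have Z := side_retract_swap.
by case: e w n s => [] [] [] [] //= _; first [ exact: r1 | exact: r2 | exact: r3
  | exact: X r2 | exact: Y r2 | exact: Y (X _ _ _ _ r2) | exact: Y r1 | exact: Y r3
  | exact: Z r1 | exact: Z (Y _ _ _ _ r1) | exact: Z r3 | exact: Z (Y _ _ _ _ r3)
  | exact: X (Z _ _ _ _ r1) | exact: X (Z _ _ _ _ r3) ].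
Qed.

Definition corner c : R * R := (c.1%:~R, c.2%:~R).

Lemma in_unit_square c z : unit_square R c z <-> in_unit (vsub z (corner c)).
Proof.
rewrite unit_squareP /in_unit /vsub /=.
by split=> -[h1 h2 h3 h4]; split; lra.
Qed.

Lemma int_meet (a b : int) (r : R) : a%:~R <= r -> r <= a%:~R + 1 ->
  b%:~R <= r -> r <= b%:~R + 1 ->
  exists2 d : int, b = a + d & [\/ d = 0, d = 1 /\ r - a%:~R = 1 | d = -1 /\ r - a%:~R = 0].
Proof.
move=> h1 h2 h3 h4.
have ab : a <= b + 1 by rewrite -(ler_int R) rmorphD; apply: le_trans h1 h4.
have ba : b <= a + 1 by rewrite -(ler_int R) rmorphD; apply: le_trans h3 h2.
exists (b - a); first by lia.
have [e|[e|e]] : b = a \/ b = a + 1 \/ b = a - 1 by lia.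
- by constructor 1; lia.
- by constructor 2; split; [lia | move: h3; rewrite e rmorphD /=; lra].
- by constructor 3; split; [lia | move: h4; rewrite e rmorphB /=; lra].
Qed.

Lemma square_meet c d z : unit_square R c z -> unit_square R d z ->
  exists dx dy, [/\ d = shift2 c dx dy,
    [\/ dx = 0, dx = 1 /\ z.1 - c.1%:~R = 1 | dx = -1 /\ z.1 - c.1%:~R = 0] &
    [\/ dy = 0, dy = 1 /\ z.2 - c.2%:~R = 1 | dy = -1 /\ z.2 - c.2%:~R = 0]].
Proof.
move=> /unit_squareP[h1 h2 h3 h4] /unit_squareP[k1 k2 k3 k4].
have [dx ex hx] := int_meet h1 h2 k1 k2; have [dy ey hy] := int_meet h3 h4 k3 k4.
by exists dx, dy; split=> //; rewrite /shift2 -ex -ey; case: (d).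
Qed.

Definition nb (P : square -> bool) c dx dy : bool := P (shift2 c dx dy).

Lemma on_sides_realize (P : square -> bool) S c z : (forall d, P d -> d \in S) ->
  unit_square R c z ->
  on_sides (nb P c 1 0) (nb P c (-1) 0) (nb P c 0 1) (nb P c 0 (-1)) (vsub z (corner c)) ->
  realize R S z.
Proof.
move=> hP /unit_squareP[h1 h2 h3 h4]; rewrite /vsub /corner /=.
by case=> -[/hP hd /= e]; [exists (shift2 c 1 0)|exists (shift2 c (-1) 0)|
  exists (shift2 c 0 1)|exists (shift2 c 0 (-1))] => //=; apply/unit_squareP;
  rewrite /= ?rmorphD ?addr0 /=; split=> //; lra.
Qed.

(** The conditions on diagonal neighbours say precisely that a contact at a corner already lies on a
    side that is present. *)
Lemma arc_on_sides S c z : c \notin S -> arc (mem S) c -> unit_square R c z ->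
  realize R S z ->
  let n := nb (mem S) c in on_sides (n 1 0) (n (-1) 0) (n 0 1) (n 0 (-1)) (vsub z (corner c)).
Proof.
move=> cS; rewrite /arc -!/(nb _ _ _ _); set n := nb _ c => ha hz [d /= dS hd].
have [dx [dy [ed hx hy]]] := square_meet hz hd.
have nd : n dx dy by rewrite /n /nb -ed.
have n00 : n 0 0 = false.
  by rewrite /n /nb /shift2 !addr0 /=; apply/negbTE; case: (c) cS.
rewrite /on_sides /vsub /corner /=; move: ha nd.
by case: hx => [->|[-> ->]|[-> ->]]; case: hy => [->|[-> ->]|[-> ->]]; rewrite ?n00 //;
  case: (n 1 0); case: (n (-1) 0); case: (n 0 1); case: (n 0 (-1));
  case: (n 1 1); case: (n (-1) 1); case: (n 1 (-1)); case: (n (-1) (-1)) => //= _ _;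
  first [by constructor 1 | by constructor 2 | by constructor 3 | by constructor 4].
Qed.

Lemma closed_square c : closed (unit_square R c).
Proof.
rewrite -[X in closed X]setCK; apply: open_closedC; rewrite openE => z hz.
apply/nbhs_pairP; apply: contrapT => H; apply: hz; apply/unit_squareP.
split; rewrite leNgt; apply/negP => lt; apply: H.
- exists (c.1%:~R - z.1); first by lra.
  by move=> w; rewrite ltr_norml => /andP[? ?] _ /unit_squareP[*]; lra.
- exists (z.1 - c.1%:~R - 1); first by lra.
  by move=> w; rewrite ltr_norml => /andP[? ?] _ /unit_squareP[*]; lra.
- exists (c.2%:~R - z.2); first by lra.
  by move=> w _; rewrite ltr_norml => /andP[? ?] /unit_squareP[*]; lra.
- exists (z.2 - c.2%:~R - 1); first by lra.
  by move=> w _; rewrite ltr_norml => /andP[? ?] /unit_squareP[*]; lra.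
Qed.

Lemma realize_fset1U c S : realize R (c |` S)%fset = realize R S `|` unit_square R c.
Proof.
apply/seteqP; split=> z.
  by case=> d /=; rewrite !inE => /orP[/eqP ->|h] hz; [right | left; exists d].
by case=> [[d /= hd hz]|hz]; [exists d|exists c] => //=; rewrite !inE ?eqxx ?hd ?orbT.
Qed.

Lemma realize0 : realize R fset0 = set0.
Proof. by apply/seteqP; split=> z // -[d]; rewrite /= inE. Qed.

Lemma closed_realize S : closed (realize R S).
Proof.
elim/finmap.finSet_rect: S => S IH; have [->|[c cS]] := fset_0Vmem S.
  by rewrite realize0; exact: closed0.
rewrite -(fsetD1K cS) realize_fset1U; apply: closedU; last exact: closed_square.
by apply: IH; rewrite fproperD1.
Qed.

Lemma convex_square c : convex2 (unit_square R c).
Proof.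
move=> x y t /unit_squareP[h1 h2 h3 h4] /unit_squareP[k1 k2 k3 k4] /andP[t0 t1].
by apply/unit_squareP; rewrite /vadd /vscale /=; split; nra.
Qed.

(** The identity on [S] and the retraction of the cell agree on the contact and glue because both
    sets are closed. *)
Lemma arc_retraction S c : c \notin S -> arc (mem S) c ->
  exists rho, [/\ {within realize R S `|` unit_square R c, continuous rho},
    forall z, realize R S z -> rho z = z &
    forall z, unit_square R c z -> realize R S (rho z) /\ unit_square R c (rho z)].
Proof.
move=> cS ha; have [r cr hr] := arc_side_retract ha; rewrite -!/(nb _ _ _ _) in hr.
pose f z := vadd (corner c) (r (vsub z (corner c))).
pose rho z := if `[< unit_square R c z >] then f z else z.
have cf : continuous f.
  apply: continuous_vadd; first exact: continuous_const.
  have cs : continuous (fun z : R * R => vsub z (corner c)) by cont.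
  by move=> z; apply: (cvg_comp _ _ (cs z)); exact: cr.
have fK u : vsub (vadd (corner c) u) (corner c) = u.
  by rewrite /vsub /vadd /= ![_ + u.1]addrC ![_ + u.2]addrC !addrK; case: u.
have Kf z : vadd (corner c) (vsub z (corner c)) = z.
  by rewrite /vsub /vadd /= ![_%:~R + _]addrC !subrK; case: z.
have idS z : realize R S z -> rho z = z.
  move=> hz; rewrite /rho; case: asboolP => // hc.
  have [_ _] := hr _ ((in_unit_square c z).1 hc); rewrite /f => ->; first exact: Kf.
  exact: arc_on_sides.
exists rho; split=> //.
- apply: withinU_continuous; [exact: closed_realize | exact: closed_square | |].
    have ci : {within realize R S, continuous (fun z : R * R => z)}.
      by apply: continuous_subspaceT; exact: continuous_self.
    by apply: subspace_eq_continuous ci => z; rewrite inE => /idS.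
  have cf' : {within unit_square R c, continuous f} by exact: continuous_subspaceT.
  have e z : unit_square R c z -> f z = rho z by move=> hz; rewrite /rho asboolT.
  by apply: subspace_eq_continuous cf' => z; rewrite inE => /e.
- move=> z hz; rewrite /rho; case: asboolP => // _.
  have [h1 h2 _] := hr _ ((in_unit_square c z).1 hz).
  have hc : unit_square R c (f z) by apply/in_unit_square; rewrite fK.
  by split=> //; apply: (@on_sides_realize (mem S) _ c) => //; rewrite fK.
Qed.

Lemma seq_fset_cons c (s : seq square) : [fset x in c :: s]%fset = (c |` [fset x in s])%fset.
Proof. by apply/fsetP => x; rewrite !inE. Qed.

Lemma arc_seq (s : seq square) c : arc (mem [fset x in s]%fset) c = arc (mem s) c.
Proof. by apply: eq_arc => x; rewrite /= !inE. Qed.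

Lemma shelled_contractible s : shelled s -> contractible (realize R [fset c in s]%fset).
Proof.
elim: s => // c s IH /=; rewrite seq_fset_cons realize_fset1U.
case/orP => [/eqP ->|/and3P[cs ha hs]].
  have -> : [fset x in [::]]%fset = fset0 :> cells by apply/fsetP => x; rewrite !inE.
  rewrite realize0 set0U; apply: (@contractible_convex _ _ (corner c)); first exact: convex_square.
  by apply/unit_squareP; rewrite /corner /=; split; lra.
have [|rho [h1 h2 h3]] := @arc_retraction [fset x in s]%fset c _ (etrans (arc_seq _ _) ha).
  by rewrite !inE.
by apply: contractible_retract h1 h2 h3; [exact: IH | exact: convex_square].
Qed.

Definition segment x y : set (R * R) :=
  (fun t => vadd (vscale (1 - t) x) (vscale t y)) @` `[0, 1].

Lemma connected_segment x y : connected (segment x y).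
Proof.
apply: connected_continuous_connected; first exact: segment_connected.
by apply: continuous_subspaceT; cont.
Qed.

Lemma segmentl x y : segment x y x.
Proof.
exists 0; first by rewrite /= in_itv /= lexx ler01.
by rewrite /vadd /vscale /= subr0 !mul1r !mul0r !addr0; case: x.
Qed.

Lemma segmentr x y : segment x y y.
Proof.
exists 1; first by rewrite /= in_itv /= lexx ler01.
by rewrite /vadd /vscale /= subrr !mul1r !mul0r !add0r; case: y.
Qed.

(** Connectedness inside the interior, in terms of a connected set joining two points. *)
Definition linked S x y : Prop := exists K, [/\ connected K, K `<=` (realize R S)°, K x & K y].

Lemma linked_sym S x y : linked S x y -> linked S y x.
Proof. by case=> K [? ? ? ?]; exists K. Qed.

Lemma linked_trans S y x z : linked S x y -> linked S y z -> linked S x z.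
Proof.
case=> K [h1 h2 h3 h4] [L [k1 k2 k3 k4]]; exists (K `|` L); split; [|by move=> t [/h2|/k2]|by left|by right].
by apply: connectedU => //; exists y.
Qed.

Lemma linked_sub S S' x y : {subset S <= S'} -> linked S x y -> linked S' x y.
Proof.
move=> h [K [h1 h2 h3 h4]]; exists K; split=> // z /h2; apply: interiorS => {}z [d /= hd hz].
by exists d => //=; apply: h.
Qed.

Lemma linked_east S c : c \in S -> shift2 c 1 0 \in S ->
  linked S (center R c) (center R (shift2 c 1 0)).
Proof.
move=> h1 h2; exists (segment (center R c) (center R (shift2 c 1 0))).
split; [exact: connected_segment | | exact: segmentl | exact: segmentr].
move=> _ [t ht <-]; move: ht; rewrite /= in_itv /= => /andP[t0 t1].
apply/nbhs_pairP; exists (1/2); first by lra.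
move=> [x y]; rewrite /center /vadd /vscale /= rmorphD /= addr0 !ltr_norml.
move=> /andP[a1 a2] /andP[b1 b2]; have [le|gt] := lerP x (c.1%:~R + 1).
  by exists c => //; apply/unit_squareP => /=; split; nra.
by exists (shift2 c 1 0) => //; apply/unit_squareP; rewrite /= rmorphD /= addr0; split; nra.
Qed.

Lemma linked_north S c : c \in S -> shift2 c 0 1 \in S ->
  linked S (center R c) (center R (shift2 c 0 1)).
Proof.
move=> h1 h2; exists (segment (center R c) (center R (shift2 c 0 1))).
split; [exact: connected_segment | | exact: segmentl | exact: segmentr].
move=> _ [t ht <-]; move: ht; rewrite /= in_itv /= => /andP[t0 t1].
apply/nbhs_pairP; exists (1/2); first by lra.
move=> [x y]; rewrite /center /vadd /vscale /= rmorphD /= addr0 !ltr_norml.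
move=> /andP[a1 a2] /andP[b1 b2]; have [le|gt] := lerP y (c.2%:~R + 1).
  by exists c => //; apply/unit_squareP => /=; split; nra.
by exists (shift2 c 0 1) => //; apply/unit_squareP; rewrite /= rmorphD /= addr0; split; nra.
Qed.

Lemma shift2K c dx dy : shift2 (shift2 c dx dy) (- dx) (- dy) = c.
Proof. by rewrite /shift2 /= !addrK; case: c. Qed.

Lemma linked_side S c (dx dy : int) : c \in S -> shift2 c dx dy \in S ->
  (dx, dy) \in [:: (1, 0); (-1, 0); (0, 1); (0, -1)] ->
  linked S (center R c) (center R (shift2 c dx dy)).
Proof.
move=> h1 h2; rewrite !inE => /or4P[] /eqP[ex ey]; rewrite ex ey in h2 *.
- exact: linked_east.
- apply: linked_sym; have := @linked_east S (shift2 c (-1) 0) h2.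
  by have := shift2K c (-1) 0; rewrite opprK oppr0 => ->; apply.
- exact: linked_north.
- apply: linked_sym; have := @linked_north S (shift2 c 0 (-1)) h2.
  by have := shift2K c 0 (-1); rewrite opprK oppr0 => ->; apply.
Qed.

Lemma arc_side P c : arc P c -> exists2 d : int * int,
  d \in [:: (1, 0); (-1, 0); (0, 1); (0, -1)] & P (shift2 c d.1 d.2).
Proof.
rewrite /arc; case E1: (P (shift2 c 1 0)); first by exists (1, 0).
case E2: (P (shift2 c (-1) 0)); first by exists (-1, 0).
case E3: (P (shift2 c 0 1)); first by exists (0, 1).
by case E4: (P (shift2 c 0 (-1))); first by exists (0, -1).
Qed.

Lemma shelled_linked s : shelled s -> exists c0, {in s, forall c,
  linked [fset x in s]%fset (center R c0) (center R c)}.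
Proof.
elim: s => // c s IH /= /orP[/eqP ->|/and3P[cs ha /IH[c0 h0]]].
  exists c => d; rewrite inE => /eqP ->; exists [set center R c]; split=> //; first exact: connected1.
  by move=> _ ->; apply: (@open_cell_interior _ c); [rewrite !inE eqxx | exact: center_open].
exists c0 => d.
have mono : {subset [fset x in s]%fset <= [fset x in c :: s]%fset}.
  by move=> x; rewrite !inE => ->; rewrite orbT.
have [[dx dy] hd /= hs] := arc_side ha.
rewrite inE => /orP[/eqP ->|hds]; last by apply: linked_sub mono _; apply: h0.
apply: (@linked_trans _ (center R (shift2 c dx dy))); first by apply: linked_sub mono _; apply: h0.
by apply: linked_sym; apply: linked_side; rewrite // !inE ?eqxx //; move: hs; rewrite /= => ->; rewrite orbT.
Qed.

Lemma shelled_region s : shelled s -> region R [fset c in s]%fset.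
Proof.
move=> /shelled_linked[c0 h0]; rewrite /region; set A := (X in connected X).
have -> : A = \bigcup_(K in [set K | [/\ connected K, K `<=` A & K (center R c0)]]) K.
  apply/seteqP; split=> z; last by case=> K /= [_ hK _] /hK.
  move=> Az; have [c /= cS hc] := interior_subset Az.
  (* An interior point is joined to the center of a cell containing it by a segment which, except
     possibly at this point, runs in the open cell. *)
  have [K [k1 k2 k3 k4]] : linked [fset x in s]%fset (center R c0) z.
    apply: (@linked_trans _ (center R c)); first by apply: h0; move: cS; rewrite !inE.
    exists (segment (center R c) z); split; [exact: connected_segment| |exact: segmentl|exact: segmentr].
    move=> _ [t ht <-]; move: ht; rewrite /= in_itv /= => /andP[t0 t1].
    have [->|ne] := eqVneq t 1.
      by rewrite /vadd /vscale /= subrr !mul0r !mul1r !add0r; case: (z) Az.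
    have {}t1 : t < 1 by rewrite lt_neqAle ne.
    apply: (@open_cell_interior _ c) => //; move: hc => /unit_squareP[a1 a2 a3 a4].
    by rewrite /center /vadd /vscale; split=> /=; nra.
  by exists K.
apply: bigcup_connected; first by exists (center R c0) => K /= [].
by move=> K /= [].
Qed.

End Shelling.

(** * Simply connected regions are shellable *)

Section Peeling.
Variable R : realType.
Local Open Scope ring_scope.
Local Open Scope classical_set_scope.
Implicit Types (S C D K : cells) (c d : square) (u z : R * R).

Definition adj c d : bool :=
  d \in [:: shift2 c 1 0; shift2 c (-1) 0; shift2 c 0 1; shift2 c 0 (-1)].

Lemma adj_sym c d : adj c d = adj d c.
Proof.
rewrite /adj !inE /shift2; case: c d => [a b] [a' b']; rewrite !xpair_eqE /=.
by apply/idP/idP; lia.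
Qed.

(** Connectedness of the graph of cells sharing a side, phrased as: a nonempty set closed under side
    neighbours is everything. *)
Definition conn4 S : Prop := forall C, C != fset0 -> {subset C <= S} ->
  (forall c d, c \in C -> d \in S -> adj c d -> d \in C) -> {subset S <= C}.

Lemma interior_square S z e : (realize R S)° z -> unit_square R e z -> e \in S.
Proof.
move=> /nbhs_pairP[r r0 hr] /unit_squareP[h1 h2 h3 h4].
pose t := Num.min (1/2) r; have t0 : 0 < t by rewrite lt_min r0 andbT; lra.
have t1 : t <= 1/2 by rewrite ge_min lexx.
have tr : t <= r by rewrite ge_min lexx orbT.
pose w : R * R := (z.1 + t * (e.1%:~R + 2^-1 - z.1), z.2 + t * (e.2%:~R + 2^-1 - z.2)).
have hw : @open_cell R e w by rewrite /w; split=> /=; nra.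
apply/(open_cell_realize _ hw); apply: hr; rewrite /w /= opprD addrA subrr add0r normrN.
  by rewrite ltr_norml; apply/andP; split; nra.
by rewrite ltr_norml; apply/andP; split; nra.
Qed.

(** The closed sets realized by a component and by its complement are disjoint inside the interior
    of [S], so one of them is empty. *)
Lemma region_conn4 S : region R S -> conn4 S.
Proof.
move=> hr C /fset0Pn[c0 c0C] CS hC d dS; apply: contraT => dC.
pose A := (realize R S)°; pose D := (S `\` C)%fset.
have key z c e : A z -> c \in C -> e \in D -> unit_square R c z -> unit_square R e z -> False.
  move=> Az cC; rewrite inE => /andP[/negP eC eS] hc he; apply: eC.
  have [dx [dy [ee hx hy]]] := square_meet hc he.
  have st p q dx' dy' : p \in C -> q \in S -> q = shift2 p dx' dy' ->
      [\/ dx' = 0 /\ (dy' = 1 \/ dy' = -1) | dy' = 0 /\ (dx' = 1 \/ dx' = -1)] -> q \in C.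
    move=> pC qS eq h; apply: (hC p q) => //; rewrite /adj eq !inE.
    by case: h => -[-> [->|->]]; rewrite eqxx ?orbT.
  (* The cells [c] and [e] meet only at a corner. Since this point is interior, a third cell around
     it lies in [S] and joins the two by sides. *)
  have vm : (dx = 1 \/ dx = -1) -> (dy = 1 \/ dy = -1) -> e \in C.
    move=> kx ky; pose f := shift2 c dx 0.
    have hf : unit_square R f z.
      move: hc he => /unit_squareP[? ? ? ?]; rewrite ee => /unit_squareP[/= ? ? _ _].
      by apply/unit_squareP; rewrite /f /= addr0; split.
    have fS := interior_square Az hf.
    have fC : f \in C by apply: (st c f dx 0) => //; right.
    apply: (st f e 0 dy) => //; last by left.
    by rewrite ee /f /shift2 /= !addr0.
  case: hx => [ex|[ex _]|[ex _]]; case: hy => [ey|[ey _]|[ey _]];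
    try (by apply: vm; rewrite ?ex ?ey; auto);
    try (by apply: (st c e dx dy) => //; rewrite ?ex ?ey; auto).
  by move: ee; rewrite ex ey /shift2 !addr0 => ->; case: (c) cC.
have AU z : A z -> realize R C z \/ realize R D z.
  move=> /interior_subset[e /= eS he]; have [eC|eC] := boolP (e \in C).
    by left; exists e.
  by right; exists e => //=; rewrite inE eC.
have hB : A `&` realize R C = A.
  apply: hr.
  - exists (center R c0); split; last by apply/center_realize.
    by apply: (@open_cell_interior _ c0); [exact: CS | exact: center_open].
  - exists (~` realize R D); first by apply: closed_openC; exact: closed_realize.
    apply/seteqP; split=> z [Az hz]; split=> //; last by case: (AU z Az).
    by move=> [e eD he]; case: hz => c cC hc; apply: (key z c e).
  - by exists (realize R C) => //; exact: closed_realize.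
have : A (center R d) by apply: (@open_cell_interior _ d) => //; exact: center_open.
by rewrite -hB => -[_ /center_realize]; rewrite (negbTE dC).
Qed.

Lemma conn4_add K c d : conn4 K -> c \in K -> adj c d -> conn4 (d |` K)%fset.
Proof.
move=> hK cK cd C C0 CK hC.
have Kd x : x \in K -> x \in (d |` K)%fset by rewrite !inE => ->; rewrite orbT.
have [[k kC kK]|no] := pselect (exists2 k, k \in C & k \in K).
  have KC : {subset K <= C}.
    move=> x xK; have : x \in (C `&` K)%fset.
      apply: (hK (C `&` K)%fset) => //; first by apply/fset0Pn; exists k; rewrite inE kC.
        by move=> y; rewrite inE => /andP[].
      move=> y y'; rewrite inE => /andP[yC yK] y'K a; rewrite inE y'K andbT.
      by apply: hC a => //; exact: Kd.
    by rewrite inE => /andP[].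
  move=> x; rewrite !inE => /orP[/eqP ->|/KC //].
  by apply: (hC c d) => //; [exact: KC | rewrite !inE eqxx].
case/fset0Pn: C0 => x xC; have := CK x xC; rewrite !inE => /orP[/eqP ex|xK]; last first.
  by case: no; exists x.
by case: no; exists c => //; apply: (hC d c); [rewrite -ex | exact: Kd | rewrite adj_sym].
Qed.

Lemma conn4_1 c : conn4 [fset c]%fset.
Proof.
move=> C /fset0Pn[x xC] CS _ d; rewrite inE => /eqP ->.
by have := CS x xC; rewrite inE => /eqP <-.
Qed.

Lemma fset_argmax D (f : square -> int) : D != fset0 ->
  exists2 d, d \in D & forall e, e \in D -> f e <= f d.
Proof.
elim/finmap.finSet_rect: D => D IH /fset0Pn[c cD].
have [e|ne] := eqVneq (D `\ c)%fset fset0.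
  exists c => // x xD; have [->//|ne] := eqVneq x c.
  by have : x \in (D `\ c)%fset; [rewrite !inE ne | rewrite e inE].
have [|d] := IH _ _ ne; first by rewrite fproperD1.
rewrite !inE => /andP[dc dD] hd; have [le|gt] := lerP (f c) (f d).
  exists d => // x xD; have [->//|nx] := eqVneq x c.
  by apply: hd; rewrite !inE nx.
exists c => // x xD; have [->//|nx] := eqVneq x c.
by apply: le_trans (ltW gt); apply: hd; rewrite !inE nx.
Qed.

(** Removing a cell with a free upper or lower side excludes most neighbourhoods that are not arcs;
    the few left are cut by one line each. *)
Definition exposed S c := (shift2 c 0 1 \notin S) || (shift2 c 0 (-1) \notin S).

(* Among the pairs of an exposed cell [q] and a connected [K] avoiding [q], the
   one with the largest [K] exhausts [S]: the topmost and the bottommost cell of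
   a nonempty rest are next to [q] or exposed, and cannot both be next to [q]. *)
Lemma exists_peel_from S q K : conn4 S -> q \in S -> exposed S q -> K != fset0 ->
  conn4 K -> {subset K <= S} -> q \notin K ->
  exists q', [/\ q' \in S, exposed S q' & conn4 (S `\ q')%fset].
Proof.
move=> hS; have [n] := ubnP (#|` S| - #|` K|); elim: n q K => // n IH q K hn qS qe K0 cK KS qK.
have lt d : d \notin K -> d \in S -> (#|` S| - #|` (d |` K)%fset| < #|` S| - #|` K|)%N.
  move=> dK dS; rewrite cardfsU1 dK /=.
  have : (#|` (d |` K)%fset| <= #|` S|)%N.
    apply: fsubset_leq_card; apply/fsubsetP => x; rewrite !inE => /orP[/eqP ->//|]; exact: KS.
  by rewrite cardfsU1 dK /=; move: #|` S| #|` K| => a b; lia.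
have [[d [c [dS dK dq cK' a]]]|no] := pselect (exists d c,
    [/\ d \in S, d \notin K, d != q, c \in K & adj c d]).
  apply: (IH q (d |` K)%fset) => //.
  - by apply: leq_trans (lt d dK dS) _; rewrite -ltnS.
  - by apply/fset0Pn; exists d; rewrite !inE eqxx.
  - exact: conn4_add a.
  - by move=> x; rewrite !inE => /orP[/eqP ->|/KS].
  - by rewrite !inE negb_or eq_sym dq.
have [c cK' a] : exists2 c, c \in K & adj c q.
  apply: contrapT => H; have cl x y : x \in K -> y \in S -> adj x y -> y \in K.
    move=> xK yS xy; apply: contraT => yK; have [e|ne] := eqVneq y q.
      by exfalso; apply: H; exists x; rewrite -?e.
    by exfalso; apply: no; exists y, x.
  by have := hS K K0 KS cl q qS; rewrite (negbTE qK).
pose D := (S `\` (q |` K))%fset.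
have DP d : d \in D = [&& d != q, d \notin K & d \in S] by rewrite !inE negb_or -andbA.
have [e|D0] := eqVneq D fset0.
  exists q; split=> //; suff -> : (S `\ q)%fset = K by [].
  apply/fsetP => x; rewrite !inE; apply/idP/idP => [/andP[xq xS]|xK].
    apply: contraT => xK; have : x \in D by rewrite DP xq xK.
    by rewrite e inE.
  by rewrite KS // andbT; apply: contraNneq qK => <-.
have next d x : d \in D -> adj d x -> x \notin D -> x \notin S \/ x = q.
  move=> dD dx; rewrite DP; have [->|xq] := eqVneq x q; first by right.
  have [xK|xK] := boolP (x \in K); last by left.
  exfalso; move: dD; rewrite DP => /and3P[dq dK dS].
  by apply: no; exists d, x; rewrite adj_sym.
have [d1 d1D m1] := fset_argmax (fun c => c.2) D0.
have [d2 d2D m2] := fset_argmax (fun c => - c.2) D0.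
have a1 : adj d1 (shift2 d1 0 1) by rewrite /adj !inE eqxx !orbT.
have a2 : adj d2 (shift2 d2 0 (-1)) by rewrite /adj !inE eqxx !orbT.
have n1 : shift2 d1 0 1 \notin D by apply/negP => /m1 /=; rewrite gerDl.
have n2 : shift2 d2 0 (-1) \notin D by apply/negP => /m2 /=; rewrite lerN2 lerDl.
have [d dD de] : exists2 d, d \in D & exposed S d.
  have [h|h1] := next _ _ d1D a1 n1; first by exists d1; rewrite // /exposed h.
  have [h|h2] := next _ _ d2D a2 n2; first by exists d2; rewrite // /exposed h orbT.
  have m12 : d2.2 <= d1.2 := m1 d2 d2D.
  have e1 : d1.2 + 1 = q.2 by rewrite -h1.
  have e2 : d2.2 - 1 = q.2 by rewrite -h2.
  by move: m12 e1 e2; clear; move: (d1.2) (d2.2) (q.2) => a b e; lia.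
move: (dD); rewrite DP => /and3P[dq dK dS].
apply: (IH d (q |` K)%fset) => //.
- by apply: leq_trans (lt q qK qS) _; rewrite -ltnS.
- by apply/fset0Pn; exists q; rewrite !inE eqxx.
- exact: conn4_add a.
- by move=> x; rewrite !inE => /orP[/eqP ->|/KS].
- by rewrite !inE negb_or dq.
Qed.

Lemma exists_peel S : conn4 S -> (1 < #|` S|)%N ->
  exists q, [/\ q \in S, exposed S q & conn4 (S `\ q)%fset].
Proof.
move=> hS S1; have S0 : S != fset0 by rewrite -cardfs_gt0; exact: ltnW.
have [q qS hq] := fset_argmax (fun c => c.2) S0.
have qe : exposed S q by rewrite /exposed; apply/orP; left; apply/negP => /hq /=; rewrite gerDl.
have [k] : exists k, k \in (S `\ q)%fset.
  by apply/fset0Pn; rewrite -cardfs_gt0; move: S1; rewrite (cardfsD1 q S) qS.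
rewrite !inE => /andP[kq kS].
apply: (@exists_peel_from S q [fset k]%fset) => //.
- by apply/fset0Pn; exists k; rewrite inE.
- exact: conn4_1.
- by move=> x; rewrite inE => /eqP ->.
- by rewrite inE eq_sym.
Qed.

Lemma adj_meet c d : adj c d -> exists p, unit_square R c p /\ unit_square R d p.
Proof.
rewrite /adj !inE => /or4P[] /eqP ->.
- exists (c.1%:~R + 1, c.2%:~R); split; apply/unit_squareP; rewrite /= ?rmorphD ?addr0 /=; split; lra.
- exists (c.1%:~R, c.2%:~R); split; apply/unit_squareP; rewrite /= ?rmorphD ?addr0 /=; split; lra.
- exists (c.1%:~R, c.2%:~R + 1); split; apply/unit_squareP; rewrite /= ?rmorphD ?addr0 /=; split; lra.
- exists (c.1%:~R, c.2%:~R); split; apply/unit_squareP; rewrite /= ?rmorphD ?addr0 /=; split; lra.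
Qed.

Definition line (x y : R * R) (t : R) : R * R := vadd (vscale (1 - t) x) (vscale t y).

Lemma line0 x y : line x y 0 = x.
Proof. by rewrite /line /vadd /vscale /= subr0 !mul1r !mul0r !addr0; case: x. Qed.

Lemma line1 x y : line x y 1 = y.
Proof. by rewrite /line /vadd /vscale /= subrr !mul1r !mul0r !add0r; case: y. Qed.

Lemma line_path Q x y : convex2 Q -> Q x -> Q y -> is_path Q (line x y).
Proof. by move=> cQ Qx Qy; apply: is_pathI; [rewrite /line; cont | move=> t ht; apply: cQ]. Qed.

Lemma is_path_sub (A B : set (R * R)) g : A `<=` B -> is_path A g -> is_path B g.
Proof. by move=> AB [h1 h2]; split=> // z /h2/AB. Qed.

(** Cells sharing a side share a point, so a path can be prolonged by a segment from cell to
    cell. *)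
Lemma conn4_path_connected S : conn4 S -> path_connected (realize R S).
Proof.
move=> hS x y [c /= cS hc] [d /= dS hd].
pose G e := `[< forall p, unit_square R e p -> exists g, [/\ is_path (realize R S) g, g 0 = x & g 1 = p] >].
pose C := [fset e in S | G e]%fset.
have sub e : e \in S -> unit_square R e `<=` realize R S by move=> h z hz; exists e.
suff /(_ d dS) : {subset S <= C} by rewrite !inE => /andP[_ /asboolP]; apply.
apply: hS.
- apply/fset0Pn; exists c; rewrite !inE cS; apply/asboolP => p hp; exists (line x p).
  rewrite line0 line1; split=> //; apply: is_path_sub (sub c cS) _.
  by apply: line_path => //; exact: convex_square.
- by move=> e; rewrite !inE => /andP[].
- move=> e f; rewrite !inE => /andP[eS /asboolP ge] fS /adj_meet[p [pe pf]].
  rewrite fS; apply/asboolP => q hq; have [g [hg g0 g1]] := ge p pe.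
  have [||k [hk k0 k1 _ _]] := path_cat hg (_ : is_path _ (line p q)).
  + apply: is_path_sub (sub f fS) _; apply: line_path => //; exact: convex_square.
  + by rewrite line0.
  by exists k; rewrite k0 k1 line1.
Qed.

Definition near (e : R) (x y : R * R) : Prop := `|x.1 - y.1| < e /\ `|x.2 - y.2| < e.

Lemma near_sym e x y : near e x y -> near e y x.
Proof. by rewrite /near !(distrC y.1) !(distrC y.2). Qed.

(** Uniform continuity on the square, from its compactness, with a mesh of the form [N.+1%:R^-1]. *)
Lemma unif_square (H : R * R -> R * R) e : continuous H -> 0 < e ->
  exists N : nat, forall z w : R * R, 0 <= z.1 <= 1 -> 0 <= z.2 <= 1 ->
    `|z.1 - w.1| < N.+1%:R^-1 -> `|z.2 - w.2| < N.+1%:R^-1 -> near e (H z) (H w).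
Proof.
move=> cH e0.
pose P (n : nat) (z : R * R) := forall w : R * R, `|z.1 - w.1| < n.+1%:R^-1 ->
  `|z.2 - w.2| < n.+1%:R^-1 -> near e (H z) (H w).
have cpt : compact (`[0 : R, 1] `*` `[0 : R, 1]) by apply: compact_setX; exact: segment_compact.
have loc z : (`[0 : R, 1] `*` `[0 : R, 1]) z -> \forall z' \near z & n \near \oo, P n z'.
  move=> _; have /nbhs_pairP[r r0 hr] : nbhs z (fun w => near (e / 2) (H z) (H w)).
    apply: (cH z); apply/nbhs_pairP; exists (e / 2); first by lra.
    by move=> w h1 h2; split.
  exists ([set w | `|z.1 - w.1| < r / 2 /\ `|z.2 - w.2| < r / 2], [set n | n.+1%:R^-1 < r / 2]).
    split=> /=; first by apply/nbhs_pairP; exists (r / 2); [lra | split].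
    have r2 : 0 < r / 2 by lra.
    have [k hk] := ltr_add_invr r2; exists k => // n /= hn; rewrite add0r in hk.
    by apply: le_lt_trans hk; rewrite lef_pV2 ?posrE ?ltr0n // ler_nat.
  move=> [w n] [[a1 a2] hn] v b1 b2.
  have {}a1 : `|z.1 - w.1| < r / 2 := a1; have {}a2 : `|z.2 - w.2| < r / 2 := a2.
  have {}hn : n.+1%:R^-1 < r / 2 := hn.
  have {}b1 : `|w.1 - v.1| < n.+1%:R^-1 := b1; have {}b2 : `|w.2 - v.2| < n.+1%:R^-1 := b2.
  have tri (p q s a b : R) : `|p - q| < a -> `|q - s| < b -> `|p - s| < a + b.
    by move=> ? ?; rewrite -(subrK q p) -addrA; apply: le_lt_trans (ler_normD _ _) _; lra.
  have [c1 c2] : near (e / 2) (H z) (H v).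
    by apply: hr; [have := tri _ _ _ _ _ a1 (lt_trans b1 hn)
      | have := tri _ _ _ _ _ a2 (lt_trans b2 hn)]; lra.
  have [d1 d2] : near (e / 2) (H z) (H w) by apply: hr; lra.
  rewrite distrC in d1; rewrite distrC in d2.
  by split; [have := tri _ _ _ _ _ d1 c1 | have := tri _ _ _ _ _ d2 c2]; lra.
have [N _ hN] := (compact_near_coveringP _).1 cpt _ _ _ _ loc.
exists N => z w z1 z2; apply: (hN N (leqnn N)).
by split; rewrite /= in_itv.
Qed.

(** Two integer unit intervals containing nearby points have a common point, which can be chosen
    near the first of them. *)
Lemma common_coord (a b : int) (r q : R) : a%:~R <= r -> r <= a%:~R + 1 ->
  b%:~R <= q -> q <= b%:~R + 1 -> `|r - q| < 1/16 ->
  exists s, [/\ a%:~R <= s, s <= a%:~R + 1, b%:~R <= s, s <= b%:~R + 1 & `|r - s| <= 1/16].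
Proof.
move=> h1 h2 h3 h4; rewrite ltr_norml => /andP[h5 h6].
have i1 : b < a + 1 + 1 by rewrite -(ltr_int R) !rmorphD /=; lra.
have i2 : a < b + 1 + 1 by rewrite -(ltr_int R) !rmorphD /=; lra.
have j1 : b%:~R <= a%:~R + 1 :> R.
  by rewrite -(rmorphD _ a 1%Z) ler_int; lia.
have j2 : a%:~R <= b%:~R + 1 :> R.
  by rewrite -(rmorphD _ b 1%Z) ler_int; lia.
have [lt|ge] := ltrP r b%:~R; first by exists b%:~R; rewrite ler_norml; split; lra.
have [le|gt] := lerP r (b%:~R + 1); first by exists r; rewrite subrr normr0; split; lra.
by exists (b%:~R + 1); rewrite ler_norml; split; lra.
Qed.

Fixpoint xrow (X : Type) (cr : X -> X -> bool) (f : nat -> X) (n : nat) : bool :=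
  if n is k.+1 then xrow cr f k (+) cr (f k) (f n) else false.

(** The relations for the small squares are added modulo 2; the inner vertical edges cancel. *)
Lemma xrow_square (X : Type) (cr : X -> X -> bool) (f g : nat -> X) (M n : nat) :
  (forall k, (k < M)%N -> cr (f k) (f k.+1) (+) cr (f k.+1) (g k.+1) =
    cr (f k) (g k) (+) cr (g k) (g k.+1)) -> (n <= M)%N ->
  xrow cr f n (+) xrow cr g n = cr (f 0) (g 0) (+) cr (f n) (g n).
Proof.
move=> sq; elim: n => [|n IH] hn; first by rewrite !addbb.
have := IH (ltnW hn); have := sq n hn; rewrite /=.
by move: (xrow cr f n) (xrow cr g n) (cr (f n) (f n.+1)) (cr (f n.+1) (g n.+1)) (cr (f n) (g n))
  (cr (g n) (g n.+1)) (cr (f 0) (g 0)) => [] [] [] [] [] [] [].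
Qed.

(** * A line that separates the contacts of a cell *)

Section Cut.
Variables (S : cells) (c : square) (al be ga : R).
Hypothesis al1 : `|al| <= 1.
Hypothesis be1 : `|be| <= 1.
Let Q := unit_square R c.
Let A := realize R S `|` Q.
Let l (z : R * R) : R := al * (z.1 - c.1%:~R) + be * (z.2 - c.2%:~R) + ga.
Hypothesis cut_far : forall z, Q z -> realize R S z -> 1/2 <= `|l z|.

Lemma cut_lip (x y : R * R) (e : R) : `|x.1 - y.1| <= e -> `|x.2 - y.2| <= e -> `|l x - l y| <= 2 * e.
Proof.
move=> h1 h2; have -> : l x - l y = al * (x.1 - y.1) + be * (x.2 - y.2) by rewrite /l; ring.
apply: le_trans (ler_normD _ _) _; rewrite !normrM.
have := normr_ge0 (x.1 - y.1); have := normr_ge0 (x.2 - y.2).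
have := normr_ge0 al; have := normr_ge0 be; move: al1 be1.
move: `|al| `|be| `|_ - _| `|_ - _| h1 h2 => p q u v; nra.
Qed.

Let inQ x : bool := `[< Q x >].
Let side x : bool := 0 <= l x.
Let cross x y : bool := [&& inQ x, inQ y & side x (+) side y].

(** A point of [S] this close to a crossing would give a common point of the cell and [S] near the
    line, against [cut_far]. *)
Lemma cross_far x y z : near (1/16) x y -> near (1/16) x z -> cross x y -> A z -> inQ z.
Proof.
move=> [h1 h2] [h3 h4] /and3P[/asboolP Qx /asboolP Qy sd] Az; apply/asboolP.
case: Az => // -[d /= dS hd].
move: (Qx) (hd) => /unit_squareP[a1 a2 a3 a4] /unit_squareP[b1 b2 b3 b4].
have [s [s1 s2 s3 s4 s5]] := common_coord a1 a2 b1 b2 h3.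
have [t [t1 t2 t3 t4 t5]] := common_coord a3 a4 b3 b4 h4.
have Qp : Q (s, t) by apply/unit_squareP.
have Sp : realize R S (s, t) by exists d => //; apply/unit_squareP.
(* The sign change gives [|l x| <= 1/8], and the common point is within 1/16 of [x] in each
   coordinate, so there [|l|] is at most 1/4, less than 1/2. *)
have := cut_far Qp Sp; have := @cut_lip x (s, t) (1/16) s5 t5.
have := @cut_lip x y (1/16) (ltW h1) (ltW h2).
move: sd; rewrite /side; case: lerP => p1; case: lerP => p2 // _;
  rewrite !ler_norml => /andP[? ?] /andP[? ?]; rewrite ler_normr => /orP[?|?]; lra.
Qed.

(** If one edge of a small triangle crosses, its third vertex is in the cell as well, and among
    points of the cell crossing is the difference of two signs. *)
Lemma cross_cocycle x y z : A x -> A y -> A z ->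
  near (1/16) x y -> near (1/16) y z -> near (1/16) x z ->
  cross x y (+) cross y z = cross x z.
Proof.
move=> Ax Ay Az xy yz xz.
have f1 := @cross_far x y z xy xz; have f2 := @cross_far y z x yz (near_sym xy).
have f3 := @cross_far x z y xz xy; move: f1 f2 f3; rewrite /cross.
case: (inQ x); case: (inQ y); case: (inQ z); case: (side x); case: (side y); case: (side z) => //=
  f1 f2 f3; try (by have := f1 isT Az); try (by have := f2 isT Ax); try (by have := f3 isT Ay).
Qed.

(* Parity of the crossings of [l = 0] inside the cell, along the rows of a fine
   subdivision of a homotopy contracting a loop that crosses once. *)
Lemma cut_not_simply_connected p1 p2 : conn4 S -> Q p1 -> realize R S p1 -> Q p2 ->
  realize R S p2 -> l p1 < 0 -> 0 < l p2 -> ~ simply_connected A.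
Proof.
move=> hS Q1 S1 Q2 S2 l1 l2 [_ _ hA].
have [g [hg g0 g1]] := conn4_path_connected hS S2 S1.
have SA : realize R S `<=` A by move=> z ?; left.
have QA : Q `<=` A by move=> z ?; right.
have hL : is_path Q (line p1 p2) by apply: line_path => //; exact: convex_square.
(* The loop crosses the cell from [p1] to [p2] on a segment during the first half of the time and
   returns through [S] during the second. *)
have [|k [hk k0 k1 kl kr]] := path_cat (is_path_sub QA hL) (is_path_sub SA hg).
  by rewrite line1.
rewrite line0 in k0; rewrite g1 in k1.
have [H [cH HA Hs Ht]] : null_homotopic A k by apply: hA => //; rewrite k0 k1.
pose Hc (z : R * R) := H (clamp z.1, clamp z.2).
have cHc : continuous Hc.
  apply: (@continuous_into _ _ _ _ H (fun z : R * R => (clamp z.1, clamp z.2)) cH); first by cont.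
  by move=> z; split; exact: clamp_itv.
have e16 : 0 < 1/16 :> R by lra.
have [N hN] := unif_square cHc e16.
(* The mesh [1/M] is finer than the modulus of continuity, and [M] is even so that the time 1/2, at
   which the loop passes [p2], is a grid point. *)
pose M := (2 * N.+1)%N; pose h i j := H (i%:R / M%:R, j%:R / M%:R).
have M0 : 0 < M%:R :> R by rewrite ltr0n.
have itv i : (i <= M)%N -> 0 <= (i%:R / M%:R : R) <= 1.
  by move=> hi; rewrite divr_ge0 //= ler_pdivrMr // mul1r ler_nat.
have hcE i j : (i <= M)%N -> (j <= M)%N -> h i j = Hc (i%:R / M%:R, j%:R / M%:R).
  by move=> hi hj; rewrite /Hc /h /= !clamp_id // itv.
have hAh i j : (i <= M)%N -> (j <= M)%N -> A (h i j).
  by move=> hi hj; apply: HA; eexists; last reflexivity; split; rewrite /unit_itv /= in_itv /= itv.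
have st i j : (i <= j)%N -> (j <= i.+1)%N -> `|i%:R / M%:R - j%:R / M%:R : R| < N.+1%:R^-1.
  move=> h1 h2; rewrite -mulrBl normrM normfV (gtr0_norm M0) ltr_pdivrMr //.
  have -> : N.+1%:R^-1 * M%:R = 2 :> R by rewrite /M natrM mulrCA mulVf ?mulr1 // pnatr_eq0.
  have [->|->] : j = i \/ j = i.+1 by lia.
    by rewrite subrr normr0; lra.
  by rewrite -natr1 opprD addrA subrr add0r normrN normr1; lra.
have hnear i j i' j' : (i <= i' <= i.+1)%N -> (j <= j' <= j.+1)%N -> (i' <= M)%N -> (j' <= M)%N ->
    near (1/16) (h i j) (h i' j').
  move=> hi hj hi' hj'; rewrite !hcE //; try lia.
  by apply: hN => /=; [apply: itv; lia | apply: itv; lia | apply: st; lia | apply: st; lia].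
have le1 j : (j <= j <= j.+1)%N by rewrite leqnn leqnSn.
have le2 j : (j <= j.+1 <= j.+1)%N by rewrite leqnSn leqnn.
pose row i := xrow cross (h i).
have hrow i n : (i < M)%N -> (n <= M)%N ->
    row i n (+) row i.+1 n = cross (h i 0) (h i.+1 0) (+) cross (h i n) (h i.+1 n).
  move=> hi; apply: xrow_square => q hk'; have hi' := ltnW hi; have hk'' := ltnW hk'.
  rewrite (cross_cocycle (hAh i q hi' hk'') (hAh i q.+1 hi' hk') (hAh i.+1 q.+1 hi hk')
    (hnear i q i q.+1 (le1 i) (le2 q) hi' hk') (hnear i q.+1 i.+1 q.+1 (le2 i) (le1 q.+1) hi hk')
    (hnear i q i.+1 q.+1 (le2 i) (le2 q) hi hk')).
  by rewrite (cross_cocycle (hAh i q hi' hk'') (hAh i.+1 q hi hk'') (hAh i.+1 q.+1 hi hk')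
    (hnear i q i.+1 q (le2 i) (le1 q) hi hk'') (hnear i.+1 q i.+1 q.+1 (le1 i.+1) (le2 q) hi hk')
    (hnear i q i.+1 q.+1 (le2 i) (le2 q) hi hk')).
have cxx x : cross x x = false by rewrite /cross addbb !andbF.
have I01 i : (i <= M)%N -> unit_itv (i%:R / M%:R : R) by move=> hi; rewrite /unit_itv /= in_itv /= itv.
have h0 i : (i <= M)%N -> h i 0 = p1 by move=> hi; rewrite /h mul0r; have [-> _] := Ht _ (I01 i hi).
have hM i : (i <= M)%N -> h i M = p1.
  by move=> hi; rewrite /h divff ?gt_eqF //; have [_ ->] := Ht _ (I01 i hi).
(* The homotopy fixes the base point, so the two vertical sides of the square contribute no
   crossing. *)
have rowE i : (i <= M)%N -> row i M = row 0 M.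
  elim: i => // i IH hi; rewrite -IH; last exact: ltnW.
  have := hrow i M hi (leqnn M).
  rewrite (h0 i (ltnW hi)) (h0 i.+1 hi) (hM i (ltnW hi)) (hM i.+1 hi) !cxx.
  by case: (row i M); case: (row i.+1 M).
have rowM : row M M = false.
  have hc j : (j <= M)%N -> h M j = p1.
    by move=> hj; rewrite /h divff ?gt_eqF //; have [_ ->] := Hs _ (I01 j hj).
  have : forall n, (n <= M)%N -> row M n = false.
    by elim=> // n IH hn; rewrite /row /= -/(row M n) (IH (ltnW hn)) (hc n (ltnW hn)) (hc n.+1 hn) cxx.
  by apply.
have h0k j : (j <= M)%N -> h 0 j = k (j%:R / M%:R).
  by move=> hj; rewrite /h mul0r; have [-> _] := Hs _ (I01 j hj).
have half : M%:R = 2 * N.+1%:R :> R by rewrite /M natrM.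
have N0 : 0 < N.+1%:R :> R by rewrite ltr0n.
have leNM : (N.+1 <= M)%N by rewrite /M; clear; lia.
have lowQ j : (j <= N.+1)%N -> Q (h 0 j).
  move=> hj; rewrite h0k; last exact: leq_trans hj leNM.
  have b : 0 <= (j%:R / M%:R : R) <= 1/2.
    rewrite divr_ge0 //= ler_pdivrMr // half.
    have : j%:R <= N.+1%:R :> R by rewrite ler_nat.
    by lra.
  by rewrite kl //; apply: (path_in hL); move: b => /andP[? ?]; apply/andP; split; lra.
have highS j : (N.+1 <= j <= M)%N -> realize R S (h 0 j).
  case/andP=> hj1 hj2; rewrite h0k //.
  have b : 1/2 <= (j%:R / M%:R : R) <= 1.
    rewrite ler_pdivlMr // ler_pdivrMr // half.
    have : N.+1%:R <= j%:R :> R by rewrite ler_nat.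
    have : j%:R <= M%:R :> R by rewrite ler_nat.
    by rewrite half; lra.
  by rewrite kr //; apply: (path_in hg); move: b => /andP[? ?]; apply/andP; split; lra.
(* All points are in the cell here, and the count telescopes to a difference of signs. *)
have low n : (n <= N.+1)%N -> row 0 n = side p1 (+) side (h 0 n).
  elim: n => [|n IH] hn; first by rewrite h0 // addbb.
  rewrite /row /= -/(row 0%N n) (IH (ltnW hn)).
  have -> : cross (h 0 n) (h 0 n.+1) = side (h 0 n) (+) side (h 0 n.+1).
    by rewrite /cross /inQ (asboolT (lowQ n (ltnW hn))) (asboolT (lowQ n.+1 hn)).
  by rewrite addbA addbK.
have mid : h 0 N.+1 = p2.
  rewrite h0k //.
  have -> : N.+1%:R / M%:R = 1/2 :> R by rewrite half invfM mulrCA mulfV ?gt_eqF // mulr1 mul1r.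
  by rewrite kl; [rewrite mulrA mulr1 divff ?line1 // pnatr_eq0 | apply/andP; split; lra].
(* On the way back there is no crossing: points of the cell lying in [S] satisfy [|l| >= 1/2], and
   the step is too short to change sign. *)
have high n : (n <= N.+1)%N -> row 0%N (N.+1 + n)%N = true.
  elim: n => [|n IH] hn.
    by rewrite addn0 low // mid /side (ltW l2) addbT leNgt l1.
  have IH' := IH (ltnW hn); rewrite addnS.
  change (row 0%N (N.+1 + n)%N (+) cross (h 0%N (N.+1 + n)%N) (h 0%N (N.+1 + n).+1) = true).
  rewrite IH' addTb; apply/negP => /and3P[/asboolP q1 /asboolP q2].
  have hb : ((N.+1 + n).+1 <= M)%N by rewrite /M; clear -hn; lia.
  have f1 := cut_far q1 (highS (N.+1 + n)%N (introT andP (conj (leq_addr _ _) (ltnW hb)))).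
  have f2 := cut_far q2 (highS (N.+1 + n).+1 (introT andP (conj (leqW (leq_addr _ _)) hb))).
  have [n1 n2] := hnear 0%N (N.+1 + n)%N 0%N (N.+1 + n).+1 (le1 0%N) (le2 _) (leq0n _) hb.
  have := cut_lip (ltW n1) (ltW n2); move: f1 f2; rewrite /side.
  by case: (lerP 0 (l (h 0 (N.+1 + n)%N))) => s1; case: (lerP 0 (l (h 0 (N.+1 + n).+1))) => s2 //;
    rewrite !ler_normr ler_norml => /orP[?|?] /orP[?|?] /andP[? ?] _; lra.
have := high N.+1 (leqnn _); have -> : (N.+1 + N.+1 = M)%N by rewrite /M; clear; lia.
by rewrite -(rowE M (leqnn M)) rowM.
Qed.

End Cut.

(** A contact that is not an arc either has a left and a right part with nothing above and below, or
    an isolated contact at one corner and something else. These five cases correspond to a vertical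
    cut and four cuts that separate a corner. *)
Lemma bad_arc (e w n s ne nw se sw : bool) : ~~ n || ~~ s -> [|| e, w, n | s] ->
  ~~ arc8 e w n s ne nw se sw ->
  [|| [&& ~~ n, ~~ s, [|| e, ne | se] & [|| w, nw | sw]],
      [&& ~~ n, ~~ e, ne & [|| s, se, sw, w | nw]],
      [&& ~~ n, ~~ w, nw & [|| s, sw, se, e | ne]],
      [&& ~~ s, ~~ e, se & [|| n, ne, nw, w | sw]]
    | [&& ~~ s, ~~ w, sw & [|| n, nw, ne, e | se]]].
Proof. by case: e w n s ne nw se sw => [] [] [] [] [] [] [] []. Qed.

Lemma nb_point S c (dx dy : int) (x y : R) : nb (mem S) c dx dy ->
  0 <= x <= 1 -> 0 <= y <= 1 ->
  dx%:~R <= x -> x <= dx%:~R + 1 -> dy%:~R <= y -> y <= dy%:~R + 1 ->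
  unit_square R c (c.1%:~R + x, c.2%:~R + y) /\ realize R S (c.1%:~R + x, c.2%:~R + y).
Proof.
move=> h /andP[? ?] /andP[? ?] ? ? ? ?; split; first by apply/unit_squareP => /=; split; lra.
by exists (shift2 c dx dy) => //; apply/unit_squareP; rewrite /= !rmorphD /=; split; lra.
Qed.

Definition side_pos (d : int) (x : R) : Prop := [\/ d = 0, d = 1 /\ x = 1 | d = -1 /\ x = 0].

Lemma cut_case S c (al be ga : R) : conn4 S -> `|al| <= 1 -> `|be| <= 1 ->
  simply_connected (realize R S `|` unit_square R c) -> c \notin S ->
  (forall (dx dy : int) (x y : R), nb (mem S) c dx dy -> 0 <= x -> x <= 1 -> 0 <= y -> y <= 1 ->
    side_pos dx x -> side_pos dy y -> 1/2 <= `|al * x + be * y + ga|) ->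
  (exists (dx dy : int) (x y : R), [/\ nb (mem S) c dx dy, 0 <= x <= 1, 0 <= y <= 1,
    [/\ dx%:~R <= x, x <= dx%:~R + 1, dy%:~R <= y & y <= dy%:~R + 1] & al * x + be * y + ga < 0]) ->
  (exists (dx dy : int) (x y : R), [/\ nb (mem S) c dx dy, 0 <= x <= 1, 0 <= y <= 1,
    [/\ dx%:~R <= x, x <= dx%:~R + 1, dy%:~R <= y & y <= dy%:~R + 1] & 0 < al * x + be * y + ga]) ->
  False.
Proof.
move=> hS al1 be1 sc cS far [dx [dy [x [y [h1 h2 h3 [a1 a2 a3 a4] neg]]]]].
move=> [dx' [dy' [x' [y' [h1' h2' h3' [b1 b2 b3 b4] pos]]]]].
have [Q1 S1] := nb_point h1 h2 h3 a1 a2 a3 a4; have [Q2 S2] := nb_point h1' h2' h3' b1 b2 b3 b4.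
have e (a b : R) : a + b - a = b by rewrite addrC addrA addNr add0r.
apply: (@cut_not_simply_connected S c al be ga al1 be1 _ _ _ hS Q1 S1 Q2 S2 _ _ sc).
- move=> z hz [d /= dS hd]; have [ex [ey [ed hx hy]]] := square_meet hz hd.
  move: hz => /unit_squareP[? ? ? ?]; apply: (far ex ey) => //; rewrite /nb -?ed //; lra.
- by rewrite /= !e.
- by rewrite /= !e.
Qed.

Definition corner_of (dx : int) (x : bool) : bool :=
  (dx == 0) || (dx == 1) && x || (dx == -1) && ~~ x.

Lemma corner_of_itv dx (x : bool) : corner_of dx x ->
  dx%:~R <= x%:R :> R /\ x%:R <= dx%:~R + 1 :> R.
Proof. by case/orP=> [/orP[/eqP ->|/andP[/eqP -> ->]]|/andP[/eqP -> /negbTE ->]]; case: x => /=; split; lra. Qed.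

Lemma nb_witness S c (dx dy : int) (x y : bool) (al be ga : R) (P : R -> Prop) :
  nb (mem S) c dx dy -> corner_of dx x && corner_of dy y -> P (al * x%:R + be * y%:R + ga) ->
  exists (dx dy : int) (x y : R), [/\ nb (mem S) c dx dy, 0 <= x <= 1, 0 <= y <= 1,
    [/\ dx%:~R <= x, x <= dx%:~R + 1, dy%:~R <= y & y <= dy%:~R + 1] & P (al * x + be * y + ga)].
Proof.
move=> h /andP[/corner_of_itv[h1 h2] /corner_of_itv[h3 h4]] hP.
by exists dx, dy, x%:R, y%:R; split=> //; [case: (x) | case: (y)]; rewrite /=; lra.
Qed.

(** [f1] and [f2] are the side neighbours whose side is crossed by the line; they are absent in the
    case at hand. All other neighbours touch the cell at distance from the line as required by
    [cut_far]. *)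
Definition far_from_cut (f1 f2 : int * int) (al be ga : R) : Prop :=
  forall (dx dy : int) (x y : R), (dx, dy) != f1 -> (dx, dy) != f2 -> (dx, dy) != (0, 0) ->
    0 <= x -> x <= 1 -> 0 <= y -> y <= 1 -> side_pos dx x -> side_pos dy y ->
    1/2 <= `|al * x + be * y + ga|.

Lemma far_ns : far_from_cut (0, 1) (0, -1) 1 0 (- (1/2)).
Proof.
move=> dx dy x y n1 n2 n3 ? ? ? ? hx hy; case: hx n1 n2 n3 => [->|[-> ->]|[-> ->]];
  case: hy => [->|[-> ->]|[-> ->]] n1 n2 n3;
  first [ (by rewrite eqxx in n1) | (by rewrite eqxx in n2) | (by rewrite eqxx in n3)
  | rewrite ler_normr; apply/orP; first [left; lra | right; lra] ].
Qed.

Lemma far_ne : far_from_cut (0, 1) (1, 0) 1 1 (- (3/2)).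
Proof.
move=> dx dy x y n1 n2 n3 ? ? ? ? hx hy; case: hx n1 n2 n3 => [->|[-> ->]|[-> ->]];
  case: hy => [->|[-> ->]|[-> ->]] n1 n2 n3;
  first [ (by rewrite eqxx in n1) | (by rewrite eqxx in n2) | (by rewrite eqxx in n3)
  | rewrite ler_normr; apply/orP; first [left; lra | right; lra] ].
Qed.

Lemma far_nw : far_from_cut (0, 1) (-1, 0) (-1) 1 (- (1/2)).
Proof.
move=> dx dy x y n1 n2 n3 ? ? ? ? hx hy; case: hx n1 n2 n3 => [->|[-> ->]|[-> ->]];
  case: hy => [->|[-> ->]|[-> ->]] n1 n2 n3;
  first [ (by rewrite eqxx in n1) | (by rewrite eqxx in n2) | (by rewrite eqxx in n3)
  | rewrite ler_normr; apply/orP; first [left; lra | right; lra] ].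
Qed.

Lemma far_se : far_from_cut (0, -1) (1, 0) 1 (-1) (- (1/2)).
Proof.
move=> dx dy x y n1 n2 n3 ? ? ? ? hx hy; case: hx n1 n2 n3 => [->|[-> ->]|[-> ->]];
  case: hy => [->|[-> ->]|[-> ->]] n1 n2 n3;
  first [ (by rewrite eqxx in n1) | (by rewrite eqxx in n2) | (by rewrite eqxx in n3)
  | rewrite ler_normr; apply/orP; first [left; lra | right; lra] ].
Qed.

Lemma far_sw : far_from_cut (0, -1) (-1, 0) (-1) (-1) (1/2).
Proof.
move=> dx dy x y n1 n2 n3 ? ? ? ? hx hy; case: hx n1 n2 n3 => [->|[-> ->]|[-> ->]];
  case: hy => [->|[-> ->]|[-> ->]] n1 n2 n3;
  first [ (by rewrite eqxx in n1) | (by rewrite eqxx in n2) | (by rewrite eqxx in n3)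
  | rewrite ler_normr; apply/orP; first [left; lra | right; lra] ].
Qed.

Lemma exposed_arc S c : c \in S -> conn4 S -> conn4 (S `\ c)%fset -> (1 < #|` S|)%N ->
  exposed S c -> simply_connected (realize R S) -> arc (mem (S `\ c)%fset) c.
Proof.
move=> cS hS hS' S1 ex sc; set S' := (S `\ c)%fset.
have cS' : c \notin S' by rewrite !inE eqxx.
have RS : realize R S = realize R S' `|` unit_square R c by rewrite -realize_fset1U fsetD1K.
rewrite RS in sc; apply: contraT; rewrite /arc -!/(nb _ _ _ _) => bad; exfalso; move: bad.
set n := nb (mem S') c => bad.
have n00 : n 0 0 = false by rewrite /n /nb /shift2 !addr0; apply/negbTE; case: (c) cS'.
have nex : ~~ n 0 1 || ~~ n 0 (-1).
  by rewrite /n /nb /= !inE; move: ex; rewrite /exposed => /orP[/negbTE ->|/negbTE ->]; rewrite andbF ?orbT.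
have nedge : [|| n 1 0, n (-1) 0, n 0 1 | n 0 (-1)].
  apply: contraT; rewrite !negb_or => /and4P[h1 h2 h3 h4]; exfalso.
  have sub : {subset S <= [fset c]%fset}.
    apply: hS; first by apply/fset0Pn; exists c; rewrite inE.
      by move=> x; rewrite inE => /eqP ->.
    move=> x y; rewrite !inE => /eqP -> yS a; apply: contraT => yc.
    have yS' : y \in S' by rewrite !inE yc.
    by move: a; rewrite /adj !inE => /or4P[] /eqP e;
      [move: h1|move: h2|move: h3|move: h4]; rewrite /n /nb /= -e yS'.
  have : (#|` S| <= #|` [fset c]%fset|)%N by apply: fsubset_leq_card; apply/fsubsetP.
  by rewrite cardfs1 leqNgt S1.
have N0 : `|0 : R| <= 1 by rewrite normr0.
have N1 : `|1 : R| <= 1 by rewrite normr1.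
have NM : `|-1 : R| <= 1 by rewrite normrN normr1.
have := bad_arc nex nedge bad.
have we al be ga (P : R -> Prop) := @nb_witness S' c 1 0 true false al be ga P.
have ww al be ga (P : R -> Prop) := @nb_witness S' c (-1) 0 false false al be ga P.
have wn al be ga (P : R -> Prop) := @nb_witness S' c 0 1 false true al be ga P.
have ws al be ga (P : R -> Prop) := @nb_witness S' c 0 (-1) false false al be ga P.
have wne al be ga (P : R -> Prop) := @nb_witness S' c 1 1 true true al be ga P.
have wnw al be ga (P : R -> Prop) := @nb_witness S' c (-1) 1 false true al be ga P.
have wse al be ga (P : R -> Prop) := @nb_witness S' c 1 (-1) true false al be ga P.
have wsw al be ga (P : R -> Prop) := @nb_witness S' c (-1) (-1) false false al be ga P.
have fin (al be ga : R) (f1 f2 : int * int) : n f1.1 f1.2 = false -> n f2.1 f2.2 = false ->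
  far_from_cut f1 f2 al be ga ->
  forall (dx dy : int) (x y : R), n dx dy -> 0 <= x -> x <= 1 -> 0 <= y -> y <= 1 ->
    side_pos dx x -> side_pos dy y -> 1/2 <= `|al * x + be * y + ga|.
  move=> e1 e2 H dx dy x y h; apply: H.
  - by apply: contraTneq h => e; move: e1; rewrite -e /= => ->.
  - by apply: contraTneq h => e; move: e2; rewrite -e /= => ->.
  - by apply: contraTneq h => -[-> ->]; rewrite n00.
case/or4P => [|||/orP[]] /and4P[/negbTE f1 /negbTE f2].
- move=> hp hn; apply: (@cut_case S' c 1 0 (- (1/2)) hS' N1 N0 sc cS').
  + apply: (fin _ _ _ (0, 1) (0, -1) f1 f2); exact: far_ns.
  + case/or3P: hn => h; [apply: (ww _ _ _ (fun r => r < 0) h isT)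
      | apply: (wnw _ _ _ (fun r => r < 0) h isT) | apply: (wsw _ _ _ (fun r => r < 0) h isT)]; rewrite /=; lra.
  + case/or3P: hp => h; [apply: (we _ _ _ (fun r => 0 < r) h isT)
      | apply: (wne _ _ _ (fun r => 0 < r) h isT) | apply: (wse _ _ _ (fun r => 0 < r) h isT)]; rewrite /=; lra.
- move=> hp hn; apply: (@cut_case S' c 1 1 (- (3/2)) hS' N1 N1 sc cS').
  + apply: (fin _ _ _ (0, 1) (1, 0) f1 f2); exact: far_ne.
  + case/or4P: hn => [h|h|h|/orP[h|h]]; [apply: (ws _ _ _ (fun r => r < 0) h isT)
      | apply: (wse _ _ _ (fun r => r < 0) h isT) | apply: (wsw _ _ _ (fun r => r < 0) h isT)
      | apply: (ww _ _ _ (fun r => r < 0) h isT) | apply: (wnw _ _ _ (fun r => r < 0) h isT)]; rewrite /=; lra.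
  + by apply: (wne _ _ _ (fun r => 0 < r) hp isT); rewrite /=; lra.
- move=> hp hn; apply: (@cut_case S' c (-1) 1 (- (1/2)) hS' NM N1 sc cS').
  + apply: (fin _ _ _ (0, 1) (-1, 0) f1 f2); exact: far_nw.
  + case/or4P: hn => [h|h|h|/orP[h|h]]; [apply: (ws _ _ _ (fun r => r < 0) h isT)
      | apply: (wsw _ _ _ (fun r => r < 0) h isT) | apply: (wse _ _ _ (fun r => r < 0) h isT)
      | apply: (we _ _ _ (fun r => r < 0) h isT) | apply: (wne _ _ _ (fun r => r < 0) h isT)]; rewrite /=; lra.
  + by apply: (wnw _ _ _ (fun r => 0 < r) hp isT); rewrite /=; lra.
- move=> hp hn; apply: (@cut_case S' c 1 (-1) (- (1/2)) hS' N1 NM sc cS').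
  + apply: (fin _ _ _ (0, -1) (1, 0) f1 f2); exact: far_se.
  + case/or4P: hn => [h|h|h|/orP[h|h]]; [apply: (wn _ _ _ (fun r => r < 0) h isT)
      | apply: (wne _ _ _ (fun r => r < 0) h isT) | apply: (wnw _ _ _ (fun r => r < 0) h isT)
      | apply: (ww _ _ _ (fun r => r < 0) h isT) | apply: (wsw _ _ _ (fun r => r < 0) h isT)]; rewrite /=; lra.
  + by apply: (wse _ _ _ (fun r => 0 < r) hp isT); rewrite /=; lra.
- move=> hp hn; apply: (@cut_case S' c (-1) (-1) (1/2) hS' NM NM sc cS').
  + apply: (fin _ _ _ (0, -1) (-1, 0) f1 f2); exact: far_sw.
  + case/or4P: hn => [h|h|h|/orP[h|h]]; [apply: (wn _ _ _ (fun r => r < 0) h isT)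
      | apply: (wnw _ _ _ (fun r => r < 0) h isT) | apply: (wne _ _ _ (fun r => r < 0) h isT)
      | apply: (we _ _ _ (fun r => r < 0) h isT) | apply: (wse _ _ _ (fun r => r < 0) h isT)]; rewrite /=; lra.
  + by apply: (wsw _ _ _ (fun r => 0 < r) hp isT); rewrite /=; lra.
Qed.

(** The rest after peeling a cell is a retract of the whole, hence again simply connected, and the
    induction goes on. *)
Lemma simply_connected_shelled S : conn4 S -> simply_connected (realize R S) ->
  exists2 s, shelled s & S = [fset c in s]%fset.
Proof.
elim/finmap.finSet_rect: S => S IH hS sc.
have S0 : (0 < #|` S|)%N.
  rewrite cardfs_gt0; apply/fset0Pn; have [[z [c cS _]] _ _] := sc.
  by exists c.
have [S1|S1] := ltnP 1 #|` S|; last first.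
  have /eqP/cardfs1P[c ->] : #|` S| = 1%N by apply/eqP; rewrite eqn_leq S1.
  exists [:: c] => //.
  by rewrite seq_fset_cons; apply/fsetP => x; rewrite !inE orbF.
have [q [qS qe hS']] := exists_peel hS S1.
have ha := exposed_arc qS hS hS' S1 qe sc.
have qS' : q \notin (S `\ q)%fset by rewrite !inE eqxx.
have [rho [h1 h2 h3]] := @arc_retraction R _ _ qS' ha.
have RS : realize R S = realize R (S `\ q)%fset `|` unit_square R q by rewrite -realize_fset1U fsetD1K.
have [||s hs es] := IH (S `\ q)%fset _ hS'; first by rewrite fproperD1.
  apply: (@simply_connected_retract _ (realize R S) _ rho) => //.
  - have /fset0Pn[d dS] : (S `\ q)%fset != fset0.
      by rewrite -cardfs_gt0; move: S1; rewrite (cardfsD1 q S) qS.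
    by exists (center R d); apply/center_realize.
  - by rewrite RS; left.
  - by rewrite RS.
  - by rewrite RS => z [hz|/h3[]//]; rewrite h2.
exists (q :: s); last by rewrite seq_fset_cons -es fsetD1K.
rewrite /= hs andbT -arc_seq -es ha andbT; apply/orP; right.
by move: qS'; rewrite es !inE.
Qed.

Lemma shellableP S : (exists2 s, shelled s & S = [fset c in s]%fset) <->
  region R S /\ simply_connected (realize R S).
Proof.
split=> [[s hs ->]|[hr sc]]; last by apply: simply_connected_shelled => //; exact: region_conn4.
by split; [exact: shelled_region | apply: contractible_simply_connected; exact: shelled_contractible].
Qed.

End Peeling.

(** * Numerals *)

Fixpoint bval (l : seq bool) : nat := if l is b :: l' then b + 2 * bval l' else 0.

Lemma bval_incl l : bval (incl l) = (bval l).+1.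
Proof. by elim: l => [|[] l IH] //=; rewrite ?IH; lia. Qed.

Lemma bval_bits n : bval (bits n) = n.
Proof. by elim: n => // n IH; rewrite /bits iterS bval_incl IH. Qed.

Lemma bits_inj : injective bits.
Proof. exact: can_inj bval_bits. Qed.

Lemma eq_bits m n : (bits m == bits n) = (m == n).
Proof. exact: (inj_eq bits_inj). Qed.

Lemma bitsS n : bits n.+1 = incl (bits n).
Proof. by []. Qed.

(** No leading zero: with the least significant bit first, the last bit is 1 unless the number is
    0. *)
Definition canon (l : seq bool) : bool := (l == [:: false]) || (last false l).

Lemma canon_bits n : canon (bits n).
Proof.
case: n => // n; apply/orP; right; rewrite bits_digits.
have [m] := ubnP n; elim: m n => // m IH [|n] // hn.
have hlt : n./2 < m by apply: leq_ltn_trans (_ : n./2 <= n) _; [rewrite -divn2 leq_div | exact: hn].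
rewrite digitsS //; have := IH n./2 hlt; have -> : n.+2./2 = n./2.+1 by [].
rewrite -[last false (_ :: _)]/(last (odd n.+2) (digits n./2.+1)).
by case: (digits n./2.+1).
Qed.

Lemma canonP l : canon l -> exists n, l = bits n.
Proof.
case/orP => [/eqP ->|]; first by exists 0.
suff H : last false l -> exists n, l = bits n.+1 by move=> /H[n ->]; exists n.+1.
elim: l => // b [|b' l] IH; first by case: b => // _; exists 0.
move=> /IH[n e]; exists (b + 2 * n.+1).-1.
have -> : (b + 2 * n.+1).-1.+1 = b + 2 * n.+1 by lia.
rewrite bits_digits digitsS; last by lia.
rewrite e bits_digits oddD oddM addbF; congr (_ :: digits _); first by case: (b).
by rewrite mul2n; case: b {IH} => /=; rewrite ?uphalf_double ?doubleK.
Qed.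

(* sign, and binary digits from the least significant one *)
Definition num : Type := (bool * seq bool)%type.

Definition numz (z : int) : num :=
  match z with Posz n => (false, bits n) | Negz n => (true, bits n.+1) end.

Definition canon_num (p : num) : bool := canon p.2 && ~~ (p.1 && (p.2 == [:: false])).

Lemma canon_numz z : canon_num (numz z).
Proof.
case: z => n; apply/andP; split; try exact: canon_bits; first by [].
by rewrite -[[:: false]]/(bits 0) eq_bits.
Qed.

Lemma canon_numP p : canon_num p -> exists z, p = numz z.
Proof.
case: p => s l /andP[/canonP[n /= ->]]; rewrite -[[:: false]]/(bits 0) eq_bits.
case: s => /=; last by exists (Posz n).
by case: n => // n _; exists (Negz n).
Qed.

Lemma numz_inj : injective numz.
Proof.
case=> m [] n // [] h; first by rewrite (bits_inj h).
by have [->] := @bits_inj m.+1 n.+1 h.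
Qed.

(** Between negative numbers the magnitude of the successor is incremented to give that of the
    predecessor; the remaining case is the step from -1 to 0. *)
Definition succ_num (p q : num) : bool :=
  if p.1 then if q.1 then incl q.2 == p.2 else (p.2 == [:: true]) && (q.2 == [:: false])
  else ~~ q.1 && (incl p.2 == q.2).

Lemma succ_numz (y z : int) : succ_num (numz y) (numz z) = (z == y + 1)%R.
Proof.
rewrite /succ_num; case: y z => m [] n /=; rewrite -?bitsS ?eq_bits //.
- by apply/eqP/eqP; lia.
- rewrite -[[:: true]]/(bits 1) -[[:: false]]/(bits 0) !eq_bits.
  by apply/andP/eqP => [[/eqP ? /eqP ?]|h]; [lia | split; apply/eqP; lia].
- by apply/eqP/eqP; lia.
Qed.

Definition zdir (d : option bool) : int := if d is Some b then if b then 1%R else (-1)%R else 0%R.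

Definition dir_num (d : option bool) (p q : num) : bool :=
  if d is Some b then if b then succ_num p q else succ_num q p else p == q.

Lemma dir_numz d (y z : int) : dir_num d (numz y) (numz z) = (z == y + zdir d)%R.
Proof.
case: d => [[]|] /=; rewrite ?succ_numz //.
- by apply/eqP/eqP => ->; lia.
- by rewrite addr0 (inj_eq numz_inj) eq_sym.
Qed.

Definition num2 (c : square) : num * num := (numz c.1, numz c.2).

Lemma num2_inj : injective num2.
Proof. by move=> [a b] [c d] [/numz_inj -> /numz_inj ->]. Qed.

Definition rel2 (dx dy : option bool) (p q : num * num) : bool :=
  dir_num dx p.1 q.1 && dir_num dy p.2 q.2.

Lemma rel2P dx dy c d : rel2 dx dy (num2 c) (num2 d) = (d == shift2 c (zdir dx) (zdir dy)).
Proof. by rewrite /rel2 !dir_numz /shift2; case: d. Qed.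

(** * Locally consistent tilings *)

(** A label holds the sides of the rectangle covering a cell and the position of the cell in it.
    Agreement with the four neighbours is a local condition. *)
Definition lab_ok (T : {fset cells}) (G : cells) (lab : square -> nat * nat * (nat * nat)) : Prop :=
  forall c, c \in G -> let: (a, b, (x, y)) := lab c in
  [/\ rectangle a b \in T, x < a, y < b &
   [/\ x.+1 < a -> shift2 c 1 0 \in G /\ lab (shift2 c 1 0) = (a, b, (x.+1, y)),
       0 < x -> shift2 c (-1) 0 \in G /\ lab (shift2 c (-1) 0) = (a, b, (x.-1, y)),
       y.+1 < b -> shift2 c 0 1 \in G /\ lab (shift2 c 0 1) = (a, b, (x, y.+1)) &
       0 < y -> shift2 c 0 (-1) \in G /\ lab (shift2 c 0 (-1)) = (a, b, (x, y.-1))]].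

Lemma mem_placed a b (v c : square) : c \in translate v (rectangle a b) <->
  exists i j : nat, [/\ i < a, j < b & c = ((v.1 + i%:Z)%R, (v.2 + j%:Z)%R)].
Proof.
rewrite mem_translate; split=> [h|[i [j [hi hj ->]]]].
  have [i [j [e hi hj]]] := mem_rectangleN h; exists i, j; split=> //.
  by move: e => [e1 e2]; case: (c) e1 e2 => c1 c2 /= e1 e2; congr pair; lia.
by rewrite /= (addrC v.1) addrK (addrC v.2) addrK mem_rectangle hi hj.
Qed.

(** Starting from a labelled cell, horizontal and then vertical steps reach every cell of its
    rectangle and find there the label that belongs to the same placed tile. *)
Lemma lab_fun_tiling T G lab : lab_ok T G lab -> exists f, fun_tiling T G f.
Proof.
move=> ok; pose f (c : square) : cells * (int * int) := let: (a, b, (x, y)) := lab c in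
  (rectangle a b, ((c.1 - x%:Z)%R, (c.2 - y%:Z)%R)).
exists f => c cG; have := ok c cG; case E: (lab c) => [[a b] [x y]] [rT xa yb _].
have fc : f c = (rectangle a b, ((c.1 - x%:Z)%R, (c.2 - y%:Z)%R)) by rewrite /f E.
pose v : square := ((c.1 - x%:Z)%R, (c.2 - y%:Z)%R).
pose at' (i j : nat) : square := ((v.1 + i%:Z)%R, (v.2 + j%:Z)%R).
pose P i j := at' i j \in G /\ lab (at' i j) = (a, b, (i, j)).
have atc : at' x y = c by rewrite /at' /v /=; case: (c) => c1 c2 /=; congr pair; lia.
have P0 : P x y by rewrite /P atc.
have sE i j : shift2 (at' i j) 1 0 = at' i.+1 j by rewrite /at' /shift2 /=; congr pair; lia.
have sN i j : shift2 (at' i j) 0 1 = at' i j.+1 by rewrite /at' /shift2 /=; congr pair; lia.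
have sW i j : shift2 (at' i.+1 j) (-1) 0 = at' i j by rewrite /at' /shift2 /=; congr pair; lia.
have sS i j : shift2 (at' i j.+1) 0 (-1) = at' i j by rewrite /at' /shift2 /=; congr pair; lia.
have stE i j : P i j -> i.+1 < a -> P i.+1 j.
  by move=> [h1 h2]; have := ok _ h1; rewrite h2 => -[_ _ _ [h _ _ _]] /h; rewrite sE.
have stN i j : P i j -> j.+1 < b -> P i j.+1.
  by move=> [h1 h2]; have := ok _ h1; rewrite h2 => -[_ _ _ [_ _ h _]] /h; rewrite sN.
have stW i j : P i.+1 j -> P i j.
  by move=> [h1 h2]; have := ok _ h1; rewrite h2 => -[_ _ _ [_ /(_ isT) h _ _]]; rewrite sW in h.
have stS i j : P i j.+1 -> P i j.
  by move=> [h1 h2]; have := ok _ h1; rewrite h2 => -[_ _ _ [_ _ _ /(_ isT) h]]; rewrite sS in h.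
have dnW k i j : P (i + k) j -> P i j.
  by elim: k => [|k IH]; rewrite ?addn0 // addnS => /stW.
have dnS k i j : P i (j + k) -> P i j.
  by elim: k => [|k IH]; rewrite ?addn0 // addnS => /stS.
have upE k i j : P i j -> i + k < a -> P (i + k) j.
  by elim: k => [|k IH] h; rewrite ?addn0 // addnS => hk; apply: stE => //; apply: IH => //; exact: ltnW.
have upN k i j : P i j -> j + k < b -> P i (j + k).
  by elim: k => [|k IH] h; rewrite ?addn0 // addnS => hk; apply: stN => //; apply: IH => //; exact: ltnW.
have all' i j : i < a -> j < b -> P i j.
  move=> hi hj; have h1 : P i y.
    have [le|lt] := leqP x i; first by rewrite -(subnKC le); apply: upE; rewrite ?subnKC.
    by apply: (dnW (x - i)); rewrite subnKC // ltnW.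
  have [le|lt] := leqP y j; first by rewrite -(subnKC le); apply: upN; rewrite ?subnKC.
  by apply: (dnS (y - j)); rewrite subnKC // ltnW.
rewrite fc; split=> //=.
  by apply/mem_placed; exists x, y; split=> //; rewrite -{1}atc.
move=> c' /mem_placed[i [j [hi hj e]]]; have [h1 h2] := all' i j hi hj.
have e' : c' = at' i j by [].
rewrite e' h1; split=> //; rewrite /f h2; congr (_, (_, _)); rewrite /at' /v /=; lia.
Qed.

Lemma fun_tiling_lab T G f : (forall t, t \in T -> rectangular t) -> fun_tiling T G f ->
  exists lab, lab_ok T G lab.
Proof.
move=> rect hf.
have hex c : exists l : nat * nat * (nat * nat), c \in G ->
    [/\ (f c).1 = rectangle l.1.1 l.1.2, 0 < l.1.1, 0 < l.1.2, l.2.1 < l.1.1 & l.2.2 < l.1.2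
     /\ c = (((f c).2.1 + l.2.1%:Z)%R, ((f c).2.2 + l.2.2%:Z)%R)].
  have [cG|cG] := boolP (c \in G); last by exists (0, 0, (0, 0)).
  have [tT hc _] := hf c cG; have [a [b [a0 b0 e]]] := rect _ tT.
  by move: hc; rewrite e => /mem_placed[i [j [hi hj ec]]]; exists (a, b, (i, j)).
have [lab hl] := choice hex; exists lab => c cG.
have [e a0 b0 xa [yb ec]] := hl c cG; have [tT _ hall] := hf c cG.
case E: (lab c) => [[a b] [x y]]; rewrite E /= in e a0 b0 xa yb ec.
have st i j : i < a -> j < b -> let c' : square := (((f c).2.1 + i%:Z)%R, ((f c).2.2 + j%:Z)%R) in
    c' \in G /\ lab c' = (a, b, (i, j)).
  move=> hi hj c'; have [|c'G fe] := hall c'; first by rewrite e; apply/mem_placed; exists i, j.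
  split=> //; have [e' a0' b0' xa' [yb' ec']] := hl c' c'G.
  case E': (lab c') => [[a' b'] [x' y']]; rewrite E' fe e /= in e' a0' b0' xa' yb' ec'.
  have [ea eb] := rectangle_inj a0 b0 e'; move: ec' => [e1 e2].
  by rewrite ea eb; congr (_, (_, _)); lia.
have sh (i j : nat) (dx dy : int) : (i%:Z = x%:Z + dx)%R -> (j%:Z = y%:Z + dy)%R ->
    shift2 c dx dy = (((f c).2.1 + i%:Z)%R, ((f c).2.2 + j%:Z)%R).
  move=> -> ->; rewrite !addrA; set v := (f c).2 in ec *.
  by rewrite /shift2 [in LHS]ec.
rewrite -e; split=> //; split=> h.
- by rewrite (sh x.+1 y); [exact: st | lia | lia].
- by rewrite (sh x.-1 y); [apply: st => //; lia | lia | lia].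
- by rewrite (sh x y.+1); [exact: st | lia | lia].
- by rewrite (sh x y.-1); [apply: st => //; lia | lia | lia].
Qed.

(** * The verifier *)

Lemma shelled_uniq s : shelled s -> uniq s.
Proof.
elim: s => // c s IH /= /orP[/eqP -> //|/and3P[-> _ /IH //]].
Qed.

(** A form with Boolean connectives only, from which polynomial-time computability follows by
    structure. *)
Lemma arc8E e w n s ne nw se sw : arc8 e w n s ne nw se sw =
  [|| [&& e, ~~ w, ~~ n, ~~ s, ~~ nw & ~~ sw],
      [&& ~~ e, w, ~~ n, ~~ s, ~~ ne & ~~ se],
      [&& ~~ e, ~~ w, n, ~~ s, ~~ se & ~~ sw],
      [&& ~~ e, ~~ w, ~~ n, s, ~~ ne & ~~ nw],
      [&& e, ~~ w, n, ~~ s & ~~ sw], [&& e, ~~ w, ~~ n, s & ~~ nw],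
      [&& ~~ e, w, n, ~~ s & ~~ se], [&& ~~ e, w, ~~ n, s & ~~ ne],
      [&& e, w, n & ~~ s], [&& e, w, ~~ n & s], [&& e, ~~ w, n & s] | [&& ~~ e, w, n & s]].
Proof. by case: e w n s => [] [] [] []; case: ne nw se sw => [] [] [] []. Qed.

Section Verifier.
Variable L : finType.
Local Instance enc_L : Enc L := enc_fin L.
Local Instance enc_L_inj : EncInj L := @enc_fin_inj L.
Local Instance enc_letter : Enc letter := enc_fin letter.
Local Instance enc_letter_inj : EncInj letter := @enc_fin_inj letter.

Definition cell_entry : Type := (num * num * L)%type.
Definition parse_state : Type := (seq cell_entry * (num * num))%type.

(** The word gives the most significant digit first, so consing the digits puts the least
    significant one in front. The parser is total; malformed words are detected by unparsing. *)
Definition pstep (a : parse_state) (x : letter * L) : parse_state :=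
  let: (done, (p, q)) := a in
  match x.1 with
  | Bit b => (done, (p, (q.1, b :: q.2)))
  | Minus => (done, (p, (true, q.2)))
  | Comma => (done, (q, (false, [::])))
  | Semicolon => ((p, q, x.2) :: done, ((false, [::]), (false, [::])))
  end.

Definition parse (w : seq (letter * L)) : seq cell_entry :=
  rev (foldl pstep ([::], ((false, [::]), (false, [::]))) w).1.

Definition unparse_num (p : num) : seq letter :=
  (if p.1 then [:: Minus] else [::]) ++ rev [seq Bit b | b <- p.2].

Definition unparse (s : seq cell_entry) : seq letter :=
  flatten [seq unparse_num p.1.1 ++ Comma :: unparse_num p.1.2 ++ [:: Semicolon] | p <- s].

Lemma unparse_numz z : unparse_num (numz z) = encode_int z.
Proof. by case: z => n; rewrite /encode_int encode_natE. Qed.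

Definition entry_of (lab : square -> L) (c : square) : cell_entry := (num2 c, lab c).

Lemma unparse_encode lab (s : seq square) : unparse (map (entry_of lab) s) = encode s.
Proof.
by rewrite /unparse /encode -map_comp; congr flatten; apply/eq_map => c; rewrite /= !unparse_numz.
Qed.

(** The certificate spells the cells in their own order, and every letter of a cell carries its
    label. *)
Definition label_word (lab : square -> L) (s : seq square) : seq (letter * L) :=
  flatten [seq [seq (x, lab c) | x <- encode [:: c]] | c <- s].

Lemma map_fst_label_word lab s : [seq x.1 | x <- label_word lab s] = encode s.
Proof.
rewrite /label_word map_flatten -map_comp /encode; congr flatten; apply/eq_map => c /=.
by rewrite -map_comp map_id cats0.
Qed.

Lemma label_word_cons lab c s : label_word lab (c :: s) =
  [seq (x, lab c) | x <- encode_int c.1] ++ (Comma, lab c) ::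
  [seq (x, lab c) | x <- encode_int c.2] ++ (Semicolon, lab c) :: label_word lab s.
Proof.
by rewrite /label_word /= /encode /= cats0 map_cat map_cons map_cat -catA cat_cons -catA.
Qed.

Lemma foldl_bits (l : seq bool) (d : L) done p q :
  foldl pstep (done, (p, q)) [seq (x, d) | x <- rev [seq Bit b | b <- l]] = (done, (p, (q.1, l ++ q.2))).
Proof.
elim: l q => [|b l IH] q; first by case: q.
by rewrite map_cons rev_cons map_rcons -cats1 foldl_cat IH /= .
Qed.

Lemma foldl_int (z : int) (d : L) done p :
  foldl pstep (done, (p, (false, [::]))) [seq (x, d) | x <- encode_int z] = (done, (p, numz z)).
Proof.
rewrite -unparse_numz /unparse_num map_cat foldl_cat.
by case: z => n; rewrite /= foldl_bits cats0.
Qed.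

Lemma parse_label_word lab s : parse (label_word lab s) = map (entry_of lab) s.
Proof.
rewrite /parse; suff H done : foldl pstep (done, ((false, [::]), (false, [::]))) (label_word lab s) =
    (rev (map (entry_of lab) s) ++ done, ((false, [::]), (false, [::]))) by rewrite H cats0 revK.
elim: s done => [|c s IH] done //; rewrite label_word_cons foldl_cat foldl_int.
rewrite -[foldl _ _ (_ :: _)]/(foldl pstep (done, (numz c.1, (false, [::]))) _) foldl_cat foldl_int.
rewrite -[foldl _ _ (_ :: _)]/(foldl pstep (entry_of lab c :: done, _) _) IH.
by rewrite map_cons rev_cons cat_rcons.
Qed.

Definition canon_entry (p : cell_entry) : bool := canon_num p.1.1 && canon_num p.1.2.

Lemma canon_entryP (s : seq cell_entry) : all canon_entry s -> exists t : seq (square * L),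
  s = [seq (num2 p.1, p.2) | p <- t].
Proof.
elim: s => [|[[p q] d] s IH] /=; first by exists [::].
case/andP => /andP[/canon_numP[x /= ->] /canon_numP[y /= ->]] /IH[t ->].
by exists ((x, y, d) :: t).
Qed.

Definition nbV (s : seq cell_entry) (p : cell_entry) (dx dy : option bool) : bool :=
  has (fun q : cell_entry => rel2 dx dy p.1 q.1) s.

Definition arcV (s : seq cell_entry) (p : cell_entry) : bool :=
  let n := nbV s p in let P := Some true in let M := Some false in
  arc8 (n P None) (n M None) (n None P) (n None M) (n P P) (n M P) (n P M) (n M M).

Fixpoint shelledV (s : seq cell_entry) : bool :=
  if s is c :: s' then (s' == [::]) || [&& ~~ nbV s' c None None, arcV s' c & shelledV s'] else false.

Lemma nbVP (t : seq (square * L)) (c : square) (d : L) dx dy :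
  nbV [seq (num2 p.1, p.2) | p <- t] (num2 c, d) dx dy =
  (shift2 c (zdir dx) (zdir dy) \in [seq p.1 | p <- t]).
Proof.
rewrite /nbV has_map; elim: t => //= p t IH; rewrite inE -IH; congr (_ || _).
by rewrite rel2P eq_sym.
Qed.

Lemma shelledVP (t : seq (square * L)) :
  shelledV [seq (num2 p.1, p.2) | p <- t] = shelled [seq p.1 | p <- t].
Proof.
elim: t => //= -[c d] t ->; rewrite /arcV !nbVP /shift2 !addr0.
congr (_ || [&& _, _ & _]); first by case: t.
  by case: (c).
by rewrite /arc /shift2 /= !addr0.
Qed.

Variables (lv : L -> bool) (need : nat -> L -> bool) (next_label : nat -> L -> L).

Definition dirs : seq (nat * (option bool * option bool)) :=
  [:: (0, (Some true, None)); (1, (Some false, None));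
      (2, (None, Some true)); (3, (None, Some false))].

Definition label_ok (s : seq cell_entry) (p : cell_entry) : bool :=
  lv p.2 && all (fun i => ~~ need i.1 p.2 ||
    has (fun q : cell_entry => rel2 i.2.1 i.2.2 p.1 q.1 && (q.2 == next_label i.1 p.2)) s) dirs.

(** [A] comes from the input and [B] from the certificate; unparsing checks that both words are
    encodings. [B] is shelled and hence free of repetitions, its cells occur in [A], and the sizes
    agree, so [A] and [B] are the same cells and the input has no repetitions either. *)
Definition verify (l0 : L) (i : seq (letter * (letter * L))) : bool :=
  let A := parse [seq (x.1, l0) | x <- i] in
  let B := parse [seq x.2 | x <- i] in
  [&& unparse A == [seq x.1 | x <- i], unparse B == [seq x.2.1 | x <- i],
      all canon_entry A, all canon_entry B, size A == size B,
      all (fun p => nbV A p None None) B, shelledV B & all (label_ok B) B].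

Lemma PTF_pstep : PTF (fun p : unit * (parse_state * (letter * L)) => pstep p.2.1 p.2.2).
Proof.
pose g (a : letter) (st : unit * (parse_state * (letter * L))) : parse_state :=
  pstep st.2.1 (a, st.2.2.2).
have e : (fun p : unit * (parse_state * (letter * L)) => g p.2.2.1 p) =1
    (fun p => pstep p.2.1 p.2.2) by case=> [u [st [a d]]].
apply: PTF_ext e _; apply: (PTF_fin (f := fun p : unit * (parse_state * (letter * L)) => p.2.2.1)).
  by ptf.
by case=> [b|||]; [apply: (PTF_ext (f := fun p : unit * (parse_state * (letter * L)) =>
       (p.2.1.1, (p.2.1.2.1, (p.2.1.2.2.1, b :: p.2.1.2.2.2)))))
  | apply: (PTF_ext (f := fun p : unit * (parse_state * (letter * L)) =>
       (p.2.1.1, (p.2.1.2.1, (true, p.2.1.2.2.2)))))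
  | apply: (PTF_ext (f := fun p : unit * (parse_state * (letter * L)) =>
       (p.2.1.1, (p.2.1.2.2, (false, Nil bool)))))
  | apply: (PTF_ext (f := fun p : unit * (parse_state * (letter * L)) =>
       ((p.2.1.2.1, p.2.1.2.2, p.2.2.2) :: p.2.1.1, ((false, Nil bool), (false, Nil bool)))))];
  rewrite /g; (try (by case=> [u [[done [p q]] [a d]]])); ptf.
Qed.

Lemma PTF_parse : PTF parse.
Proof.
have h : PTF (fun w => foldl pstep ([::], ((false, [::]), (false, [::]))) w).
  apply: (PTF_foldl (step := fun (_ : seq (letter * L)) => pstep)).
  - have hp : PTF (fun p : (seq (letter * L)) * (parse_state * (letter * L)) => (tt, p.2)) by ptf.
    exact: (PTF_comp PTF_pstep hp).
  - exists (fun m => m + 20); first by pb.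
    move=> w [done [p q]] [a d]; have hd := @esize_gt0 _ _ d; have ha := @esize_gt0 _ _ a.
    have hq := @esize_gt0 _ _ q; have hp := @esize_gt0 _ _ p.
    have e1 : esize true = 3 by []; have e2 : esize false = 1 by [].
    case: a ha => [b|||] ha /=; rewrite !esize_pair ?esize_cons ?esize_pair ?esize_nil ?e1 ?e2.
    + by case: q hq => s l hq; rewrite /= !esize_pair; case: b {ha}; rewrite ?e1 ?e2; lia.
    + by case: q hq => s l hq; rewrite /= !esize_pair; have := @esize_gt0 _ _ s; lia.
    + lia.
    + lia.
  - exact: PTF_id.
  - exact: PTF_const.
by apply: PTF_revl; apply: PTF_fst.
Qed.

Lemma PTF_bit (E : Type) (eE : Enc E) (f : E -> bool) : PTF f -> PTF (fun e => Bit (f e)).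
Proof.
move=> hf; apply: PTF_ext (PTF_if hf (PTF_const (Bit true)) (PTF_const (Bit false))) => e.
by case: (f e).
Qed.

Lemma PTF_unparse : PTF unparse.
Proof.
have hn (E : Type) (eE : Enc E) (f : E -> num) : PTF f -> PTF (fun e => unparse_num (f e)).
  move=> hf; apply: PTF_cat; first by apply: PTF_if; ptf.
  apply: PTF_revl; apply: (PTF_map (f := fun _ b => Bit b)); last exact: PTF_snd.
  by apply: PTF_bit; ptf.
apply: (PTF_flatmap (f := fun _ (p : cell_entry) => _)); last exact: PTF_id.
by apply: PTF_cat; [apply: hn; ptf | apply: PTF_cons; [ptf | apply: PTF_cat; [apply: hn; ptf | ptf]]].
Qed.

Section Local.
Variables (E : Type) (eE : Enc E).

Lemma PTF_canon_num (f : E -> num) : PTF f -> PTF (fun e => canon_num (f e)).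
Proof.
move=> hf; rewrite /canon_num /canon; apply: PTF_andb; last by ptf.
apply: PTF_orb; first by ptf.
have hl : PTF (fun l : seq bool => foldl (fun _ b => b) false l).
  apply: (PTF_foldl (E := seq bool) (step := fun _ (_ : bool) b => b)); try by ptf.
  exists (fun m => m); first by pb.
  by move=> e a x; lia.
apply: PTF_ext (PTF_comp hl (PTF_snd hf)) => e.
by elim: ((f e).2) false => //= b l IH c; rewrite IH.
Qed.

Lemma PTF_incl2 (f : E -> seq bool) : PTF f -> PTF (fun e => incl (f e)).
Proof. exact: (PTF_comp PTF_incl). Qed.

Lemma PTF_succ_num (f g : E -> num) : PTF f -> PTF g -> PTF (fun e => succ_num (f e) (g e)).
Proof.
move=> hf hg; rewrite /succ_num.
have h1 := PTF_incl2 (PTF_snd hf); have h2 := PTF_incl2 (PTF_snd hg).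
by apply: PTF_if; [ptf | apply: PTF_if; [ptf | apply: PTF_eq => //; ptf | ptf]
  | apply: PTF_andb; [ptf | apply: PTF_eq => //; ptf]].
Qed.

Lemma PTF_rel2 dx dy (f g : E -> num * num) : PTF f -> PTF g ->
  PTF (fun e => rel2 dx dy (f e) (g e)).
Proof.
move=> hf hg; rewrite /rel2 /dir_num; apply: PTF_andb.
  by case: dx => [[]|]; [apply: PTF_succ_num; exact: PTF_fst
    | apply: PTF_succ_num; exact: PTF_fst | apply: PTF_eq; exact: PTF_fst].
by case: dy => [[]|]; [apply: PTF_succ_num; exact: PTF_snd
  | apply: PTF_succ_num; exact: PTF_snd | apply: PTF_eq; exact: PTF_snd].
Qed.

End Local.

Section Local2.
Variables (E : Type) (eE : Enc E).

Lemma PTF_nbV dx dy (s : E -> seq cell_entry) (p : E -> cell_entry) : PTF s -> PTF p ->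
  PTF (fun e => nbV (s e) (p e) dx dy).
Proof.
move=> hs hp; apply: (PTF_has (P := fun e (q : cell_entry) => rel2 dx dy (p e).1 q.1)) => //.
apply: PTF_rel2; last by ptf.
by apply: PTF_fst; apply: (PTF_comp hp); ptf.
Qed.

Lemma PTF_arcV (s : E -> seq cell_entry) (p : E -> cell_entry) : PTF s -> PTF p ->
  PTF (fun e => arcV (s e) (p e)).
Proof.
move=> hs hp; have h dx dy := PTF_nbV dx dy hs hp; rewrite /arcV.
have e : (fun e => _) =1 (fun e => arcV (s e) (p e)) := fun e => esym (arc8E _ _ _ _ _ _ _ _).
by apply: PTF_ext e _; ptf; exact: h.
Qed.

End Local2.

Lemma PTF_shelledV : PTF shelledV.
Proof.
pose step (a : seq cell_entry * bool) (c : cell_entry) : seq cell_entry * bool :=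
  (c :: a.1, (a.1 == [::]) || [&& ~~ nbV a.1 c None None, arcV a.1 c & a.2]).
have h : PTF (fun s => foldl step ([::], false) (rev s)).
  apply: (PTF_foldl (E := seq cell_entry) (step := fun _ => step)).
  - rewrite /step; apply: PTF_pair; first by ptf.
    apply: PTF_orb; first by ptf.
    apply: PTF_andb; first by apply: PTF_negb; apply: PTF_nbV; ptf.
    by apply: PTF_andb; [apply: PTF_arcV; ptf | ptf].
  - exists (fun m => m + 20); first by pb.
    move=> w [s b] c; rewrite /step /= !esize_pair esize_cons; have := @esize_gt0 bool enc_bool b.
    have hb (x : bool) : esize x <= 3 by case: x.
    by move: (hb ((s == [::]) || [&& ~~ nbV s c None None, arcV s c & b])); move: (esize (_ || _)) => u; lia.
  - exact: PTF_rev.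
  - by ptf.
apply: PTF_ext (PTF_snd h) => s.
suff -> : foldl step ([::], false) (rev s) = (s, shelledV s) by [].
by elim: s => // c s IH; rewrite rev_cons -cats1 foldl_cat IH.
Qed.

Lemma PTF_label_ok : PTF (fun p : seq cell_entry * cell_entry => label_ok p.1 p.2).
Proof.
rewrite /label_ok; apply: PTF_andb; first by apply: PTF_fin_const; ptf.
have : forall ds : seq (nat * (option bool * option bool)),
   PTF (fun p : seq cell_entry * cell_entry => all (fun i => ~~ need i.1 p.2.2 ||
    has (fun q : cell_entry => rel2 i.2.1 i.2.2 p.2.1 q.1 && (q.2 == next_label i.1 p.2.2)) p.1) ds).
  elim=> [|i ds IH] /=; first exact: PTF_const.
  apply: PTF_andb IH; apply: PTF_orb; first by apply: PTF_negb; apply: PTF_fin_const; ptf.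
  apply: (PTF_has (P := fun (p : seq cell_entry * cell_entry) (q : cell_entry) =>
     rel2 i.2.1 i.2.2 p.2.1 q.1 && (q.2 == next_label i.1 p.2.2))); last by ptf.
  apply: PTF_andb; first by apply: PTF_rel2; ptf.
  by apply: PTF_eq; [ptf | apply: PTF_fin_const; ptf].
exact.
Qed.

Lemma PTF_verify l0 :
  @PTF _ _ (@enc_seq _ (enc_fin (letter * (letter * L))%type)) enc_bool (verify l0).
Proof.
pose I := (letter * (letter * L))%type; pose eI : Enc (seq I) := @enc_seq _ (enc_fin I).
have hm (Y : Type) (eY : Enc Y) (f : I -> Y) : @PTF _ _ eI _ (fun i => [seq f x | x <- i]).
  apply: (@PTF_map _ eI _ _ (enc_fin I) _ (fun _ x => f x)); last exact: PTF_id.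
  by apply: (@PTF_fin_const _ _ I _ _ _ f); exact: PTF_snd PTF_id.
have hA : @PTF _ _ eI _ (fun i => parse [seq (x.1, l0) | x <- i]) by exact: PTF_comp PTF_parse (hm _ _ _).
have hB : @PTF _ _ eI _ (fun i : seq I => parse [seq x.2 | x <- i]).
  by apply: (PTF_comp PTF_parse); exact: hm.
have hall (P : cell_entry -> bool) (f : seq I -> seq cell_entry) : PTF P -> @PTF _ _ eI _ f ->
    @PTF _ _ eI _ (fun i => all P (f i)).
  move=> hP hf; apply: (@PTF_all _ eI _ _ (fun _ => P)) => //.
  by apply: (PTF_comp hP); exact: PTF_snd PTF_id.
have hc : PTF canon_entry.
  by rewrite /canon_entry; apply: PTF_andb; apply: PTF_canon_num; ptf.
rewrite /verify; apply: PTF_andb; first by apply: PTF_eq; [exact: PTF_comp PTF_unparse hA | exact: hm].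
apply: PTF_andb; first by apply: PTF_eq; [exact: PTF_comp PTF_unparse hB | exact: (hm _ _ (fun x => x.2.1))].
apply: PTF_andb; first exact: hall.
apply: PTF_andb; first exact: hall.
apply: PTF_andb; first by apply: PTF_eq; apply: PTF_size.
apply: PTF_andb.
  apply: (@PTF_all _ eI _ _ (fun i p => nbV (parse [seq (x.1, l0) | x <- i]) p None None)) => //.
  by apply: PTF_nbV; [exact: PTF_comp hA (PTF_fst PTF_id) | exact: PTF_snd PTF_id].
apply: PTF_andb; first exact: PTF_comp PTF_shelledV hB.
apply: (@PTF_all _ eI _ _ (fun i p => label_ok (parse [seq x.2 | x <- i]) p)) => //.
apply: (PTF_app2 PTF_label_ok); [exact: PTF_comp hB (PTF_fst PTF_id) | exact: PTF_snd PTF_id].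
Qed.

End Verifier.

Section Membership.
Variables (R : realType) (T : {fset cells}) (N : nat).
Hypothesis T_rect : forall t, t \in T -> rectangular t.
Hypothesis T_small : forall a b, 0 < a -> 0 < b -> rectangle a b \in T -> a < N /\ b < N.

(** All sides of the finitely many tiles are below [N], so labels form a finite type. *)
Definition label : finType := ('I_N.+1 * 'I_N.+1 * ('I_N.+1 * 'I_N.+1))%type.
Definition lval (l : label) : nat * nat * (nat * nat) :=
  (val l.1.1, val l.1.2, (val l.2.1, val l.2.2)).
Definition lnum (l : nat * nat * (nat * nat)) : label :=
  (inord l.1.1, inord l.1.2, (inord l.2.1, inord l.2.2)).

Definition lv (l : label) : bool :=
  [&& rectangle l.1.1 l.1.2 \in T, l.2.1 < l.1.1 & l.2.2 < l.1.2].
Definition need (i : nat) (l : label) : bool :=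
  match i with
  | 0 => l.2.1.+1 < l.1.1 | 1 => 0 < l.2.1 | 2 => l.2.2.+1 < l.1.2 | _ => 0 < l.2.2
  end.
Definition next_label (i : nat) (l : label) : label :=
  match i with
  | 0 => (l.1, (inord l.2.1.+1, l.2.2)) | 1 => (l.1, (inord l.2.1.-1, l.2.2))
  | 2 => (l.1, (l.2.1, inord l.2.2.+1)) | _ => (l.1, (l.2.1, inord l.2.2.-1))
  end.

Definition l0 : label := lnum (0, 0, (0, 0)).

Notation ent t := [seq (num2 p.1, p.2) : cell_entry label | p <- t].

Lemma has_rel2 (t : seq (square * label)) c dx dy l :
  has (fun q : cell_entry label => rel2 dx dy (num2 c) q.1 && (q.2 == l)) (ent t) =
  ((shift2 c (zdir dx) (zdir dy), l) \in t).
Proof.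
rewrite has_map; elim: t => //= -[d m] t IH; rewrite inE -IH; congr (_ || _).
by rewrite /= rel2P xpair_eqE ![_ == d]eq_sym (eq_sym l).
Qed.

Lemma label_okE (t : seq (square * label)) c l : label_ok lv need next_label (ent t) (num2 c, l) =
  [&& lv l, (l.2.1.+1 < l.1.1) ==> ((shift2 c 1 0, (l.1, (inord l.2.1.+1, l.2.2))) \in t),
      (0 < l.2.1) ==> ((shift2 c (-1) 0, (l.1, (inord l.2.1.-1, l.2.2))) \in t),
      (l.2.2.+1 < l.1.2) ==> ((shift2 c 0 1, (l.1, (l.2.1, inord l.2.2.+1))) \in t)
    & (0 < l.2.2) ==> ((shift2 c 0 (-1), (l.1, (l.2.1, inord l.2.2.-1))) \in t)].
Proof.
have allE (X : Type) (f : X -> bool) p q r u : all f [:: p; q; r; u] = [&& f p, f q, f r & f u].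
  by rewrite /all andbT.
by rewrite /label_ok; congr (_ && _); rewrite /dirs allE !has_rel2 -!implybE.
Qed.

Definition look (t : seq (square * label)) (c : square) : label :=
  head l0 [seq p.2 | p <- t & p.1 == c].

Lemma look_mem t c l : uniq [seq p.1 | p <- t] -> (c, l) \in t -> look t c = l.
Proof.
rewrite /look; elim: t => //= -[d m] t IH /= /andP[hd ht]; rewrite inE.
case: (eqVneq d c) => [e|ne] /=.
  by case/orP => [/eqP[_ ->]//|h]; case/negP: hd; rewrite e; apply/mapP; exists (c, l).
by case/orP => [/eqP[e _]|/IH ->//]; rewrite e eqxx in ne.
Qed.

Lemma unparse_ent (t : seq (square * label)) : unparse (ent t) = encode [seq p.1 | p <- t].
Proof.
by rewrite /unparse /encode -!map_comp; congr flatten; apply/eq_map => c; rewrite /= !unparse_numz.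
Qed.

Lemma verify_sound w c : size c = size w -> verify lv need next_label l0 (zip w c) ->
  tiling_problem R T w.
Proof.
move=> sz; set i := zip w c; rewrite /verify; set A := parse [seq (x.1, l0) | x <- i].
set B := parse [seq x.2 | x <- i].
case/and4P => /eqP hA _ /canon_entryP[tA eA] /and5P[/canon_entryP[tB eB] /eqP hsz hsub hsh hlab].
pose s := [seq p.1 | p <- tA]; pose s' := [seq p.1 | p <- tB].
have ew : w = encode s.
  by rewrite /s -unparse_ent -eA hA /i -/(unzip1 _) unzip1_zip // sz.
have hs' : shelled s' by rewrite /s' -shelledVP -eB.
have us' := shelled_uniq hs'.
have sub : {subset s' <= s}.
  move=> x /mapP[[y l] hp ->]; have hin : (num2 y, l) \in ent tB by apply/mapP; exists (y, l).
  move: hsub; rewrite eB => /allP/(_ _ hin); rewrite eA nbVP /shift2 /= !addr0.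
  by case: (y).
have sz' : size s <= size s' by rewrite !size_map; move: hsz; rewrite eA eB !size_map => ->.
have [_ es] := uniq_min_size us' sub sz'.
have us : uniq s by apply: leq_size_uniq us' sub sz'.
have eG : [fset x in s]%fset = [fset x in s']%fset :> cells by apply/fsetP => x; rewrite !inE es.
have [hr sc] : region R [fset x in s]%fset /\ simply_connected (realize R [fset x in s]%fset).
  by apply/shellableP; exists s'.
exists s; split=> //; apply/tileableP; apply: (@lab_fun_tiling _ _ (fun x => lval (look tB x))).
rewrite eG => x; rewrite !inE => /mapP[[y l] hp /= ->]; rewrite (look_mem us' hp).
have /allP/(_ (num2 y, l)) := hlab; rewrite eB => /(_ _).
rewrite label_okE; case: l hp => [[a b] [u v]] hp /=.
have mem z m : (z, m) \in tB -> z \in s' /\ lval (look tB z) = lval m.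
  by move=> h; rewrite (look_mem us' h); split=> //; apply/mapP; exists (z, m).
have hin : (num2 y, (a, b, (u, v))) \in ent tB by apply/mapP; exists (y, (a, b, (u, v))).
move=> /(_ hin)/and5P[/and3P[h1 h2 h3] k1 k2 k3 k4]; rewrite /= in h1 h2 h3 k1 k2 k3 k4.
have bd (n : nat) (q : 'I_N.+1) : n <= q -> n < N.+1 by move=> h; apply: leq_ltn_trans h (ltn_ord q).
split=> //; split=> h.
- have [-> ->] := mem _ _ (implyP k1 h); split=> //.
  by rewrite /lval /= inordK //; exact: (bd _ a (ltnW h)).
- have [-> ->] := mem _ _ (implyP k2 h); split=> //.
  by rewrite /lval /= inordK //; exact: (bd _ u (leq_pred _)).
- have [-> ->] := mem _ _ (implyP k3 h); split=> //.
  by rewrite /lval /= inordK //; exact: (bd _ b (ltnW h)).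
- have [-> ->] := mem _ _ (implyP k4 h); split=> //.
  by rewrite /lval /= inordK //; exact: (bd _ v (leq_pred _)).
Qed.

Lemma verify_complete w : tiling_problem R T w -> exists2 c, size c = size w &
  verify lv need next_label l0 (zip w c).
Proof.
case=> s [[us ew] hr sc /tileableP[f /(fun_tiling_lab T_rect)[lab ok]]].
set G := [fset x in s]%fset in hr sc ok.
have [s' hs' eG] := (shellableP R G).2 (conj hr sc); have us' := shelled_uniq hs'.
have es : s =i s' by move=> x; have := congr1 (fun S : cells => x \in S) eG; rewrite /G !inE.
have ps : perm_eq s s' by apply: uniq_perm.
pose labL c := lnum (lab c).
have bd c : c \in G -> [/\ (lab c).1.1 < N, (lab c).1.2 < N, (lab c).2.1 < N & (lab c).2.2 < N].
  move=> /ok; case: (lab c) => [[a b] [x y]] /= [hT xa yb _].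
  have [a1 b1] := T_small (leq_ltn_trans (leq0n _) xa) (leq_ltn_trans (leq0n _) yb) hT.
  by split=> //; [exact: ltn_trans xa a1 | exact: ltn_trans yb b1].
have lK c : c \in G -> lval (labL c) = lab c.
  move=> /bd; rewrite /labL /lval /lnum /=; case: (lab c) => [[a b] [x y]] /= [h1 h2 h3 h4].
  by rewrite !inordK // ltnS ltnW.
(* Permuting the cells permutes the pieces of the encoding, which keeps its length. *)
have szE : size (label_word labL s') = size w.
  rewrite -(size_map fst) map_fst_label_word ew /encode; apply/perm_size.
  by apply: perm_flatten; apply: perm_map; rewrite perm_sym.
exists (label_word labL s') => //; set i := zip w _.
have e1 : [seq x.1 | x <- i] = w by rewrite -/(unzip1 _) unzip1_zip // szE.
have e2 : [seq x.2 | x <- i] = label_word labL s' by rewrite -/(unzip2 _) unzip2_zip // szE.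
have e3 : [seq (x.1, l0) | x <- i] = label_word (fun=> l0) s.
  rewrite (map_comp (fun x : letter => (x, l0)) fst) e1 ew /encode /label_word map_flatten -map_comp.
  by congr flatten; apply/eq_map => c /=; rewrite /encode /= cats0.
have e4 : [seq x.2.1 | x <- i] = encode s'.
  by rewrite (map_comp fst snd) e2 map_fst_label_word.
have eB : map (entry_of labL) s' = ent [seq (c, labL c) | c <- s'] by rewrite -map_comp.
have eA : map (entry_of (fun=> l0)) s = ent [seq (c, l0) | c <- s] by rewrite -map_comp.
rewrite /verify e2 e3 !parse_label_word !unparse_encode e1 e4 ew !eqxx /= !size_map (perm_size ps) eqxx /=.
have can lb (t : seq square) : all (@canon_entry label) (map (entry_of lb) t).
  by apply/allP => _ /mapP[c _ ->]; rewrite /canon_entry !canon_numz.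
rewrite !can /=; apply/and3P; split.
- apply/allP => _ /mapP[c cs ->]; rewrite eA nbVP /shift2 /= !addr0 -map_comp map_id es.
  by case: (c) cs.
- by rewrite eB shelledVP -map_comp map_id.
- apply/allP => _ /mapP[c cs ->]; rewrite eB label_okE.
  have cG : c \in G by rewrite /G !inE es.
  have := ok c cG; rewrite -(lK c cG); case E: (labL c) => [[a b] [x y]].
  rewrite /lval /= => -[h1 h2 h3 [k1 k2 k3 k4]].
  have mem d l : d \in G -> lab d = l -> (d, lnum l) \in [seq (c, labL c) | c <- s'].
    move=> dG <-; apply/mapP; exists d => //; by move: dG; rewrite /G !inE es.
  have iv (q : 'I_N.+1) : inord q = q by apply/val_inj; rewrite /= inordK.
  rewrite /lv /= h1 h2 h3 /=.
  apply/and4P; split; apply/implyP => h.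
  + by have [d1 d2] := k1 h; have := mem _ _ d1 d2; rewrite /lnum /= !iv.
  + by have [d1 d2] := k2 h; have := mem _ _ d1 d2; rewrite /lnum /= !iv.
  + by have [d1 d2] := k3 h; have := mem _ _ d1 d2; rewrite /lnum /= !iv.
  + by have [d1 d2] := k4 h; have := mem _ _ d1 d2; rewrite /lnum /= !iv.
Qed.

Lemma tiling_NP_small : NP (tiling_problem R T).
Proof.
apply: (NP_guess (PTF_verify lv need next_label l0)) => w; split; first exact: verify_complete.
by case=> c; exact: verify_sound.
Qed.

End Membership.

Lemma rectangular_small (T : seq cells) : (forall t, t \in T -> rectangular t) ->
  exists N, forall a b, 0 < a -> 0 < b -> rectangle a b \in T -> a < N /\ b < N.
Proof.
elim: T => [|t T IH] hT; first by exists 0.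
have [|N hN] := IH; first by move=> u hu; apply: hT; rewrite inE hu orbT.
have [a [b [a0 b0 e]]] := hT t (mem_head _ _).
exists (N + a.+1 + b.+1) => a' b' a0' b0'; rewrite inE => /orP[/eqP|/(hN _ _ a0' b0')[]]; last by lia.
by rewrite e => /(rectangle_inj a0' b0')[-> ->]; lia.
Qed.

Lemma tiling_NP (R : realType) (T : {fset cells}) : (forall t, t \in T -> rectangular t) ->
  NP (tiling_problem R T).
Proof.
move=> hT; have [N hN] := rectangular_small hT.
exact: (tiling_NP_small R hT hN).
Qed.

(** * Column-convex regions are shellable *)

(** Complete columns before [n], and of column [n] only the cells from [a] to [b]: the stages of a
    shelling column by column. *)
Definition in_cols (n a b : nat) (lo hi : nat -> nat) (c : square) : bool :=
  match c with
  | (Posz x, Posz y) => (x < n) && (lo x <= y < hi x) || (x == n) && (a <= y < b)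
  | _ => false
  end.

Lemma nbE (n y : nat) : [/\ shift2 (Posz n, Posz y) 1 0 = (Posz n.+1, Posz y),
   shift2 (Posz n, Posz y) 0 1 = (Posz n, Posz y.+1),
   shift2 (Posz n, Posz y) 1 1 = (Posz n.+1, Posz y.+1) &
   shift2 (Posz n, Posz y) 1 (-1) = (Posz n.+1, (Posz y - 1)%R)].
Proof. by rewrite /shift2 /= !addr0; split=> //; congr pair; lia. Qed.

Section Columns.
Variables lo hi : nat -> nat.
Local Notation S n a b := (in_cols n a b lo hi).

Lemma colE n a b (x : nat) (y : int) : n < x -> S n a b (Posz x, y) = false.
Proof.
move=> h; case: y => y //; rewrite /in_cols.
have -> : (x < n) = false by lia.
by have -> : (x == n) = false by lia.
Qed.

Definition prev n (y : int) : bool :=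
  if n is k.+1 then if y is Posz z then lo k <= z < hi k else false else false.

Lemma colW n a b (y : int) : S n a b ((Posz n - 1)%R, y) = prev n y.
Proof.
case: n => [|n]; first by case: y.
have -> : (Posz n.+1 - 1)%R = Posz n by lia.
by case: y => //= y; rewrite ltnSn /= (_ : (n == n.+1) = false) ?orbF //; lia.
Qed.

Lemma colO n a b (y : nat) : S n a b (Posz n, Posz y) = (a <= y < b).
Proof. by rewrite /= ltnn eqxx. Qed.

Lemma colON n a b (y : nat) : S n a b (Posz n, (Posz y - 1)%R) = (a < y <= b).
Proof.
case: y => [|y]; first by rewrite /=; lia.
have -> : (Posz y.+1 - 1)%R = Posz y by lia.
by rewrite colO.
Qed.

Lemma arc_col n a b (y : nat) : arc (S n a b) (Posz n, Posz y) =
  arc8 false (prev n y) (a <= y.+1 < b) (a < y <= b) false (prev n y.+1)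
    false (prev n (Posz y - 1)%R).
Proof.
have [e1 e2 e3 e4] := nbE n y; rewrite /arc e1 e2 e3 e4 !(colE _ _ _ (ltnSn n)) colO.
have f1 : shift2 (Posz n, Posz y) (-1) 0 = ((Posz n - 1)%R, Posz y) by rewrite /shift2 addr0.
have f2 : shift2 (Posz n, Posz y) 0 (-1) = (Posz n, (Posz y - 1)%R) by rewrite /shift2 addr0.
have f3 : shift2 (Posz n, Posz y) (-1) 1 = ((Posz n - 1)%R, Posz y.+1).
  by rewrite /shift2; congr pair; rewrite /=; lia.
have f4 : shift2 (Posz n, Posz y) (-1) (-1) = ((Posz n - 1)%R, (Posz y - 1)%R) by [].
by rewrite f1 f2 f3 f4 !colW colON.
Qed.

Definition repr (s : seq square) n a b : Prop := shelled s /\ forall c, (c \in s) = S n a b c.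

Lemma repr_add s n a b a' b' (y : nat) : repr s n a b -> s != [::] ->
  ~~ (a <= y < b) -> arc (S n a b) (Posz n, Posz y) ->
  (forall z, (a' <= z < b') = (z == y) || (a <= z < b)) -> repr ((Posz n, Posz y) :: s) n a' b'.
Proof.
move=> [hs es] s0 hy ha hz; split.
  rewrite /= hs andbT (eq_arc _ (_ : mem s =1 S n a b)) ?ha ?andbT; last by move=> c; rewrite -es.
  by rewrite es colO hy orbT.
move=> c; rewrite inE es; case: c => -[x|x] [z|z]; last 3 first.
- by rewrite xpair_eqE /= ?andbF.
- by rewrite xpair_eqE /= ?andbF.
- by rewrite xpair_eqE /= ?andbF.
rewrite /in_cols hz xpair_eqE; have -> : (Posz x == Posz n) = (x == n) by apply/eqP/eqP => [[]|->].
have -> : (Posz z == Posz y) = (z == y) by apply/eqP/eqP => [[]|->].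
by case: (x == n); case: (z == y); rewrite ?orbT ?orbF ?andbT //= ?orbT.
Qed.

Lemma repr_neq0 s n a b : repr s n a b -> s != [::].
Proof. by case=> hs _; case: s hs. Qed.

(** The new cell rests on the one below. A left upper neighbour without a left one would break the
    arc; it would be the bottom of the previous column, which the hypothesis on [lo] places
    lower. *)
Lemma repr_up s n a b k : repr s n a b -> a < b ->
  (forall j, n = j.+1 -> lo j <= b) -> exists s', repr s' n a (b + k).
Proof.
move=> hs ab hp; elim: k => [|k [s' hs']]; first by exists s; rewrite addn0.
exists ((Posz n, Posz (b + k)) :: s'); apply: (repr_add hs') => //.
- exact: repr_neq0 hs'.
- by lia.
- rewrite arc_col; have -> : a <= (b + k).+1 < b + k = false by lia.
  have -> : a < b + k <= b + k by lia.
  case: n hp {hs hs'} => [|n] hp //=; have := hp n erefl => h.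
  case: (boolP (lo n <= b + k < hi n)) => //= h1.
  by have -> : lo n <= (b + k).+1 < hi n = false by lia.
- by move=> z; lia.
Qed.

Lemma repr_down s n a b k : repr s n (a + k) b -> a + k < b ->
  (forall j, n = j.+1 -> a + k <= hi j) -> exists s', repr s' n a b.
Proof.
elim: k s => [|k IH] s hs ab hp; first by exists s; rewrite addn0 in hs.
apply: (IH ((Posz n, Posz (a + k)) :: s)); [|by lia|by move=> j /hp; lia].
apply: (repr_add hs); [exact: repr_neq0 hs | by lia | | by move=> z; lia].
rewrite arc_col; have -> : a + k.+1 <= (a + k).+1 < b by lia.
have -> : a + k.+1 < a + k <= b = false by lia.
case: n hp {hs IH} => [|n] hp //=; have := hp n erefl => h.
case: (boolP (lo n <= a + k < hi n)) => //= h1.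
case E: (a + k) h1 => [|z] h1 //.
have -> : (Posz z.+1 - 1)%R = Posz z by lia.
by have -> : lo n <= z < hi n = false by lia.
Qed.

(** Consecutive columns overlap in height, so a new column can start with a cell next to the
    previous one and then grow upwards and downwards. *)
Lemma columns_shelled n : (forall x, x <= n -> lo x < hi x) ->
  (forall x, x < n -> lo x < hi x.+1 /\ lo x.+1 < hi x) -> exists s, repr s n (lo n) (hi n).
Proof.
elim: n => [|n IH] h1 h2.
  have [s hs] : exists s, repr s 0 (lo 0) ((lo 0).+1 + (hi 0 - (lo 0).+1)).
    apply: (@repr_up [:: (Posz 0, Posz (lo 0))]) => //; split=> // c; rewrite inE.
    by case: c => -[[|x]|x] [z|z] //=; rewrite xpair_eqE; apply/andP/idP => [[_ /eqP[->]]|h]; [lia|split=> //; apply/eqP; congr Posz; lia].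
  by exists s; have := h1 0 (leqnn _); move: hs => /[swap] lt; rewrite subnKC.
have [s [hs es]] := IH (fun x hx => h1 x (leqW hx)) (fun x hx => h2 x (ltnW hx)).
have [k1 k2] := h2 n (ltnSn n); have k3 := h1 n.+1 (leqnn _); have k4 := h1 n (leqnSn _).
have [y0 [y1 y2 y3 y4]] : exists y0, [/\ lo n <= y0, lo n.+1 <= y0, y0 < hi n & y0 < hi n.+1].
  by exists (maxn (lo n) (lo n.+1)); split; lia.
have es' c : (c \in s) = S n.+1 0 0 c.
  rewrite es; case: c => -[x|x] [z|z] //; rewrite /in_cols ltn0 !andbF orbF.
  case: (eqVneq x n) => [->|ne]; first by rewrite ltnn ltnSn.
  have -> : (x < n.+1) = (x < n) by (move/eqP: ne => ne; lia).
  by rewrite andFb orbF.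
have r0 : repr ((Posz n.+1, Posz y0) :: s) n.+1 y0 y0.+1.
  apply: (repr_add (conj hs es')); [by case: (s) hs | by [] | | by move=> z; lia].
  rewrite arc_col; have -> : (0 <= y0.+1 < 0) = false by lia.
  have -> : (0 < y0 <= 0) = false by lia.
  by have -> : prev n.+1 y0 by rewrite /= y1 y3.
have [s1 r1] : exists s1, repr s1 n.+1 y0 (hi n.+1).
  have [|s1] := @repr_up _ _ _ _ (hi n.+1 - y0.+1) r0 (ltnSn _); first by move=> j [<-]; lia.
  by rewrite subnKC // => r1; exists s1.
have [|||s2 r2] := @repr_down s1 n.+1 (lo n.+1) (hi n.+1) (y0 - lo n.+1).
- by rewrite subnKC.
- by rewrite subnKC.
- by move=> j [<-]; rewrite subnKC // ltnW.
by exists s2.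
Qed.

End Columns.

Section GridColumns.
Variables (C : finType) (m n : nat) (cb : nat -> nat -> C).
Hypotheses (m_gt0 : 0 < m) (n_gt0 : 0 < n).
Local Notation Y := (Yb cb).

(** The base values differ by at least [hsm], more than the digits can contribute. *)
Lemma Yb_lt i k i' k' : i <= i' -> k <= k' -> (i < i') || (k < k') -> Y i k < Y i' k'.
Proof.
move=> hi hk h; have /andP[_ h1] := lev_le i k (cb i k); have /andP[h2 _] := lev_le i' k' (cb i' k').
rewrite /Yb; apply: leq_ltn_trans h1 _; apply: leq_trans h2; rewrite /base.
have d0 := dlt_gt0 C; have e1 : hbg C = 2 * hsm C by rewrite /hbg /hsm mulnA.
have e2 : dlt C < hsm C by rewrite /hsm ltn_Pmull.
have a1 : hbg C * i <= hbg C * i' by rewrite leq_mul2l hi orbT.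
have a2 : hsm C * k <= hsm C * k' by rewrite leq_mul2l hk orbT.
case/orP: h => h.
  have : hbg C * i.+1 <= hbg C * i' by rewrite leq_mul2l h orbT.
  by rewrite mulnS; move: (hbg C * i) (hbg C * i') (hsm C * k) (hsm C * k') a1 a2 => *; lia.
have : hsm C * k.+1 <= hsm C * k' by rewrite leq_mul2l h orbT.
by rewrite mulnS; move: (hbg C * i) (hbg C * i') (hsm C * k) (hsm C * k') a1 a2 => *; lia.
Qed.

Lemma kidx_mono u v : u <= v -> kidx u <= kidx v.
Proof.
move=> h; rewrite leqNgt kidx_lt -leqNgt; apply: leq_trans h.
by have /andP[] := kidxP u.
Qed.

(** For equal abscissas the columns are nonempty; for adjacent ones they overlap, as
    [columns_shelled] needs. *)
Lemma env_lt x x' : x < Xt m n -> x' < Xt m n -> x <= x'.+1 -> x' <= x.+1 ->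
  env m n Y 0 x < env m n Y m x'.
Proof.
move=> hx hx' h1 h2; have W1 : 0 < Ws n by rewrite -kidx_lt.
rewrite /env subn0 subnn muln0 ltn0 subn0; rewrite /Xt in hx hx'.
case: (ltnP x (4 * m)) => k1; case: (ltnP x' (Ws n)) => k2.
- apply: Yb_lt => //; first by lia.
  by have -> : m.-1 - x %/ 4 < m by lia.
- apply: Yb_lt => //; last by rewrite n_gt0 orbT.
  by apply: leq_sub2l; apply: leq_div2r; lia.
- have -> : x - 4 * m < Ws n by lia.
  by apply: Yb_lt => //; [apply: kidx_mono; lia | rewrite m_gt0].
- have hk : x - 4 * m < Ws n by lia.
  by rewrite hk; apply: Yb_lt; rewrite ?kidx_lt ?hk ?orbT // ltnW // kidx_lt.
Qed.

Lemma grid_shelled : exists2 s, shelled s & [fset c in grid_cells m n cb]%fset = [fset c in s]%fset :> cells.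
Proof.
have X0 : 0 < Xt m n by rewrite /Xt; lia.
pose lo := env m n Y 0; pose hi := env m n Y m.
have [|x hx|s [hs es]] := @columns_shelled lo hi (Xt m n).-1.
- by move=> x hx; apply: env_lt; lia.
- by split; apply: env_lt; lia.
have mg c : (c \in grid_cells m n cb) = (c \in s).
  have [H1 H2] := mem_grid_cells cb m_gt0 n_gt0 c; rewrite es; apply/idP/idP => [/H1[x [y [-> h]]]|h].
    move: h; rewrite /inG -/lo -/hi => /andP[hx hy]; rewrite /in_cols.
    have [e|ne] := eqVneq x (Xt m n).-1; first by rewrite -e ltnn hy.
    have h0 : 0 < Xt m n by apply: leq_ltn_trans hx.
    have hx' : x < (Xt m n).-1 by rewrite ltn_neqAle ne andTb -ltnS prednK.
    by rewrite hx' hy.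
  apply: H2; move: h; clear H1; case: c => -[x|x] [y|y] // h; exists x, y; split=> //; rewrite /inG -/lo -/hi.
  move: h => /orP[/andP[hx hy]|/andP[/eqP -> hy]]; rewrite hy andbT; lia.
by exists s => //; apply/fsetP => c; rewrite !inE mg.
Qed.

End GridColumns.

(** * Computing the formula *)

Definition ix (F : finType) (x : F) : nat := index x (enum F).

Lemma ix_lt (F : finType) (x : F) : ix x < #|F|.
Proof. by rewrite cardE index_mem mem_enum. Qed.

Lemma eq_ix (F : finType) (x y : F) : (ix x == ix y) = (x == y).
Proof.
apply/eqP/eqP => [h|-> //]; rewrite -(nth_index x (mem_enum F x)) -/(ix x) h.
by rewrite /ix nth_index // mem_enum.
Qed.

Lemma has_ix (F : finType) (P : F -> bool) (x : F) :
  has (fun y => (ix x == ix y) && P y) (enum F) = P x.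
Proof.
apply/hasP/idP => [[y _ /andP[]]|h]; first by rewrite eq_ix => /eqP ->.
by exists x; rewrite ?mem_enum // eqxx.
Qed.

Lemma radix_inj c o i o' i' : i < c -> i' < c -> o * c + i = o' * c + i' -> o = o' /\ i = i'.
Proof.
move=> h h' e; have c0 : 0 < c by apply: leq_ltn_trans h.
have := congr1 (divn^~ c) e; rewrite !divnMDl // !divn_small // !addn0 => eo.
by split=> //; move: e; rewrite eo => /addnI.
Qed.

Section Numbering.
Variables (M : tm) (T : nat).
Local Notation Q := (state M).
Local Notation U := (choice_of M).
Local Notation KS := ('I_(ntapes M).+1 * symb M)%type.

(** Number of variables for one time: states, then choices, then the contents of the offsets of the
    window. *)
Definition period : nat := #|{: Q}| + #|{: U}| + (2 * T.+1).+1 * #|{: KS}|.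
Definition nS (t : nat) (q : Q) : nat := t * period + ix q.
Definition nU (t : nat) (u : U) : nat := t * period + (#|{: Q}| + ix u).
Definition nC (t o : nat) (j : 'I_(ntapes M).+1) (s : symb M) : nat :=
  t * period + (#|{: Q}| + #|{: U}| + (o * #|{: KS}| + ix ((j, s) : KS))).

(** The numbering is injective; [x] decodes a variable by division by the period and by searching
    the three blocks. *)
Lemma assignment (yS : nat -> Q -> bool) (yU : nat -> U -> bool)
    (yC : nat -> nat -> 'I_(ntapes M).+1 -> symb M -> bool) :
  exists x, forall t, t <= T ->
  [/\ forall q, x (nS t q) = yS t q, forall u, x (nU t u) = yU t u
    & forall o j s, o <= 2 * T.+1 -> x (nC t o j s) = yC t o j s].
Proof.
pose a := #|{: Q}|; pose b := #|{: U}|; pose c := #|{: KS}|.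
pose x v := let t := v %/ period in let r := v %% period in
  [|| has (fun q => (r == ix q) && yS t q) (enum Q),
      has (fun u => (r == a + ix u) && yU t u) (enum U)
    | has (fun o => has (fun p : KS => (r == a + b + (o * c + ix p)) && yC t o p.1 p.2)
            (enum (KS : finType))) (iota 0 (2 * T.+1).+1)].
have xE t r : r < period -> x (t * period + r) =
    [|| has (fun q => (r == ix q) && yS t q) (enum Q),
      has (fun u => (r == a + ix u) && yU t u) (enum U)
    | has (fun o => has (fun p : KS => (r == a + b + (o * c + ix p)) && yC t o p.1 p.2)
            (enum (KS : finType))) (iota 0 (2 * T.+1).+1)].
  move=> hr; have p0 : 0 < period by apply: leq_ltn_trans hr.
  by rewrite /x divnMDl // modnMDl divn_small // modn_small // addn0.
have S0 r t : a <= r -> has (fun q => (r == ix q) && yS t q) (enum Q) = false.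
  move=> h; apply/negbTE/hasPn => q _; have := ix_lt q; rewrite -/a => h'.
  by have -> : (r == ix q) = false by lia.
have U0 r t : r < a \/ a + b <= r -> has (fun u => (r == a + ix u) && yU t u) (enum U) = false.
  move=> h; apply/negbTE/hasPn => u _; have := ix_lt u; rewrite -/b => h'.
  by have -> : (r == a + ix u) = false by lia.
have C0 r t : r < a + b -> has (fun o => has (fun p : KS => (r == a + b + (o * c + ix p)) && yC t o p.1 p.2)
            (enum (KS : finType))) (iota 0 (2 * T.+1).+1) = false.
  move=> h; apply/negbTE/hasPn => o _; apply/hasPn => p _.
  by have -> : (r == a + b + (o * c + ix p)) = false by lia.
have P0 : period = a + b + (2 * T.+1).+1 * c by [].
exists x => t _; split.
- move=> q; have := ix_lt q; rewrite -/a => h; rewrite /nS xE; last by rewrite P0; lia.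
  by rewrite U0 ?C0 ?orbF ?has_ix //; [lia | left].
- move=> u; have := ix_lt u; rewrite -/b => h; rewrite /nU -/a xE; last by rewrite P0; lia.
  rewrite S0 ?C0 ?orbF /=; [|lia|lia].
  by rewrite -[RHS](has_ix (yU t)); apply: eq_has => v; rewrite eqn_add2l.
- move=> o j s ho; have := ix_lt ((j, s) : KS); rewrite -/c => h; rewrite /nC -/a -/b -/c.
  have ho' : o * c + ix ((j, s) : KS) < (2 * T.+1).+1 * c.
    apply: leq_trans (_ : o.+1 * c <= _); first by rewrite mulSn addnC ltn_add2r.
    by rewrite leq_mul2r ltnS ho orbT.
  rewrite xE; last by rewrite P0 ltn_add2l.
  rewrite S0 ?U0 ?orFb; [|by right; exact: leq_addr|by rewrite -addnA leq_addr].
  apply/hasP/idP => [[o' _ /hasP[p _ /andP[/eqP e hp]]]|hy].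
    have [eo /eqP] := radix_inj h (ix_lt p) (addnI e); rewrite eq_ix => /eqP ep.
    by rewrite -ep -eo in hp.
  exists o; first by rewrite mem_iota ltnS.
  by apply/hasP; exists (j, s); rewrite ?mem_enum // eqxx.
Qed.

End Numbering.

Fixpoint horner_nat (s : seq nat) (n : nat) : nat :=
  if s is a :: s' then horner_nat s' n * n + a else 0.

Lemma horner_natE (p : {poly nat}) (n : nat) : horner_nat (polyseq p) n = p.[n]%R.
Proof. by rewrite /horner; elim: (polyseq p) => //= a s ->. Qed.


Lemma PTF_horner (E : Type) (eE : Enc E) (s : seq nat) (f : E -> nat) :
  PTF f -> PTF (fun e => horner_nat s (f e)).
Proof.
move=> hf; elim: s => [|a s IH] /=; first exact: PTF_const.
by apply: PTF_add; [apply: PTF_mul | exact: PTF_const].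
Qed.

Section PTFliterals.
Variables (E : Type) (eE : Enc E) (M : tm).

Lemma PTF_pos (f : E -> nat) : PTF f -> PTF (fun e => pos (f e)).
Proof. by move=> hf; apply: PTF_pair hf (PTF_const _). Qed.

Lemma PTF_neg (f : E -> nat) : PTF f -> PTF (fun e => neg (f e)).
Proof. by move=> hf; apply: PTF_pair hf (PTF_const _). Qed.

Variables (T t : E -> nat) (hT : PTF T) (ht : PTF t).

Lemma PTF_period : PTF (fun e => period M (T e)).
Proof.
rewrite /period; apply: PTF_add; first exact: PTF_const.
by apply: PTF_mul; [apply: PTF_S; apply: PTF_mul; [exact: PTF_const | exact: PTF_S] | exact: PTF_const].
Qed.

Lemma PTF_nS (q : state M) : PTF (fun e => nS (T e) (t e) q).
Proof.
rewrite /nS; apply: PTF_add; last exact: PTF_const.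
by apply: PTF_mul => //; exact: PTF_period.
Qed.

Lemma PTF_nU (u : choice_of M) : PTF (fun e => nU (T e) (t e) u).
Proof.
rewrite /nU; apply: PTF_add; last exact: PTF_const.
by apply: PTF_mul => //; exact: PTF_period.
Qed.

Lemma PTF_nC (o : E -> nat) (j : 'I_(ntapes M).+1) (s : symb M) :
  PTF o -> PTF (fun e => nC (T e) (t e) (o e) j s).
Proof.
move=> ho; rewrite /nC; apply: PTF_add; first by apply: PTF_mul => //; exact: PTF_period.
apply: PTF_add; first exact: PTF_const.
by apply: PTF_add; [apply: PTF_mul => //|]; exact: PTF_const.
Qed.

Lemma PTF_shift (mv : move) : PTF (fun e => shift mv (t e)).
Proof. by case: mv; [exact: PTF_S | exact: PTF_pred | exact: ht]. Qed.

Lemma PTF_offsets : PTF (fun e => offsets (T e)).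
Proof.
rewrite /offsets; apply: PTF_iota; first exact: PTF_const.
by apply: PTF_S; apply: PTF_mul; [exact: PTF_const | exact: PTF_S].
Qed.

End PTFliterals.

Ltac lits := repeat first [assumption | exact: PTF_const | apply: PTF_cons | apply: PTF_pos
  | apply: PTF_neg | apply: PTF_nS | apply: PTF_nU | apply: PTF_nC | apply: PTF_shift | apply: PTF_S].

Section PTFformula.
Variables (M : tm).

Section AtTime.
Variables (E : Type) (eE : Enc E) (T t : E -> nat) (hT : PTF T) (ht : PTF t).

Lemma PTF_F_choose : PTF (fun e => F_choose (@nU M (T e)) (t e)).
Proof. by rewrite /F_choose; apply: PTF_cons; [apply: PTF_map_const => u; lits | exact: PTF_const]. Qed.

Lemma PTF_F_read : PTF (fun e => F_read (T e) (@nS M (T e)) (@nU M (T e)) (@nC M (T e)) (t e)).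
Proof.
rewrite /F_read; apply: PTF_flatmap_const => u; apply: PTF_cons; first by lits.
by apply: PTF_map_const => j; lits.
Qed.

Lemma PTF_F_unique : PTF (fun e => F_unique (T e) (@nS M (T e)) (@nC M (T e)) (t e)).
Proof.
rewrite /F_unique; apply: PTF_cat; first by apply: PTF_map_const => p; lits.
by apply: PTF_flatmap_const => j; apply: PTF_map_const => p; lits.
Qed.

Lemma PTF_F_move : PTF (fun e => F_move (T e) (@nS M (T e)) (@nU M (T e)) (@nC M (T e)) (t e)).
Proof.
rewrite /F_move; apply: PTF_flatmap_const => u; apply: PTF_cons; first by lits.
apply: PTF_flatmap_const => j; apply: PTF_cons; first by lits.
apply: PTF_flatmap_const => x; apply: PTF_map; last exact: PTF_offsets.
have hT1 : PTF (fun p : E * nat => T p.1) by apply: PTF_comp hT (PTF_fst PTF_id).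
have ht1 : PTF (fun p : E * nat => t p.1) by apply: PTF_comp ht (PTF_fst PTF_id).
have ho : PTF (fun p : E * nat => p.2) by exact: PTF_snd PTF_id.
apply: PTF_if; [|by lits|by lits].
apply: PTF_orb; [apply: PTF_orb|]; apply: PTF_eq => //; [exact: PTF_S|exact: PTF_const|].
by apply: PTF_mul; [exact: PTF_const | exact: PTF_S].
Qed.

End AtTime.

Local Instance enc_symb : Enc (symb M) := enc_fin (symb M).

Lemma PTF_formula (E : Type) (eE : Enc E) (W : E -> seq (symb M)) (T : E -> nat) :
  PTF W -> PTF T ->
  PTF (fun e => formula (W e) (T e) (@nS M (T e)) (@nU M (T e)) (@nC M (T e))).
Proof.
move=> hW hT; rewrite /formula; apply: PTF_cat; last apply: PTF_cat; last apply: PTF_cat.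
- rewrite /F_init; apply: PTF_cat; first by lits.
  apply: PTF_flatmap_const => j; apply: PTF_map; last exact: PTF_offsets.
  have hT1 : PTF (fun p : E * nat => T p.1) by apply: PTF_comp hT (PTF_fst PTF_id).
  have hW1 : PTF (fun p : E * nat => W p.1) by apply: PTF_comp hW (PTF_fst PTF_id).
  have ho : PTF (fun p : E * nat => p.2) by exact: PTF_snd PTF_id.
  apply: (PTF_fin (F := symb M) (f := fun p : E * nat => init_cell (W p.1) (T p.1) j p.2)
    (g := fun s p => [:: pos (nC (T p.1) 0 p.2 j s)])); last by move=> s; lits.
  rewrite /init_cell; case: (j == ord0); last exact: PTF_const.
  apply: PTF_if; [by apply: PTF_leq; exact: PTF_S | exact: PTF_const |].
  by apply: PTF_nth => //; [exact: PTF_const | apply: PTF_sub => //; exact: PTF_S].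
- by rewrite /F_last; apply: PTF_cons; [apply: PTF_map_const => u; lits | exact: PTF_const].
- apply: PTF_flatmap; last by apply: PTF_iota; [exact: PTF_const | exact: PTF_S].
  have hT1 : PTF (fun p : E * nat => T p.1) by apply: PTF_comp hT (PTF_fst PTF_id).
  have ho : PTF (fun p : E * nat => p.2) by exact: PTF_snd PTF_id.
  apply: PTF_cat; first exact: (PTF_F_choose hT1 ho).
  by apply: PTF_cat; [exact: (PTF_F_read hT1 ho) | exact: (PTF_F_unique hT1 ho)].
- apply: PTF_flatmap; last by apply: PTF_iota; [exact: PTF_const | exact: hT].
  have hT1 : PTF (fun p : E * nat => T p.1) by apply: PTF_comp hT (PTF_fst PTF_id).
  have ho : PTF (fun p : E * nat => p.2) by exact: PTF_snd PTF_id.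
  exact: (PTF_F_move hT1 ho).
Qed.

End PTFformula.

(** * Computing the region *)

(** With truncated subtraction, [a + (b - a)] is the maximum of [a] and [b]. *)
Definition max_var (F : cnf) : nat := foldl (fun a (l : literal) => a + (l.1 - a)) 0 (flatten F).

Lemma max_varP F : all (all (fun l : literal => l.1 < (max_var F).+1)) F.
Proof.
have H (s : seq literal) a : a <= foldl (fun a (l : literal) => a + (l.1 - a)) a s /\
    {in s, forall l, l.1 <= foldl (fun a (l : literal) => a + (l.1 - a)) a s}.
  elim: s a => [|l s IH] a /=; first by split.
  have [h1 h2] := IH (a + (l.1 - a)); split; first by lia.
  by move=> k; rewrite inE => /orP[/eqP ->|/h2 //]; lia.
apply/allP => cl hcl; apply/allP => l hl; rewrite ltnS.
by have [_] := H (flatten F) 0; apply; apply/flattenP; exists cl.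
Qed.

Definition wletter : finType := (option bool * option bool)%type.

Definition block1 (V : nat) (l : literal) : seq wletter :=
  [seq ((if p == V - l.1.+1 then Some l.2 else None, if p == V then Some true else None) : wletter)
  | p <- iota 0 V.+1].

(** The word of the formula without truth values, as nested maps that can be computed directly. *)
Definition fword (V : nat) (F : cnf) : seq wletter :=
  flatten [seq flatten [seq block1 V l | l <- cl] ++ [:: (None, Some false)] | cl <- F].

Lemma word_fword V F : word V F = fword V F.
Proof.
rewrite /word /fword; elim: F => // cl F IH.
have -> : pieces (cl :: F) = rcons (map Some cl) None ++ pieces F by [].
rewrite /word_of map_cat flatten_cat -!/(word_of _ _ _) /unzip1 map_cat -!/(unzip1 _) IH /=.
congr (_ ++ _); elim: cl => // l cl IHc; rewrite map_cons rcons_cons word_some /unzip1 map_cat -!/(unzip1 _) IHc.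
have e1 : unzip1 (block V xpred0 l) = block1 V l by rewrite /block /block1 /unzip1 -map_comp.
by rewrite e1 catA.
Qed.

(** The border as a function of the computed word, so that the formula need not be consulted
    again. *)
Definition bd (V : nat) (w : seq wletter) (i k : nat) : color :=
  if k == 0 then cL (i == V.+1) else if k == (size w).+1 then cR
  else if i == 0 then
    cB ((nth (None, None) w k.-1).1, if k.-1 == 0 then None else (nth (None, None) w k.-1.-1).1,
        (nth (None, None) w k.-1).2)
  else cT.

Lemma border_bd V F i k : border V F i k = bd V (word V F) i k.
Proof.
rewrite /border /bd /gn /tr0 /kd0; case: k => // k; rewrite [k.+1 == 0]/= [k.+1.-1]/=.
by case: k.
Qed.

Section GridText.
Variables (V : nat) (w : seq wletter).
Local Notation m := V.+2.
Local Notation n := (size w).+1.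
Local Notation Y := (Yb (bd V w)).

Definition cell_word (x y : nat) : seq letter :=
  rev [seq Bit b | b <- bits x] ++ Comma :: rev [seq Bit b | b <- bits y] ++ [:: Semicolon].

Definition grid_text : seq letter :=
  flatten [seq flatten [seq cell_word x y | y <- iota (env m n Y 0 x) (env m n Y m x - env m n Y 0 x)]
          | x <- iota 0 (Xt m n)].

Lemma grid_textE : grid_text = encode (grid_cells m n (bd V w)).
Proof.
rewrite /grid_text /grid_cells /encode; elim: (iota 0 _) => //= x s IH.
rewrite map_cat flatten_cat -IH; congr (_ ++ _); rewrite -map_comp; congr flatten.
by apply/eq_map => y; rewrite /cell_word /= !encode_natE.
Qed.

End GridText.

Local Instance enc_wl : Enc wletter := enc_fin wletter.
Local Instance enc_lt : Enc letter := enc_fin letter.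

Section PTFgrid.
Variables (E : Type) (eE : Enc E).

Lemma PTF_b2n (f : E -> bool) : PTF f -> PTF (fun e => nat_of_bool (f e)).
Proof.
move=> hf; apply: PTF_ext (PTF_if hf (PTF_const 1) (PTF_const 0)) => e; by case: (f e).
Qed.

Variables (V : E -> nat) (w : E -> seq wletter) (hV : PTF V) (hw : PTF w).

Lemma PTF_lev (i k : E -> nat) (c : color) : PTF i -> PTF k -> PTF (fun e => lev (i e) (k e) c).
Proof.
move=> hi hk; rewrite /lev /base /phi /val4 /dg.
by repeat first [apply: PTF_add | apply: PTF_mul | apply: PTF_if | apply: PTF_andb
  | apply: PTF_negb | apply: PTF_odd | exact: PTF_const | exact: hi | exact: hk].
Qed.

(** The border color takes finitely many values, and for a fixed color the level is arithmetic. *)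
Lemma PTF_Y (i k : E -> nat) : PTF i -> PTF k -> PTF (fun e => Yb (bd (V e) (w e)) (i e) (k e)).
Proof.
move=> hi hk; apply: (PTF_fin (F := color) (f := fun e => bd (V e) (w e) (i e) (k e))
  (g := fun c e => lev (i e) (k e) c)); last by move=> c; exact: PTF_lev.
pose ec : Enc color := enc_fin color.
rewrite /bd; apply: PTF_if; first by apply: PTF_eq => //; exact: PTF_const.
  apply: PTF_ext (PTF_if (c := fun e => i e == (V e).+1) _ (PTF_const (cL true)) (PTF_const (cL false))) => [e|].
    by case: (i e == _).
  by apply: PTF_eq => //; exact: PTF_S.
apply: PTF_if; first by apply: PTF_eq => //; apply: PTF_S; exact: PTF_size.
  exact: PTF_const.
apply: PTF_if; [by apply: PTF_eq => //; exact: PTF_const| |exact: PTF_const].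
apply: (PTF_fin (F := wletter) (f := fun e => nth (None, None) (w e) (k e).-1)
  (g := fun x e => cB (x.1, if (k e).-1 == 0 then None else (nth (None, None) (w e) (k e).-1.-1).1, x.2))).
  by apply: PTF_nth => //; [exact: PTF_const | exact: PTF_pred].
move=> x; apply: PTF_ext (PTF_if (c := fun e => (k e).-1 == 0) _ (PTF_const (cB (x.1, None, x.2)))
  (PTF_fin_const ec (f := fun e => nth ((None, None) : wletter) (w e) (k e).-1.-1) (fun y : wletter => cB (x.1, y.1, x.2)) _)) => [e||].
- by case: (_ == 0).
- by apply: PTF_eq; [exact: PTF_pred | exact: PTF_const].
- by apply: PTF_nth => //; [exact: PTF_const | apply: PTF_pred; exact: PTF_pred].
Qed.

Lemma PTF_Ws (f : E -> nat) : PTF f -> PTF (fun e => Ws (f e)).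
Proof. by move=> hf; rewrite /Ws; ptf. Qed.

Lemma PTF_env (i x : E -> nat) : PTF i -> PTF x ->
  PTF (fun e => env (V e).+2 (size (w e)).+1 (Yb (bd (V e) (w e))) (i e) (x e)).
Proof.
move=> hi hx; rewrite /env.
have hn : PTF (fun e => (size (w e)).+1) by apply: PTF_S; exact: PTF_size.
have hW := PTF_Ws hn.
have h4 : PTF (fun e => 4 * ((V e).+2 - i e)) by ptf.
apply: PTF_if; first by ptf.
  by apply: PTF_Y; [ptf | exact: PTF_const].
apply: PTF_if; first by apply: PTF_leq => //; apply: PTF_S; exact: PTF_sub.
  apply: PTF_Y => //; rewrite /kidx; apply: PTF_add; first by ptf.
  by apply: PTF_b2n; ptf.
apply: PTF_Y => //; apply: PTF_sub; first by ptf.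
by apply: PTF_div; exact: PTF_sub.
Qed.

End PTFgrid.

Lemma PTF_grid_text : PTF (fun e : nat * seq wletter => grid_text e.1 e.2).
Proof.
have hb (E : Type) (eE : Enc E) (f : E -> nat) : PTF f -> PTF (fun e => rev [seq Bit b | b <- bits (f e)]).
  move=> hf; apply: PTF_revl; apply: (PTF_map (f := fun _ b => Bit b)); last exact: PTF_comp PTF_bits hf.
  apply: PTF_ext (PTF_if (c := fun p : E * bool => p.2) _ (PTF_const (Bit true)) (PTF_const (Bit false))) => [[e []]//|].
  exact: PTF_snd PTF_id.
pose lo (e : nat * seq wletter) i x := env e.1.+2 (size e.2).+1 (Yb (bd e.1 e.2)) i x.
have h1 : PTF (fun p : (nat * seq wletter) * nat => lo p.1 0 p.2).
  by apply: (PTF_env (V := fun p => p.1.1) (w := fun p => p.1.2)); ptf.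
have h2 : PTF (fun p : (nat * seq wletter) * nat => lo p.1 p.1.1.+2 p.2).
  by apply: (PTF_env (V := fun p => p.1.1) (w := fun p => p.1.2)); ptf.
apply: (PTF_flatmap (f := fun e x => flatten [seq cell_word x y | y <- iota (lo e 0 x) (lo e e.1.+2 x - lo e 0 x)])).
  apply: (PTF_flatmap (f := fun (p : (nat * seq wletter) * nat) y => cell_word p.2 y)).
    rewrite /cell_word; apply: PTF_cat; first by apply: hb; ptf.
    by apply: PTF_cons; [exact: PTF_const | apply: PTF_cat; [apply: hb; ptf | exact: PTF_const]].
  by apply: PTF_iota => //; exact: PTF_sub.
apply: PTF_iota; first exact: PTF_const.
rewrite /Xt; apply: PTF_add; last by ptf.
by apply: PTF_Ws; ptf.
Qed.

Lemma PTF_max_var : PTF max_var.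
Proof.
have h : PTF (fun F : cnf => flatten F).
  apply: PTF_ext (PTF_flatmap (f := fun (_ : cnf) (cl : seq literal) => cl) (l := id) _ PTF_id) => [F|].
    by rewrite map_id.
  exact: PTF_snd PTF_id.
apply: (PTF_foldl (E := cnf) (step := fun _ a (l : literal) => a + (l.1 - a))) => //.
- by ptf.
- exists (fun m => m); first by pb.
  by move=> F a [v b]; rewrite esize_pair !esize_nat [(v, b).1]/=; lia.
- exact: PTF_const.
Qed.

Lemma PTF_fword : PTF (fun e : nat * cnf => fword e.1 e.2).
Proof.
apply: (PTF_flatmap (f := fun (e : nat * cnf) cl => flatten [seq block1 e.1 l | l <- cl] ++ [:: (None, Some false)])); last by ptf.
apply: PTF_cat; last exact: PTF_const.
apply: (PTF_flatmap (f := fun (p : (nat * cnf) * seq literal) l => block1 p.1.1 l)); last by ptf.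
pose Z := (((nat * cnf) * seq literal) * literal)%type.
apply: (PTF_map (f := fun (z : Z) p => ((if p == z.1.1.1 - z.2.1.+1 then Some z.2.2 else None,
   if p == z.1.1.1 then Some true else None) : wletter))); last by ptf.
pose c1 (z : Z * nat) := z.2 == z.1.1.1.1 - z.1.2.1.+1; pose c2 (z : Z * nat) := z.2 == z.1.1.1.1.
have h1 : PTF c1 by rewrite /c1; ptf.
have h2 : PTF c2 by rewrite /c2; ptf.
have h3 : PTF (fun z : Z * nat => z.1.2.2) by ptf.
pose k (a b : option bool) : wletter := (a, b).
apply: PTF_ext (PTF_if h1 (PTF_if h2
   (PTF_if h3 (PTF_const (k (Some true) (Some true))) (PTF_const (k (Some false) (Some true))))
   (PTF_if h3 (PTF_const (k (Some true) None)) (PTF_const (k (Some false) None))))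
  (PTF_if h2 (PTF_const (k None (Some true))) (PTF_const (k None None)))) => z.
by rewrite -/(c1 z) -/(c2 z); case: (c1 z); case: (c2 z); case: (z.1.2.2).
Qed.

(** The parser with trivial labels is a left inverse up to [num2]. Injectivity is needed because
    membership in the tiling problem only provides some list with the given encoding. *)
Lemma encode_inj : injective encode.
Proof.
move=> s s' h.
have E t : label_word (fun=> tt) t = [seq (x, tt) | x <- encode t].
  rewrite -(map_fst_label_word (fun=> tt) t) -map_comp -[LHS]map_id.
  by apply: eq_map => -[x []].
have := congr1 (@parse unit) (etrans (E s) (etrans (congr1 (map (fun x => (x, tt))) h) (esym (E s')))).
rewrite !parse_label_word; apply: inj_map => a b e.
by apply: num2_inj; exact: (congr1 fst e).
Qed.

Lemma tiling_NP_hard (R : realType) : NP_hard (tiling_problem R (tile_set Rh Rv)).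
Proof.
move=> A L [M [e [p [_ hp]]]].
pose eA : Enc A := enc_fin A; pose eS : Enc (symb M) := enc_fin (symb M).
pose eW : Enc wletter := enc_fin wletter.
pose T (w : seq A) := horner_nat (polyseq p) (size w).
pose F w := formula (map e w) (T w) (@nS M (T w)) (@nU M (T w)) (@nC M (T w)).
pose V w := (max_var (F w)).+1.
exists (fun w => grid_text (V w) (fword (V w) (F w))).
  apply: PTF_polytime.
  have hF : PTF F.
    apply: PTF_formula; last by apply: PTF_horner; apply: PTF_size; exact: PTF_id.
    apply: (PTF_map (f := fun _ a => e a)); last exact: PTF_id.
    by apply: (PTF_fin_const eS (f := fun p : seq A * A => p.2) e); apply: PTF_snd; exact: PTF_id.
  have hV : PTF V by apply: PTF_S; apply: PTF_comp PTF_max_var hF.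
  have hw : PTF (fun w => fword (V w) (F w)) by apply: (PTF_comp PTF_fword (PTF_pair hV hF)).
  exact: (PTF_comp PTF_grid_text (PTF_pair hV hw)).
move=> w; rewrite grid_textE; set fw := fword _ _; set s := grid_cells _ _ _.
have eb : border (V w) (F w) = bd (V w) fw.
  by apply/funext => i; apply/funext => k; rewrite border_bd word_fword.
have E : L w <-> colorable Rh Rv (V w).+2 (size fw).+1 (bd (V w) fw).
  rewrite -eb /fw -word_fword -/(gn (V w) (F w)) -/(gm (V w)); split.
    move=> /((hp w).2)[n [c [h1 h2 h3]]]; have hn := (hp w).1 n c h1.
    rewrite -horner_natE in hn.
    (* The polynomial bounds all computations, so the accepting one fits into the time [T w] of the
       formula. *)
    have [x hx] := formula_complete h1 h2 h3 hn (@assignment M (T w)).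
    exact: sat_colorable (max_varP (F w)) _ hx.
  move=> /(colorable_sat (max_varP (F w)))[x /formula_sound h].
  exact/((hp w).2).
split=> [/E hc|[s' [[_ /encode_inj <-] _ _ /tileable_colorable h]]]; last exact/E/h.
have [s' hs es] : exists2 s', shelled s' & [fset c in s]%fset = [fset c in s']%fset.
  exact: grid_shelled.
have [hr hc'] : region R [fset c in s]%fset /\ simply_connected (realize R [fset c in s]%fset).
  by apply/shellableP; exists s'.
exists s; split=> //; last exact: colorable_tileable.
by split=> //; exact: uniq_grid_cells.
Qed.

Theorem theorem1p1 (R : realType) :
  exists T : {fset cells},
    [/\ forall t, t \in T -> rectangular t,
        (#|` T|%fset <= 10 ^ 6)%N
      & NP_complete (tiling_problem R T)].
Proof.
exists (tile_set Rh Rv); split.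
- by move=> t; exact: tile_set_rectangular.
- exact: leq_trans (card_tile_set Rh Rv) card_color.
- split; last exact: tiling_NP_hard.
  by apply: tiling_NP => t; exact: tile_set_rectangular.
Qed.
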